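(* There is $\varepsilon_0>0$ such that for every $\varepsilon\in(0,\varepsilon_0)$ there exists a constant $C<\infty$ (depending only on $\varepsilon$ and the kernel $\Phi$) with the following property. Let $\zeta, \tau_1, Y_2, Y_3, u$ be smooth real functions on $\mathbb{R}\times\mathbb{R}^3$ and $C_1,C_2\in\mathbb{R}$. Put $\tau_2:=\tau_1^2-C_1$ and $\tau_3:=\tau_1^3-3C_1\tau_1$. Assume that pointwise on $P$ $$(\partial_t-\Delta)\tau_1=\zeta,\qquad (\partial_t-\Delta)Y_2=\tau_2,\qquad (\partial_t-\Delta)Y_3=\tau_3,$$ $$(\partial_t-\Delta)u=-u^3+\zeta+(3C_1-9C_2)u ,$$ and set $v:=u-\tau_1$ (so that $(\partial_t-\Delta)v=-v^3-3v^2\tau_1-3v\tau_2-\tau_3-9C_2(v+\tau_1)$ on $P$). Define the nine quantities $Q_1=[\tau_1]_{-\frac12-\varepsilon}$, $Q_2=[\tau_2]_{-1-2\varepsilon}$, $Q_3=[\tau_3]_{-\frac32-3\varepsilon}$, $Q_4=[Y_2]_{1-2\varepsilon}$, $Q_5=[Y_3]_{\frac12-3\varepsilon}$, $$Q_6=\sup_{x\in P}\sup_{T<1}T^{2\varepsilon}\Big|\int X(y-x)\,\tau_2(y)\,\Psi_T(x-y)\,dy\Big|,$$ $$Q_7=\sup_{x\in P}\sup_{T<1}T^{4\varepsilon}\Big|\int \big(Y_2(y)\tau_2(y)-C_2-Y_2(x)\tau_2(y)\big)\Psi_T(x-y)\,dy\Big|,$$ $$Q_8=\sup_{x\in P}\sup_{T<1}T^{4\varepsilon}\Big|\int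 \big(Y_3(y)\tau_1(y)-Y_3(x)\tau_1(y)\big)\Psi_T(x-y)\,dy\Big|,$$ $$Q_9=\sup_{x\in P}\sup_{T<1}T^{\frac12+5\varepsilon}\Big|\int \big(Y_3(y)\tau_2(y)-3C_2\tau_1(y)-Y_3(x)\tau_2(y)\big)\Psi_T(x-y)\,dy\Big|,$$ with associated integers $(n_1,\dots,n_9)=(1,2,3,2,3,2,4,4,5)$. Then for every $R\in(0,1)$, $$\|v\|_{P_R}\le C\max\Big\{\frac1R,\;Q_i^{\frac{1}{n_i(\frac12-\varepsilon)}},\ i=1,\dots,9\Big\}.$$
   Context: Space-time points are $z=(t,x)\in\mathbb{R}\times\mathbb{R}^3$; $|x|$ is the supremum norm on $\mathbb{R}^3$, $X(z)=x$ is the spatial projection, and the parabolic metric is $d((t,x),(\bar t,\bar x))=\max\{\sqrt{|t-\bar t|},|x-\bar x|\}$. The past parabolic ball is $B(z,R)=\{\bar z=(\bar t,\bar x): d(z,\bar z)<R,\ \bar t<t\}$. $P=(0,1)\times(-1,1)^3$ and $P_R=(R^2,1)\times\{x:|x|<1-R\}$. $\|f\|_B=\sup_B|f|$. Kernel: fix a smooth $\Phi\ge0$ with values in $[0,1]$, integral $1$, symmetric under $x\mapsto -x$, supported in $\{(t,x):0<t<1,|x|<1\}$ (so that convolution at $z$ only sees $B(z,\cdot)$). Set $\Phi_T(t,x)=T^{-5}\Phi(t/T^2,x/T)$, $\Psi_{T,n}=\Phi_{T2^{-1}}*\Phi_{T2^{-2}}*\cdots*\Phi_{T2^{-n}}$,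 $\Psi_T=\lim_{n\to\infty}\Psi_{T,n}$, and $(f)_T(z)=\int\Psi_T(z-w)f(w)\,dw$. Norms: for $\alpha<0$, $[\theta]_\alpha=\sup_{z\in P}\sup_{T\le1}T^{-\alpha}|(\theta)_T(z)|$; for $\alpha\in(0,1)$, $[f]_\alpha=\sup_{z\neq\bar z}|f(z)-f(\bar z)|/d(z,\bar z)^\alpha$; for $\alpha\in(1,2)$, $[f]_\alpha=\sup_{z\ne\bar z}|f(\bar z)-f(z)-\nabla f(z)\cdot(\bar x-x)|/d(z,\bar z)^\alpha$ ($\nabla$ the spatial gradient), suprema over $\mathbb{R}\times\mathbb{R}^3$. *)

(* Defs.v *)
From Stdlib Require Import Reals Lra List ClassicalEpsilon.
Open Scope R_scope.

Record pt := mkpt { pt_t : R; pt_x1 : R; pt_x2 : R; pt_x3 : R }.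

Definition psub (z w : pt) : pt :=
  mkpt (pt_t z - pt_t w) (pt_x1 z - pt_x1 w) (pt_x2 z - pt_x2 w) (pt_x3 z - pt_x3 w).

Definition xnorm (z : pt) : R :=
  Rmax (Rabs (pt_x1 z)) (Rmax (Rabs (pt_x2 z)) (Rabs (pt_x3 z))).

Definition pdist (z w : pt) : R :=
  Rmax (sqrt (Rabs (pt_t z - pt_t w))) (xnorm (psub z w)).

Inductive dir := Dt | D1 | D2 | D3.

Definition shift (z : pt) (d : dir) (s : R) : pt :=
  match d with
  | Dt => mkpt (pt_t z + s) (pt_x1 z) (pt_x2 z) (pt_x3 z)
  | D1 => mkpt (pt_t z) (pt_x1 z + s) (pt_x2 z) (pt_x3 z)
  | D2 => mkpt (pt_t z) (pt_x1 z) (pt_x2 z + s) (pt_x3 z)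
  | D3 => mkpt (pt_t z) (pt_x1 z) (pt_x2 z) (pt_x3 z + s)
  end.

(* the partial derivative in direction d (meaningful when it exists) *)
Definition pd (d : dir) (f : pt -> R) (z : pt) : R :=
  epsilon (inhabits 0) (fun l => derivable_pt_lim (fun s => f (shift z d s)) 0 l).

Definition pdl (ds : list dir) (f : pt -> R) : pt -> R := fold_right pd f ds.

Definition cont4 (f : pt -> R) : Prop :=
  forall z eps, 0 < eps -> exists del, 0 < del /\
    forall w, pdist z w < del -> Rabs (f w - f z) < eps.

Definition Smooth (f : pt -> R) : Prop :=
  forall ds : list dir, cont4 (pdl ds f) /\
    forall d z, derivable_pt_lim (fun s => pdl ds f (shift z d s)) 0 (pd d (pdl ds f) z).

Definition heat (f : pt -> R) (z : pt) : R :=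
  pd Dt f z - (pd D1 (pd D1 f) z + pd D2 (pd D2 f) z + pd D3 (pd D3 f) z).

Definition RInt (f : R -> R) (a b : R) : R :=
  epsilon (inhabits 0) (fun l => exists pr : Riemann_integrable f a b, RiemannInt pr = l).

Definition box_int (h : pt -> R) (M : R) : R :=
  RInt (fun t => RInt (fun a => RInt (fun b => RInt (fun c => h (mkpt t a b c))
    (-M) M) (-M) M) (-M) M) (-M) M.

(* integral over R x R^3 (of continuous, compactly supported integrands) *)
Definition Int4 (h : pt -> R) : R :=
  epsilon (inhabits 0) (fun l => exists M0, forall M, M0 <= M -> box_int h M = l).

Definition conv (f g : pt -> R) (z : pt) : R := Int4 (fun w => f (psub z w) * g w).

Definition PhiT (Phi : pt -> R) (T : R) (z : pt) : R :=
  / T ^ 5 * Phi (mkpt (pt_t z / T ^ 2) (pt_x1 z / T) (pt_x2 z / T) (pt_x3 z / T)).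

(* PsiN Phi T n = Psi_{T,n+1} = Phi_{T/2} * ... * Phi_{T/2^(n+1)} *)
Fixpoint PsiN (Phi : pt -> R) (T : R) (n : nat) : pt -> R :=
  match n with
  | O => PhiT Phi (T / 2)
  | S m => conv (PsiN Phi T m) (PhiT Phi (T / 2 ^ (S (S m))))
  end.

Definition Psi (Phi : pt -> R) (T : R) (z : pt) : R :=
  epsilon (inhabits 0) (fun l => Un_cv (fun n => PsiN Phi T n z) l).

Definition moll (Phi : pt -> R) (T : R) (f : pt -> R) (z : pt) : R :=
  Int4 (fun w => Psi Phi T (psub z w) * f w).

Definition inP (z : pt) : Prop :=
  0 < pt_t z < 1 /\ Rabs (pt_x1 z) < 1 /\ Rabs (pt_x2 z) < 1 /\ Rabs (pt_x3 z) < 1.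

Definition inPR (R0 : R) (z : pt) : Prop :=
  R0 ^ 2 < pt_t z < 1 /\ xnorm z < 1 - R0.

(* [theta]_alpha <= q, alpha < 0 *)
Definition neg_bound (Phi : pt -> R) (alpha : R) (th : pt -> R) (q : R) : Prop :=
  forall z, inP z -> forall T, 0 < T <= 1 ->
    Rpower T (- alpha) * Rabs (moll Phi T th z) <= q.

(* [f]_alpha <= q, alpha in (0,1), supremum over all of R x R^3 *)
Definition holder_bound (alpha : R) (f : pt -> R) (q : R) : Prop :=
  forall z w, z <> w -> Rabs (f z - f w) / Rpower (pdist z w) alpha <= q.

Definition loc_bound (Phi : pt -> R) (ex : R) (F : pt -> pt -> R) (q : R) : Prop :=
  forall x, inP x -> forall T, 0 < T < 1 ->
    Rpower T ex * Rabs (Int4 (fun y => F x y * Psi Phi T (psub x y))) <= q.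

(* Q6 <= q: the integrand is vector valued, |.| the sup norm on R^3 *)
Definition Q6_bound (Phi : pt -> R) (eps : R) (tau2 : pt -> R) (q : R) : Prop :=
  forall x, inP x -> forall T, 0 < T < 1 ->
    Rpower T (2 * eps) *
      Rmax (Rabs (Int4 (fun y => (pt_x1 y - pt_x1 x) * tau2 y * Psi Phi T (psub x y))))
      (Rmax (Rabs (Int4 (fun y => (pt_x2 y - pt_x2 x) * tau2 y * Psi Phi T (psub x y))))
            (Rabs (Int4 (fun y => (pt_x3 y - pt_x3 x) * tau2 y * Psi Phi T (psub x y)))))
    <= q.

(* q^a for q >= 0 and a > 0 (with 0^a = 0) *)
Definition rpow (q a : R) : R := if Rlt_dec 0 q then Rpower q a else 0.

Definition kernel_ok (Phi : pt -> R) : Prop :=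
  Smooth Phi /\
  (forall z, 0 <= Phi z <= 1) /\
  Int4 Phi = 1 /\
  (forall t a b c, Phi (mkpt t (- a) (- b) (- c)) = Phi (mkpt t a b c)) /\
  (forall z, Phi z <> 0 -> 0 < pt_t z < 1 /\ xnorm z < 1).

(* Main.v *)
(** Everything is measured at the parabolic scale given by the size of [v].
    Call a point [x] good at level [mu] if [|v x| <= mu] and if, in the past ball of
    radius [1/mu] around [x], the remainder of
      [v(y) - v(x) + Y3(y) - Y3(x) + 3 v(x) (Y2(y) - Y2(x))]
    after subtracting its spatial linear part is at most [mu^{9/4} d(x,y)^{5/4}].
    With [d x] the parabolic distance of [x] to the past boundary of [P], smoothness makes
    every [x] good at level [A + V / d x] for some large [V].  If [A] dominates the
    quantities [Q_i^{1/(n_i(1/2-eps))}], then [V] may be replaced by [9V/10] as long as [V]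
    is larger than a universal constant, and iterating gives the theorem.

    For the improvement, rescale parabolically by the level [lam] at one point: on a large
    past cube all [Q_i] are small, all points are good at level 3, and the origin must be
    shown to be good at level 1.
    - A multiscale (reconstruction) argument bounds the mollified products
      [v tau2 + 3 C2 (tau1 + v)] and [v^2 tau1] through the remainders and the [Q_i].
    - Hence the mollified [v] solves [Lw = - w^3 + small]; comparison with a quadratic
      barrier makes [v] small near the origin, the cubic term forgetting the boundary data
      because the cube is large.
    - [v + Y3 + 3 v(0) Y2] then has a small right-hand side, and a Schauder estimate, by
      telescoping over dyadic scales of a truncated heat kernel, bounds the remainder at
      the origin.

    All exponents are kept in multiples of 1/8, which leaves room for [eps < 1/100]. *)

From Coquelicot Require Import Coquelicot.
From Stdlib Require Import Reals Lra Lia ZArith List ClassicalEpsilon FunctionalExtensionality.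
Require Import Defs.
Open Scope R_scope.

(** * Points, neighbourhoods and continuity *)

(** A sup bound on [v] cannot be iterated alone: it does not control the products of [v] with [tau2]
    and of [v^2] with [tau1]. Hence goodness carries a remainder bound, and both parts are improved
    together. Counted in eighths, [tau1], [tau2], [tau3] have regularity -5, -9, -13, and [Y2],
    [Y3], [v] have 7, 3, 3. In the equation of [v + Y3 + 3 v(0) Y2] the worst term is
    [(v - v(0)) tau2], of order 3 - 9 = -6; inverting the heat operator gains 16, whence the
    exponent 10, that is 5/4. As 10 > 9, the remainder may in turn be multiplied by [tau2]. [C1] and
    [C2] may be huge and are never estimated: [C1] is hidden in [tau2] and [tau3], and
    [9 C2 (v + tau1)] is exactly what turns [Y2 tau2] and [Y3 tau2], with their coefficients in the
    expansion of [v], into the centred products of [Q7] and [Q9]. A dilation by [1/lam] multiplies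
    [Q_i] by [lam^(-n_i (1/2 - eps))], which explains the exponents in the maximum. At distance [d]
    from the past boundary the levels used are at least of order [Kr / d], so the rescaled domain
    contains a cube of fixed large size. *)

Definition crd (d : dir) (z : pt) : R :=
  match d with Dt => pt_t z | D1 => pt_x1 z | D2 => pt_x2 z | D3 => pt_x3 z end.

Definition setc (z : pt) (d : dir) (c : R) : pt :=
  match d with
  | Dt => mkpt c (pt_x1 z) (pt_x2 z) (pt_x3 z)
  | D1 => mkpt (pt_t z) c (pt_x2 z) (pt_x3 z)
  | D2 => mkpt (pt_t z) (pt_x1 z) c (pt_x3 z)
  | D3 => mkpt (pt_t z) (pt_x1 z) (pt_x2 z) c
  end.

Definition origin : pt := mkpt 0 0 0 0.

(** Translations, reflections and parabolic dilations all have this diagonal form, so one change of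
    variables and one chain rule serve for all of them. *)
Definition aff (p m z : pt) : pt :=
  mkpt (pt_t p + pt_t m * pt_t z) (pt_x1 p + pt_x1 m * pt_x1 z)
       (pt_x2 p + pt_x2 m * pt_x2 z) (pt_x3 p + pt_x3 m * pt_x3 z).

Definition padd (z w : pt) : pt :=
  mkpt (pt_t z + pt_t w) (pt_x1 z + pt_x1 w) (pt_x2 z + pt_x2 w) (pt_x3 z + pt_x3 w).

(** One radius for time and space: the topology is that of [pdist], but uniform continuity and
    compactness can be handled coordinate by coordinate. *)
Definition near (e : R) (z w : pt) : Prop := forall d, Rabs (crd d w - crd d z) < e.

Definition inbox (M : R) (z : pt) : Prop := forall d, Rabs (crd d z) <= M.

Lemma pt_ext (z w : pt) : (forall d, crd d z = crd d w) -> z = w.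
Proof.
  destruct z, w; intros H.
  generalize (H Dt) (H D1) (H D2) (H D3); simpl; intros; subst; reflexivity.
Qed.

Lemma crd_aff (p m z : pt) (d : dir) : crd d (aff p m z) = crd d p + crd d m * crd d z.
Proof. destruct d; reflexivity. Qed.

Lemma crd_psub (z w : pt) (d : dir) : crd d (psub z w) = crd d z - crd d w.
Proof. destruct d; reflexivity. Qed.

Lemma crd_setc_eq (z : pt) (d : dir) (c : R) : crd d (setc z d c) = c.
Proof. destruct d; reflexivity. Qed.

Lemma crd_setc_neq (z : pt) (d d' : dir) (c : R) : d' <> d -> crd d' (setc z d c) = crd d' z.
Proof. destruct d, d'; intros H; try reflexivity; congruence. Qed.

Lemma dir_eq_dec (d d' : dir) : {d = d'} + {d <> d'}.
Proof. decide equality. Qed.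

Lemma forall_dir_pos (P : dir -> R -> Prop) :
  (forall d e e', 0 < e' <= e -> P d e -> P d e') ->
  (forall d, exists e, 0 < e /\ P d e) -> exists e, 0 < e /\ forall d, P d e.
Proof.
  intros mono H.
  destruct (H Dt) as [e0 [P0 Q0]], (H D1) as [e1 [P1 Q1]], (H D2) as [e2 [P2 Q2]],
    (H D3) as [e3 [P3 Q3]].
  exists (Rmin (Rmin e0 e1) (Rmin e2 e3)); split.
  - repeat apply Rmin_pos; assumption.
  - assert (E : 0 < Rmin (Rmin e0 e1) (Rmin e2 e3)) by (repeat apply Rmin_pos; assumption).
    pose proof (Rmin_l (Rmin e0 e1) (Rmin e2 e3)).
    pose proof (Rmin_r (Rmin e0 e1) (Rmin e2 e3)).
    pose proof (Rmin_l e0 e1). pose proof (Rmin_r e0 e1).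
    pose proof (Rmin_l e2 e3). pose proof (Rmin_r e2 e3).
    intros [ | | | ]; [apply mono with e0|apply mono with e1|apply mono with e2|apply mono with e3];
      try assumption; lra.
Qed.

Lemma xnorm_crd (z : pt) (r : R) :
  xnorm z <= r <-> Rabs (pt_x1 z) <= r /\ Rabs (pt_x2 z) <= r /\ Rabs (pt_x3 z) <= r.
Proof.
  unfold xnorm; split.
  - intros H.
    pose proof (Rmax_l (Rabs (pt_x1 z)) (Rmax (Rabs (pt_x2 z)) (Rabs (pt_x3 z)))).
    pose proof (Rmax_r (Rabs (pt_x1 z)) (Rmax (Rabs (pt_x2 z)) (Rabs (pt_x3 z)))).
    pose proof (Rmax_l (Rabs (pt_x2 z)) (Rabs (pt_x3 z))).
    pose proof (Rmax_r (Rabs (pt_x2 z)) (Rabs (pt_x3 z))).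
    repeat split; lra.
  - intros [H1 [H2 H3]]. repeat apply Rmax_lub; assumption.
Qed.

Lemma xnorm_crd_lt (z : pt) (r : R) :
  xnorm z < r <-> Rabs (pt_x1 z) < r /\ Rabs (pt_x2 z) < r /\ Rabs (pt_x3 z) < r.
Proof.
  unfold xnorm; split.
  - intros H.
    pose proof (Rmax_l (Rabs (pt_x1 z)) (Rmax (Rabs (pt_x2 z)) (Rabs (pt_x3 z)))).
    pose proof (Rmax_r (Rabs (pt_x1 z)) (Rmax (Rabs (pt_x2 z)) (Rabs (pt_x3 z)))).
    pose proof (Rmax_l (Rabs (pt_x2 z)) (Rabs (pt_x3 z))).
    pose proof (Rmax_r (Rabs (pt_x2 z)) (Rabs (pt_x3 z))).
    repeat split; lra.
  - intros [H1 [H2 H3]]. repeat apply Rmax_lub_lt; assumption.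
Qed.

Lemma sqrt_Rabs_le (x r : R) : 0 <= r -> (sqrt (Rabs x) <= r <-> Rabs x <= r ^ 2).
Proof.
  intros Hr; split; intros H.
  - rewrite <- (sqrt_def (Rabs x)) by apply Rabs_pos.
    pose proof (sqrt_pos (Rabs x)). nra.
  - rewrite <- (sqrt_pow2 r Hr). apply sqrt_le_1_alt; assumption.
Qed.

Lemma sqrt_Rabs_lt (x r : R) : 0 < r -> (sqrt (Rabs x) < r <-> Rabs x < r ^ 2).
Proof.
  intros Hr; split; intros H.
  - rewrite <- (sqrt_def (Rabs x)) by apply Rabs_pos.
    pose proof (sqrt_pos (Rabs x)). nra.
  - rewrite <- (sqrt_pow2 r) by lra. apply sqrt_lt_1_alt; split; [apply Rabs_pos|assumption].
Qed.

Lemma pdist_le_iff (z w : pt) (r : R) : 0 <= r ->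
  (pdist z w <= r <-> Rabs (pt_t z - pt_t w) <= r ^ 2 /\ Rabs (pt_x1 z - pt_x1 w) <= r /\
     Rabs (pt_x2 z - pt_x2 w) <= r /\ Rabs (pt_x3 z - pt_x3 w) <= r).
Proof.
  intros Hr. unfold pdist. rewrite <- (sqrt_Rabs_le _ _ Hr).
  pose proof (xnorm_crd (psub z w) r) as X; simpl in X.
  split.
  - intros H.
    pose proof (Rmax_l (sqrt (Rabs (pt_t z - pt_t w))) (xnorm (psub z w))).
    pose proof (Rmax_r (sqrt (Rabs (pt_t z - pt_t w))) (xnorm (psub z w))).
    split; [lra|]. apply X; lra.
  - intros [H1 H2]. apply Rmax_lub; [assumption|]. apply X; assumption.
Qed.

Lemma pdist_lt_iff (z w : pt) (r : R) : 0 < r ->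
  (pdist z w < r <-> Rabs (pt_t z - pt_t w) < r ^ 2 /\ Rabs (pt_x1 z - pt_x1 w) < r /\
     Rabs (pt_x2 z - pt_x2 w) < r /\ Rabs (pt_x3 z - pt_x3 w) < r).
Proof.
  intros Hr. unfold pdist. rewrite <- (sqrt_Rabs_lt _ _ Hr).
  pose proof (xnorm_crd_lt (psub z w) r) as X; simpl in X.
  split.
  - intros H.
    pose proof (Rmax_l (sqrt (Rabs (pt_t z - pt_t w))) (xnorm (psub z w))).
    pose proof (Rmax_r (sqrt (Rabs (pt_t z - pt_t w))) (xnorm (psub z w))).
    split; [lra|]. apply X; lra.
  - intros [H1 H2]. apply Rmax_lub_lt; [assumption|]. apply X; assumption.
Qed.

Lemma pdist_pos (z w : pt) : 0 <= pdist z w.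
Proof. unfold pdist. eapply Rle_trans; [apply sqrt_pos|apply Rmax_l]. Qed.

(** As a filter, this gives access to the limit calculus although [pt] is a bare record without a
    topology of its own. *)
Definition nb (z : pt) (P : pt -> Prop) : Prop :=
  exists e, 0 < e /\ forall w, near e z w -> P w.

Global Instance nb_filter (z : pt) : Filter (nb z).
Proof.
  constructor.
  - exists 1; split; [lra|trivial].
  - intros P Q [e1 [He1 H1]] [e2 [He2 H2]].
    exists (Rmin e1 e2); split; [apply Rmin_pos; assumption|].
    intros w Hw; split; [apply H1|apply H2]; intros d; specialize (Hw d);
      eapply Rlt_le_trans; [exact Hw|apply Rmin_l|exact Hw|apply Rmin_r].
  - intros P Q HPQ [e [He H]]. exists e; split; [assumption|]. intros; apply HPQ, H; assumption.
Qed.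

Lemma filterlim_R_iff (F : (pt -> Prop) -> Prop) (FF : Filter F) (f : pt -> R) (l : R) :
  filterlim f F (locally l) <-> forall e, 0 < e -> F (fun w => Rabs (f w - l) < e).
Proof.
  split.
  - intros H e He. apply (H (fun y => Rabs (y - l) < e)).
    exists (mkposreal e He). intros y Hy. exact Hy.
  - intros H P [e HP]. unfold filtermap.
    apply (filter_imp (fun w => Rabs (f w - l) < e)); [|exact (H e (cond_pos e))].
    intros w Hw. apply HP. exact Hw.
Qed.

Lemma cont4_nb (f : pt -> R) :
  cont4 f <-> forall z, filterlim f (nb z) (locally (f z)).
Proof.
  split.
  - intros H z. apply filterlim_R_iff; [apply nb_filter|]. intros e He.
    destruct (H z e He) as [del [Hd Hw]].
    (* Time enters [pdist] through a square root, hence the second radius [del ^ 2]. *)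
    exists (Rmin del (del ^ 2)); split; [apply Rmin_pos; [assumption|apply pow_lt; assumption]|].
    intros w N. apply Hw. apply pdist_lt_iff; [assumption|].
    pose proof (Rmin_l del (del ^ 2)). pose proof (Rmin_r del (del ^ 2)).
    generalize (N Dt) (N D1) (N D2) (N D3); cbn [crd].
    rewrite (Rabs_minus_sym (pt_t w)), (Rabs_minus_sym (pt_x1 w)), (Rabs_minus_sym (pt_x2 w)),
      (Rabs_minus_sym (pt_x3 w)). intros; repeat split; lra.
  - intros H z e He. specialize (H z). rewrite (filterlim_R_iff _ _) in H.
    destruct (H e He) as [d [Hd Hw]].
    pose proof (Rmin_l d 1). pose proof (Rmin_r d 1).
    assert (P : 0 < Rmin d 1) by (apply Rmin_pos; lra).
    exists (Rmin d 1); split; [assumption|].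
    intros w Hzw. apply Hw. apply pdist_lt_iff in Hzw; [|assumption].
    rewrite (Rabs_minus_sym (pt_t z)), (Rabs_minus_sym (pt_x1 z)), (Rabs_minus_sym (pt_x2 z)),
      (Rabs_minus_sym (pt_x3 z)) in Hzw.
    assert (Rmin d 1 ^ 2 <= d) by nra.
    intros [ | | | ]; simpl; lra.
Qed.

Lemma cont4_const (c : R) : cont4 (fun _ => c).
Proof. apply cont4_nb; intros z. apply filterlim_const. Qed.

Lemma cont4_crd (d : dir) : cont4 (crd d).
Proof.
  apply cont4_nb; intros z. apply filterlim_R_iff; [apply nb_filter|].
  intros e He. exists e; split; [assumption|]. intros w Hw; apply Hw.
Qed.

Lemma cont4_plus (f g : pt -> R) : cont4 f -> cont4 g -> cont4 (fun z => f z + g z).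
Proof.
  rewrite !cont4_nb. intros Hf Hg z.
  apply (filterlim_comp_2 (F := nb z) f g Rplus (Hf z) (Hg z)).
  apply (filterlim_plus (f z) (g z)).
Qed.

Lemma cont4_mult (f g : pt -> R) : cont4 f -> cont4 g -> cont4 (fun z => f z * g z).
Proof.
  rewrite !cont4_nb. intros Hf Hg z.
  apply (filterlim_comp_2 (F := nb z) f g Rmult (Hf z) (Hg z)).
  apply (filterlim_mult (f z) (g z)).
Qed.

Lemma cont4_comp1 (g : R -> R) (f : pt -> R) :
  cont4 f -> (forall x, continuity_pt g x) -> cont4 (fun z => g (f z)).
Proof.
  rewrite !cont4_nb. intros Hf Hg z.
  apply (filterlim_comp _ _ _ f g (nb z) (locally (f z)) _ (Hf z)).
  apply continuity_pt_filterlim, Hg.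
Qed.

Lemma cont4_ext (f g : pt -> R) : (forall z, f z = g z) -> cont4 f -> cont4 g.
Proof. intros H. replace g with f; [trivial|]. extensionality z; apply H. Qed.

Lemma cont4_scal (c : R) (f : pt -> R) : cont4 f -> cont4 (fun z => c * f z).
Proof. intros; apply cont4_mult; [apply cont4_const|assumption]. Qed.

Lemma cont4_opp (f : pt -> R) : cont4 f -> cont4 (fun z => - f z).
Proof. intros. apply (cont4_ext (fun z => -1 * f z)); [intros; ring|apply cont4_scal; assumption]. Qed.

Lemma cont4_minus (f g : pt -> R) : cont4 f -> cont4 g -> cont4 (fun z => f z - g z).
Proof. intros; apply cont4_plus; [assumption|apply cont4_opp; assumption]. Qed.

Lemma cont4_pow (f : pt -> R) (n : nat) : cont4 f -> cont4 (fun z => f z ^ n).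
Proof.
  intros Hf; induction n; simpl; [apply cont4_const|apply cont4_mult; assumption].
Qed.

Lemma cont4_aff (f : pt -> R) (p m : pt) : cont4 f -> cont4 (fun z => f (aff p m z)).
Proof.
  rewrite !cont4_nb. intros Hf z.
  apply (filterlim_comp _ _ _ (aff p m) f (nb z) (nb (aff p m z))); [|apply Hf].
  intros P [e [He HP]].
  destruct (forall_dir_pos (fun d r => Rabs (crd d m) * r < e)) as [r [Hr Hd]].
  - intros d a b Hb Ha. pose proof (Rabs_pos (crd d m)). nra.
  - intros d. pose proof (Rabs_pos (crd d m)).
    exists (e / (Rabs (crd d m) + 1)); split; [apply Rdiv_lt_0_compat; lra|].
    apply Rmult_lt_reg_r with (Rabs (crd d m) + 1); [lra|].
    field_simplify; nra.
  - exists r; split; [assumption|]. intros w Hw. apply HP. intros d.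
    rewrite !crd_aff. replace (_ - _) with (crd d m * (crd d w - crd d z)) by ring.
    rewrite Rabs_mult. specialize (Hw d); specialize (Hd d).
    pose proof (Rabs_pos (crd d m)). nra.
Qed.

Lemma psub_aff (z w : pt) : psub z w = aff z (mkpt (-1) (-1) (-1) (-1)) w.
Proof. apply pt_ext; intros []; simpl; ring. Qed.

Lemma psub_aff_l (z w : pt) :
  psub z w = aff (psub origin w) (mkpt 1 1 1 1) z.
Proof. apply pt_ext; intros []; simpl; ring. Qed.

Lemma cont4_psub_r (f : pt -> R) (z : pt) : cont4 f -> cont4 (fun w => f (psub z w)).
Proof.
  intros H. apply (cont4_ext (fun w => f (aff z (mkpt (-1) (-1) (-1) (-1)) w))).
  - intros w; rewrite psub_aff; reflexivity.
  - apply cont4_aff; assumption.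
Qed.

(** * Compactness of boxes *)

(** Compactness of boxes is available for nested products; [T4] and [P4] transport it to [pt]. *)
Definition T4 (z : pt) : Compactness.Tn 4 R := (pt_t z, (pt_x1 z, (pt_x2 z, (pt_x3 z, tt)))).
Definition P4 (x : Compactness.Tn 4 R) : pt :=
  let '(t, (a, (b, (c, _)))) := x in mkpt t a b c.

(** A Lebesgue number argument: every centre gets half of a radius on which [f] varies by less than
    [e / 2], so a point of the box and its neighbour, even one outside the box, lie in the ball of
    one common centre. *)
Lemma cont4_unif_box (f : pt -> R) (M e : R) : cont4 f -> 0 < e ->
  exists r, 0 < r /\ forall z w, inbox M z -> near r z w -> Rabs (f w - f z) <= e.
Proof.
  rewrite cont4_nb; intros Hf He.
  assert (H2 : 0 < e / 2) by lra.
  assert (X : forall z, exists d : posreal, forall w, near d z w -> Rabs (f w - f z) < e / 2).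
  { intros z. specialize (Hf z). rewrite (filterlim_R_iff _ _) in Hf.
    destruct (Hf (e / 2) H2) as [d [Hd Hw]]. exists (mkposreal d Hd); exact Hw. }
  set (del := fun z => proj1_sig (constructive_indefinite_description _ (X z))).
  assert (Hdel : forall z w, near (del z) z w -> Rabs (f w - f z) < e / 2)
    by (intros z; exact (proj2_sig (constructive_indefinite_description _ (X z)))).
  set (hdel := fun x => mkposreal (del (P4 x) / 2)
     (Rdiv_lt_0_compat _ _ (cond_pos (del (P4 x))) Rlt_0_2)).
  destruct (compactness_value 4 (T4 (mkpt (-M) (-M) (-M) (-M))) (T4 (mkpt M M M M)) hdel)
    as [d Hd].
  exists d; split; [apply cond_pos|].
  intros z w Hz Hzw.
  (* The finite cover is given under a double negation, so the estimate is proved by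
     contradiction. *)
  apply NNPP; intros Hn. apply (Hd (T4 z)).
  - simpl. generalize (Hz Dt) (Hz D1) (Hz D2) (Hz D3); simpl.
    repeat rewrite Rabs_le_between. intros; repeat split; lra.
  - intros [x [Hx [Hc Hdx]]]. apply Hn.
    destruct x as [x0 [x1 [x2 [x3 []]]]].
    set (y := mkpt x0 x1 x2 x3). simpl in Hc, Hdx.
    fold y in Hc, Hdx. clearbody del.
    assert (N1 : near (del y) y z).
    { generalize (cond_pos (del y)); intros.
      intros []; unfold y; simpl; fold y; lra. }
    assert (N2 : near (del y) y w).
    { assert (Y : forall d', Rabs (crd d' z - crd d' y) < del y / 2)
        by (intros []; unfold y; simpl; fold y; lra).
      intros d'. specialize (Hzw d'); specialize (Y d').
      replace (crd d' w - crd d' y) with ((crd d' w - crd d' z) + (crd d' z - crd d' y)) by ring.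
      eapply Rle_lt_trans; [apply Rabs_triang|]. lra. }
    apply Hdel in N1, N2.
    replace (f w - f z) with ((f w - f y) - (f z - f y)) by ring.
    unfold Rminus at 1. eapply Rle_trans; [apply Rabs_triang|]. rewrite Rabs_Ropp. lra.
Qed.

(** Walking from the origin to [z] in [N] equal steps, each shorter than the radius of uniform
    continuity for error 1, changes [f] by at most 1 per step. *)
Lemma cont4_bounded_box (f : pt -> R) (M : R) : cont4 f ->
  exists B, 0 <= B /\ forall z, inbox M z -> Rabs (f z) <= B.
Proof.
  intros Hf.
  destruct (Rlt_or_le M 0) as [HM|HM].
  { exists 0; split; [lra|]. intros z Hz. specialize (Hz Dt). pose proof (Rabs_pos (crd Dt z)). lra. }
  destruct (cont4_unif_box f M 1 Hf Rlt_0_1) as [r [Hr Hu]].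
  destruct (archimed (M / r)) as [HN _].
  set (N := Z.to_nat (up (M / r))).
  assert (HNr : INR N > M / r).
  { unfold N. rewrite INR_IZR_INZ, Z2Nat.id; [assumption|].
    apply le_IZR. apply Rle_trans with (M / r); [|lra]. apply Rle_div_r; lra. }
  assert (HNp : 0 < INR N) by (apply Rle_lt_trans with (M / r); [apply Rle_div_r; lra|lra]).
  exists (Rabs (f origin) + INR N); split; [pose proof (Rabs_pos (f origin)); lra|].
  intros z Hz.
  set (g := fun k : nat => aff origin (mkpt (INR k / INR N) (INR k / INR N) (INR k / INR N) (INR k / INR N)) z).
  assert (Hg : forall k d, crd d (g k) = INR k / INR N * crd d z)
    by (intros k []; simpl; ring).
  assert (K : forall k, (k <= N)%nat -> Rabs (f (g k)) <= Rabs (f origin) + INR k).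
  { induction k; intros Hk.
    - replace (g 0%nat) with origin; [simpl; lra|].
      apply pt_ext; intros d; rewrite Hg; destruct d; simpl; unfold Rdiv; ring.
    - rewrite S_INR.
      replace (f (g (S k))) with (f (g k) + (f (g (S k)) - f (g k))) by ring.
      eapply Rle_trans; [apply Rabs_triang|].
      assert (Rabs (f (g (S k)) - f (g k)) <= 1); [|assert (k <= N)%nat by lia; specialize (IHk H0); lra].
      apply Hu.
      + intros d; rewrite Hg, Rabs_mult. specialize (Hz d).
        assert (0 <= INR k / INR N <= 1).
        { split; [apply Rle_div_r; [lra|]; pose proof (pos_INR k); lra|].
          apply Rle_div_l; [lra|]. rewrite Rmult_1_l; apply le_INR; lia. }
        rewrite (Rabs_pos_eq (INR k / INR N)) by lra. pose proof (Rabs_pos (crd d z)). nra.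
      + intros d; rewrite !Hg, S_INR.
        replace (_ - _) with (crd d z / INR N) by (field; lra).
        unfold Rdiv; rewrite Rabs_mult, Rabs_inv, (Rabs_pos_eq (INR N)) by lra.
        apply Rlt_div_l; [lra|]. specialize (Hz d).
        apply Rlt_div_l in HNr; [|lra]. lra. }
  specialize (K N (Nat.le_refl N)).
  replace (g N) with z in K; [exact K|].
  apply pt_ext; intros d; rewrite Hg; field; lra.
Qed.

(** If the supremum [s] were not attained, every point would have a neighbourhood on which
    [f <= s - d] within [D], with [d] also the radius; compactness yields one [d] for all points,
    and [s - d] would be a smaller upper bound. *)
Lemma cont4_attains_max (f : pt -> R) (M : R) (D : pt -> Prop) : cont4 f ->
  (exists z, D z) -> (forall z, D z -> inbox M z) ->
  (forall z, ~ D z -> exists r, 0 < r /\ forall w, near r z w -> ~ D w) ->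
  exists z, D z /\ forall w, D w -> f w <= f z.
Proof.
  intros Hf [z0 Hz0] Hb Hcl.
  destruct (cont4_bounded_box f M Hf) as [B [HB Hfb]].
  destruct (completeness (fun y => exists z, D z /\ y = f z)) as [s [Hub Hlub]].
  - exists B. intros y [z [Hz ->]]. specialize (Hfb z (Hb z Hz)).
    apply Rabs_le_between in Hfb; lra.
  - exists (f z0), z0; auto.
  - apply NNPP; intros Hn.
    assert (Hlt : forall z, D z -> f z < s).
    { intros z Hz. destruct (Hub (f z)) as [H|H]; [exists z; auto|assumption|].
      exfalso; apply Hn. exists z; split; [assumption|]. intros w Hw. rewrite H.
      apply Hub; exists w; auto. }
    assert (X : forall z, exists d : posreal, forall w, near d z w -> D w -> f w <= s - d).
    { intros z. destruct (classic (D z)) as [Hz|Hz].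
      - assert (0 < (s - f z) / 2) by (specialize (Hlt z Hz); lra).
        pose proof Hf as Hf'. rewrite cont4_nb in Hf'. specialize (Hf' z).
        rewrite (filterlim_R_iff _ _) in Hf'. destruct (Hf' _ H) as [r [Hr Hw]].
        assert (P : 0 < Rmin r ((s - f z) / 2)) by (apply Rmin_pos; assumption).
        exists (mkposreal _ P); simpl. intros w Nw _.
        pose proof (Rmin_l r ((s - f z) / 2)). pose proof (Rmin_r r ((s - f z) / 2)).
        assert (N' : near r z w) by (intros d; specialize (Nw d); lra).
        apply Hw in N'. apply Rabs_lt_between in N'. lra.
      - destruct (Hcl z Hz) as [r [Hr Hw]]. exists (mkposreal r Hr); simpl.
        intros w Nw Dw; exfalso; apply (Hw w Nw Dw). }
    set (del := fun z => proj1_sig (constructive_indefinite_description _ (X z))).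
    assert (Hdel : forall z w, near (del z) z w -> D w -> f w <= s - del z)
      by (intros z; exact (proj2_sig (constructive_indefinite_description _ (X z)))).
    destruct (compactness_value 4 (T4 (mkpt (-M) (-M) (-M) (-M))) (T4 (mkpt M M M M))
      (fun x => del (P4 x))) as [d Hd].
    assert (HU : is_upper_bound (fun y => exists z, D z /\ y = f z) (s - d)).
    { intros y [z [Hz ->]]. apply NNPP; intros Hc. apply (Hd (T4 z)).
      - simpl. pose proof (Hb z Hz) as I. generalize (I Dt) (I D1) (I D2) (I D3); simpl.
        repeat rewrite Rabs_le_between. intros; repeat split; lra.
      - intros [x [Hx [Hcl' Hdx]]]. apply Hc.
        destruct x as [x0 [x1 [x2 [x3 []]]]]. simpl in Hcl', Hdx.
        apply Rle_trans with (s - del (mkpt x0 x1 x2 x3)); [|lra].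
        apply Hdel; [|assumption]. intros []; simpl; lra. }
    specialize (Hlub _ HU). pose proof (cond_pos d). lra.
Qed.

(** * Iterated integrals of compactly supported functions *)

Definition UC (h : pt -> R) : Prop :=
  forall e, 0 < e -> exists r, 0 < r /\ forall z w, near r z w -> Rabs (h w - h z) <= e.

Definition supp_in (M : R) (h : pt -> R) : Prop := forall z, ~ inbox M z -> h z = 0.

Definition Cc (h : pt -> R) : Prop := cont4 h /\ exists M, supp_in M h.

Lemma near_le (r r' : R) (z w : pt) : r <= r' -> near r z w -> near r' z w.
Proof. intros H N d; specialize (N d); lra. Qed.

Lemma inbox_le (M M' : R) (z : pt) : M <= M' -> inbox M z -> inbox M' z.
Proof. intros H N d; specialize (N d); lra. Qed.

Lemma supp_in_le (M M' : R) (h : pt -> R) : M <= M' -> supp_in M h -> supp_in M' h.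
Proof. intros H S z Hz; apply S; intros I; apply Hz; apply inbox_le with M; assumption. Qed.

Lemma UC_cont4 (h : pt -> R) : UC h -> cont4 h.
Proof.
  intros H. apply cont4_nb; intros z. apply filterlim_R_iff; [apply nb_filter|].
  intros e He. destruct (H (e / 2)) as [r [Hr Hw]]; [lra|].
  exists r; split; [assumption|]. intros w N. specialize (Hw z w N). lra.
Qed.

Lemma Cc_UC (h : pt -> R) : Cc h -> UC h.
Proof.
  intros [Hc [M HM]] e He.
  destruct (cont4_unif_box h (Rabs M + 1) e Hc He) as [r [Hr Hu]].
  pose proof (Rmin_l r 1). pose proof (Rmin_r r 1).
  exists (Rmin r 1); split; [apply Rmin_pos; lra|].
  intros z w N. destruct (classic (inbox (Rabs M + 1) z)) as [I|I].
  - apply Hu; [assumption|]. apply near_le with (Rmin r 1); assumption.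
  - pose proof (Rle_abs M).
    rewrite (HM z), (HM w); [rewrite Rminus_diag, Rabs_R0; lra| |].
    + intros J. apply I. intros d. specialize (J d); specialize (N d).
      replace (crd d z) with (crd d w - (crd d w - crd d z)) by ring.
      unfold Rminus at 1. eapply Rle_trans; [apply Rabs_triang|]. rewrite Rabs_Ropp. lra.
    + intros J. apply I. apply inbox_le with M; [lra|assumption].
Qed.

Lemma Cc_bounded (h : pt -> R) : Cc h -> exists B, 0 <= B /\ forall z, Rabs (h z) <= B.
Proof.
  intros [Hc [M HM]]. destruct (cont4_bounded_box h M Hc) as [B [HB H]].
  exists B; split; [assumption|]. intros z. destruct (classic (inbox M z)); [auto|].
  rewrite HM by assumption. rewrite Rabs_R0; assumption.
Qed.

Lemma near_setc (r : R) (z w : pt) (d : dir) (c c' : R) :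
  near r z w -> Rabs (c' - c) < r -> near r (setc z d c) (setc w d c').
Proof.
  intros N H d'. destruct (dir_eq_dec d' d) as [->|Hd].
  - rewrite !crd_setc_eq; assumption.
  - rewrite !crd_setc_neq by assumption; apply N.
Qed.

Lemma line_continuous (h : pt -> R) (z : pt) (d : dir) (c : R) :
  cont4 h -> continuous (fun x => h (setc z d x)) c.
Proof.
  rewrite cont4_nb; intros H. apply filterlim_locally. intros e.
  specialize (H (setc z d c)). rewrite (filterlim_R_iff _ _) in H.
  destruct (H e (cond_pos e)) as [r [Hr Hw]]. exists (mkposreal r Hr).
  intros y Hy. apply Hw. apply near_setc; [|exact Hy].
  intros d'. rewrite Rminus_diag, Rabs_R0; assumption.
Qed.

Lemma line_ex_RInt (h : pt -> R) (z : pt) (d : dir) (a b : R) :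
  cont4 h -> ex_RInt (fun x => h (setc z d x)) a b.
Proof. intros H. apply (ex_RInt_continuous (V := R_CompleteNormedModule)). intros; apply line_continuous; assumption. Qed.

(** The partial integral stays a function of the whole point, constant in coordinate [d], so that
    iterated integrals are compositions of operators of one type. *)
Definition Pint (d : dir) (M : R) (h : pt -> R) (z : pt) : R :=
  RInt.RInt (fun c => h (setc z d c)) (-M) M.

Lemma Pint_diff (d : dir) (M e : R) (h g : pt -> R) (z w : pt) : 0 <= M ->
  cont4 h -> cont4 g -> (forall c, Rabs (h (setc z d c) - g (setc w d c)) <= e) ->
  Rabs (Pint d M h z - Pint d M g w) <= 2 * M * e.
Proof.
  intros HM Hh Hg H. unfold Pint.
  pose proof (line_ex_RInt h z d (-M) M Hh) as X. pose proof (line_ex_RInt g w d (-M) M Hg) as Y.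
  replace (RInt.RInt _ (-M) M - RInt.RInt _ (-M) M)
    with (RInt.RInt (fun c => h (setc z d c) - g (setc w d c)) (-M) M).
  - replace (2 * M * e) with ((M - - M) * e) by ring.
    apply abs_RInt_le_const; [lra| |intros; apply H].
    apply (ex_RInt_minus (V := R_NormedModule)); assumption.
  - apply (RInt_minus (V := R_CompleteNormedModule)); assumption.
Qed.

Lemma Pint_UC (d : dir) (M : R) (h : pt -> R) : 0 < M -> UC h -> UC (Pint d M h).
Proof.
  intros HM H e He. destruct (H (e / (2 * M))) as [r [Hr Hw]]; [apply Rdiv_lt_0_compat; lra|].
  exists r; split; [assumption|]. intros z w N.
  replace e with (2 * M * (e / (2 * M))) by (field; lra).
  apply Pint_diff; [lra|apply UC_cont4; assumption|apply UC_cont4; assumption|].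
  intros c. apply Hw. apply near_setc; [assumption|]. rewrite Rminus_diag, Rabs_R0; assumption.
Qed.

Lemma Pint_lin (d : dir) (M a b : R) (h g : pt -> R) : cont4 h -> cont4 g ->
  Pint d M (fun z => a * h z + b * g z) = fun z => a * Pint d M h z + b * Pint d M g z.
Proof.
  intros Hh Hg. extensionality z. unfold Pint.
  pose proof (line_ex_RInt h z d (-M) M Hh) as X. pose proof (line_ex_RInt g z d (-M) M Hg) as Y.
  rewrite (RInt_plus (V := R_CompleteNormedModule) (fun c => a * h (setc z d c)) (fun c => b * g (setc z d c))).
  - rewrite (RInt_scal (V := R_CompleteNormedModule) (fun c => h (setc z d c))) by assumption.
    rewrite (RInt_scal (V := R_CompleteNormedModule) (fun c => g (setc z d c))) by assumption.
    reflexivity.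
  - apply (ex_RInt_scal (V := R_NormedModule) (fun c => h (setc z d c))); assumption.
  - apply (ex_RInt_scal (V := R_NormedModule) (fun c => g (setc z d c))); assumption.
Qed.

Lemma Pint_ge_0 (d : dir) (M : R) (h : pt -> R) : 0 <= M -> cont4 h ->
  (forall z, 0 <= h z) -> forall z, 0 <= Pint d M h z.
Proof.
  intros HM Hh H z. apply RInt_ge_0; [lra|apply line_ex_RInt; assumption|]. intros; apply H.
Qed.

Lemma RInt_zero_on (g : R -> R) (a b : R) :
  (forall x, Rmin a b < x < Rmax a b -> g x = 0) -> RInt.RInt g a b = 0.
Proof.
  intros H. rewrite (RInt_ext _ (fun _ => 0)) by assumption.
  rewrite (RInt_const (V := R_CompleteNormedModule)). apply Rmult_0_r.
Qed.

Lemma RInt_shrink (g : R -> R) (a b a' b' : R) : a <= a' -> a' <= b' -> b' <= b ->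
  (forall c e, ex_RInt g c e) -> (forall x, x < a' \/ b' < x -> g x = 0) ->
  RInt.RInt g a b = RInt.RInt g a' b'.
Proof.
  intros H1 H2 H3 Hex Hz.
  rewrite <- (RInt_Chasles g a a' b), <- (RInt_Chasles g a' b' b) by apply Hex.
  rewrite (RInt_zero_on g a a'), (RInt_zero_on g b' b).
  - unfold plus; simpl; ring.
  - intros x. rewrite Rmin_left, Rmax_right by lra. intros; apply Hz; lra.
  - intros x. rewrite Rmin_left, Rmax_right by lra. intros; apply Hz; lra.
Qed.

Lemma Pint_bound (d : dir) (M A c r : R) (h : pt -> R) (z : pt) : cont4 h ->
  0 <= r -> -M <= c - r -> c + r <= M ->
  (forall x, Rabs (h (setc z d x)) <= A) ->
  (forall x, r < Rabs (x - c) -> h (setc z d x) = 0) ->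
  Rabs (Pint d M h z) <= A * (2 * r).
Proof.
  intros Hh Hr H1 H2 HA Hs. unfold Pint.
  rewrite (RInt_shrink _ (-M) M (c - r) (c + r)); try lra.
  - replace (A * (2 * r)) with ((c + r - (c - r)) * A) by ring.
    apply abs_RInt_le_const; [lra|apply line_ex_RInt; assumption|auto].
  - intros; apply line_ex_RInt; assumption.
  - intros x Hx. apply Hs. apply Rnot_le_lt; intros Hc. apply Rabs_le_between in Hc. lra.
Qed.

Lemma Pint_supp (d : dir) (M : R) (h : pt -> R) (z : pt) :
  (forall x, h (setc z d x) = 0) -> Pint d M h z = 0.
Proof. intros H. apply RInt_zero_on. intros; apply H. Qed.

Definition I4 (M : R) (h : pt -> R) : R :=
  Pint Dt M (Pint D1 M (Pint D2 M (Pint D3 M h))) origin.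

(* [Pint d] kills the dependence on the coordinate [d]; the remaining
   coordinates keep their support. *)
Definition supp_dirs (M : R) (D : dir -> Prop) (h : pt -> R) : Prop :=
  forall z d, D d -> M < Rabs (crd d z) -> h z = 0.

Lemma supp_in_dirs (M : R) (h : pt -> R) : supp_in M h <-> supp_dirs M (fun _ => True) h.
Proof.
  split.
  - intros H z d _ Hd. apply H. intros I. specialize (I d). lra.
  - intros H z Hz. apply not_all_ex_not in Hz. destruct Hz as [d Hd]. apply (H z d); [trivial|lra].
Qed.

Lemma Pint_supp_dirs (d : dir) (M M' : R) (D : dir -> Prop) (h : pt -> R) :
  supp_dirs M D h -> supp_dirs M (fun d' => D d' /\ d' <> d) (Pint d M' h).
Proof.
  intros H z d' [Hd Hn] Hz. apply Pint_supp. intros x. apply (H _ d'); [assumption|].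
  rewrite crd_setc_neq; assumption.
Qed.

Lemma Pint_indep_dirs (d : dir) (M M' : R) (D : dir -> Prop) (h : pt -> R) :
  0 <= M -> M <= M' -> cont4 h -> supp_dirs M D h -> D d ->
  Pint d M' h = Pint d M h.
Proof.
  intros HM HMM Hh Hs HD. extensionality z. apply RInt_shrink; try lra.
  - intros; apply line_ex_RInt; assumption.
  - intros x Hx. apply (Hs _ d); [assumption|]. rewrite crd_setc_eq.
    apply Rnot_le_lt; intros I. apply Rabs_le_between in I. lra.
Qed.

Lemma I4_indep (M M' : R) (h : pt -> R) : 0 < M -> M <= M' -> UC h -> supp_in M h ->
  I4 M' h = I4 M h.
Proof.
  intros HM HMM Hh Hs. apply supp_in_dirs in Hs. unfold I4.
  rewrite (Pint_indep_dirs D3 M M' _ h) with (1 := Rlt_le _ _ HM) (4 := Hs);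
    [|assumption|apply UC_cont4; assumption|trivial].
  apply (Pint_supp_dirs D3 M M) in Hs. apply (Pint_UC D3 M) in Hh; [|assumption].
  revert Hs Hh; generalize (Pint D3 M h); intros h2 Hs Hh.
  rewrite (Pint_indep_dirs D2 M M' _ h2) with (1 := Rlt_le _ _ HM) (4 := Hs);
    [|assumption|apply UC_cont4; assumption|split; [trivial|discriminate]].
  apply (Pint_supp_dirs D2 M M) in Hs. apply (Pint_UC D2 M) in Hh; [|assumption].
  revert Hs Hh; generalize (Pint D2 M h2); intros h3 Hs Hh.
  rewrite (Pint_indep_dirs D1 M M' _ h3) with (1 := Rlt_le _ _ HM) (4 := Hs);
    [|assumption|apply UC_cont4; assumption|repeat split; try trivial; discriminate].
  apply (Pint_supp_dirs D1 M M) in Hs. apply (Pint_UC D1 M) in Hh; [|assumption].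
  revert Hs Hh; generalize (Pint D1 M h3); intros h4 Hs Hh.
  rewrite (Pint_indep_dirs Dt M M' _ h4) with (1 := Rlt_le _ _ HM) (4 := Hs);
    [|assumption|apply UC_cont4; assumption|repeat split; try trivial; discriminate].
  reflexivity.
Qed.

(** Derivatives, integrals and the limit kernel are all chosen by [epsilon]; each is identified by
    exhibiting a value and its uniqueness. *)
Lemma epsilon_unique (P : R -> Prop) (l : R) : P l -> (forall l', P l' -> l' = l) ->
  epsilon (inhabits 0) P = l.
Proof. intros H U. apply U. apply epsilon_spec. exists l; assumption. Qed.

Lemma DRInt_eq (g : R -> R) (a b : R) : ex_RInt g a b -> Defs.RInt g a b = RInt.RInt g a b.
Proof.
  intros H. apply epsilon_unique.
  - exists (ex_RInt_Reals_0 g a b H). symmetry. apply RInt_Reals.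
  - intros l' [pr <-]. symmetry. apply RInt_Reals.
Qed.

Lemma box_int_I4 (M : R) (h : pt -> R) : 0 < M -> UC h -> box_int h M = I4 M h.
Proof.
  intros HM H. unfold box_int, I4.
  pose proof (Pint_UC D3 M h HM H) as H3. pose proof (Pint_UC D2 M _ HM H3) as H2.
  pose proof (Pint_UC D1 M _ HM H2) as H1.
  unfold Pint at 1. rewrite <- DRInt_eq
    by (apply line_ex_RInt, UC_cont4; assumption).
  f_equal. extensionality t. unfold Pint at 1.
  rewrite <- DRInt_eq by (apply line_ex_RInt, UC_cont4; assumption).
  f_equal. extensionality a. unfold Pint at 1.
  rewrite <- DRInt_eq by (apply line_ex_RInt, UC_cont4; assumption).
  f_equal. extensionality b. unfold Pint at 1.
  rewrite <- DRInt_eq by (apply line_ex_RInt, UC_cont4; assumption).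
  reflexivity.
Qed.

(** Box integrals no longer change once the box contains the support, so the eventual value chosen
    by [Int4] is already reached at [M]. *)
Lemma Int4_I4 (M : R) (h : pt -> R) : 0 < M -> cont4 h -> supp_in M h -> Int4 h = I4 M h.
Proof.
  intros HM Hc Hs. assert (H : UC h) by (apply Cc_UC; split; [assumption|exists M; assumption]).
  apply epsilon_unique.
  - exists M. intros M' HM'. rewrite box_int_I4 by (try assumption; lra).
    apply I4_indep; assumption.
  - intros l' [M0 H0]. specialize (H0 (Rmax M M0) (Rmax_r _ _)). pose proof (Rmax_l M M0).
    rewrite box_int_I4 in H0 by (try assumption; lra). rewrite <- H0. apply I4_indep; assumption.
Qed.

Lemma Cc_common (h g : pt -> R) : Cc h -> Cc g -> exists M, 0 < M /\ supp_in M h /\ supp_in M g.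
Proof.
  intros [_ [M HM]] [_ [N HN]].
  pose proof (Rmax_l 1 (Rmax M N)). pose proof (Rmax_r 1 (Rmax M N)).
  pose proof (Rmax_l M N). pose proof (Rmax_r M N).
  exists (Rmax 1 (Rmax M N)); split; [lra|].
  split; [apply supp_in_le with M|apply supp_in_le with N]; try assumption; lra.
Qed.

Lemma Cc_lin (a b : R) (h g : pt -> R) : Cc h -> Cc g -> Cc (fun z => a * h z + b * g z).
Proof.
  intros Hh Hg. destruct (Cc_common h g Hh Hg) as [M [HM [H1 H2]]].
  destruct Hh as [Hh _], Hg as [Hg _]. split.
  - apply cont4_plus; apply cont4_scal; assumption.
  - exists M. intros z Hz. rewrite H1, H2 by assumption. ring.
Qed.

Lemma Int4_lin (a b : R) (h g : pt -> R) : Cc h -> Cc g ->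
  Int4 (fun z => a * h z + b * g z) = a * Int4 h + b * Int4 g.
Proof.
  intros Hh Hg. pose proof (Cc_lin a b h g Hh Hg) as [Hc _].
  destruct (Cc_common h g Hh Hg) as [M [HM [H1 H2]]].
  pose proof (Cc_UC h Hh) as U. pose proof (Cc_UC g Hg) as V.
  destruct Hh as [Hh _], Hg as [Hg _].
  rewrite !(Int4_I4 M); try assumption.
  - unfold I4. rewrite Pint_lin by assumption.
    pose proof (Pint_UC D3 M h HM U) as U3. pose proof (Pint_UC D3 M g HM V) as V3.
    rewrite Pint_lin by (apply UC_cont4; assumption).
    pose proof (Pint_UC D2 M _ HM U3) as U2. pose proof (Pint_UC D2 M _ HM V3) as V2.
    rewrite Pint_lin by (apply UC_cont4; assumption).
    pose proof (Pint_UC D1 M _ HM U2) as U1. pose proof (Pint_UC D1 M _ HM V2) as V1.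
    rewrite Pint_lin by (apply UC_cont4; assumption). reflexivity.
  - intros z Hz. rewrite H1, H2 by assumption. ring.
Qed.

Lemma Int4_ge_0 (h : pt -> R) : Cc h -> (forall z, 0 <= h z) -> 0 <= Int4 h.
Proof.
  intros Hh H. destruct (Cc_common h h Hh Hh) as [M [HM [H1 _]]].
  pose proof (Cc_UC h Hh) as U. rewrite (Int4_I4 M) by (try apply Hh; assumption).
  pose proof (Pint_UC D3 M h HM U) as U3. pose proof (Pint_UC D2 M _ HM U3) as U2.
  pose proof (Pint_UC D1 M _ HM U2) as U1.
  repeat (apply Pint_ge_0; [lra|apply UC_cont4; assumption|intros ?]). apply H.
Qed.

Lemma Int4_le (h g : pt -> R) : Cc h -> Cc g -> (forall z, h z <= g z) -> Int4 h <= Int4 g.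
Proof.
  intros Hh Hg H.
  assert (X : 0 <= Int4 (fun z => (-1) * h z + 1 * g z)).
  { apply Int4_ge_0; [apply Cc_lin; assumption|]. intros z; specialize (H z); lra. }
  rewrite Int4_lin in X by assumption. lra.
Qed.

(** Supremum times volume of the support: each one-dimensional integration contributes the side
    [2 * crd d r] and leaves the support in the other directions intact. Centre and half-sides are
    arbitrary because past balls are not centred at their base point in time. *)
Lemma Int4_bound_box (h : pt -> R) (A : R) (c r : pt) : cont4 h -> 0 <= A ->
  (forall d, 0 <= crd d r) -> (forall z, Rabs (h z) <= A) ->
  (forall z d, crd d r < Rabs (crd d z - crd d c) -> h z = 0) ->
  Rabs (Int4 h) <= A * (2 * pt_t r) * (2 * pt_x1 r) * (2 * pt_x2 r) * (2 * pt_x3 r).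
Proof.
  intros Hc HA Hr Hb Hs.
  set (M := 1 + (Rabs (pt_t c) + pt_t r) + (Rabs (pt_x1 c) + pt_x1 r) +
            (Rabs (pt_x2 c) + pt_x2 r) + (Rabs (pt_x3 c) + pt_x3 r)).
  assert (HMd : forall d, Rabs (crd d c) + crd d r + 1 <= M).
  { pose proof (Rabs_pos (pt_t c)). pose proof (Rabs_pos (pt_x1 c)). pose proof (Rabs_pos (pt_x2 c)).
    pose proof (Rabs_pos (pt_x3 c)). generalize (Hr Dt) (Hr D1) (Hr D2) (Hr D3).
    unfold M; intros ? ? ? ? []; simpl in *; lra. }
  assert (HM : 0 < M).
  { specialize (HMd Dt). specialize (Hr Dt). pose proof (Rabs_pos (crd Dt c)). lra. }
  assert (Hsupp : supp_in M h).
  { apply supp_in_dirs. intros z d _ Hz. apply (Hs z d). specialize (HMd d).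
    replace (crd d z) with ((crd d z - crd d c) + crd d c) in Hz by ring.
    pose proof (Rabs_triang (crd d z - crd d c) (crd d c)). lra. }
  assert (Hbd : forall d, - M <= crd d c - crd d r /\ crd d c + crd d r <= M).
  { intros d. specialize (HMd d). pose proof (Rle_abs (crd d c)). pose proof (Rle_abs (- crd d c)).
    rewrite Rabs_Ropp in *. split; lra. }
  rewrite (Int4_I4 M) by assumption.
  assert (U : UC h) by (apply Cc_UC; split; [assumption|exists M; assumption]).
  assert (G : forall (d : dir) (D : dir -> Prop) (A : R) (g : pt -> R), D d -> UC g ->
     (forall z, Rabs (g z) <= A) ->
     (forall z d', D d' -> crd d' r < Rabs (crd d' z - crd d' c) -> g z = 0) ->
     UC (Pint d M g) /\ (forall z, Rabs (Pint d M g z) <= A * (2 * crd d r)) /\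
     (forall z d', (D d' /\ d' <> d) -> crd d' r < Rabs (crd d' z - crd d' c) -> Pint d M g z = 0)).
  { intros d D A' g Dd Ug Bg Sg. split; [apply Pint_UC; assumption|split].
    - intros z. apply (Pint_bound d M A' (crd d c)); try apply Hbd; try apply Hr; auto.
      + apply UC_cont4; assumption.
      + intros x Hx. apply (Sg _ d Dd). rewrite crd_setc_eq; assumption.
    - intros z d' [D' Hn] Hz. apply Pint_supp. intros x. apply (Sg _ d' D').
      rewrite crd_setc_neq; assumption. }
  destruct (G D3 (fun _ => True) A h) as [U3 [B3 S3]]; try assumption; [trivial|intros z d' _; apply Hs|].
  destruct (fun H => G D2 _ _ _ H U3 B3 S3) as [U2 [B2 S2]]; [repeat split; try trivial; discriminate|].
  destruct (fun H => G D1 _ _ _ H U2 B2 S2) as [U1 [B1 S1]]; [repeat split; try trivial; discriminate|].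
  destruct (fun H => G Dt _ _ _ H U1 B1 S1) as [U0 [B0 S0]]; [repeat split; try trivial; discriminate|].
  specialize (B0 origin). unfold I4. simpl in B0.
  replace (A * (2 * pt_t r) * (2 * pt_x1 r) * (2 * pt_x2 r) * (2 * pt_x3 r))
    with (A * (2 * pt_x3 r) * (2 * pt_x2 r) * (2 * pt_x1 r) * (2 * pt_t r)) by ring.
  exact B0.
Qed.

(** * Affine change of variables *)

Lemma RInt_affine (g : R -> R) (p m M M' : R) : m <> 0 -> 0 <= M -> Rabs p + M <= Rabs m * M' ->
  (forall c e, ex_RInt g c e) -> (forall x, M < Rabs x -> g x = 0) ->
  RInt.RInt (fun c => g (p + m * c)) (- M') M' = / Rabs m * RInt.RInt g (-M) M.
Proof.
  intros Hm HM HMM Hex Hs.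
  pose proof (Rle_abs p). pose proof (Rle_abs (-p)). rewrite Rabs_Ropp in *.
  assert (E : RInt.RInt (fun c => g (p + m * c)) (- M') M' =
              / m * RInt.RInt g (m * (- M') + p) (m * M' + p)).
  { rewrite <- (RInt_comp_lin g m p) by apply Hex.
    rewrite (RInt_ext _ (fun c => scal (/ m) (scal m (g (m * c + p))))).
    - rewrite (RInt_scal (V := R_CompleteNormedModule)); [reflexivity|].
      apply (ex_RInt_comp_lin g); apply Hex.
    - intros x _. unfold scal; simpl; unfold mult; simpl. rewrite (Rplus_comm p).
      field; assumption. }
  rewrite E. destruct (Rdichotomy m 0 Hm) as [Hn|Hp].
  - rewrite (Rabs_left m) in * by assumption.
    rewrite <- (opp_RInt_swap g) by apply Hex.
    rewrite (RInt_shrink g (m * M' + p) (m * (- M') + p) (-M) M); try assumption; try lra.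
    + unfold opp; simpl. field; assumption.
    + intros x Hx. apply Hs. apply Rnot_le_lt; intros I. apply Rabs_le_between in I. lra.
  - rewrite (Rabs_pos_eq m) in * by lra.
    rewrite (RInt_shrink g _ _ (-M) M); try assumption; try lra.
    intros x Hx. apply Hs. apply Rnot_le_lt; intros I. apply Rabs_le_between in I. lra.
Qed.

Lemma Pint_affine (d : dir) (M M' : R) (D : dir -> Prop) (h : pt -> R) (p m : pt) :
  D d -> crd d m <> 0 -> 0 <= M -> Rabs (crd d p) + M <= Rabs (crd d m) * M' ->
  cont4 h -> supp_dirs M D h ->
  Pint d M' (fun z => h (aff p m z)) = fun z => / Rabs (crd d m) * Pint d M h (aff p m z).
Proof.
  intros Dd Hm HM HMM Hh Hs. extensionality z. unfold Pint.
  rewrite <- (RInt_affine (fun c => h (setc (aff p m z) d c)) (crd d p) (crd d m) M M'); try assumption.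
  - apply RInt_ext. intros x _. f_equal. apply pt_ext; intros d'.
    destruct (dir_eq_dec d' d) as [->|Hd].
    + rewrite crd_aff, !crd_setc_eq. reflexivity.
    + rewrite crd_aff, !crd_setc_neq, crd_aff by assumption. reflexivity.
  - intros; apply line_ex_RInt; assumption.
  - intros x Hx. apply (Hs _ d Dd). rewrite crd_setc_eq; assumption.
Qed.

Lemma Cc_aff (h : pt -> R) (p m : pt) : (forall d, crd d m <> 0) -> Cc h ->
  Cc (fun z => h (aff p m z)) /\
  exists M M', 0 < M /\ 0 < M' /\ supp_in M h /\ supp_in M' (fun z => h (aff p m z)) /\
    forall d, Rabs (crd d p) + M <= Rabs (crd d m) * M'.
Proof.
  intros Hm Hh. destruct (Cc_common h h Hh Hh) as [M [HM [H1 _]]].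
  assert (X : exists M', 0 < M' /\ forall d, Rabs (crd d p) + M <= Rabs (crd d m) * M').
  { destruct (forall_dir_pos (fun d e => (Rabs (crd d p) + M) * e <= Rabs (crd d m))) as [e [He H]].
    - intros d e e' He H. pose proof (Rabs_pos (crd d p)). nra.
    - intros d. pose proof (Rabs_pos (crd d p)). pose proof (Rabs_pos_lt _ (Hm d)).
      exists (Rabs (crd d m) / (Rabs (crd d p) + M)); split; [apply Rdiv_lt_0_compat; lra|].
      right; field; lra.
    - exists (/ e). split; [apply Rinv_0_lt_compat; assumption|]. intros d.
      apply Rle_div_r; [assumption|]. apply H. }
  destruct X as [M' [HM' HB]].
  assert (S' : supp_in M' (fun z => h (aff p m z))).
  { intros z Hz. apply H1. intros I. apply Hz. intros d. specialize (I d). rewrite crd_aff in I.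
    specialize (HB d). apply Rmult_le_reg_l with (Rabs (crd d m)); [apply Rabs_pos_lt, Hm|].
    rewrite <- Rabs_mult.
    replace (crd d m * crd d z) with ((crd d p + crd d m * crd d z) + - crd d p) by ring.
    eapply Rle_trans; [apply Rabs_triang|]. rewrite Rabs_Ropp. lra. }
  split.
  - split; [apply cont4_aff, Hh|exists M'; assumption].
  - exists M, M'; auto.
Qed.

Lemma Int4_aff (h : pt -> R) (p m : pt) : (forall d, crd d m <> 0) -> Cc h ->
  Int4 (fun z => h (aff p m z)) =
  / (Rabs (pt_t m) * Rabs (pt_x1 m) * Rabs (pt_x2 m) * Rabs (pt_x3 m)) * Int4 h.
Proof.
  intros Hm Hh. destruct (Cc_aff h p m Hm Hh) as [Hc [M [M' [HM [HM' [S [S' HB]]]]]]].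
  pose proof (Cc_UC h Hh) as U.
  rewrite (Int4_I4 M') by (try apply Hc; assumption).
  rewrite (Int4_I4 M h) by (try apply Hh; assumption).
  apply supp_in_dirs in S. unfold I4.
  rewrite (Pint_affine D3 M M' _ h p m I (Hm D3) (Rlt_le _ _ HM) (HB D3) (proj1 Hh) S).
  pose proof (Pint_UC D3 M h HM U) as U3. apply (Pint_supp_dirs D3 M M) in S.
  set (h3 := Pint D3 M h) in *.
  assert (Sc : forall d k c, UC k -> Pint d M' (fun z => c * k (aff p m z)) = fun z => c * Pint d M' (fun z => k (aff p m z)) z).
  { intros d k c Uk. pose proof (cont4_aff k p m (UC_cont4 k Uk)) as C.
    pose proof (Pint_lin d M' c 0 _ _ C C) as E.
    transitivity (Pint d M' (fun z => c * k (aff p m z) + 0 * k (aff p m z))).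
    - f_equal; extensionality z; ring.
    - rewrite E. extensionality z; ring. }
  assert (Sc2 : forall c k d, (fun z => c * (fun w => / Rabs (crd d m) * k (aff p m w)) z) =
      fun z => (c * / Rabs (crd d m)) * k (aff p m z)).
  { intros; extensionality z; ring. }
  rewrite Sc by assumption.
  rewrite (fun H => Pint_affine D2 M M' _ h3 p m H
     (Hm D2) (Rlt_le _ _ HM) (HB D2) (UC_cont4 _ U3) S), Sc2
    by (repeat split; try trivial; discriminate).
  pose proof (Pint_UC D2 M _ HM U3) as U2. apply (Pint_supp_dirs D2 M M) in S.
  set (h2 := Pint D2 M h3) in *.
  rewrite Sc by assumption.
  rewrite (fun H => Pint_affine D1 M M' _ h2 p m H
     (Hm D1) (Rlt_le _ _ HM) (HB D1) (UC_cont4 _ U2) S), Sc2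
    by (repeat split; try trivial; discriminate).
  pose proof (Pint_UC D1 M _ HM U2) as U1. apply (Pint_supp_dirs D1 M M) in S.
  set (h1 := Pint D1 M h2) in *.
  rewrite Sc by assumption.
  rewrite (fun H => Pint_affine Dt M M' _ h1 p m H
     (Hm Dt) (Rlt_le _ _ HM) (HB Dt) (UC_cont4 _ U1) S)
    by (repeat split; try trivial; discriminate).
  change (Pint Dt M h1 (aff p m origin)) with (Pint Dt M h1 origin).
  simpl. field. repeat split; apply Rabs_no_R0; [apply (Hm D3)|apply (Hm D2)|apply (Hm D1)|apply (Hm Dt)].
Qed.

Lemma Int4_sup (k : pt -> R) (M e : R) : 0 <= M -> cont4 k -> supp_in M k ->
  (forall z, Rabs (k z) <= e) -> Rabs (Int4 k) <= e * (2 * M) ^ 4.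
Proof.
  intros HM Hc Hs He.
  assert (0 <= e) by (eapply Rle_trans; [apply Rabs_pos|apply (He origin)]).
  pose proof (Int4_bound_box k e origin (mkpt M M M M) Hc H) as X. simpl in X.
  replace (e * (2 * M) ^ 4) with (e * (2 * M) * (2 * M) * (2 * M) * (2 * M)) by ring.
  apply X; [intros []; simpl; assumption|assumption|].
  intros z d Hz. apply supp_in_dirs in Hs. apply (Hs z d); [trivial|].
  destruct d; simpl in *; rewrite Rminus_0_r in Hz; assumption.
Qed.

Lemma Int4_minus (h g : pt -> R) : Cc h -> Cc g ->
  Int4 (fun z => h z - g z) = Int4 h - Int4 g.
Proof.
  intros Hh Hg. replace (fun z => h z - g z) with (fun z => 1 * h z + (-1) * g z)
    by (extensionality z; ring).
  rewrite Int4_lin by assumption. ring.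
Qed.

Lemma Int4_plus (h g : pt -> R) : Cc h -> Cc g ->
  Int4 (fun z => h z + g z) = Int4 h + Int4 g.
Proof.
  intros Hh Hg. replace (fun z => h z + g z) with (fun z => 1 * h z + 1 * g z)
    by (extensionality z; ring).
  rewrite Int4_lin by assumption. ring.
Qed.

Lemma Int4_scal (c : R) (h : pt -> R) : Cc h -> Int4 (fun z => c * h z) = c * Int4 h.
Proof.
  intros Hh. replace (fun z => c * h z) with (fun z => c * h z + 0 * h z)
    by (extensionality z; ring).
  rewrite Int4_lin by assumption. ring.
Qed.

Lemma Int4_diff (k1 k2 : pt -> R) (M e : R) : 0 <= M -> cont4 k1 -> cont4 k2 ->
  supp_in M k1 -> supp_in M k2 ->
  (forall z, Rabs (k1 z - k2 z) <= e) -> Rabs (Int4 k1 - Int4 k2) <= e * (2 * M) ^ 4.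
Proof.
  intros HM H1 H2 S1 S2 He.
  rewrite <- Int4_minus by (split; [assumption|exists M; assumption]).
  apply Int4_sup; [assumption|apply cont4_minus; assumption| |assumption].
  intros z Hz. rewrite S1, S2 by assumption. ring.
Qed.

(** * Exchanging integrals *)

Definition UC2 (h : pt -> pt -> R) : Prop :=
  forall e, 0 < e -> exists r, 0 < r /\ forall z z' w w', near r z z' -> near r w w' ->
    Rabs (h z' w' - h z w) <= e.

Lemma near_refl (r : R) (z : pt) : 0 < r -> near r z z.
Proof. intros H d; rewrite Rminus_diag, Rabs_R0; assumption. Qed.

Lemma UC2_r (h : pt -> pt -> R) (z : pt) : UC2 h -> UC (h z).
Proof.
  intros H e He. destruct (H e He) as [r [Hr Hw]]. exists r; split; [assumption|].
  intros w w' N. apply Hw; [apply near_refl|]; assumption.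
Qed.

Lemma UC2_l (h : pt -> pt -> R) (w : pt) : UC2 h -> UC (fun z => h z w).
Proof.
  intros H e He. destruct (H e He) as [r [Hr Hw]]. exists r; split; [assumption|].
  intros z z' N. apply Hw; [|apply near_refl]; assumption.
Qed.

(** The exchange is made by varying the upper endpoint [b]: the function [F b], where the line
    integral up to [b] is inside, vanishes at [-M] and has derivative [Int4 (g b)], so the
    fundamental theorem of calculus recovers it from the other order. *)
Lemma Int4_swap_Pint (d : dir) (M : R) (h : pt -> pt -> R) (z0 : pt) : 0 < M -> UC2 h ->
  (forall z, supp_in M (h z)) ->
  Pint d M (fun z => Int4 (h z)) z0 = Int4 (fun w => Pint d M (fun z => h z w) z0).
Proof.
  intros HM U S.
  set (A := (2 * M) ^ 4). assert (HA : 0 < A) by (unfold A; apply pow_lt; lra).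
  set (g := fun c w => h (setc z0 d c) w).
  set (k := fun a b w => RInt.RInt (fun c => g c w) a b).
  assert (gc : forall c, cont4 (g c)) by (intros c; apply UC_cont4, UC2_r, U).
  assert (gex : forall w a b, ex_RInt (fun c => g c w) a b)
    by (intros w a b; apply (line_ex_RInt (fun z => h z w) z0 d), UC_cont4, (UC2_l h w U)).
  assert (gUC : forall e, 0 < e -> exists r, 0 < r /\ forall c c' w w', Rabs (c' - c) < r ->
     near r w w' -> Rabs (g c' w' - g c w) <= e).
  { intros e He. destruct (U e He) as [r [Hr Hw]]. exists r; split; [assumption|].
    intros c c' w w' Hc N. apply Hw; [|assumption]. apply near_setc; [apply near_refl|]; assumption. }
  assert (kb : forall a b w e (p : R -> R), (forall x y, ex_RInt p x y) -> 0 <= e ->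
     (forall c, Rmin a b <= c <= Rmax a b -> Rabs (g c w - p c) <= e) ->
     Rabs (k a b w - RInt.RInt p a b) <= Rabs (b - a) * e).
  { intros a b w e p Hp He H. unfold k.
    replace (_ - _) with (RInt.RInt (fun c => g c w - p c) a b)
      by (apply (RInt_minus (V := R_CompleteNormedModule)); auto).
    assert (ex : forall x y, ex_RInt (fun c => g c w - p c) x y)
      by (intros; apply (ex_RInt_minus (V := R_NormedModule)); auto).
    destruct (Rle_lt_dec a b) as [Hab|Hab].
    - rewrite (Rabs_pos_eq (b - a)) by lra. apply abs_RInt_le_const; auto.
      intros t Ht; apply H. rewrite Rmin_left, Rmax_right; lra.
    - rewrite <- (opp_RInt_swap _ _ _ (ex b a)). unfold opp; simpl. rewrite Rabs_Ropp.
      rewrite (Rabs_left (b - a)) by lra. replace (- (b - a)) with (a - b) by ring.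
      apply abs_RInt_le_const; [lra|auto|].
      intros t Ht; apply H. rewrite Rmin_right, Rmax_left; lra. }
  assert (kc : forall a b, cont4 (k a b)).
  { intros a b. apply UC_cont4. intros e He. pose proof (Rabs_pos (b - a)).
    destruct (gUC (e / (Rabs (b - a) + 1))) as [r [Hr Hw]]; [apply Rdiv_lt_0_compat; lra|].
    exists r; split; [assumption|]. intros w w' N.
    apply Rle_trans with (Rabs (b - a) * (e / (Rabs (b - a) + 1))).
    - apply (kb a b w' _ (fun c => g c w)); auto.
      + apply Rlt_le, Rdiv_lt_0_compat; lra.
      + intros c _. apply Hw; [rewrite Rminus_diag, Rabs_R0|]; assumption.
    - apply Rle_trans with ((Rabs (b - a) + 1) * (e / (Rabs (b - a) + 1))); [|right; field; lra].
      apply Rmult_le_compat_r; [apply Rlt_le, Rdiv_lt_0_compat; lra|lra]. }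
  assert (ks : forall a b, supp_in M (k a b)).
  { intros a b w Hw. apply RInt_zero_on. intros; apply S; assumption. }
  assert (kCc : forall a b, Cc (k a b)) by (intros a b; split; [apply kc|exists M; apply ks]).
  assert (gCc : forall c, Cc (g c)) by (intros c; split; [apply gc|exists M; apply S]).
  set (F := fun b => Int4 (k (-M) b)).
  (* The difference quotient is the integral of averages of [g] over short intervals, uniformly
     close to [g b]; [A] is the volume of the box. *)
  assert (dF : forall b, is_derive F b (Int4 (g b))).
  { intros b. apply is_derive_Reals. intros e He.
    destruct (gUC (e / (2 * A))) as [r [Hr Hw]]; [apply Rdiv_lt_0_compat; lra|].
    exists (mkposreal r Hr). intros x Hx Hxr. simpl in Hxr.
    replace ((F (b + x) - F b) / x) with (Int4 (fun w => / x * k b (b + x) w)).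
    - apply Rle_lt_trans with (e / (2 * A) * A); [|replace (e / (2 * A) * A) with (e / 2) by (field; lra); lra].
      apply Int4_diff; [lra|apply cont4_scal; auto|auto| |auto|].
      + intros w Hw'. rewrite ks by assumption. ring.
      + apply S.
      + intros w. replace (/ x * k b (b + x) w - g b w) with (/ x * (k b (b + x) w - x * g b w)) by (field; assumption).
        rewrite Rabs_mult, Rabs_inv.
        apply Rmult_le_reg_l with (Rabs x); [apply Rabs_pos_lt; assumption|].
        rewrite <- Rmult_assoc, Rinv_r, Rmult_1_l by (apply Rabs_no_R0; assumption).
        pose proof (kb b (b + x) w (e / (2 * A)) (fun _ => g b w)) as B.
        rewrite (RInt_const (V := R_CompleteNormedModule)) in B.
        replace (b + x - b) with x in B by ring.
        apply B.
        * intros; apply (ex_RInt_const (V := R_NormedModule)).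
        * apply Rlt_le, Rdiv_lt_0_compat; lra.
        * intros c Hc. apply Hw; [|apply near_refl; assumption].
          apply Rle_lt_trans with (Rabs x); [|assumption].
          unfold Rmin, Rmax in Hc. apply Rabs_le_between.
          destruct (Rle_dec b (b + x)); unfold Rabs; destruct (Rcase_abs x); lra.
    - rewrite Int4_scal by auto. unfold F.
      rewrite <- Int4_minus by auto. unfold Rdiv. rewrite Rmult_comm. f_equal. f_equal.
      extensionality w. unfold k.
      assert (CC : RInt.RInt (fun c => g c w) (-M) b + RInt.RInt (fun c => g c w) b (b + x)
        = RInt.RInt (fun c => g c w) (-M) (b + x)) by (apply (RInt_Chasles (V := R_CompleteNormedModule)); auto).
      lra. }
  assert (cF : forall b, continuous (fun c => Int4 (g c)) b).
  { intros b. apply filterlim_locally. intros e. pose proof (cond_pos e).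
    destruct (gUC (e / (2 * A))) as [r [Hr Hw]]; [apply Rdiv_lt_0_compat; lra|].
    exists (mkposreal r Hr). intros y Hy. change (Rabs (Int4 (g y) - Int4 (g b)) < e).
    apply Rle_lt_trans with (e / (2 * A) * A); [|replace (e / (2 * A) * A) with (e / 2) by (field; lra); lra].
    apply Int4_diff; [lra|auto|auto|apply S|apply S|].
    intros w. apply Hw; [exact Hy|apply near_refl; assumption]. }
  pose proof (is_RInt_derive F (fun c => Int4 (g c)) (-M) M (fun b _ => dF b) (fun b _ => cF b)) as E.
  apply is_RInt_unique in E. change (RInt.RInt (fun c => Int4 (g c)) (-M) M = Int4 (k (-M) M)). rewrite E.
  assert (F0 : F (-M) = 0).
  { unfold F. replace (k (-M) (-M)) with (fun w => 0 * g 0 w).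
    - rewrite Int4_scal by auto. ring.
    - extensionality w. unfold k. rewrite RInt_point. unfold zero; simpl. ring. }
  rewrite F0. unfold minus, plus, opp; simpl. rewrite Ropp_0, Rplus_0_r. reflexivity.
Qed.

Lemma UC2_Pint (d : dir) (M : R) (h : pt -> pt -> R) : 0 < M -> UC2 h ->
  UC2 (fun z w => Pint d M (fun z' => h z' w) z).
Proof.
  intros HM U e He. destruct (U (e / (2 * M))) as [r [Hr Hw]]; [apply Rdiv_lt_0_compat; lra|].
  exists r; split; [assumption|]. intros z z' w w' N N'.
  replace e with (2 * M * (e / (2 * M))) by (field; lra).
  apply (Pint_diff d M _ (fun z => h z w') (fun z => h z w) z' z); [lra| | |].
  - apply UC_cont4, (UC2_l h w' U).
  - apply UC_cont4, (UC2_l h w U).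
  - intros c. apply Hw; [|assumption]. apply near_setc; [assumption|].
    rewrite Rminus_diag, Rabs_R0; assumption.
Qed.

(** The outer integral is a composition of four line integrals, and each is carried through the
    inner one in turn; joint uniform continuity survives every stage. *)
Lemma Int4_fubini (M : R) (h : pt -> pt -> R) : 0 < M -> UC2 h ->
  (forall z, supp_in M (h z)) -> (forall w, supp_in M (fun z => h z w)) ->
  Int4 (fun z => Int4 (h z)) = Int4 (fun w => Int4 (fun z => h z w)).
Proof.
  intros HM U S S'.
  assert (Uz : UC (fun z => Int4 (h z))).
  { intros e He. assert (HA : 0 < (2 * M) ^ 4) by (apply pow_lt; lra).
    destruct (U (e / (2 * M) ^ 4)) as [r [Hr Hw]]; [apply Rdiv_lt_0_compat; assumption|].
    exists r; split; [assumption|]. intros z z' N.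
    replace e with (e / (2 * M) ^ 4 * (2 * M) ^ 4) by (field; lra).
    apply Int4_diff; [lra| | |apply S|apply S|].
    - apply UC_cont4, UC2_r, U.
    - apply UC_cont4, UC2_r, U.
    - intros w. apply Hw; [assumption|apply near_refl; assumption]. }
  rewrite (Int4_I4 M); [|assumption|apply UC_cont4; assumption|].
  2: { intros z Hz. replace (h z) with (fun w => 0 * h z w).
       - rewrite Int4_scal; [ring|]. split; [apply UC_cont4, UC2_r, U|exists M; apply S].
       - extensionality w. rewrite (S' w z Hz). ring. }
  assert (Step : forall d k, UC2 k -> (forall z, supp_in M (k z)) ->
    Pint d M (fun z => Int4 (k z)) = (fun z0 => Int4 (fun w => Pint d M (fun z => k z w) z0))
    /\ UC2 (fun z w => Pint d M (fun z' => k z' w) z) /\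
    (forall z, supp_in M (fun w => Pint d M (fun z' => k z' w) z))).
  { intros d k Uk Sk. split; [|split].
    - extensionality z0. apply Int4_swap_Pint; assumption.
    - apply UC2_Pint; assumption.
    - intros z w Hw. apply Pint_supp. intros x. apply Sk; assumption. }
  unfold I4.
  destruct (Step D3 h U S) as [E3 [U3 S3]]. rewrite E3.
  destruct (Step D2 _ U3 S3) as [E2 [U2 S2]]. rewrite E2.
  destruct (Step D1 _ U2 S2) as [E1 [U1 S1]]. rewrite E1.
  destruct (Step Dt _ U1 S1) as [E0 _]. rewrite E0.
  f_equal. extensionality w. symmetry.
  apply (Int4_I4 M (fun z => h z w)); [assumption|apply UC_cont4, (UC2_l h w U)|apply S'].
Qed.

(** * Convolution *)

Lemma inbox_psub (M N : R) (z w : pt) : inbox N z -> inbox M (psub z w) -> inbox (N + M) w.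
Proof.
  intros Hz H d. specialize (Hz d); specialize (H d). rewrite crd_psub in H.
  replace (crd d w) with (crd d z + - (crd d z - crd d w)) by ring.
  eapply Rle_trans; [apply Rabs_triang|]. rewrite Rabs_Ropp. lra.
Qed.

Lemma inbox_ex (z : pt) : exists N, 0 < N /\ inbox N z.
Proof.
  pose proof (Rabs_pos (pt_t z)). pose proof (Rabs_pos (pt_x1 z)). pose proof (Rabs_pos (pt_x2 z)).
  pose proof (Rabs_pos (pt_x3 z)).
  exists (1 + Rabs (pt_t z) + Rabs (pt_x1 z) + Rabs (pt_x2 z) + Rabs (pt_x3 z)).
  split; [lra|]. intros []; simpl; lra.
Qed.

Lemma Cc_mult_l (f g : pt -> R) : Cc f -> cont4 g -> Cc (fun z => f z * g z).
Proof.
  intros [Hf [M HM]] Hg. split; [apply cont4_mult; assumption|].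
  exists M. intros z Hz. rewrite HM by assumption. ring.
Qed.

Lemma Cc_mult_r (f g : pt -> R) : cont4 f -> Cc g -> Cc (fun z => f z * g z).
Proof.
  intros Hf [Hg [M HM]]. split; [apply cont4_mult; assumption|].
  exists M. intros z Hz. rewrite HM by assumption. ring.
Qed.

Lemma Cc_psub (f : pt -> R) (z : pt) : Cc f -> Cc (fun w => f (psub z w)).
Proof.
  intros [Hf [M HM]]. split; [apply cont4_psub_r; assumption|].
  destruct (inbox_ex z) as [N [HN Hz]]. exists (N + M). intros w Hw. apply HM.
  intros I. apply Hw, (inbox_psub M N z); assumption.
Qed.

Lemma Cc_conv_integrand (f g : pt -> R) (z : pt) : Cc f -> cont4 g ->
  Cc (fun w => f (psub z w) * g w).
Proof. intros Hf Hg. apply Cc_mult_l; [apply Cc_psub; assumption|assumption]. Qed.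

Lemma conv_comm (f g : pt -> R) (z : pt) :
  (Cc f /\ cont4 g) \/ (cont4 f /\ Cc g) -> conv f g z = conv g f z.
Proof.
  intros H. unfold conv.
  set (k := fun y => g (psub z y) * f y).
  replace (fun w => f (psub z w) * g w)
    with (fun w => k (aff z (mkpt (-1) (-1) (-1) (-1)) w)).
  - rewrite Int4_aff.
    + simpl. rewrite Rabs_left by lra. unfold k. field.
    + intros []; simpl; lra.
    + unfold k. destruct H as [[Hf Hg]|[Hf Hg]].
      * apply Cc_mult_r; [apply cont4_psub_r|]; assumption.
      * apply Cc_mult_l; [apply Cc_psub|]; assumption.
  - extensionality w. unfold k. rewrite <- psub_aff.
    replace (psub z (psub z w)) with w; [ring|].
    apply pt_ext; intros d; rewrite !crd_psub; ring.
Qed.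

Lemma near_psub (r : R) (z z' w w' : pt) : near (r / 2) z z' -> near (r / 2) w w' ->
  near r (psub z w) (psub z' w').
Proof.
  intros N N' d. specialize (N d); specialize (N' d). rewrite !crd_psub.
  replace (_ - _) with ((crd d z' - crd d z) + - (crd d w' - crd d w)) by ring.
  eapply Rle_lt_trans; [apply Rabs_triang|]. rewrite Rabs_Ropp. lra.
Qed.

Lemma conv_cont (f g : pt -> R) : Cc f -> cont4 g -> cont4 (conv f g).
Proof.
  intros Hf Hg. apply cont4_nb; intros z. apply filterlim_R_iff; [apply nb_filter|].
  intros e He. pose proof (Cc_UC f Hf) as U. destruct (Cc_common f f Hf Hf) as [M [HM [S _]]].
  destruct (inbox_ex z) as [N [HN Hz]].
  destruct (cont4_bounded_box g (N + 1 + M) Hg) as [B [HB Hb]].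
  set (A := (2 * (N + 1 + M)) ^ 4). assert (HA : 0 < A) by (apply pow_lt; lra).
  assert (HBA : 0 < (B + 1) * A) by (apply Rmult_lt_0_compat; lra).
  destruct (U (e / (2 * ((B + 1) * A)))) as [r [Hr Hw]]; [apply Rdiv_lt_0_compat; lra|].
  exists (Rmin 1 (r / 2)); split; [apply Rmin_pos; lra|]. intros z' Nz.
  pose proof (Rmin_l 1 (r / 2)). pose proof (Rmin_r 1 (r / 2)).
  assert (Hz' : inbox (N + 1) z').
  { intros d. specialize (Nz d); specialize (Hz d).
    replace (crd d z') with ((crd d z' - crd d z) + crd d z) by ring.
    eapply Rle_trans; [apply Rabs_triang|]. lra. }
  assert (Hz1 : inbox (N + 1) z) by (apply inbox_le with N; [lra|assumption]).
  assert (SS : forall y, inbox (N + 1) y -> supp_in (N + 1 + M) (fun w => f (psub y w) * g w)).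
  { intros y Hy w Hw'. rewrite S; [ring|]. intros I. apply Hw', (inbox_psub M (N + 1) y); assumption. }
  apply Rle_lt_trans with (e / (2 * ((B + 1) * A)) * B * A).
  - apply Int4_diff; [lra| | |apply SS; assumption|apply SS; assumption|].
    + apply cont4_mult; [apply cont4_psub_r, Hf|assumption].
    + apply cont4_mult; [apply cont4_psub_r, Hf|assumption].
    + intros w. destruct (classic (inbox (N + 1 + M) w)) as [I|I].
      * replace (_ - _) with ((f (psub z' w) - f (psub z w)) * g w) by ring.
        rewrite Rabs_mult. apply Rmult_le_compat; try apply Rabs_pos; [|apply Hb; assumption].
        apply Hw. apply near_psub; [|apply near_refl; lra].
        apply near_le with (Rmin 1 (r / 2)); assumption.
      * rewrite (SS z'), (SS z) by assumption. rewrite Rminus_diag, Rabs_R0.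
        apply Rmult_le_pos; [apply Rlt_le, Rdiv_lt_0_compat; lra|assumption].
  - replace (e / (2 * ((B + 1) * A)) * B * A) with (e / 2 * (B / (B + 1))) by (field; lra).
    assert (B / (B + 1) <= 1) by (apply Rle_div_l; lra).
    assert (0 <= B / (B + 1)) by (apply Rle_div_r; lra). nra.
Qed.

Lemma Int4_ext0 (h : pt -> R) : (forall z, h z = 0) -> Int4 h = 0.
Proof.
  intros H. replace h with (fun z : pt => 0 * (fun _ : pt => 0) z).
  - rewrite (Int4_scal 0 (fun _ => 0)); [ring|]. split; [apply cont4_const|exists 0; intros z _; reflexivity].
  - extensionality z. rewrite H. ring.
Qed.

Lemma conv_supp (f g : pt -> R) (M N : R) : supp_in M f -> supp_in N g ->
  supp_in (M + N) (conv f g).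
Proof.
  intros Hf Hg z Hz. apply Int4_ext0. intros w.
  destruct (classic (inbox N w)) as [I|I]; [|rewrite Hg by assumption; ring].
  destruct (classic (inbox M (psub z w))) as [J|J]; [|rewrite Hf by assumption; ring].
  exfalso; apply Hz. intros d. specialize (I d); specialize (J d). rewrite crd_psub in J.
  replace (crd d z) with ((crd d z - crd d w) + crd d w) by ring.
  eapply Rle_trans; [apply Rabs_triang|]. lra.
Qed.

Lemma conv_Cc (f g : pt -> R) : Cc f -> Cc g -> Cc (conv f g).
Proof.
  intros Hf Hg. split; [apply conv_cont; [assumption|apply Hg]|].
  destruct Hf as [_ [M HM]], Hg as [_ [N HN]]. exists (M + N). apply conv_supp; assumption.
Qed.

(** * Truncation to a box and associativity of convolution *)

Definition clamp (M : R) (z : pt) : pt :=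
  let cl x := Rmax (- M) (Rmin M x) in
  mkpt (cl (pt_t z)) (cl (pt_x1 z)) (cl (pt_x2 z)) (cl (pt_x3 z)).

Lemma clamp_R (M x y : R) : 0 <= M ->
  Rabs (Rmax (- M) (Rmin M x)) <= M /\ (Rabs x <= M -> Rmax (- M) (Rmin M x) = x) /\
  Rabs (Rmax (- M) (Rmin M x) - Rmax (- M) (Rmin M y)) <= Rabs (x - y).
Proof.
  intros HM. split; [|split].
  - apply Rabs_le_between. unfold Rmax, Rmin.
    destruct (Rle_dec M x); [destruct (Rle_dec (-M) M)|destruct (Rle_dec (-M) x)]; lra.
  - intros H. apply Rabs_le_between in H. unfold Rmax, Rmin.
    destruct (Rle_dec M x); [destruct (Rle_dec (-M) M)|destruct (Rle_dec (-M) x)]; lra.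
  - unfold Rmax, Rmin.
    destruct (Rle_dec M x), (Rle_dec M y);
      repeat match goal with |- context [Rle_dec ?a ?b] => destruct (Rle_dec a b) end;
      unfold Rabs; repeat match goal with |- context [Rcase_abs ?a] => destruct (Rcase_abs a) end; lra.
Qed.

(** Composition with the projection onto a box, which does not increase distances. It lets Fubini
    apply to a merely continuous last factor of a convolution. *)
Lemma clamp_ext (g : pt -> R) (M : R) : 0 <= M -> cont4 g ->
  exists g', UC g' /\ (exists B, 0 <= B /\ forall z, Rabs (g' z) <= B) /\
    forall z, inbox M z -> g' z = g z.
Proof.
  intros HM Hg. exists (fun z => g (clamp M z)).
  assert (I : forall z, inbox M (clamp M z)) by (intros z []; simpl; apply clamp_R; assumption).
  split; [|split].
  - intros e He. destruct (cont4_unif_box g M e Hg He) as [r [Hr Hu]].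
    exists r; split; [assumption|]. intros z w N. apply Hu; [apply I|].
    intros d. eapply Rle_lt_trans; [|apply (N d)]. destruct d; simpl; apply clamp_R; assumption.
  - destruct (cont4_bounded_box g M Hg) as [B [HB Hb]]. exists B; split; auto.
  - intros z Hz. f_equal. apply pt_ext; intros d; specialize (Hz d).
    destruct d; simpl in *; apply clamp_R; assumption.
Qed.

Lemma UC2_mult (f g : pt -> pt -> R) (A B : R) : UC2 f -> UC2 g ->
  (forall z w, Rabs (f z w) <= A) -> (forall z w, Rabs (g z w) <= B) ->
  UC2 (fun z w => f z w * g z w).
Proof.
  intros Hf Hg HA HB e He.
  assert (0 <= A) by (eapply Rle_trans; [apply Rabs_pos|apply (HA origin origin)]).
  assert (0 <= B) by (eapply Rle_trans; [apply Rabs_pos|apply (HB origin origin)]).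
  set (e' := e / (A + B + 1)). assert (He' : 0 < e') by (apply Rdiv_lt_0_compat; lra).
  destruct (Hf e' He') as [r [Hr Hw]]. destruct (Hg e' He') as [r' [Hr' Hw']].
  exists (Rmin r r'); split; [apply Rmin_pos; assumption|]. intros z z' w w' N N'.
  assert (N1 := near_le _ r _ _ (Rmin_l r r') N). assert (N2 := near_le _ r' _ _ (Rmin_r r r') N).
  assert (N3 := near_le _ r _ _ (Rmin_l r r') N'). assert (N4 := near_le _ r' _ _ (Rmin_r r r') N').
  specialize (Hw _ _ _ _ N1 N3). specialize (Hw' _ _ _ _ N2 N4).
  replace (_ - _) with ((f z' w' - f z w) * g z' w' + f z w * (g z' w' - g z w)) by ring.
  eapply Rle_trans; [apply Rabs_triang|]. rewrite !Rabs_mult.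
  specialize (HA z w). specialize (HB z' w').
  pose proof (Rabs_pos (f z' w' - f z w)). pose proof (Rabs_pos (g z' w' - g z w)).
  pose proof (Rabs_pos (f z w)). pose proof (Rabs_pos (g z' w')).
  apply Rle_trans with (e' * B + A * e'); [nra|].
  replace e with (e' * (A + B + 1)) by (unfold e'; field; lra). nra.
Qed.

Lemma conv_assoc (f g k : pt -> R) (z : pt) : Cc f -> Cc g -> cont4 k ->
  conv f (conv g k) z = conv (conv f g) k z.
Proof.
  intros Hf Hg Hk.
  destruct (Cc_common f g Hf Hg) as [M [HM [Sf Sg]]]. destruct (inbox_ex z) as [N [HN Hz]].
  (* The first kernel confines [w] to the box of size [N + M], and the second then confines [y] to
     that of size [N + M + M]. *)
  set (L := N + M + M).
  destruct (clamp_ext k L) as [k' [Uk [[Bk [_ Hbk]] Hkk]]]; [unfold L; lra|assumption|].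
  destruct (Cc_bounded f Hf) as [Bf [_ Hbf]]. destruct (Cc_bounded g Hg) as [Bg [_ Hbg]].
  pose proof (Cc_UC f Hf) as Uf. pose proof (Cc_UC g Hg) as Ug.
  set (h := fun w y => f (psub z w) * g (psub w y) * k' y).
  assert (Hs : forall w y, f (psub z w) * g (psub w y) <> 0 -> inbox L w /\ inbox L y).
  { intros w y Hn. assert (I : inbox (N + M) w).
    { apply inbox_psub with z; [assumption|]. apply NNPP; intros I. apply Hn.
      rewrite Sf by assumption; ring. }
    split; [apply inbox_le with (N + M); [unfold L; lra|assumption]|].
    apply (inbox_psub M (N + M) w); [assumption|]. apply NNPP; intros J. apply Hn.
    rewrite Sg by assumption; ring. }
  assert (Hh : forall w y, h w y = f (psub z w) * g (psub w y) * k y).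
  { intros w y. unfold h. destruct (Req_dec (f (psub z w) * g (psub w y)) 0) as [E|E].
    - rewrite E; ring.
    - apply Hs in E. rewrite Hkk by apply E. reflexivity. }
  assert (Hz0 : forall w y, ~ inbox L w \/ ~ inbox L y -> h w y = 0).
  { intros w y H. unfold h. destruct (Req_dec (f (psub z w) * g (psub w y)) 0) as [E|E].
    - rewrite E; ring.
    - apply Hs in E. tauto. }
  assert (U : UC2 h).
  { apply (UC2_mult (fun w y => f (psub z w) * g (psub w y)) (fun _ y => k' y) (Bf * Bg) Bk).
    - apply (UC2_mult (fun w y => f (psub z w)) (fun w y => g (psub w y)) Bf Bg); auto.
      + intros e He. destruct (Uf e He) as [r [Hr Hw]]. exists (r / 2); split; [lra|].
        intros w w' y y' N1 N2. apply Hw. apply near_psub; [apply near_refl; lra|assumption].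
      + intros e He. destruct (Ug e He) as [r [Hr Hw]]. exists (r / 2); split; [lra|].
        intros w w' y y' N1 N2. apply Hw. apply near_psub; assumption.
    - intros e He. destruct (Uk e He) as [r [Hr Hw]]. exists r; split; [assumption|].
      intros w w' y y' N1 N2. apply Hw; assumption.
    - intros w y. rewrite Rabs_mult. apply Rmult_le_compat; auto; apply Rabs_pos.
    - intros w y; apply Hbk. }
  unfold conv at 1. transitivity (Int4 (fun w => Int4 (h w))).
  - f_equal. extensionality w. unfold conv. rewrite <- Int4_scal.
    + f_equal. extensionality y. rewrite Hh. ring.
    + apply Cc_conv_integrand; assumption.
  - rewrite (Int4_fubini L h); [|unfold L; lra|assumption| |].
    + unfold conv at 1. f_equal. extensionality y. unfold conv.
      rewrite Rmult_comm, <- Int4_scal by (apply Cc_conv_integrand; [assumption|apply Hg]).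
      (* The substitution of [w - y] for [w] turns the inner integral into [conv f g] at [z - y]. *)
      set (q := fun w => k y * (f (psub (psub z y) w) * g w)).
      replace (fun w => h w y) with (fun w => q (aff (psub origin y) (mkpt 1 1 1 1) w)).
      * rewrite Int4_aff; [simpl; rewrite Rabs_R1; unfold q; field|intros []; simpl; lra|].
        unfold q. apply Cc_mult_r; [apply cont4_const|].
        apply Cc_conv_integrand; [assumption|apply Hg].
      * extensionality w. rewrite <- psub_aff_l. unfold q. rewrite Hh.
        replace (psub (psub z y) (psub w y)) with (psub z w); [ring|].
        apply pt_ext; intros d; rewrite !crd_psub; ring.
    + intros w y Hy. apply Hz0; auto.
    + intros y w Hw. apply Hz0; auto.
Qed.

(** * Differentiation *)

(** A relation between functions, so that derivatives are computed by rules and matched with the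
    chosen value [pd] only at the end. *)
Definition hasD (d : dir) (k k' : pt -> R) : Prop :=
  forall z, derivable_pt_lim (fun s => k (shift z d s)) 0 (k' z).

Lemma hasD_pd (d : dir) (k k' : pt -> R) : hasD d k k' -> pd d k = k'.
Proof.
  intros H. extensionality z. apply epsilon_unique; [apply H|].
  intros l' Hl. apply (uniqueness_limite _ _ _ _ Hl (H z)).
Qed.

Lemma shift_shift (z : pt) (d : dir) (s s' : R) : shift (shift z d s) d s' = shift z d (s + s').
Proof. apply pt_ext; intros d'; destruct d, d'; simpl; ring. Qed.

Lemma shift_0 (z : pt) (d : dir) : shift z d 0 = z.
Proof. apply pt_ext; intros d'; destruct d, d'; simpl; ring. Qed.

Lemma hasD_at (d : dir) (k k' : pt -> R) (z : pt) (s : R) : hasD d k k' ->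
  is_derive (fun s => k (shift z d s)) s (k' (shift z d s)).
Proof.
  intros H. apply is_derive_Reals. intros e He.
  destruct (H (shift z d s) e He) as [r Hr]. exists r. intros h H0 Hh.
  specialize (Hr h H0 Hh). rewrite !shift_shift in Hr.
  rewrite Rplus_0_l, Rplus_0_r in Hr. exact Hr.
Qed.

Lemma psub_shift (z w : pt) (d : dir) (s : R) : psub (shift z d s) w = shift (psub z w) d s.
Proof. apply pt_ext; intros d'; destruct d, d'; simpl; ring. Qed.

Lemma crd_shift (z : pt) (d d' : dir) (s : R) : Rabs (crd d' (shift z d s) - crd d' z) <= Rabs s.
Proof.
  pose proof (Rabs_pos s).
  destruct d, d'; simpl;
    match goal with |- Rabs ?x <= _ => first [replace x with s by ring; lra|replace x with 0 by ring; rewrite Rabs_R0; lra] end.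
Qed.

Lemma hasD_MVT (d : dir) (k k' : pt -> R) (z : pt) (s : R) : hasD d k k' ->
  exists lam, 0 <= lam <= 1 /\ k (shift z d s) - k z = k' (shift z d (lam * s)) * s.
Proof.
  intros H. destruct (Req_dec s 0) as [->|Hs].
  { exists 0. split; [lra|]. rewrite shift_0. ring. }
  destruct (MVT_gen (fun s => k (shift z d s)) 0 s (fun s => k' (shift z d s))) as [c [Hc E]].
  - intros x _. apply hasD_at; assumption.
  - intros x _. apply continuity_pt_filterlim.
    apply (ex_derive_continuous (fun s => k (shift z d s))). eexists; apply hasD_at; eassumption.
  - exists (c / s). split.
    + unfold Rmin, Rmax in Hc. destruct (Rle_dec 0 s).
      * split; [apply Rle_div_r|apply Rle_div_l]; lra.
      * replace (c / s) with ((- c) / (- s)) by (field; assumption).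
        split; [apply Rle_div_r|apply Rle_div_l]; lra.
    + rewrite shift_0 in E. rewrite E. replace (c / s * s) with c by (field; assumption). ring.
Qed.

Lemma lam_abs (lam s : R) : 0 <= lam <= 1 -> Rabs (lam * s) <= Rabs s.
Proof. intros H. rewrite Rabs_mult, (Rabs_pos_eq lam) by lra. pose proof (Rabs_pos s). nra. Qed.

Lemma hasD_unif (d : dir) (k k' : pt -> R) (M e : R) : hasD d k k' -> cont4 k' -> 0 < e ->
  exists r, 0 < r /\ forall s, s <> 0 -> Rabs s < r -> forall w, inbox M w ->
    Rabs ((k (shift w d s) - k w) / s - k' w) <= e.
Proof.
  intros H Hc He. destruct (cont4_unif_box k' M e Hc He) as [r [Hr Hu]].
  exists r; split; [assumption|]. intros s Hs Hsr w Hw.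
  destruct (hasD_MVT d k k' w s H) as [lam [Hl E]]. rewrite E. pose proof (lam_abs lam s Hl).
  replace (k' (shift w d (lam * s)) * s / s - k' w) with (k' (shift w d (lam * s)) - k' w) by (field; assumption).
  apply Hu; [assumption|]. intros d'. eapply Rle_lt_trans; [apply crd_shift|]. lra.
Qed.

Lemma hasD_supp (d : dir) (k k' : pt -> R) (M : R) : hasD d k k' -> supp_in M k -> supp_in M k'.
Proof.
  intros H S z Hz. apply not_all_ex_not in Hz. destruct Hz as [d' Hd'].
  apply Rnot_le_lt in Hd'. apply (uniqueness_limite (fun s => k (shift z d s)) 0); [apply H|].
  intros e He. assert (Hp : 0 < Rabs (crd d' z) - M) by lra.
  exists (mkposreal _ Hp). intros h H0 Hh. simpl in Hh.
  rewrite shift_shift || idtac.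
  rewrite (S (shift z d (0 + h))), (S (shift z d 0)).
  - replace ((0 - 0) / h - 0) with 0 by (field; assumption). rewrite Rabs_R0; assumption.
  - rewrite shift_0. intros I; specialize (I d'); lra.
  - rewrite Rplus_0_l. intros I; specialize (I d'). pose proof (crd_shift z d d' h).
    pose proof (Rabs_triang (crd d' (shift z d h)) (- (crd d' (shift z d h) - crd d' z))).
    replace (crd d' (shift z d h) + - (crd d' (shift z d h) - crd d' z)) with (crd d' z) in H2 by ring.
    rewrite Rabs_Ropp in H2. lra.
Qed.

(** Difference quotients of [k] converge uniformly on the box that carries the integrand. Either
    factor may supply that box: for the mollification the compactly supported factor [Psi] is known
    only to be continuous, and derivatives have to fall on the other one. *)
Lemma conv_hasD (d : dir) (k k' f : pt -> R) : hasD d k k' -> cont4 k -> cont4 k' -> cont4 f ->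
  (Cc k \/ Cc f) -> hasD d (conv k f) (conv k' f).
Proof.
  intros H Ck Ck' Cf HC z e He.
  destruct (inbox_ex z) as [N [HN Hz]].
  assert (X : exists L, 0 < L /\ (forall s w, Rabs s <= 1 -> ~ inbox L w ->
            k (shift (psub z w) d s) * f w = 0) /\ (forall w, ~ inbox L w -> k' (psub z w) * f w = 0)).
  { destruct HC as [Hk|Hf].
    - destruct (Cc_common k k Hk Hk) as [M [HM [Sk _]]]. exists (N + 1 + M); split; [lra|].
      assert (Y : forall s w, Rabs s <= 1 -> ~ inbox (N + 1 + M) w -> ~ inbox M (shift (psub z w) d s)).
      { intros s w Hs Hw I. apply Hw. apply (inbox_psub M (N + 1) (shift z d s)).
        - intros d'. specialize (Hz d'). pose proof (crd_shift z d d' s).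
          replace (crd d' (shift z d s)) with ((crd d' (shift z d s) - crd d' z) + crd d' z) by ring.
          eapply Rle_trans; [apply Rabs_triang|]. lra.
        - rewrite psub_shift. assumption. }
      split.
      + intros s w Hs Hw. rewrite Sk; [ring|apply Y; assumption].
      + intros w Hw. rewrite (hasD_supp d k k' M H Sk); [ring|].
        rewrite <- (shift_0 (psub z w) d). apply Y; [rewrite Rabs_R0; lra|assumption].
    - destruct (Cc_common f f Hf Hf) as [M [HM [Sf _]]]. exists M; split; [lra|].
      split; intros; rewrite Sf by assumption; ring. }
  destruct X as [L [HL [S1 S2]]].
  destruct (cont4_bounded_box f L Cf) as [B [HB Hb]].
  set (A := (2 * L) ^ 4). assert (HA : 0 < A) by (apply pow_lt; lra).
  assert (HBA : 0 < (B + 1) * A) by (apply Rmult_lt_0_compat; lra).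
  destruct (hasD_unif d k k' (N + L) (e / (2 * ((B + 1) * A))) H Ck') as [r [Hr Hu]];
    [apply Rdiv_lt_0_compat; lra|].
  assert (Hp : 0 < Rmin 1 r) by (apply Rmin_pos; lra).
  exists (mkposreal _ Hp). intros s Hs Hsr. simpl in Hsr.
  pose proof (Rmin_l 1 r). pose proof (Rmin_r 1 r).
  rewrite Rplus_0_l, shift_0. unfold conv.
  assert (cK : forall s, cont4 (fun w => k (psub (shift z d s) w) * f w))
    by (intros; apply cont4_mult; [apply cont4_psub_r|]; assumption).
  assert (c0 : cont4 (fun w => k (psub z w) * f w))
    by (apply cont4_mult; [apply cont4_psub_r|]; assumption).
  assert (s0 : supp_in L (fun w => k (psub z w) * f w)).
  { intros w Hw. specialize (S1 0 w). rewrite shift_0 in S1. apply S1; [rewrite Rabs_R0; lra|assumption]. }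
  assert (ss : supp_in L (fun w => k (psub (shift z d s) w) * f w)).
  { intros w Hw. rewrite psub_shift. apply S1; [lra|assumption]. }
  replace ((_ - _) / s) with (Int4 (fun w => / s * (k (psub (shift z d s) w) * f w - k (psub z w) * f w))).
  2: { rewrite Int4_scal, Int4_minus.
       - unfold Rdiv; ring.
       - split; [apply cK|exists L; assumption].
       - split; [apply c0|exists L; assumption].
       - split; [apply cont4_minus; [apply cK|apply c0]|exists L].
         intros w Hw. rewrite ss, s0 by assumption; ring. }
  apply Rle_lt_trans with (e / (2 * ((B + 1) * A)) * B * A).
  - apply Int4_diff; [lra| | | |exact S2|].
    + apply cont4_scal, cont4_minus; [apply cK|apply c0].
    + apply cont4_mult; [apply cont4_psub_r|]; assumption.
    + intros w Hw. rewrite ss, s0 by assumption; ring.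
    + intros w. destruct (classic (inbox L w)) as [I|I].
      * rewrite psub_shift.
        replace (_ - _) with (((k (shift (psub z w) d s) - k (psub z w)) / s - k' (psub z w)) * f w)
          by (field; assumption).
        rewrite Rabs_mult. apply Rmult_le_compat; try apply Rabs_pos; [|apply Hb; assumption].
        apply Hu; [assumption|lra|]. intros d'. specialize (I d'); specialize (Hz d').
        rewrite crd_psub. unfold Rminus. eapply Rle_trans; [apply Rabs_triang|]. rewrite Rabs_Ropp; lra.
      * rewrite ss, s0, S2 by assumption. rewrite Rminus_diag, Rmult_0_r, Rminus_diag, Rabs_R0.
        apply Rmult_le_pos; [apply Rlt_le, Rdiv_lt_0_compat; lra|assumption].
  - replace (e / (2 * ((B + 1) * A)) * B * A) with (e / 2 * (B / (B + 1))) by (field; lra).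
    assert (B / (B + 1) <= 1) by (apply Rle_div_l; lra).
    assert (0 <= B / (B + 1)) by (apply Rle_div_r; lra). nra.
Qed.

(** * Smooth functions *)

Lemma Smooth_cont4 (f : pt -> R) : Smooth f -> cont4 f.
Proof. intros H. apply (H nil). Qed.

Lemma Smooth_hasD (f : pt -> R) (d : dir) : Smooth f -> hasD d f (pd d f).
Proof. intros H z. apply (H nil). Qed.

Lemma Smooth_pd (f : pt -> R) (d : dir) : Smooth f -> Smooth (pd d f).
Proof.
  intros H ds. specialize (H (ds ++ d :: nil)).
  replace (pdl (ds ++ d :: nil) f) with (pdl ds (pd d f)) in H; [exact H|].
  unfold pdl. rewrite fold_right_app. reflexivity.
Qed.

(** Smoothness by coinduction: a class of continuous functions that contains a derivative of each
    member in every direction consists of smooth functions. The difficulty is thereby reduced to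
    finding a class closed under the rules of differentiation. *)
Lemma Smooth_coind (S : (pt -> R) -> Prop) :
  (forall f, S f -> cont4 f /\ forall d, exists g, S g /\ hasD d f g) ->
  forall f, S f -> Smooth f.
Proof.
  intros H f Hf ds.
  assert (X : S (pdl ds f)).
  { induction ds as [|d ds IH]; [assumption|]. simpl.
    destruct (H _ IH) as [_ D]. destruct (D d) as [g [Sg Hg]].
    rewrite (hasD_pd _ _ _ Hg). assumption. }
  destruct (H _ X) as [C D]. split; [assumption|]. intros d.
  destruct (D d) as [g [_ Hg]]. rewrite (hasD_pd _ _ _ Hg). exact Hg.
Qed.

Lemma hasD_plus (d : dir) (f g f' g' : pt -> R) : hasD d f f' -> hasD d g g' ->
  hasD d (fun z => f z + g z) (fun z => f' z + g' z).
Proof. intros Hf Hg z. apply derivable_pt_lim_plus; [apply Hf|apply Hg]. Qed.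

Lemma hasD_mult (d : dir) (f g f' g' : pt -> R) : hasD d f f' -> hasD d g g' ->
  hasD d (fun z => f z * g z) (fun z => f' z * g z + f z * g' z).
Proof.
  intros Hf Hg z.
  pose proof (derivable_pt_lim_mult _ _ _ _ _ (Hf z) (Hg z)) as X.
  cbv beta in X. rewrite !shift_0 in X. exact X.
Qed.

Lemma hasD_const (d : dir) (c : R) : hasD d (fun _ => c) (fun _ => 0).
Proof. intros z. apply derivable_pt_lim_const. Qed.

Lemma hasD_scal (d : dir) (c : R) (f f' : pt -> R) : hasD d f f' ->
  hasD d (fun z => c * f z) (fun z => c * f' z).
Proof. intros Hf z. apply derivable_pt_lim_scal. apply Hf. Qed.

Lemma hasD_ext (d : dir) (f f' g g' : pt -> R) : (forall z, f z = g z) -> (forall z, f' z = g' z) ->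
  hasD d f f' -> hasD d g g'.
Proof.
  intros E E'. replace g with f by (extensionality z; apply E).
  replace g' with f' by (extensionality z; apply E'). trivial.
Qed.

Lemma aff_shift (p m z : pt) (d : dir) (s : R) :
  aff p m (shift z d s) = shift (aff p m z) d (crd d m * s).
Proof. apply pt_ext; intros d'; destruct d, d'; simpl; ring. Qed.

Lemma hasD_aff (d : dir) (f f' : pt -> R) (p m : pt) : hasD d f f' ->
  hasD d (fun z => f (aff p m z)) (fun z => crd d m * f' (aff p m z)).
Proof.
  intros H z.
  apply is_derive_Reals. apply (is_derive_ext (fun s => f (shift (aff p m z) d (crd d m * s)))).
  { intros s. rewrite aff_shift; reflexivity. }
  apply (is_derive_comp (fun s => f (shift (aff p m z) d s)) (fun s => crd d m * s)).
  - rewrite Rmult_0_r. replace (f' (aff p m z)) with (f' (shift (aff p m z) d 0)) by (rewrite shift_0; reflexivity).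
    apply hasD_at; assumption.
  - auto_derive; [trivial|ring].
Qed.

Definition unitd (d d' : dir) : R := if dir_eq_dec d d' then 1 else 0.

Lemma hasD_crd (d d' : dir) : hasD d (crd d') (fun _ => unitd d d').
Proof.
  intros z. apply is_derive_Reals. unfold unitd. destruct (dir_eq_dec d d') as [->|Hd].
  - apply (is_derive_ext (fun s => crd d' z + s)); [intros s; destruct d'; simpl; reflexivity|].
    auto_derive; [trivial|ring].
  - apply (is_derive_ext (fun s => crd d' z)).
    + intros s; destruct d, d'; simpl; try reflexivity; congruence.
    + auto_derive; trivial.
Qed.

(** Sums and products are constructors because the product rule leaves any class without them; the
    other constructors are the building blocks met later. *)
Inductive SmAlg : (pt -> R) -> Prop :=
| SmAlg_aff f p m : Smooth f -> SmAlg (fun z => f (aff p m z))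
| SmAlg_crd d : SmAlg (crd d)
| SmAlg_const c : SmAlg (fun _ => c)
| SmAlg_plus f g : SmAlg f -> SmAlg g -> SmAlg (fun z => f z + g z)
| SmAlg_mult f g : SmAlg f -> SmAlg g -> SmAlg (fun z => f z * g z).

Lemma SmAlg_Smooth (f : pt -> R) : SmAlg f -> Smooth f.
Proof.
  apply Smooth_coind. clear f. intros f Hf. induction Hf.
  - split; [apply cont4_aff, Smooth_cont4; assumption|]. intros d. eexists; split.
    2: apply hasD_aff, Smooth_hasD; assumption.
    apply SmAlg_mult; [apply SmAlg_const|]. apply SmAlg_aff, Smooth_pd; assumption.
  - split; [apply cont4_crd|]. intros d'. eexists; split; [|apply hasD_crd]. apply SmAlg_const.
  - split; [apply cont4_const|]. intros d'. eexists; split; [|apply hasD_const]. apply SmAlg_const.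
  - destruct IHHf1 as [C1 D1'], IHHf2 as [C2 D2']. split; [apply cont4_plus; assumption|].
    intros d. destruct (D1' d) as [f' [Sf Hf']], (D2' d) as [g' [Sg Hg']].
    eexists; split; [|apply hasD_plus; eassumption]. apply SmAlg_plus; assumption.
  - destruct IHHf1 as [C1 D1'], IHHf2 as [C2 D2']. split; [apply cont4_mult; assumption|].
    intros d. destruct (D1' d) as [f' [Sf Hf']], (D2' d) as [g' [Sg Hg']].
    eexists; split; [|apply hasD_mult; eassumption].
    apply SmAlg_plus; apply SmAlg_mult; assumption.
Qed.

Lemma Smooth_ext (f g : pt -> R) : (forall z, f z = g z) -> Smooth f -> Smooth g.
Proof. intros E. replace g with f by (extensionality z; apply E). trivial. Qed.

Lemma SmAlg_of_Smooth (f : pt -> R) : Smooth f -> SmAlg f.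
Proof.
  intros H. replace f with (fun z => f (aff origin (mkpt 1 1 1 1) z)); [apply SmAlg_aff; assumption|].
  extensionality z. f_equal. apply pt_ext; intros []; simpl; ring.
Qed.

Lemma Smooth_aff (f : pt -> R) (p m : pt) : Smooth f -> Smooth (fun z => f (aff p m z)).
Proof. intros H. apply SmAlg_Smooth, SmAlg_aff; assumption. Qed.

Lemma Smooth_plus (f g : pt -> R) : Smooth f -> Smooth g -> Smooth (fun z => f z + g z).
Proof. intros. apply SmAlg_Smooth, SmAlg_plus; apply SmAlg_of_Smooth; assumption. Qed.

Lemma Smooth_mult (f g : pt -> R) : Smooth f -> Smooth g -> Smooth (fun z => f z * g z).
Proof. intros. apply SmAlg_Smooth, SmAlg_mult; apply SmAlg_of_Smooth; assumption. Qed.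

Lemma Smooth_const (c : R) : Smooth (fun _ => c).
Proof. apply SmAlg_Smooth, SmAlg_const. Qed.

Lemma Smooth_scal (c : R) (f : pt -> R) : Smooth f -> Smooth (fun z => c * f z).
Proof. intros. apply Smooth_mult; [apply Smooth_const|assumption]. Qed.

Lemma Smooth_minus (f g : pt -> R) : Smooth f -> Smooth g -> Smooth (fun z => f z - g z).
Proof.
  intros. apply (Smooth_ext (fun z => f z + (-1) * g z)); [intros; ring|].
  apply Smooth_plus; [assumption|apply Smooth_scal; assumption].
Qed.

Lemma Smooth_crd (d : dir) : Smooth (crd d).
Proof. apply SmAlg_Smooth, SmAlg_crd. Qed.

Lemma pd_plus (d : dir) (f g : pt -> R) : Smooth f -> Smooth g ->
  pd d (fun z => f z + g z) = fun z => pd d f z + pd d g z.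
Proof. intros. apply hasD_pd, hasD_plus; apply Smooth_hasD; assumption. Qed.

Lemma pd_scal (d : dir) (c : R) (f : pt -> R) : Smooth f ->
  pd d (fun z => c * f z) = fun z => c * pd d f z.
Proof. intros. apply hasD_pd, hasD_scal, Smooth_hasD; assumption. Qed.

Lemma pd_const (d : dir) (c : R) : pd d (fun _ => c) = fun _ => 0.
Proof. apply hasD_pd, hasD_const. Qed.

Lemma pd_aff (d : dir) (f : pt -> R) (p m : pt) : Smooth f ->
  pd d (fun z => f (aff p m z)) = fun z => crd d m * pd d f (aff p m z).
Proof. intros. apply hasD_pd, hasD_aff, Smooth_hasD; assumption. Qed.

Lemma heat_plus (f g : pt -> R) (z : pt) : Smooth f -> Smooth g ->
  heat (fun z => f z + g z) z = heat f z + heat g z.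
Proof.
  intros Hf Hg. unfold heat.
  assert (X : forall d, pd d (fun z => f z + g z) = fun z => pd d f z + pd d g z)
    by (intros; apply pd_plus; assumption).
  rewrite !X. rewrite !pd_plus by (apply Smooth_pd; assumption). ring.
Qed.

Lemma heat_scal (c : R) (f : pt -> R) (z : pt) : Smooth f ->
  heat (fun z => c * f z) z = c * heat f z.
Proof.
  intros Hf. unfold heat.
  assert (X : forall d, pd d (fun z => c * f z) = fun z => c * pd d f z)
    by (intros; apply pd_scal; assumption).
  rewrite !X. rewrite !pd_scal by (apply Smooth_pd; assumption). ring.
Qed.

Lemma heat_const (c : R) (z : pt) : heat (fun _ => c) z = 0.
Proof. unfold heat. rewrite !pd_const. ring. Qed.

(* [aff p (dil l)] is the parabolic dilation by [l] that sends the origin to [p]. *)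
Definition dil (l : R) : pt := mkpt (l ^ 2) l l l.

Lemma heat_dil (f : pt -> R) (p z : pt) (l : R) : Smooth f ->
  heat (fun z => f (aff p (dil l) z)) z = l ^ 2 * heat f (aff p (dil l) z).
Proof.
  intros Hf. unfold heat.
  assert (X0 : forall d, pd d (fun z => f (aff p (dil l) z)) = fun z => crd d (dil l) * pd d f (aff p (dil l) z))
    by (intros; apply pd_aff; assumption).
  rewrite !X0.
  assert (X : forall d, pd d (fun z => crd d (dil l) * pd d f (aff p (dil l) z)) =
     fun z => crd d (dil l) * (crd d (dil l) * pd d (pd d f) (aff p (dil l) z))).
  { intros d. rewrite (pd_scal d (crd d (dil l)) (fun z => pd d f (aff p (dil l) z)))
      by (apply Smooth_aff, Smooth_pd; assumption).
    rewrite pd_aff by (apply Smooth_pd; assumption). reflexivity. }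
  rewrite !X. simpl. ring.
Qed.

Lemma conv_pd (d : dir) (k f : pt -> R) : Smooth k -> cont4 f -> (Cc k \/ Cc f) ->
  hasD d (conv k f) (conv (pd d k) f).
Proof.
  intros Hk Hf HC. apply conv_hasD; try assumption.
  - apply Smooth_hasD; assumption.
  - apply Smooth_cont4; assumption.
  - apply Smooth_cont4, Smooth_pd; assumption.
Qed.

Lemma Cc_pd (d : dir) (k : pt -> R) : Smooth k -> Cc k -> Cc (pd d k).
Proof.
  intros Hk [_ [M HM]]. split; [apply Smooth_cont4, Smooth_pd; assumption|].
  exists M. apply (hasD_supp d k); [apply Smooth_hasD|]; assumption.
Qed.

Lemma conv_cont_any (k f : pt -> R) : cont4 k -> cont4 f -> (Cc k \/ Cc f) -> cont4 (conv k f).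
Proof.
  intros Hk Hf [H|H].
  - apply conv_cont; assumption.
  - apply (cont4_ext (conv f k)); [intros z; apply conv_comm; left; split; assumption|].
    apply conv_cont; assumption.
Qed.

Lemma conv_Smooth (k f : pt -> R) : Smooth k -> cont4 f -> (Cc k \/ Cc f) -> Smooth (conv k f).
Proof.
  intros Hk Hf HC.
  apply (Smooth_coind (fun g => exists k, Smooth k /\ (Cc k \/ Cc f) /\ g = conv k f)).
  - clear k Hk HC. intros g [k [Hk [HC ->]]]. split.
    + apply conv_cont_any; try assumption. apply Smooth_cont4; assumption.
    + intros d. exists (conv (pd d k) f); split; [|apply conv_pd; assumption].
      exists (pd d k); split; [apply Smooth_pd; assumption|]. split; [|reflexivity].
      destruct HC; [left; apply Cc_pd; assumption|right; assumption].
  - exists k; auto.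
Qed.

Lemma conv_heat (k f : pt -> R) (z : pt) : Smooth k -> cont4 f -> (Cc k \/ Cc f) ->
  heat (conv k f) z = conv (heat k) f z.
Proof.
  intros Hk Hf HC.
  assert (HCd : forall d, Cc (pd d k) \/ Cc f)
    by (intros d; destruct HC; [left; apply Cc_pd; assumption|right; assumption]).
  unfold heat at 1. rewrite !(hasD_pd _ _ _ (conv_pd _ k f Hk Hf HC)).
  rewrite !(fun d => hasD_pd _ _ _ (conv_pd d (pd d k) f (Smooth_pd k d Hk) Hf (HCd d))).
  assert (I : forall j, Smooth j -> Cc j \/ Cc f -> Cc (fun w => j (psub z w) * f w)).
  { intros j Hj [H|H]; [apply Cc_conv_integrand; assumption|].
    apply Cc_mult_r; [apply cont4_psub_r, Smooth_cont4|]; assumption. }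
  assert (I1 := I _ (Smooth_pd k Dt Hk) (HCd Dt)).
  assert (I2 : forall d, Cc (fun w => pd d (pd d k) (psub z w) * f w)).
  { intros d. apply I; [apply Smooth_pd, Smooth_pd; assumption|].
    destruct (HCd d); [left; apply Cc_pd; [apply Smooth_pd|]; assumption|right; assumption]. }
  unfold conv at 1 2 3 4. unfold conv.
  rewrite <- (Int4_plus (fun w => pd D1 (pd D1 k) (psub z w) * f w)) by auto.
  assert (I3 : Cc (fun w => pd D1 (pd D1 k) (psub z w) * f w + pd D2 (pd D2 k) (psub z w) * f w)).
  { pose proof (Cc_lin 1 1 _ _ (I2 D1) (I2 D2)) as X.
    replace (fun w => _ + _) with (fun z0 => 1 * (pd D1 (pd D1 k) (psub z z0) * f z0) +
      1 * (pd D2 (pd D2 k) (psub z z0) * f z0)) by (extensionality w; ring). exact X. }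
  rewrite <- (Int4_plus _ (fun w => pd D3 (pd D3 k) (psub z w) * f w)) by auto.
  rewrite <- Int4_minus; [|assumption|].
  - f_equal. extensionality w. unfold heat. ring.
  - pose proof (Cc_lin 1 1 _ _ I3 (I2 D3)) as X.
    replace (fun w => _ + _ + _) with (fun z0 => 1 * (pd D1 (pd D1 k) (psub z z0) * f z0 + pd D2 (pd D2 k) (psub z z0) * f z0) +
      1 * (pd D3 (pd D3 k) (psub z z0) * f z0)) by (extensionality w; ring). exact X.
Qed.

Lemma heat_cont4 (f : pt -> R) : Smooth f -> cont4 (heat f).
Proof.
  intros H. unfold heat.
  apply cont4_minus; [apply Smooth_cont4, Smooth_pd; assumption|].
  repeat apply cont4_plus; apply Smooth_cont4; repeat apply Smooth_pd; assumption.
Qed.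

(* The heat operator may be moved across a convolution because both sides
   are the heat operator applied to the convolution. *)
Lemma conv_heat_swap (k f : pt -> R) (z : pt) : Smooth k -> Cc k -> Smooth f ->
  conv k (heat f) z = conv (heat k) f z.
Proof.
  intros Hk Hc Hf.
  rewrite <- conv_heat; [|assumption|apply Smooth_cont4; assumption|left; assumption].
  replace (conv k f) with (conv f k).
  - rewrite conv_heat; [|assumption|apply Smooth_cont4; assumption|right; assumption].
    apply conv_comm. left; split; [assumption|apply heat_cont4; assumption].
  - extensionality w. apply conv_comm. right; split; [apply Smooth_cont4|]; assumption.
Qed.

(** * Parabolic Taylor estimates *)

Definition dot3 (nu y : pt) : R := pt_x1 nu * pt_x1 y + pt_x2 nu * pt_x2 y + pt_x3 nu * pt_x3 y.

Definition grad (F : pt -> R) (z : pt) : pt := mkpt 0 (pd D1 F z) (pd D2 F z) (pd D3 F z).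

Definition D2bound (F : pt -> R) (A : R) (w : pt) : Prop :=
  Rabs (pd Dt F w) <= A /\ forall d d', d <> Dt -> d' <> Dt -> Rabs (pd d (pd d' F) w) <= A.

(* [w] lies in the coordinate box spanned by [z] and [padd z y] *)
Definition btw (z y w : pt) : Prop :=
  forall d, exists lam, 0 <= lam <= 1 /\ crd d w = crd d z + lam * crd d y.

(** The path from [z] to [padd z y] follows the three spatial axes and then time. It produces one
    first-order time increment, three second-order spatial terms and three corrections that bring
    the gradients back to [z]: seven terms of size [A * r ^ 2], the first because the time
    displacement is at most [r ^ 2]. *)
Lemma taylor_parabolic (F : pt -> R) (A : R) (z y : pt) : Smooth F -> 0 <= A ->
  (forall w, btw z y w -> D2bound F A w) ->
  forall r, 0 <= r -> Rabs (pt_t y) <= r ^ 2 -> Rabs (pt_x1 y) <= r -> Rabs (pt_x2 y) <= r ->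
  Rabs (pt_x3 y) <= r ->
  Rabs (F (padd z y) - F z - dot3 (grad F z) y) <= 7 * A * r ^ 2.
Proof.
  intros HF HA HB r Hr Ht H1 H2 H3.
  assert (Lip : forall (d : dir) (G : pt -> R) w s, Smooth G ->
     (forall lam, 0 <= lam <= 1 -> Rabs (pd d G (shift w d (lam * s))) <= A) ->
     Rabs (G (shift w d s) - G w) <= A * Rabs s).
  { intros d G w s HG H. destruct (hasD_MVT d G _ w s (Smooth_hasD G d HG)) as [c [Hc E]].
    rewrite E, Rabs_mult. apply Rmult_le_compat_r; [apply Rabs_pos|]. apply H; assumption. }
  assert (Tay : forall (d : dir) w s,
     (forall lam, 0 <= lam <= 1 -> Rabs (pd d (pd d F) (shift w d (lam * s))) <= A) ->
     Rabs (F (shift w d s) - F w - s * pd d F w) <= A * Rabs s * Rabs s).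
  { intros d w s H. destruct (hasD_MVT d F _ w s (Smooth_hasD F d HF)) as [lam [Hl E]].
    rewrite E. replace (pd d F (shift w d (lam * s)) * s - s * pd d F w)
      with ((pd d F (shift w d (lam * s)) - pd d F w) * s) by ring.
    rewrite Rabs_mult. apply Rmult_le_compat_r; [apply Rabs_pos|].
    apply Rle_trans with (A * Rabs (lam * s)); [|apply Rmult_le_compat_l; [assumption|apply lam_abs; assumption]].
    apply Lip; [apply Smooth_pd; assumption|]. intros lam' Hl'.
    replace (lam' * (lam * s)) with ((lam' * lam) * s) by ring. apply H. nra. }
  set (z1 := shift z D1 (pt_x1 y)). set (z2 := shift z1 D2 (pt_x2 y)). set (z3 := shift z2 D3 (pt_x3 y)).
  assert (Hz : padd z y = shift z3 Dt (pt_t y)) by (apply pt_ext; intros []; simpl; ring).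
  assert (bt : forall lam, 0 <= lam <= 1 -> D2bound F A (shift z3 Dt (lam * pt_t y))).
  { intros lam Hl. apply HB. intros []; [exists lam|exists 1|exists 1|exists 1]; simpl; split; lra. }
  assert (b3 : forall lam, 0 <= lam <= 1 -> D2bound F A (shift z2 D3 (lam * pt_x3 y))).
  { intros lam Hl. apply HB. intros []; [exists 0|exists 1|exists 1|exists lam]; simpl; split; lra. }
  assert (b2 : forall lam, 0 <= lam <= 1 -> D2bound F A (shift z1 D2 (lam * pt_x2 y))).
  { intros lam Hl. apply HB. intros []; [exists 0|exists 1|exists lam|exists 0]; simpl; split; lra. }
  assert (b1 : forall lam, 0 <= lam <= 1 -> D2bound F A (shift z D1 (lam * pt_x1 y))).
  { intros lam Hl. apply HB. intros []; [exists 0|exists lam|exists 0|exists 0]; simpl; split; lra. }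
  pose proof (Lip Dt F z3 (pt_t y) HF (fun c Hc => proj1 (bt c Hc))) as E0.
  pose proof (Tay D3 z2 (pt_x3 y) (fun c Hc => proj2 (b3 c Hc) D3 D3 ltac:(discriminate) ltac:(discriminate))) as E1.
  pose proof (Tay D2 z1 (pt_x2 y) (fun c Hc => proj2 (b2 c Hc) D2 D2 ltac:(discriminate) ltac:(discriminate))) as E2.
  pose proof (Tay D1 z (pt_x1 y) (fun c Hc => proj2 (b1 c Hc) D1 D1 ltac:(discriminate) ltac:(discriminate))) as E3.
  pose proof (Lip D2 (pd D3 F) z1 (pt_x2 y) (Smooth_pd F D3 HF)
    (fun c Hc => proj2 (b2 c Hc) D2 D3 ltac:(discriminate) ltac:(discriminate))) as E4.
  pose proof (Lip D1 (pd D3 F) z (pt_x1 y) (Smooth_pd F D3 HF)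
    (fun c Hc => proj2 (b1 c Hc) D1 D3 ltac:(discriminate) ltac:(discriminate))) as E5.
  pose proof (Lip D1 (pd D2 F) z (pt_x1 y) (Smooth_pd F D2 HF)
    (fun c Hc => proj2 (b1 c Hc) D1 D2 ltac:(discriminate) ltac:(discriminate))) as E6.
  fold z1 in E3, E5, E6. fold z2 in E2, E4. fold z3 in E1.
  rewrite Hz. unfold dot3, grad; cbn [pt_x1 pt_x2 pt_x3].
  replace (_ - _ - _) with ((F (shift z3 Dt (pt_t y)) - F z3) +
    (F z3 - F z2 - pt_x3 y * pd D3 F z2) + (F z2 - F z1 - pt_x2 y * pd D2 F z1) +
    (F z1 - F z - pt_x1 y * pd D1 F z) + pt_x3 y * (pd D3 F z2 - pd D3 F z1) +
    pt_x3 y * (pd D3 F z1 - pd D3 F z) + pt_x2 y * (pd D2 F z1 - pd D2 F z)) by ring.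
  assert (Hprod : forall a b x y : R, Rabs a <= r -> Rabs b <= A * y -> 0 <= y <= r -> Rabs (a * b) <= A * r ^ 2).
  { intros a b x y' Ha Hb Hy. rewrite Rabs_mult. apply Rle_trans with (r * (A * r)); [|right; ring].
    apply Rmult_le_compat; try apply Rabs_pos; [assumption|].
    apply Rle_trans with (A * y'); [assumption|]. apply Rmult_le_compat_l; lra. }
  assert (Hsq : forall a x, Rabs a <= A * x * x -> 0 <= x <= r -> Rabs a <= A * r ^ 2).
  { intros a x Ha Hx. eapply Rle_trans; [exact Ha|]. rewrite Rmult_assoc.
    apply Rmult_le_compat_l; [assumption|]. nra. }
  pose proof (Rabs_pos (pt_x1 y)). pose proof (Rabs_pos (pt_x2 y)). pose proof (Rabs_pos (pt_x3 y)).
  assert (A * Rabs (pt_t y) <= A * r ^ 2) by (apply Rmult_le_compat_l; assumption).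
  apply Hsq in E1; [|lra]. apply Hsq in E2; [|lra]. apply Hsq in E3; [|lra].
  apply (Hprod (pt_x3 y) _ 0) in E4; [|lra|lra]. apply (Hprod (pt_x3 y) _ 0) in E5; [|lra|lra].
  apply (Hprod (pt_x2 y) _ 0) in E6; [|lra|lra].
  apply Rabs_le_between in E0. apply Rabs_le_between in E1. apply Rabs_le_between in E2.
  apply Rabs_le_between in E3. apply Rabs_le_between in E4. apply Rabs_le_between in E5.
  apply Rabs_le_between in E6. apply Rabs_le_between. lra.
Qed.

(** * Causal probability kernels *)

(* [w] lies in the closed past parabolic ball of radius [r] around [z] *)
Definition past (r : R) (z w : pt) : Prop :=
  0 <= pt_t z - pt_t w <= r ^ 2 /\ Rabs (pt_x1 z - pt_x1 w) <= r /\
  Rabs (pt_x2 z - pt_x2 w) <= r /\ Rabs (pt_x3 z - pt_x3 w) <= r.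

Definition psupp (r : R) (k : pt -> R) : Prop := forall z, k z <> 0 -> past r z origin.

Definition prob (k : pt -> R) : Prop := Cc k /\ (forall z, 0 <= k z) /\ Int4 k = 1.

Lemma past_le (r s : R) (z w : pt) : 0 <= r <= s -> past r z w -> past s z w.
Proof. intros H [H0 [H1 [H2 H3]]]. repeat split; try lra. nra. Qed.

(** Time displacements add to at most [r^2 + s^2], which is below [(r + s)^2]; so the radii of
    causal supports add under convolution. *)
Lemma past_trans (r s : R) (z w y : pt) : 0 <= r -> 0 <= s -> past r z w -> past s w y ->
  past (r + s) z y.
Proof.
  intros Hr Hs [A0 [A1 [A2 A3]]] [B0 [B1 [B2 B3]]].
  assert (0 <= r * s) by (apply Rmult_le_pos; assumption).
  repeat split; try nra.
  - replace (pt_x1 z - pt_x1 y) with ((pt_x1 z - pt_x1 w) + (pt_x1 w - pt_x1 y)) by ring.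
    eapply Rle_trans; [apply Rabs_triang|lra].
  - replace (pt_x2 z - pt_x2 y) with ((pt_x2 z - pt_x2 w) + (pt_x2 w - pt_x2 y)) by ring.
    eapply Rle_trans; [apply Rabs_triang|lra].
  - replace (pt_x3 z - pt_x3 y) with ((pt_x3 z - pt_x3 w) + (pt_x3 w - pt_x3 y)) by ring.
    eapply Rle_trans; [apply Rabs_triang|lra].
Qed.

Lemma past_refl (r : R) (z : pt) : 0 <= r -> past r z z.
Proof.
  intros Hr. unfold past. rewrite !Rminus_diag, Rabs_R0. repeat split; try lra. apply pow2_ge_0.
Qed.

Lemma past_psub (r : R) (z w : pt) : past r (psub z w) origin <-> past r z w.
Proof. unfold past, psub, origin; simpl. rewrite !Rminus_0_r. tauto. Qed.

Lemma past_pdist (r : R) (z w : pt) : 0 <= r ->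
  (past r z w <-> pt_t w <= pt_t z /\ pdist z w <= r).
Proof.
  intros Hr. rewrite (pdist_le_iff z w r Hr). unfold past. split.
  - intros [H0 H]. split; [lra|]. rewrite Rabs_pos_eq by lra. tauto.
  - intros [H0 [H1 H]]. rewrite Rabs_pos_eq in H1 by lra. split; [lra|tauto].
Qed.

Lemma psupp_Cc (r : R) (k : pt -> R) : 0 <= r -> cont4 k -> psupp r k -> Cc k.
Proof.
  intros Hr Hc H. split; [assumption|]. exists (r + r ^ 2). intros z Hz. apply NNPP; intros Hn.
  apply Hz. destruct (H z Hn) as [H0 [H1 [H2 H3]]]. unfold origin in *; simpl in *.
  rewrite !Rminus_0_r in *. intros []; simpl.
  - rewrite Rabs_pos_eq; nra.
  - nra.
  - nra.
  - nra.
Qed.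

Lemma psupp_conv (r s : R) (f g : pt -> R) : 0 <= r -> 0 <= s -> psupp r f -> psupp s g ->
  psupp (r + s) (conv f g).
Proof.
  intros Hr Hs Hf Hg z Hz. apply NNPP; intros Hn. apply Hz. apply Int4_ext0. intros w.
  destruct (Req_dec (g w) 0) as [E|E]; [rewrite E; ring|].
  destruct (Req_dec (f (psub z w)) 0) as [E'|E']; [rewrite E'; ring|].
  exfalso; apply Hn. apply past_trans with w; try assumption; [|apply Hg; assumption].
  apply past_psub. apply Hf; assumption.
Qed.

Lemma conv_one (k : pt -> R) (z : pt) (c : R) : Cc k -> conv k (fun _ => c) z = c * Int4 k.
Proof.
  intros Hk. rewrite conv_comm by (left; split; [assumption|apply cont4_const]).
  unfold conv. apply Int4_scal; assumption.
Qed.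

(** Convolving with the constant 1 reads off the integral, and associativity then splits it into two
    factors. *)
Lemma Int4_conv (f g : pt -> R) : Cc f -> Cc g -> Int4 (conv f g) = Int4 f * Int4 g.
Proof.
  intros Hf Hg.
  pose proof (conv_one (conv f g) origin 1 (conv_Cc f g Hf Hg)) as E.
  rewrite <- conv_assoc in E by (try assumption; apply cont4_const).
  replace (conv g (fun _ => 1)) with (fun _ : pt => 1 * Int4 g) in E
    by (extensionality w; rewrite conv_one by assumption; reflexivity).
  rewrite conv_one in E by assumption. lra.
Qed.

Lemma conv_ge_0 (f g : pt -> R) (z : pt) : Cc f -> cont4 g -> (forall z, 0 <= f z) ->
  (forall z, 0 <= g z) -> 0 <= conv f g z.
Proof.
  intros Hf Hg Pf Pg. apply Int4_ge_0; [apply Cc_conv_integrand; assumption|].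
  intros w. apply Rmult_le_pos; auto.
Qed.

Lemma conv_prob (f g : pt -> R) : prob f -> prob g -> prob (conv f g).
Proof.
  intros [Cf [Pf If]] [Cg [Pg Ig]]. split; [apply conv_Cc; assumption|split].
  - intros z. apply conv_ge_0; try assumption. apply Cg.
  - rewrite Int4_conv by assumption. rewrite If, Ig. ring.
Qed.

Lemma conv_plus_r (k f g : pt -> R) (z : pt) : Cc k -> cont4 f -> cont4 g ->
  conv k (fun w => f w + g w) z = conv k f z + conv k g z.
Proof.
  intros Hk Hf Hg. unfold conv. rewrite <- Int4_plus by (apply Cc_conv_integrand; assumption).
  f_equal; extensionality w; ring.
Qed.

Lemma conv_scal_r (k f : pt -> R) (c : R) (z : pt) : Cc k -> cont4 f ->
  conv k (fun w => c * f w) z = c * conv k f z.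
Proof.
  intros Hk Hf. unfold conv. rewrite <- Int4_scal by (apply Cc_conv_integrand; assumption).
  f_equal; extensionality w; ring.
Qed.

Lemma conv_minus_r (k f g : pt -> R) (z : pt) : Cc k -> cont4 f -> cont4 g ->
  conv k (fun w => f w - g w) z = conv k f z - conv k g z.
Proof.
  intros Hk Hf Hg. unfold conv. rewrite <- Int4_minus by (apply Cc_conv_integrand; assumption).
  f_equal; extensionality w; ring.
Qed.

Lemma conv_minus_l (k j f : pt -> R) (z : pt) : Cc k -> Cc j -> cont4 f ->
  conv (fun w => k w - j w) f z = conv k f z - conv j f z.
Proof.
  intros Hk Hj Hf. unfold conv. rewrite <- Int4_minus by (apply Cc_conv_integrand; assumption).
  f_equal; extensionality w; ring.
Qed.

Lemma conv_plus_l (k j f : pt -> R) (z : pt) : Cc k -> Cc j -> cont4 f ->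
  conv (fun w => k w + j w) f z = conv k f z + conv j f z.
Proof.
  intros Hk Hj Hf. unfold conv. rewrite <- Int4_plus by (apply Cc_conv_integrand; assumption).
  f_equal; extensionality w; ring.
Qed.

Lemma conv_scal_l (c : R) (k f : pt -> R) (z : pt) : Cc k -> cont4 f ->
  conv (fun w => c * k w) f z = c * conv k f z.
Proof.
  intros Hk Hf. unfold conv. rewrite <- Int4_scal by (apply Cc_conv_integrand; assumption).
  f_equal; extensionality w; ring.
Qed.

(** A causal probability kernel is an average over the past ball, so any bound on the oscillation
    around [c] there passes to the convolution. *)
Lemma conv_prob_le (k g : pt -> R) (r c e : R) (z : pt) : prob k -> psupp r k -> cont4 g ->
  (forall w, past r z w -> Rabs (g w - c) <= e) -> Rabs (conv k g z - c) <= e.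
Proof.
  intros [Ck [Pk Ik]] Hs Hg H.
  assert (E1 : conv k g z - c = conv k (fun w => g w - c) z).
  { rewrite conv_minus_r by (try assumption; apply cont4_const). rewrite conv_one by assumption.
    rewrite Ik; ring. }
  assert (Cg : cont4 (fun w => g w - c)) by (apply cont4_minus; [assumption|apply cont4_const]).
  assert (E2 : conv k (fun _ => e) z = e) by (rewrite conv_one, Ik by assumption; ring).
  assert (P : forall w, Rabs (k (psub z w) * (g w - c)) <= k (psub z w) * e).
  { intros w. rewrite Rabs_mult, (Rabs_pos_eq (k _)) by auto.
    destruct (Req_dec (k (psub z w)) 0) as [E|E]; [rewrite E; lra|].
    apply Rmult_le_compat_l; [auto|]. apply H, past_psub, Hs; assumption. }
  rewrite E1. apply Rabs_le_between. split.
  - assert (X : conv k (fun _ => - e) z <= conv k (fun w => g w - c) z).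
    { apply Int4_le; try (apply Cc_conv_integrand; try assumption; apply cont4_const).
      intros w. specialize (P w). apply Rabs_le_between in P. lra. }
    rewrite conv_one, Ik in X by assumption. lra.
  - rewrite <- E2. apply Int4_le; try (apply Cc_conv_integrand; try assumption; apply cont4_const).
    intros w. specialize (P w). apply Rabs_le_between in P. lra.
Qed.

Lemma geometric_cv (a : nat -> R) (c : R) : 0 <= c ->
  (forall n, Rabs (a (S n) - a n) <= c / 2 ^ n) ->
  exists l, Un_cv a l /\ forall n, Rabs (a n - l) <= 2 * c / 2 ^ n.
Proof.
  intros Hc H.
  assert (P : forall n, 0 < 2 ^ n) by (intros; apply pow_lt; lra).
  assert (G : forall n m, Rabs (a (n + m)%nat - a n) <= 2 * c / 2 ^ n - 2 * c / 2 ^ (n + m)).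
  { intros n m. induction m.
    - rewrite Nat.add_0_r, !Rminus_diag, Rabs_R0; lra.
    - rewrite Nat.add_succ_r. specialize (H (n + m)%nat).
      replace (a (S (n + m)) - a n) with ((a (S (n + m)) - a (n + m)%nat) + (a (n + m)%nat - a n)) by ring.
      eapply Rle_trans; [apply Rabs_triang|].
      replace (2 * c / 2 ^ S (n + m)) with (c / 2 ^ (n + m)).
      + replace (2 * c / 2 ^ n - c / 2 ^ (n + m)) with (c / 2 ^ (n + m) + (2 * c / 2 ^ n - 2 * c / 2 ^ (n + m)));
          [lra|]. specialize (P (n + m)%nat). specialize (P) as _. field. split; apply pow_nonzero; lra.
      + simpl. field. apply pow_nonzero; lra. }
  assert (G2 : forall n m, Rabs (a (n + m)%nat - a n) <= 2 * c / 2 ^ n).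
  { intros n m. eapply Rle_trans; [apply G|].
    assert (0 <= 2 * c / 2 ^ (n + m)) by (apply Rle_div_r; [apply P|lra]). lra. }
  destruct (R_complete a) as [l Hl].
  - intros e He.
    assert (X : exists N, 4 * c / 2 ^ N < e).
    { destruct (Rle_lt_dec c 0) as [H0|H0].
      - exists 0%nat. replace c with 0 by lra. simpl. lra.
      - destruct (Pow_x_infinity 2 ltac:(rewrite Rabs_pos_eq; lra) (4 * c / e + 1)) as [N HN].
        exists N. specialize (HN N (Nat.le_refl N)). rewrite Rabs_pos_eq in HN by (apply Rlt_le, P).
        apply Rlt_div_l; [apply P|]. apply Rlt_le_trans with (e * (4 * c / e + 1)).
        + replace (e * (4 * c / e + 1)) with (4 * c + e) by (field; lra). lra.
        + apply Rmult_le_compat_l; lra. }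
    destruct X as [N HN]. exists N. intros n m Hn Hm. unfold Rdist.
    replace n with (N + (n - N))%nat by lia. replace m with (N + (m - N))%nat by lia.
    pose proof (G2 N (n - N)%nat). pose proof (G2 N (m - N)%nat).
    apply Rle_lt_trans with (4 * c / 2 ^ N); [|assumption].
    replace (4 * c / 2 ^ N) with (2 * c / 2 ^ N + 2 * c / 2 ^ N) by (field; apply pow_nonzero; lra).
    replace (a (N + (n - N))%nat - a (N + (m - N))%nat) with
      ((a (N + (n - N))%nat - a N) + - (a (N + (m - N))%nat - a N)) by ring.
    eapply Rle_trans; [apply Rabs_triang|]. rewrite Rabs_Ropp. lra.
  - exists l; split; [assumption|]. intros n.
    apply Rnot_lt_le; intros Hlt.
    destruct (Hl (Rabs (a n - l) - 2 * c / 2 ^ n)) as [N HN]; [lra|].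
    specialize (HN (n + N)%nat ltac:(lia)). unfold Rdist in HN. specialize (G2 n N).
    pose proof (Rabs_triang (a n - a (n + N)%nat) (a (n + N)%nat - l)).
    replace (a n - a (n + N)%nat + (a (n + N)%nat - l)) with (a n - l) in H0 by ring.
    rewrite Rabs_minus_sym in G2. lra.
Qed.

(** * The kernel [Psi] *)

Section Kernel.
Variable Phi : pt -> R.
Hypothesis Hok : kernel_ok Phi.

Lemma Phi_Cc : Cc Phi.
Proof.
  destruct Hok as [S [_ [_ [_ Sp]]]]. split; [apply Smooth_cont4; assumption|].
  exists 1. intros z Hz. apply NNPP; intros Hn. apply Hz. destruct (Sp z Hn) as [H0 H1].
  apply xnorm_crd_lt in H1. intros []; simpl; try lra. rewrite Rabs_pos_eq; lra.
Qed.

Lemma PhiT_aff (T : R) (z : pt) : 0 < T ->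
  PhiT Phi T z = / T ^ 5 * Phi (aff origin (dil (/ T)) z).
Proof.
  intros HT. unfold PhiT. f_equal. f_equal. apply pt_ext; intros []; simpl; field; lra.
Qed.

Lemma PhiT_Smooth (T : R) : 0 < T -> Smooth (PhiT Phi T).
Proof.
  intros HT. apply (Smooth_ext (fun z => / T ^ 5 * Phi (aff origin (dil (/ T)) z))).
  - intros z; rewrite PhiT_aff by assumption; reflexivity.
  - apply Smooth_scal, Smooth_aff, Hok.
Qed.

Lemma dil_neq0 (l : R) : l <> 0 -> forall d, crd d (dil l) <> 0.
Proof. intros H []; simpl; try assumption. rewrite Rmult_1_r. apply Rmult_integral_contrapositive; auto. Qed.

Lemma PhiT_prob (T : R) : 0 < T -> prob (PhiT Phi T).
Proof.
  intros HT. assert (E : PhiT Phi T = fun z => / T ^ 5 * Phi (aff origin (dil (/ T)) z))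
    by (extensionality z; apply PhiT_aff; assumption).
  rewrite E. pose proof (dil_neq0 (/ T) (Rinv_neq_0_compat _ (Rgt_not_eq _ _ HT))) as Hd.
  destruct (Cc_aff Phi origin (dil (/ T)) Hd Phi_Cc) as [C _].
  assert (PT : 0 < / T ^ 5) by (apply Rinv_0_lt_compat, pow_lt; assumption).
  split; [|split].
  - apply (Cc_mult_r (fun _ => / T ^ 5)); [apply cont4_const|assumption].
  - intros z. apply Rmult_le_pos; [lra|]. apply Hok.
  - rewrite Int4_scal by assumption. rewrite (Int4_aff Phi) by (try assumption; apply Phi_Cc).
    destruct Hok as [_ [_ [I _]]]. rewrite I.
    assert (0 < / T) by (apply Rinv_0_lt_compat; assumption).
    unfold dil; cbn [pt_t pt_x1 pt_x2 pt_x3]. rewrite !Rabs_pos_eq by (try apply pow_le; lra). field. lra.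
Qed.

Lemma PhiT_psupp (T : R) : 0 < T -> psupp T (PhiT Phi T).
Proof.
  intros HT z Hz. rewrite PhiT_aff in Hz by assumption.
  assert (Hn : Phi (aff origin (dil (/ T)) z) <> 0) by (intros E; apply Hz; rewrite E; ring).
  destruct Hok as [_ [_ [_ [_ Sp]]]]. destruct (Sp _ Hn) as [H0 H1]. apply xnorm_crd_lt in H1.
  simpl in *.
  assert (Hx : forall x, Rabs (0 + / T * x) < 1 -> Rabs (x - 0) <= T).
  { intros x Hx. rewrite Rplus_0_l, Rabs_mult, Rabs_inv, (Rabs_pos_eq T) in Hx by lra.
    rewrite Rminus_0_r. apply Rmult_lt_compat_l with (r := T) in Hx; [|assumption].
    rewrite <- Rmult_assoc, Rinv_r, Rmult_1_l in Hx by lra. lra. }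
  unfold past; simpl. repeat split; try (apply Hx; apply H1).
  - assert (0 < T * T) by nra. assert (E : pt_t z = T * T * (0 + / T * (/ T * 1) * pt_t z)) by (field; lra).
    rewrite E. nra.
  - assert (0 < T * T) by nra. assert (E : pt_t z = T * T * (0 + / T * (/ T * 1) * pt_t z)) by (field; lra).
    rewrite E. nra.
Qed.

Lemma PhiT_sym (T t a b c : R) : 0 < T ->
  PhiT Phi T (mkpt t (-a) (-b) (-c)) = PhiT Phi T (mkpt t a b c).
Proof.
  intros HT. unfold PhiT. f_equal. simpl. destruct Hok as [_ [_ [_ [Sy _]]]].
  unfold Rdiv. rewrite <- !Ropp_mult_distr_l. apply Sy.
Qed.

Lemma pow2_pos (n : nat) : 0 < 2 ^ n.
Proof. apply pow_lt; lra. Qed.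

(** There are [n + 1] factors, whose radii [T / 2, ..., T / 2 ^ (n + 1)] add up to the stated
    radius; it stays below [T] for all [n], which gives the support of the limit. *)
Lemma PsiN_ok (T : R) (n : nat) : 0 < T ->
  prob (PsiN Phi T n) /\ psupp (T * (1 - / 2 ^ S n)) (PsiN Phi T n).
Proof.
  intros HT. induction n as [|n [IH1 IH2]].
  - simpl. split; [apply PhiT_prob; lra|].
    replace (T * (1 - / (2 * 1))) with (T / 2) by field. apply PhiT_psupp; lra.
  - cbn [PsiN]. pose proof (pow2_pos (S (S n))) as P.
    assert (HT' : 0 < T / 2 ^ S (S n)) by (apply Rdiv_lt_0_compat; assumption).
    split; [apply conv_prob; [assumption|apply PhiT_prob; assumption]|].
    replace (T * (1 - / 2 ^ S (S n))) with (T * (1 - / 2 ^ S n) + T / 2 ^ S (S n))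
      by (simpl; field; apply pow_nonzero; lra).
    apply psupp_conv; [|lra|assumption|apply PhiT_psupp; assumption].
    apply Rmult_le_pos; [lra|]. assert (/ 2 ^ S n <= 1); [|lra].
    rewrite <- Rinv_1. apply Rinv_le_contravar; [lra|]. apply pow_R1_Rle; lra.
Qed.

(** The definition adds ever finer factors on the right. By associativity the coarsest one can be
    taken off on the left instead, and what remains is the same product built from [T / 2]: the
    source of the self-similarity of [Psi]. *)
Lemma PsiN_left (T : R) (n : nat) (z : pt) : 0 < T ->
  PsiN Phi T (S n) z = conv (PhiT Phi (T / 2)) (PsiN Phi (T / 2) n) z.
Proof.
  intros HT. revert z. induction n as [|n IH]; intros z.
  - simpl. replace (T / (2 * (2 * 1))) with (T / 2 / 2) by field. reflexivity.
  - change (PsiN Phi T (S (S n)) z) with (conv (PsiN Phi T (S n)) (PhiT Phi (T / 2 ^ S (S (S n)))) z).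
    replace (PsiN Phi T (S n)) with (conv (PhiT Phi (T / 2)) (PsiN Phi (T / 2) n))
      by (extensionality w; symmetry; apply IH).
    rewrite <- conv_assoc.
    + change (PsiN Phi (T / 2) (S n)) with (conv (PsiN Phi (T / 2) n) (PhiT Phi (T / 2 / 2 ^ S (S n)))).
      replace (T / 2 / 2 ^ S (S n)) with (T / 2 ^ S (S (S n))); [reflexivity|].
      simpl; field. apply pow_nonzero; lra.
    + apply PhiT_prob; lra.
    + apply PsiN_ok; lra.
    + apply PhiT_prob. apply Rdiv_lt_0_compat; [assumption|apply pow2_pos].
Qed.

Lemma Smooth_Cc_lip (F : pt -> R) : Smooth F -> Cc F ->
  exists L, 0 <= L /\ forall z r w, (forall d, Rabs (crd d w - crd d z) <= r) ->
    Rabs (F w - F z) <= L * r.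
Proof.
  intros HF HC.
  assert (B : forall d, exists B, 0 <= B /\ forall z, Rabs (pd d F z) <= B)
    by (intros d; apply Cc_bounded, Cc_pd; assumption).
  destruct (B Dt) as [B0 [P0 Q0]], (B D1) as [B1 [P1 Q1]], (B D2) as [B2 [P2 Q2]], (B D3) as [B3 [P3 Q3]].
  exists (B0 + B1 + B2 + B3); split; [lra|]. intros z r w H.
  assert (Lip : forall d B z s, (forall z, Rabs (pd d F z) <= B) -> Rabs s <= r ->
     Rabs (F (shift z d s) - F z) <= B * r).
  { intros d B4 z' s HB Hs. destruct (hasD_MVT d F _ z' s (Smooth_hasD F d HF)) as [lam [Hl E]].
    rewrite E, Rabs_mult. apply Rmult_le_compat; try apply Rabs_pos; auto. }
  set (z1 := shift z D1 (pt_x1 w - pt_x1 z)). set (z2 := shift z1 D2 (pt_x2 w - pt_x2 z)).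
  set (z3 := shift z2 D3 (pt_x3 w - pt_x3 z)).
  assert (Hz : w = shift z3 Dt (pt_t w - pt_t z)) by (apply pt_ext; intros []; simpl; ring).
  pose proof (Lip D1 B1 z _ Q1 (H D1)) as E1. pose proof (Lip D2 B2 z1 _ Q2 (H D2)) as E2.
  pose proof (Lip D3 B3 z2 _ Q3 (H D3)) as E3. pose proof (Lip Dt B0 z3 _ Q0 (H Dt)) as E0.
  cbn [crd] in E0, E1, E2, E3. rewrite <- Hz in E0. fold z1 in E1. fold z2 in E2. fold z3 in E3.
  apply Rabs_le_between in E0. apply Rabs_le_between in E1. apply Rabs_le_between in E2.
  apply Rabs_le_between in E3. apply Rabs_le_between. lra.
Qed.

Lemma past_crd (r e : R) (z w : pt) : r <= e -> r ^ 2 <= e -> past r z w ->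
  forall d, Rabs (crd d w - crd d z) <= e.
Proof.
  intros H1 H2 [P0 [P1 [P2 P3]]] []; cbn [crd]; rewrite Rabs_minus_sym; try lra.
  rewrite Rabs_pos_eq; lra.
Qed.

(** The coarsest factor makes all products Lipschitz with one constant, and the factor added next
    only averages over displacements of size about [T / 2 ^ (n + 3)]. *)
Lemma PsiN_cauchy (T : R) : 0 < T -> exists c, 0 <= c /\
  forall n z, Rabs (PsiN Phi T (S (S n)) z - PsiN Phi T (S n) z) <= c / 2 ^ n.
Proof.
  intros HT.
  assert (HT2 : 0 < T / 2) by lra.
  destruct (Smooth_Cc_lip (PhiT Phi (T / 2)) (PhiT_Smooth _ HT2) (proj1 (PhiT_prob _ HT2))) as [L [HL Hlip]].
  exists (L * (T * (1 + T))); split; [apply Rmult_le_pos; nra|].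
  intros n z.
  set (s := T / 2 ^ S (S (S n))).
  assert (P := pow2_pos (S (S (S n)))). assert (Hs : 0 < s) by (apply Rdiv_lt_0_compat; lra).
  assert (HsT : s <= T).
  { unfold s. apply Rle_div_l; [assumption|]. assert (1 <= 2 ^ S (S (S n))) by (apply pow_R1_Rle; lra). nra. }
  assert (Hs2 : s * (1 + T) <= T * (1 + T) / 2 ^ n).
  { unfold s. pose proof (pow2_pos n). simpl.
    replace (T / (2 * (2 * (2 * 2 ^ n))) * (1 + T)) with (T * (1 + T) / 2 ^ n / 8) by (field; lra).
    assert (0 <= T * (1 + T) / 2 ^ n) by (apply Rle_div_r; nra). lra. }
  destruct (PsiN_ok T (S n) HT) as [[Cn _] _].
  destruct (PsiN_ok (T / 2) n HT2) as [[Cn2 [Pn2 In2]] _].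
  change (PsiN Phi T (S (S n)) z) with (conv (PsiN Phi T (S n)) (PhiT Phi s) z).
  assert (Ps := PhiT_prob s Hs).
  rewrite conv_comm by (left; split; [assumption|apply Ps]).
  replace (L * (T * (1 + T)) / 2 ^ n) with (L * (T * (1 + T) / 2 ^ n)) by (unfold Rdiv; ring).
  apply Rle_trans with (L * (s * (1 + T))); [|apply Rmult_le_compat_l; assumption].
  apply conv_prob_le with s; [assumption|apply PhiT_psupp; assumption|apply Cn|].
  intros w Hw. rewrite !PsiN_left by assumption.
  replace (L * (s * (1 + T))) with (conv (fun _ => L * (s * (1 + T))) (PsiN Phi (T / 2) n) z).
  2: { rewrite conv_comm by (right; split; [apply cont4_const|assumption]).
       rewrite conv_one by assumption. rewrite In2; ring. }
  (* Spatial coordinates move by at most [s] and time by at most [s ^ 2 <= s * T]. *)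
  assert (Hd : forall d, Rabs (crd d w - crd d z) <= s * (1 + T)).
  { apply past_crd with s; [nra|nra|assumption]. }
  unfold conv. rewrite <- Int4_minus by (apply Cc_mult_r; [apply cont4_psub_r, Smooth_cont4, PhiT_Smooth; assumption|assumption]).
  assert (Cd : Cc (fun w0 => PhiT Phi (T / 2) (psub w w0) * PsiN Phi (T / 2) n w0 -
                 PhiT Phi (T / 2) (psub z w0) * PsiN Phi (T / 2) n w0)).
  { apply (Cc_mult_r (fun w0 => PhiT Phi (T / 2) (psub w w0) - PhiT Phi (T / 2) (psub z w0)) (PsiN Phi (T / 2) n)) in Cn2.
    - replace (fun w0 => _ - _) with (fun z0 : pt => (PhiT Phi (T / 2) (psub w z0) - PhiT Phi (T / 2) (psub z z0)) * PsiN Phi (T / 2) n z0)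
        by (extensionality y; ring). assumption.
    - apply cont4_minus; apply cont4_psub_r, Smooth_cont4, PhiT_Smooth; assumption. }
  assert (Ce : Cc (fun w0 => L * (s * (1 + T)) * PsiN Phi (T / 2) n w0))
    by (apply (Cc_mult_r (fun _ => L * (s * (1 + T)))); [apply cont4_const|assumption]).
  assert (Bd : forall y, Rabs (PhiT Phi (T / 2) (psub w y) * PsiN Phi (T / 2) n y -
                 PhiT Phi (T / 2) (psub z y) * PsiN Phi (T / 2) n y) <= L * (s * (1 + T)) * PsiN Phi (T / 2) n y).
  { intros y. rewrite <- Rmult_minus_distr_r, Rabs_mult, (Rabs_pos_eq (PsiN _ _ _ _)) by auto.
    apply Rmult_le_compat_r; [auto|]. apply Hlip. intros d. rewrite !crd_psub.
    replace (_ - _) with (crd d w - crd d z) by ring. apply Hd. }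
  apply Rabs_le_between. split.
  - pose proof (Int4_le _ _ (Cc_lin (-1) 0 _ _ Ce Ce) Cd) as X.
    rewrite Int4_lin in X by assumption. rewrite Rmult_0_l, Rplus_0_r in X.
    match goal with |- - ?a <= _ => replace (- a) with (-1 * a) by ring end. apply X.
    intros y. specialize (Bd y). apply Rabs_le_between in Bd. lra.
  - apply Int4_le; [assumption|assumption|]. intros y. specialize (Bd y). apply Rabs_le_between in Bd. lra.
Qed.

Lemma Psi_unif (T : R) : 0 < T -> exists c, 0 <= c /\
  forall n z, Rabs (PsiN Phi T (S n) z - Psi Phi T z) <= c / 2 ^ n.
Proof.
  intros HT. destruct (PsiN_cauchy T HT) as [c [Hc H]]. exists (2 * c); split; [lra|].
  intros n z. destruct (geometric_cv (fun n => PsiN Phi T (S n) z) c Hc (fun n => H n z)) as [l [Hl Hb]].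
  replace (Psi Phi T z) with l; [apply Hb|]. symmetry. apply epsilon_unique.
  - intros e He. destruct (Hl e He) as [N HN]. exists (S N). intros m Hm.
    destruct m; [lia|]. apply HN. lia.
  - intros l' Hl'. apply (UL_sequence (fun n => PsiN Phi T (S n) z)); [|assumption].
    intros e He. destruct (Hl' e He) as [N HN]. exists N. intros m Hm. apply HN. lia.
Qed.

Lemma small_pow2 (c e : R) : 0 <= c -> 0 < e -> exists n, c / 2 ^ n < e.
Proof.
  intros Hc He. destruct (Pow_x_infinity 2 ltac:(rewrite Rabs_pos_eq; lra) (c / e + 1)) as [N HN].
  exists N. specialize (HN N (Nat.le_refl N)). pose proof (pow2_pos N).
  rewrite Rabs_pos_eq in HN by lra. apply Rlt_div_l; [assumption|].
  apply Rlt_le_trans with (e * (c / e + 1)).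
  - replace (e * (c / e + 1)) with (c + e) by (field; lra). lra.
  - apply Rmult_le_compat_l; lra.
Qed.

Lemma Rle_pow2 (a b c : R) : 0 <= c -> (forall n : nat, a <= b + c / 2 ^ n) -> a <= b.
Proof.
  intros Hc H. apply Rnot_lt_le; intros Hlt.
  destruct (small_pow2 c (a - b) Hc ltac:(lra)) as [n Hn]. specialize (H n). lra.
Qed.

Lemma Psi_psupp (T : R) : 0 < T -> psupp T (Psi Phi T).
Proof.
  intros HT z Hz. destruct (Psi_unif T HT) as [c [Hc H]].
  apply NNPP; intros Hn. apply Hz. apply Rabs_eq_0. apply Rle_antisym; [|apply Rabs_pos].
  apply Rle_pow2 with c; [assumption|]. intros n. rewrite Rplus_0_l.
  specialize (H n z). replace (PsiN Phi T (S n) z) with 0 in H.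
  - rewrite Rminus_0_l, Rabs_Ropp in H. assumption.
  - symmetry. apply NNPP; intros Hp. apply Hn. apply past_le with (T * (1 - / 2 ^ S (S n))).
    + assert (0 < / 2 ^ S (S n) <= 1).
      { split; [apply Rinv_0_lt_compat, pow2_pos|]. rewrite <- Rinv_1.
        apply Rinv_le_contravar; [lra|]. apply pow_R1_Rle; lra. }
      nra.
    + apply (proj2 (PsiN_ok T (S n) HT)); assumption.
Qed.

Lemma Psi_prob (T : R) : 0 < T -> prob (Psi Phi T).
Proof.
  intros HT. destruct (Psi_unif T HT) as [c [Hc H]].
  assert (C : cont4 (Psi Phi T)).
  { apply UC_cont4. intros e He. destruct (small_pow2 c (e / 3) Hc ltac:(lra)) as [n Hn].
    destruct (PsiN_ok T (S n) HT) as [[Cn _] _].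
    destruct (Cc_UC _ Cn (e / 3) ltac:(lra)) as [r [Hr Hw]]. exists r; split; [assumption|].
    intros z w N. specialize (Hw z w N). pose proof (H n z) as H1. pose proof (H n w) as H2.
    apply Rabs_le_between in H1. apply Rabs_le_between in H2. apply Rabs_le_between in Hw.
    apply Rabs_le_between. lra. }
  assert (CC : Cc (Psi Phi T)) by (apply psupp_Cc with T; [lra|assumption|apply Psi_psupp; assumption]).
  split; [assumption|split].
  - intros z. apply Rle_pow2 with c; [assumption|]. intros n. specialize (H n z).
    destruct (PsiN_ok T (S n) HT) as [[_ [Pn _]] _]. specialize (Pn z).
    apply Rabs_le_between in H. lra.
  - set (M := T + T ^ 2). assert (HM : 0 <= M) by (unfold M; nra).
    assert (Sup : forall k, psupp T k -> supp_in M k).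
    { intros k Hk z Hz. apply NNPP; intros Hn. apply Hz. destruct (Hk z Hn) as [H0 [H1 [H2 H3]]].
      unfold origin in *; simpl in *. rewrite !Rminus_0_r in *. unfold M. intros []; simpl; try nra.
      rewrite Rabs_pos_eq; nra. }
    apply Rminus_diag_uniq. apply Rabs_eq_0. apply Rle_antisym; [|apply Rabs_pos].
    apply Rle_pow2 with (c * (2 * M) ^ 4); [apply Rmult_le_pos; [assumption|apply pow_le; lra]|].
    intros n. rewrite Rplus_0_l. destruct (PsiN_ok T (S n) HT) as [[Cn [_ In]] Sn].
    rewrite <- In. replace (c * (2 * M) ^ 4 / 2 ^ n) with (c / 2 ^ n * (2 * M) ^ 4) by (unfold Rdiv; ring).
    apply Int4_diff; [assumption|assumption|apply Cn| | |].
    + apply Sup, Psi_psupp; assumption.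
    + apply Sup. intros z Hz. apply past_le with (T * (1 - / 2 ^ S (S n))); [|apply Sn; assumption].
      assert (0 < / 2 ^ S (S n) <= 1).
      { split; [apply Rinv_0_lt_compat, pow2_pos|]. rewrite <- Rinv_1.
        apply Rinv_le_contravar; [lra|]. apply pow_R1_Rle; lra. }
      nra.
    + intros z. rewrite Rabs_minus_sym. apply H.
Qed.

(** Passage to the limit in [PsiN_left]: averaging with [PhiT Phi (T / 2)] does not increase the
    uniform error of the inner approximation. *)
Lemma Psi_rec (T : R) (z : pt) : 0 < T ->
  Psi Phi T z = conv (PhiT Phi (T / 2)) (Psi Phi (T / 2)) z.
Proof.
  intros HT. assert (HT2 : 0 < T / 2) by lra.
  destruct (Psi_unif T HT) as [c [Hc H]]. destruct (Psi_unif (T / 2) HT2) as [c' [Hc' H']].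
  apply Rminus_diag_uniq. apply Rabs_eq_0. apply Rle_antisym; [|apply Rabs_pos].
  apply Rle_pow2 with (c + c'); [lra|]. intros n. rewrite Rplus_0_l.
  specialize (H (S n) z). rewrite PsiN_left in H by assumption.
  pose proof (PhiT_prob (T / 2) HT2) as P. pose proof (Psi_prob (T / 2) HT2) as Q.
  destruct (PsiN_ok (T / 2) (S n) HT2) as [[Cn _] _].
  assert (X : Rabs (conv (PhiT Phi (T / 2)) (fun w => PsiN Phi (T / 2) (S n) w - Psi Phi (T / 2) w) z - 0) <= c' / 2 ^ n).
  { apply conv_prob_le with (T / 2); [assumption|apply PhiT_psupp; assumption| |].
    - apply cont4_minus; [apply Cn|apply Q].
    - intros w _. rewrite Rminus_0_r. apply H'. }
  rewrite Rminus_0_r, conv_minus_r in X by (first [apply P|apply Cn|apply Q]).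
  assert (E : c / 2 ^ S n <= c / 2 ^ n).
  { unfold Rdiv. apply Rmult_le_compat_l; [assumption|]. apply Rinv_le_contravar; [apply pow2_pos|].
    simpl. pose proof (pow2_pos n). lra. }
  replace ((c + c') / 2 ^ n) with (c / 2 ^ n + c' / 2 ^ n) by (unfold Rdiv; ring).
  apply Rabs_le_between in X. apply Rabs_le_between in H. apply Rabs_le_between. lra.
Qed.

Lemma moll_cont4 (T : R) (f : pt -> R) : 0 < T -> cont4 f -> cont4 (moll Phi T f).
Proof. intros HT Hf. apply (conv_cont (Psi Phi T) f); [apply Psi_prob|]; assumption. Qed.

Lemma moll_rec (T : R) (f : pt -> R) (z : pt) : 0 < T -> cont4 f ->
  moll Phi T f z = conv (PhiT Phi (T / 2)) (moll Phi (T / 2) f) z.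
Proof.
  intros HT Hf. change (moll Phi T f z) with (conv (Psi Phi T) f z).
  change (moll Phi (T / 2) f) with (conv (Psi Phi (T / 2)) f).
  rewrite conv_assoc by (try assumption; first [apply PhiT_prob; lra|apply Psi_prob; lra]).
  f_equal. extensionality w. apply Psi_rec; assumption.
Qed.

Lemma moll_le (T c e : R) (f : pt -> R) (z : pt) : 0 < T -> cont4 f ->
  (forall w, past T z w -> Rabs (f w - c) <= e) -> Rabs (moll Phi T f z - c) <= e.
Proof.
  intros HT Hf H. apply (conv_prob_le (Psi Phi T) f T);
    [apply Psi_prob|apply Psi_psupp| |]; assumption.
Qed.

Lemma moll_cv (f : pt -> R) (M e : R) : cont4 f -> 0 < e -> exists T0, 0 < T0 /\
  forall T, 0 < T <= T0 -> forall z, inbox M z -> Rabs (moll Phi T f z - f z) <= e.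
Proof.
  intros Hf He. destruct (cont4_unif_box f M e Hf He) as [r [Hr Hu]].
  exists (Rmin 1 (r / 2)); split; [apply Rmin_pos; lra|]. intros T HT z Hz.
  pose proof (Rmin_l 1 (r / 2)). pose proof (Rmin_r 1 (r / 2)).
  apply moll_le; [lra|assumption|]. intros w Hw. apply Hu; [assumption|].
  intros d. apply Rle_lt_trans with (r / 2); [|lra]. apply (past_crd T); [lra|nra|assumption].
Qed.

End Kernel.

(** * Eighth roots and geometric sums *)

(** The power [root8 x ^ k] is [x^(k/8)]. With natural exponents, all comparisons of powers become
    polynomial identities for [ring] and [field]. *)
Definition root8 (x : R) : R := sqrt (sqrt (sqrt x)).

Lemma root8_ge0 (x : R) : 0 <= root8 x.
Proof. apply sqrt_pos. Qed.

Lemma root8_pos (x : R) : 0 < x -> 0 < root8 x.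
Proof. intros. repeat apply sqrt_lt_R0. assumption. Qed.

Lemma root8_pow (x : R) : 0 <= x -> root8 x ^ 8 = x.
Proof.
  intros H. unfold root8. replace 8%nat with (2 * (2 * 2))%nat by reflexivity.
  rewrite !pow_mult. rewrite pow2_sqrt by apply sqrt_pos. rewrite pow2_sqrt by apply sqrt_pos.
  apply pow2_sqrt; assumption.
Qed.

Lemma root8_le (x y : R) : x <= y -> root8 x <= root8 y.
Proof. intros. repeat apply sqrt_le_1_alt. assumption. Qed.

Lemma root8_mult (x y : R) : 0 <= x -> root8 (x * y) = root8 x * root8 y.
Proof.
  intros H. unfold root8. rewrite sqrt_mult_alt by assumption.
  rewrite sqrt_mult_alt by apply sqrt_pos. apply sqrt_mult_alt, sqrt_pos.
Qed.

Lemma root8_1 : root8 1 = 1.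
Proof. unfold root8. rewrite !sqrt_1. reflexivity. Qed.

Lemma root8_le1 (x : R) : x <= 1 -> root8 x <= 1.
Proof. intros. rewrite <- root8_1. apply root8_le; assumption. Qed.

Lemma pow_lt_mono (a b : R) (n : nat) : 0 <= a -> a < b -> (0 < n)%nat -> a ^ n < b ^ n.
Proof.
  intros Ha Hab Hn. destruct n; [lia|]. clear Hn. induction n.
  - simpl; lra.
  - change (a * a ^ S n < b * b ^ S n). apply Rmult_le_0_lt_compat; try assumption. apply pow_le; assumption.
Qed.

(** The upper bound, which holds since [(11/10)^8 > 2], makes [2^(9/8) / 4] at most 11/20: the ratio
    of the geometric series in [kernel_swap]. *)
Lemma root8_2 : 1 < root8 2 <= 11 / 10.
Proof.
  split.
  - rewrite <- root8_1. unfold root8.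
    apply sqrt_lt_1_alt; split; [apply sqrt_pos|]. apply sqrt_lt_1_alt; split; [apply sqrt_pos|].
    apply sqrt_lt_1_alt; lra.
  - apply Rnot_lt_le; intros H.
    pose proof (pow_lt_mono (11 / 10) (root8 2) 8 ltac:(lra) H ltac:(lia)) as X.
    rewrite root8_pow in X by lra. lra.
Qed.

Lemma root8_half (x : R) (n : nat) : 0 <= x -> root8 (x / 2 ^ n) = root8 x / root8 2 ^ n.
Proof.
  intros Hx. pose proof root8_2. induction n.
  - simpl. unfold Rdiv. rewrite Rinv_1, !Rmult_1_r. reflexivity.
  - assert (E : root8 2 * root8 (x / 2 ^ S n) = root8 (x / 2 ^ n)).
    { rewrite <- root8_mult by lra. f_equal. simpl. field. apply pow_nonzero; lra. }
    rewrite IHn in E. apply Rmult_eq_reg_l with (root8 2); [|lra]. rewrite E. simpl. field.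
    split; [apply pow_nonzero|]; lra.
Qed.

Lemma geom_sum_bound (a : nat -> R) (c rho : R) (n : nat) : 0 <= c -> 0 <= rho < 1 ->
  (forall k, (k < n)%nat -> Rabs (a (S k) - a k) <= c * rho ^ k) -> Rabs (a n - a 0%nat) <= c / (1 - rho).
Proof.
  intros Hc Hr H.
  assert (X : Rabs (a n - a 0%nat) <= c / (1 - rho) * (1 - rho ^ n)).
  { induction n.
    - simpl. rewrite !Rminus_diag, Rabs_R0; lra.
    - specialize (H n (Nat.lt_succ_diag_r n)) as Hn.
      assert (IH : Rabs (a n - a 0%nat) <= c / (1 - rho) * (1 - rho ^ n)) by (apply IHn; intros; apply H; lia).
      replace (a (S n) - a 0%nat) with ((a (S n) - a n) + (a n - a 0%nat)) by ring.
      eapply Rle_trans; [apply Rabs_triang|].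
      replace (c / (1 - rho) * (1 - rho ^ S n)) with (c * rho ^ n + c / (1 - rho) * (1 - rho ^ n))
        by (simpl; field; lra). lra. }
  eapply Rle_trans; [exact X|]. assert (0 <= rho ^ n) by (apply pow_le; lra).
  assert (0 <= c / (1 - rho)) by (apply Rle_div_r; lra). nra.
Qed.

(** * Testing against arbitrary kernels *)

(** The past ball has volume [r^2 (2r)^3 = 8 r^5]. *)
Lemma conv_bound (k g : pt -> R) (r A G : R) (z : pt) : 0 <= r -> cont4 k -> psupp r k -> cont4 g ->
  (forall w, Rabs (k w) <= A) -> (forall w, past r z w -> Rabs (g w) <= G) ->
  Rabs (conv k g z) <= 8 * A * G * r ^ 5.
Proof.
  intros Hr Hk Hs Hg HA HG.
  assert (A0 : 0 <= A) by (eapply Rle_trans; [apply Rabs_pos|apply (HA origin)]).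
  assert (G0 : 0 <= G) by (eapply Rle_trans; [apply Rabs_pos|apply (HG z), past_refl; assumption]).
  replace (8 * A * G * r ^ 5) with (A * G * (2 * (r ^ 2 / 2)) * (2 * r) * (2 * r) * (2 * r)) by field.
  assert (0 <= r ^ 2) by apply pow2_ge_0.
  apply (Int4_bound_box _ (A * G) (mkpt (pt_t z - r ^ 2 / 2) (pt_x1 z) (pt_x2 z) (pt_x3 z))
    (mkpt (r ^ 2 / 2) r r r)).
  - apply cont4_mult; [apply cont4_psub_r|]; assumption.
  - apply Rmult_le_pos; assumption.
  - intros []; cbn [crd pt_t pt_x1 pt_x2 pt_x3]; lra.
  - intros w. destruct (Req_dec (k (psub z w)) 0) as [E|E].
    + rewrite E, Rmult_0_l, Rabs_R0. apply Rmult_le_pos; assumption.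
    + rewrite Rabs_mult. apply Rmult_le_compat; try apply Rabs_pos; [apply HA|].
      apply HG, past_psub, Hs; assumption.
  - intros w d Hd. destruct (Req_dec (k (psub z w)) 0) as [E|E]; [rewrite E; ring|].
    exfalso. apply Hs in E. apply (proj1 (past_psub _ _ _)) in E. destruct E as [E0 [E1 [E2 E3]]].
    rewrite Rabs_minus_sym in Hd.
    destruct d; cbn [crd pt_t pt_x1 pt_x2 pt_x3] in Hd; try lra.
    apply Rlt_not_le in Hd; apply Hd. apply Rabs_le_between. lra.
Qed.

(** * Pairing rough functions with smooth kernels *)

Definition xrefl (h : pt) : pt := mkpt (pt_t h) (- pt_x1 h) (- pt_x2 h) (- pt_x3 h).

(** Only space is reflected, time moves the same way in both terms: gradients cancel, and a time
    displacement of size [r^2] is already quadratic. The factor 2 disappears when the two copies of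
    the convolution are averaged. *)
Definition sdiff_bound (kap : pt -> R) (A T : R) : Prop :=
  forall z h r, 0 <= r -> past r h origin ->
    Rabs (kap (psub z h) + kap (psub z (xrefl h)) - 2 * kap z) <= 2 * A * (r / T) ^ 2.

(** Since [Phi] is even in space, the convolution equals its reflected copy. The mean of the two,
    minus [kap z], is half the average of the symmetric second difference. *)
Lemma conv_PhiT_sdiff (Phi : pt -> R) (kap : pt -> R) (A T s : R) (z : pt) : kernel_ok Phi ->
  0 < s -> 0 < T -> Cc kap -> sdiff_bound kap A T ->
  Rabs (kap z - conv kap (PhiT Phi s) z) <= A * (s / T) ^ 2.
Proof.
  intros Hok Hs HT Hk Hd.
  destruct (PhiT_prob Phi Hok s Hs) as [CP [PP IP]].
  set (F := PhiT Phi s) in *.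
  assert (C1 : Cc (fun w => kap (psub z w) * F w)) by (apply Cc_conv_integrand; [assumption|apply CP]).
  assert (Cx : forall c, Cc (fun w => c * F w)) by (intros c; apply (Cc_mult_r (fun _ => c)); [apply cont4_const|assumption]).
  assert (E2 : conv kap F z = Int4 (fun w => kap (psub z (xrefl w)) * F w)).
  { set (q := fun w => kap (psub z (xrefl w)) * F w).
    assert (X : xrefl = aff origin (mkpt 1 (-1) (-1) (-1)))
      by (extensionality w; apply pt_ext; intros []; simpl; ring).
    unfold conv. replace (fun w => kap (psub z w) * F w) with (fun w => q (aff origin (mkpt 1 (-1) (-1) (-1)) w)).
    - rewrite Int4_aff.
      + simpl. rewrite Rabs_R1, (Rabs_left (-1)) by lra. field.
      + intros []; simpl; lra.
      + unfold q. apply Cc_mult_r; [|assumption]. rewrite X.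
        apply (cont4_ext (fun w => kap (aff z (mkpt (-1) 1 1 1) w))).
        * intros w. f_equal. apply pt_ext; intros []; simpl; ring.
        * apply cont4_aff, Hk.
    - extensionality w. rewrite <- X. unfold q.
      replace (xrefl (xrefl w)) with w by (apply pt_ext; intros []; simpl; ring).
      f_equal. unfold F. destruct w. apply (PhiT_sym Phi Hok); assumption. }
  assert (C2 : Cc (fun w => kap (psub z (xrefl w)) * F w)).
  { apply Cc_mult_r; [|assumption]. apply (cont4_ext (fun w => kap (aff z (mkpt (-1) 1 1 1) w))).
    - intros w. f_equal. apply pt_ext; intros []; simpl; ring.
    - apply cont4_aff, Hk. }
  assert (E : 2 * (conv kap F z - kap z) =
    Int4 (fun w => (kap (psub z w) * F w + kap (psub z (xrefl w)) * F w) - 2 * kap z * F w)).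
  { rewrite Int4_minus.
    - rewrite Int4_plus, Int4_scal, IP by assumption. rewrite <- E2. unfold conv. ring.
    - replace (fun w => _ + _) with (fun w => 1 * (kap (psub z w) * F w) + 1 * (kap (psub z (xrefl w)) * F w))
        by (extensionality w; ring). apply Cc_lin; assumption.
    - apply Cx. }
  assert (C12 : Cc (fun w => (kap (psub z w) * F w + kap (psub z (xrefl w)) * F w) - 2 * kap z * F w)).
  { replace (fun w => _ - _) with (fun w => 1 * (1 * (kap (psub z w) * F w) + 1 * (kap (psub z (xrefl w)) * F w)) + (-1) * (2 * kap z * F w))
      by (extensionality w; ring).
    apply Cc_lin; [apply Cc_lin; assumption|apply Cx]. }
  assert (B : forall w, Rabs ((kap (psub z w) * F w + kap (psub z (xrefl w)) * F w) - 2 * kap z * F w)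
     <= 2 * A * (s / T) ^ 2 * F w).
  { intros w. replace (_ - _) with ((kap (psub z w) + kap (psub z (xrefl w)) - 2 * kap z) * F w) by ring.
    rewrite Rabs_mult, (Rabs_pos_eq (F w)) by apply PP.
    destruct (Req_dec (F w) 0) as [E0|E0]; [rewrite E0; lra|].
    apply Rmult_le_compat_r; [apply PP|]. apply Hd; [lra|]. apply (PhiT_psupp Phi Hok s Hs); assumption. }
  assert (R1 : Int4 (fun w => (kap (psub z w) * F w + kap (psub z (xrefl w)) * F w) - 2 * kap z * F w)
    <= 2 * A * (s / T) ^ 2).
  { rewrite <- (Rmult_1_r (2 * A * (s / T) ^ 2)), <- IP, <- Int4_scal by assumption.
    apply Int4_le; [assumption|apply Cx|]. intros w. specialize (B w). apply Rabs_le_between in B. lra. }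
  assert (R2 : - (2 * A * (s / T) ^ 2) <= Int4 (fun w => (kap (psub z w) * F w + kap (psub z (xrefl w)) * F w) - 2 * kap z * F w)).
  { rewrite <- (Rmult_1_r (- (2 * A * (s / T) ^ 2))), <- IP, <- Int4_scal by assumption.
    apply Int4_le; [apply Cx|assumption|]. intros w. specialize (B w). apply Rabs_le_between in B. lra. }
  rewrite <- E in R1, R2. apply Rabs_le_between. lra.
Qed.

(* Bounds on [(f)_s] for all small [s] control the pairing of [f] with any
   twice differentiable kernel: [(f)_{s/2} - (f)_s] is the increment
   [(f)_{s/2} - Phi_{s/2} * (f)_{s/2}], and moving [Phi_{s/2}] onto the kernel
   gains [s^2] by spatial symmetry, which beats the loss [s^{-9/8}]. *)
Lemma kernel_swap (Phi kap f : pt -> R) (a A T H : R) (z : pt) : kernel_ok Phi ->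
  0 < T -> 1 <= a -> Cc kap -> psupp (a * T) kap -> (forall w, Rabs (kap w) <= A) ->
  sdiff_bound kap A T -> cont4 f ->
  (forall s w, 0 < s <= T -> past ((a + 1) * T) z w -> Rabs (moll Phi s f w) <= H / root8 s ^ 9) ->
  Rabs (conv kap f z) <= 24 * A * ((a + 1) * T) ^ 5 * (H / root8 T ^ 9).
Proof.
  intros Hok HT Ha Hk Hs HA Hd Hf HH.
  assert (A0 : 0 <= A) by (eapply Rle_trans; [apply Rabs_pos|apply (HA origin)]).
  assert (aT : 0 <= a * T) by nra. assert (aT1 : 0 <= (a + 1) * T) by nra.
  set (G := H / root8 T ^ 9).
  assert (G0 : 0 <= G).
  { eapply Rle_trans; [apply Rabs_pos|]. apply (HH T z); [lra|]. apply past_refl; assumption. }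
  pose proof root8_2 as Q2. pose proof (root8_pos T HT) as QT.
  set (b := fun n => conv kap (moll Phi (T / 2 ^ n) f) z).
  assert (Tn : forall n, 0 < T / 2 ^ n) by (intros; apply Rdiv_lt_0_compat; [assumption|apply pow2_pos]).
  assert (TnT : forall n, T / 2 ^ n <= T).
  { intros n. apply Rle_div_l; [apply pow2_pos|]. assert (1 <= 2 ^ n) by (apply pow_R1_Rle; lra). nra. }
  assert (Hg : forall n w, past ((a + 1) * T) z w -> Rabs (moll Phi (T / 2 ^ n) f w) <= G * (root8 2 ^ 9) ^ n).
  { intros n w Hw. eapply Rle_trans; [apply HH; [split; [apply Tn|apply TnT]|assumption]|].
    rewrite root8_half by lra. right. unfold G.
    rewrite <- !pow_mult. replace (9 * n)%nat with (n * 9)%nat by lia. rewrite pow_mult. field.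
    repeat split; repeat apply pow_nonzero; lra. }
  assert (S0 : Rabs (b 0%nat) <= 8 * A * G * ((a + 1) * T) ^ 5).
  { unfold b. apply conv_bound.
    - assumption.
    - apply Hk.
    - intros w Hw. apply past_le with (a * T); [nra|]. apply Hs; assumption.
    - apply moll_cont4; [assumption|apply Tn|assumption].
    - assumption.
    - intros w Hw. rewrite <- (Rmult_1_r G). exact (Hg 0%nat w Hw). }
  assert (B0 : 0 <= 8 * A * G * ((a + 1) * T) ^ 5).
  { apply Rmult_le_pos; [|apply pow_le; assumption]. apply Rmult_le_pos; [lra|exact G0]. }
  (* Halving the scale costs a factor [2^(9/8)] in the bound on the mollified function and gains 1/4
     from the kernel; the product is [root8 2 / 2 <= 11/20]. *)
  assert (Inc : forall n, Rabs (b (S n) - b n) <= (8 * A * G * ((a + 1) * T) ^ 5 * (11 / 20)) * (11 / 20) ^ n).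
  { intros n. set (s := T / 2 ^ S n).
    assert (Hs0 : 0 < s) by apply Tn.
    destruct (PhiT_prob Phi Hok s Hs0) as [CP _].
    assert (E : b (S n) - b n = conv (fun w => kap w - conv kap (PhiT Phi s) w) (moll Phi s f) z).
    { rewrite conv_minus_l; [|assumption|apply conv_Cc; assumption|apply moll_cont4; assumption].
      rewrite <- conv_assoc; [|assumption|assumption|apply moll_cont4; assumption].
      unfold b. fold s. f_equal. f_equal. f_equal. extensionality w.
      rewrite moll_rec by (try assumption; apply Tn).
      replace (T / 2 ^ n / 2) with s; [reflexivity|]. unfold s. simpl. field. apply pow_nonzero; lra. }
    rewrite E.
    apply Rle_trans with (8 * (A * (s / T) ^ 2) * (G * (root8 2 ^ 9) ^ S n) * ((a + 1) * T) ^ 5).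
    - apply conv_bound.
      + assumption.
      + apply cont4_minus; [apply Hk|apply conv_Cc; assumption].
      + intros w Hw. destruct (Req_dec (kap w) 0) as [E0|E0].
        * apply past_le with (a * T + s); [specialize (TnT (S n)); fold s in TnT; nra|].
          apply (psupp_conv (a * T) s kap (PhiT Phi s)); [assumption|lra|assumption|apply PhiT_psupp; assumption|].
          intros E1. apply Hw. rewrite E0, E1; ring.
        * apply past_le with (a * T); [nra|]. apply Hs; assumption.
      + apply moll_cont4; assumption.
      + intros w. apply conv_PhiT_sdiff; assumption.
      + intros w Hw. apply Hg; assumption.
    - assert (E2 : (s / T) ^ 2 * (root8 2 ^ 9) ^ S n <= (11 / 20) ^ S n).
      { replace (s / T) with (/ 2 ^ S n) by (unfold s; field; split; first [lra|apply pow_nonzero; lra]).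
        rewrite pow_inv, <- pow_mult, Nat.mul_comm, pow_mult.
        replace (/ (2 ^ 2) ^ S n) with ((/ 4) ^ S n) by (rewrite pow_inv; f_equal; f_equal; ring).
        rewrite <- Rpow_mult_distr. apply pow_incr.
        assert (X9 : root8 2 ^ 9 = 2 * root8 2) by (change (root8 2 ^ 9) with (root8 2 * root8 2 ^ 8); rewrite root8_pow by lra; ring).
        rewrite X9. lra. }
      replace (8 * (A * (s / T) ^ 2) * (G * (root8 2 ^ 9) ^ S n) * ((a + 1) * T) ^ 5)
        with ((8 * A * G * ((a + 1) * T) ^ 5) * ((s / T) ^ 2 * (root8 2 ^ 9) ^ S n)) by ring.
      replace (8 * A * G * ((a + 1) * T) ^ 5 * (11 / 20) * (11 / 20) ^ n)
        with ((8 * A * G * ((a + 1) * T) ^ 5) * (11 / 20) ^ S n) by (simpl; ring).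
      apply Rmult_le_compat_l; assumption. }
  (* The first term and the whole series together give [8 (1 + 11/9)], which is below 20. *)
  assert (Bn : forall n, Rabs (b n) <= 20 * A * G * ((a + 1) * T) ^ 5).
  { intros n. pose proof (geom_sum_bound b (8 * A * G * ((a + 1) * T) ^ 5 * (11 / 20)) (11 / 20) n ltac:(lra) ltac:(lra) (fun k _ => Inc k)) as X.
    apply Rabs_le_between in X. apply Rabs_le_between in S0. apply Rabs_le_between.
    replace (8 * A * G * ((a + 1) * T) ^ 5 * (11 / 20) / (1 - 11 / 20)) with
      (8 * A * G * ((a + 1) * T) ^ 5 * (11 / 9)) in X by field. lra. }
  (* Since [f] is continuous, its mollifications converge uniformly on the box seen by [kap]; hence
     the uniform bound on [b n] passes to the unmollified pairing. *)
  apply le_epsilon. intros e He.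
  destruct (inbox_ex z) as [N [HN Hz]].
  set (L := N + ((a + 1) * T) + ((a + 1) * T) ^ 2).
  set (V := 8 * A * ((a + 1) * T) ^ 5). assert (V0 : 0 <= V)
    by (unfold V; repeat apply Rmult_le_pos; try assumption; try lra; apply pow_le; assumption).
  destruct (moll_cv Phi Hok f L (e / (V + 1)) Hf) as [T0 [HT0 Hcv]]; [apply Rdiv_lt_0_compat; lra|].
  destruct (small_pow2 T T0 (Rlt_le _ _ HT) HT0) as [n Hn].
  assert (X : Rabs (conv kap (fun w => moll Phi (T / 2 ^ n) f w - f w) z) <= e).
  { apply Rle_trans with (8 * A * (e / (V + 1)) * ((a + 1) * T) ^ 5).
    - apply conv_bound.
      + assumption.
      + apply Hk.
      + intros w Hw. apply past_le with (a * T); [nra|]. apply Hs; assumption.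
      + apply cont4_minus; [apply moll_cont4; [assumption|apply Tn|assumption]|assumption].
      + assumption.
      + intros w Hw. apply Hcv; [specialize (Tn n); lra|]. destruct Hw as [W0 [W1 [W2 W3]]].
        assert (0 <= ((a + 1) * T) ^ 2) by apply pow2_ge_0.
        generalize (Hz Dt) (Hz D1) (Hz D2) (Hz D3). cbn [crd]. intros Z0 Z1 Z2 Z3.
        apply Rabs_le_between in W1. apply Rabs_le_between in W2. apply Rabs_le_between in W3.
        apply Rabs_le_between in Z0. apply Rabs_le_between in Z1. apply Rabs_le_between in Z2.
        apply Rabs_le_between in Z3.
        intros []; cbn [crd]; apply Rabs_le_between; unfold L; lra.
    - replace (8 * A * (e / (V + 1)) * ((a + 1) * T) ^ 5) with (V * (e / (V + 1))) by (unfold V; ring).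
      apply Rle_trans with ((V + 1) * (e / (V + 1))); [|right; field; lra].
      apply Rmult_le_compat_r; [apply Rlt_le, Rdiv_lt_0_compat; lra|lra]. }
  rewrite conv_minus_r in X; [|assumption|apply moll_cont4; [assumption|apply Tn|assumption]|assumption].
  specialize (Bn n). unfold b in Bn. apply Rabs_le_between in X. apply Rabs_le_between in Bn.
  apply Rabs_le_between. fold G. lra.
Qed.

(** * A truncated heat kernel *)

(** A copy of [Phi] dilated into the neighbourhood of [z0] where [h] exceeds half of [h z0] serves
    as a minorant with known positive integral. *)
Lemma Int4_pos (Phi h : pt -> R) (z0 : pt) : kernel_ok Phi -> Cc h -> (forall z, 0 <= h z) ->
  0 < h z0 -> 0 < Int4 h.
Proof.
  intros Hok Hh Hp H0. pose proof (Cc_UC h Hh) as U.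
  destruct (U (h z0 / 2)) as [r [Hr Hw]]; [lra|].
  set (m := mkpt (2 / r) (2 / r) (2 / r) (2 / r)).
  set (p := mkpt (- (2 / r) * pt_t z0) (- (2 / r) * pt_x1 z0) (- (2 / r) * pt_x2 z0) (- (2 / r) * pt_x3 z0)).
  assert (H2r : 0 < 2 / r) by (apply Rdiv_lt_0_compat; lra).
  assert (Hm : forall d, crd d m <> 0) by (intros []; simpl; lra).
  destruct (Cc_aff Phi p m Hm (Phi_Cc Phi Hok)) as [C _].
  apply Rlt_le_trans with (Int4 (fun z => h z0 / 2 * Phi (aff p m z))).
  - rewrite (Int4_scal (h z0 / 2) (fun z => Phi (aff p m z)) C), (Int4_aff Phi p m Hm (Phi_Cc Phi Hok)).
    destruct Hok as [_ [_ [I _]]]. rewrite I. unfold m; simpl. rewrite Rabs_pos_eq by lra.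
    apply Rmult_lt_0_compat; [lra|]. rewrite Rmult_1_r. apply Rinv_0_lt_compat.
    repeat apply Rmult_lt_0_compat; lra.
  - apply Int4_le; [apply (Cc_mult_r (fun _ => h z0 / 2)); [apply cont4_const|assumption]|assumption|].
    intros z. destruct Hok as [_ [B [_ [_ Sp]]]]. specialize (B (aff p m z)).
    destruct (Req_dec (Phi (aff p m z)) 0) as [E|E]; [rewrite E, Rmult_0_r; apply Hp|].
    apply Rle_trans with (h z0 / 2 * 1); [apply Rmult_le_compat_l; lra|].
    assert (N : near r z0 z).
    { destruct (Sp _ E) as [T0 X]. apply xnorm_crd_lt in X. simpl in T0, X.
      assert (Y : forall a b, Rabs (- (2 / r) * b + 2 / r * a) < 1 -> Rabs (a - b) < r).
      { intros a b Hab. replace (- (2 / r) * b + 2 / r * a) with (2 / r * (a - b)) in Hab by ring.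
        rewrite Rabs_mult, (Rabs_pos_eq (2 / r)) in Hab by lra.
        apply Rmult_lt_compat_l with (r := r / 2) in Hab; [|lra].
        replace (r / 2 * (2 / r * Rabs (a - b))) with (Rabs (a - b)) in Hab by (field; lra). lra. }
      intros []; simpl; apply Y; try apply X. apply Rabs_lt_between; lra. }
    specialize (Hw z0 z N). apply Rabs_le_between in Hw. lra.
Qed.

(** The kernel [Phi] itself supplies the smooth bump: a slice through a point [z0] where it is
    positive, integrated and normalised, gives the cutoff. The whole family of derivatives [S k] is
    kept, since the class used for smoothness needs them all. *)
Lemma cutoff_exists (Phi : pt -> R) : kernel_ok Phi ->
  exists S : nat -> R -> R, (forall k x, is_derive (S k) x (S (k + 1)%nat x)) /\
    (forall x, x <= 3 / 8 -> S 0%nat x = 1) /\ (forall x, 7 / 8 <= x -> S 0%nat x = 0) /\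
    (forall x, S 1%nat x <= 0) /\ S 1%nat (5 / 8) < 0.
Proof.
  intros Hok.
  assert (X : exists z0, 0 < Phi z0).
  { apply NNPP; intros Hn. destruct Hok as [_ [B [I _]]]. rewrite Int4_ext0 in I; [lra|].
    intros z. apply NNPP; intros Hz. apply Hn. exists z. specialize (B z). lra. }
  destruct X as [z0 Hz0]. pose proof Hok as Hok'. destruct Hok' as [HS [HB [_ [_ Sp]]]].
  set (g := fun k s => pdl (repeat D1 k) Phi (shift z0 D1 s)).
  assert (Hg : forall k s, is_derive (g k) s (g (k + 1)%nat s)).
  { intros k s. rewrite Nat.add_1_r. apply (hasD_at D1 (pdl (repeat D1 k) Phi) (pdl (repeat D1 (Datatypes.S k)) Phi)).
    intros z. apply HS. }
  (* Two points of the support differ by less than 2 in [x1], so compressing the slice by 8 around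
     5/8 puts it between 3/8 and 7/8. *)
  set (b := fun k q => 8 ^ k * g k (8 * (q - 5 / 8))).
  assert (Hb : forall k q, is_derive (b k) q (b (k + 1)%nat q)).
  { intros k q. unfold b.
    evar_last. { apply (is_derive_scal (fun q => g k (8 * (q - 5 / 8)))).
      apply (is_derive_comp (g k) (fun q => 8 * (q - 5 / 8))); [apply Hg|]. auto_derive; [trivial|reflexivity]. }
    unfold scal; simpl; unfold mult; simpl. rewrite Nat.add_1_r. simpl. ring. }
  assert (Hcont : forall q, continuous (b 0%nat) q)
    by (intros q; apply (ex_derive_continuous (b 0%nat)); eexists; apply Hb).
  assert (Hex : forall x y, ex_RInt (b 0%nat) x y)
    by (intros; apply (ex_RInt_continuous (V := R_CompleteNormedModule)); intros; apply Hcont).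
  assert (b0 : forall q, 0 <= b 0%nat q) by (intros q; unfold b, g; simpl; rewrite Rmult_1_l; apply HB).
  assert (bp : 0 < b 0%nat (5 / 8)).
  { unfold b, g. simpl. rewrite Rmult_1_l. rewrite Rminus_diag, Rmult_0_r. 
    replace (mkpt (pt_t z0) (pt_x1 z0 + 0) (pt_x2 z0) (pt_x3 z0)) with z0; [assumption|].
    apply pt_ext; intros []; simpl; ring. }
  assert (bs : forall q, q <= 3 / 8 \/ 7 / 8 <= q -> b 0%nat q = 0).
  { intros q Hq. unfold b. cut (g 0%nat (8 * (q - 5 / 8)) = 0); [intros ->; ring|].
    apply NNPP; intros Hn. unfold g in Hn; simpl in Hn. destruct (Sp _ Hn) as [_ Y].
    apply xnorm_crd_lt in Y. simpl in Y. destruct (Sp z0 (Rgt_not_eq _ _ Hz0)) as [_ W].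
    apply xnorm_crd_lt in W. destruct Y as [Y _], W as [W _].
    apply Rabs_lt_between in Y. apply Rabs_lt_between in W. lra. }
  set (I := fun q => RInt.RInt (b 0%nat) 0 q).
  assert (HI : forall q, is_derive I q (b 0%nat q)).
  { intros q. apply (is_derive_RInt (b 0%nat) I 0 q); [|apply Hcont].
    apply filter_forall. intros y. apply (RInt_correct (V := R_CompleteNormedModule)), Hex. }
  assert (Imono : forall x y, x <= y -> I x <= I y).
  { intros x y Hxy. assert (E : I x + RInt.RInt (b 0%nat) x y = I y)
      by (apply (RInt_Chasles (V := R_CompleteNormedModule)); apply Hex).
    assert (0 <= RInt.RInt (b 0%nat) x y) by (apply RInt_ge_0; auto). lra. }
  assert (I0 : forall x, x <= 3 / 8 -> I x = 0).
  { intros x Hx. apply RInt_zero_on. intros y Hy. apply bs. left.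
    unfold Rmin, Rmax in Hy. destruct (Rle_dec 0 x); lra. }
  assert (I1 : forall x, 7 / 8 <= x -> I x = I (7 / 8)).
  { intros x Hx. assert (E : I (7 / 8) + RInt.RInt (b 0%nat) (7 / 8) x = I x)
      by (apply (RInt_Chasles (V := R_CompleteNormedModule)); apply Hex).
    rewrite RInt_zero_on in E; [lra|]. intros y. rewrite Rmin_left, Rmax_right by lra.
    intros; apply bs; lra. }
  set (Z := I (7 / 8)).
  (* If the total mass were not positive, monotonicity would make the primitive vanish identically,
     against its positive derivative at 5/8. *)
  assert (HZ : 0 < Z).
  { destruct (Rle_lt_dec Z 0) as [H|H]; [|assumption]. exfalso.
    assert (E : forall x, I x = 0).
    { intros x. destruct (Rle_lt_dec x (3 / 8)); [apply I0; assumption|].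
      destruct (Rle_lt_dec x (7 / 8)) as [Hx|Hx].
      - pose proof (Imono (3 / 8) x ltac:(lra)). pose proof (Imono x (7 / 8) Hx).
        rewrite (I0 (3 / 8)) in H0 by lra. fold Z in H1. lra.
      - rewrite I1 by lra. pose proof (Imono (3 / 8) (7 / 8) ltac:(lra)).
        rewrite (I0 (3 / 8)) in H0 by lra. fold Z in H0 |- *. lra. }
    assert (D : is_derive I (5 / 8) 0).
    { apply (is_derive_ext (fun _ => 0)); [intros; symmetry; apply E|].
      apply (is_derive_const (K := R_AbsRing) (V := R_NormedModule) 0). }
    pose proof (is_derive_unique _ _ _ D) as E1. rewrite (is_derive_unique _ _ _ (HI (5 / 8))) in E1. lra. }
  exists (fun k q => match k with O => 1 - I q / Z | Datatypes.S k => - (b k q / Z) end).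
  split; [|split; [|split; [|split]]].
  - intros [|k] q; simpl.
    + evar_last. { apply (is_derive_minus (fun _ => 1) (fun q => I q / Z)).
        - apply (is_derive_const (K := R_AbsRing) (V := R_NormedModule) 1).
        - apply (is_derive_scal_l I q (b 0%nat q) (/ Z)). apply HI. }
      unfold minus, plus, opp, zero, scal, mult; simpl. unfold Rdiv. unfold mult; simpl. ring.
    + evar_last. { apply (is_derive_opp (fun q => b k q / Z)).
        apply (is_derive_scal_l (b k) q (b (k + 1)%nat q) (/ Z)). apply Hb. }
      unfold opp, scal, mult; simpl. unfold mult; simpl. reflexivity.
  - intros x Hx. rewrite I0 by assumption. field. lra.
  - intros x Hx. rewrite I1 by assumption. fold Z. field. lra.
  - intros x. specialize (b0 x). assert (0 <= b 0%nat x / Z) by (apply Rle_div_r; lra). lra.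
  - assert (0 < b 0%nat (5 / 8) / Z) by (apply Rdiv_lt_0_compat; assumption). lra.
Qed.

(** * Gaussian factors across time zero *)

Definition n2 (z : pt) : R := pt_x1 z ^ 2 + pt_x2 z ^ 2 + pt_x3 z ^ 2.

Lemma n2_ge0 (z : pt) : 0 <= n2 z.
Proof. unfold n2. pose proof (pow2_ge_0 (pt_x1 z)). pose proof (pow2_ge_0 (pt_x2 z)). pose proof (pow2_ge_0 (pt_x3 z)). lra. Qed.

Lemma n2_Smooth : Smooth n2.
Proof.
  apply (Smooth_ext (fun z => crd D1 z * crd D1 z + crd D2 z * crd D2 z + crd D3 z * crd D3 z)).
  - intros z; unfold n2; simpl; ring.
  - repeat apply Smooth_plus; apply Smooth_mult; apply Smooth_crd.
Qed.

(** With [m = 3] and [a = |x|^2 / 4] this is the heat kernel of three-dimensional space up to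
    normalisation; differentiation raises [m]. *)
Definition Em (m : nat) (t a : R) : R :=
  if Rlt_dec 0 t then (/ sqrt t) ^ m * exp (- (a / t)) else 0.

(* The [es c m k], multiplied by polynomials, form a class closed under [pd]: this is how
   smoothness of the truncated heat kernel across [t = 0] is obtained.  [c k] stands for
   the [k]-th derivative of a cutoff in [t + |x|^2] that vanishes near the singularity. *)
Definition es (c : nat -> R -> R) (m k : nat) (z : pt) : R :=
  Em m (pt_t z) (n2 z / 4) * c k (pt_t z + n2 z).

Definition chain (c : nat -> R -> R) (c0 : R) : Prop :=
  0 < c0 <= 1 /\ (forall k x, is_derive (c k) x (c (k + 1)%nat x)) /\
  (forall k x, x < c0 \/ 1 < x -> c k x = 0).

Lemma Em_pos (m : nat) (t a : R) : 0 < t -> Em m t a = (/ sqrt t) ^ m * exp (- (a / t)).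
Proof. intros H. unfold Em. destruct (Rlt_dec 0 t); [reflexivity|lra]. Qed.

Lemma Em_nonpos (m : nat) (t a : R) : t <= 0 -> Em m t a = 0.
Proof. intros H. unfold Em. destruct (Rlt_dec 0 t); [lra|reflexivity]. Qed.

Lemma exp_INR_mult (x : R) (n : nat) : exp (INR n * x) = exp x ^ n.
Proof.
  induction n; [simpl; rewrite Rmult_0_l; apply exp_0|].
  rewrite S_INR. replace ((INR n + 1) * x) with (x + INR n * x) by ring. rewrite exp_plus, IHn. reflexivity.
Qed.

Lemma exp_neg_le_pow (y : R) (n : nat) : 0 < y -> exp (- y) <= (INR (S n) / y) ^ S n.
Proof.
  intros Hy. assert (Hn : 0 < INR (S n)) by (apply lt_0_INR; lia).
  assert (E : exp (- y) = / exp (y / INR (S n)) ^ S n).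
  { rewrite exp_Ropp. f_equal. rewrite <- exp_INR_mult. f_equal. field. lra. }
  rewrite E, <- pow_inv. apply pow_incr. split; [apply Rlt_le, Rinv_0_lt_compat, exp_pos|].
  replace (INR (S n) / y) with (/ (y / INR (S n))) by (field; split; lra).
  assert (P : 0 < y / INR (S n)) by (apply Rdiv_lt_0_compat; assumption).
  apply Rinv_le_contravar; [assumption|]. pose proof (exp_ineq1_le (y / INR (S n))). lra.
Qed.

Section Chain.
Variables (c : nat -> R -> R) (c0 : R).
Hypothesis Hc : chain c c0.

Lemma chain_bounded (k : nat) : exists B, 0 <= B /\ forall x, Rabs (c k x) <= B.
Proof.
  destruct Hc as [H0 [Hd Hs]].
  assert (Cf : cont4 (fun z => c k (pt_t z))).
  { apply (cont4_comp1 (c k) (crd Dt)); [apply cont4_crd|]. intros x. apply continuity_pt_filterlim.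
    apply (ex_derive_continuous (c k)). eexists; apply Hd. }
  destruct (cont4_bounded_box _ 1 Cf) as [B [HB H]]. exists B; split; [assumption|].
  intros x. destruct (Rlt_or_le x c0) as [Hx|Hx]; [rewrite Hs by lra; rewrite Rabs_R0; assumption|].
  destruct (Rlt_or_le 1 x) as [Hx1|Hx1]; [rewrite Hs by lra; rewrite Rabs_R0; assumption|].
  apply (H (mkpt x 0 0 0)). intros []; simpl; try (rewrite Rabs_R0; lra). rewrite Rabs_pos_eq; lra.
Qed.

(** On the support of the cutoff [t + |x|^2 >= c0]: either [t] is bounded below, or
    [|x|^2 >= c0 / 2] and the exponential beats every negative power of [t]. The order [t^2]
    suffices for continuity and for a vanishing derivative at [t = 0]. *)
Lemma es_flat (m k : nat) : exists B, 0 <= B /\ forall z, 0 < pt_t z -> pt_t z <= 1 ->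
  Rabs (es c m k z) <= B * pt_t z ^ 2.
Proof.
  destruct (chain_bounded k) as [B [HB H]]. destruct Hc as [H0 [Hd Hs]].
  set (B1 := (INR (S (m + 1)) * 8 / c0) ^ S (m + 1)). set (B2 := (2 / c0) ^ m * (4 / c0 ^ 2)).
  assert (P1 : 0 <= B1).
  { apply pow_le. apply Rle_div_r; [lra|]. rewrite Rmult_0_l. apply Rmult_le_pos; [apply pos_INR|lra]. }
  assert (P2 : 0 <= B2).
  { apply Rmult_le_pos; [apply pow_le; apply Rle_div_r; lra|]. apply Rle_div_r; [apply pow_lt; lra|lra]. }
  exists ((B1 + B2) * B); split; [apply Rmult_le_pos; lra|].
  intros z Ht Ht1. set (t := pt_t z) in *. unfold es. fold t.
  destruct (Rlt_or_le (t + n2 z) c0) as [Hq|Hq].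
  { rewrite Hs by lra. rewrite Rmult_0_r, Rabs_R0.
    apply Rmult_le_pos; [apply Rmult_le_pos; lra|apply pow2_ge_0]. }
  rewrite Em_pos by assumption. rewrite Rabs_mult.
  assert (St : 0 < sqrt t) by (apply sqrt_lt_R0; assumption).
  assert (It : (/ sqrt t) ^ m <= (/ t) ^ m).
  { apply pow_incr. split; [apply Rlt_le, Rinv_0_lt_compat; assumption|].
    apply Rinv_le_contravar; [assumption|]. rewrite <- (sqrt_sqrt t) at 1 by lra.
    assert (sqrt t <= 1) by (rewrite <- sqrt_1; apply sqrt_le_1_alt; assumption). nra. }
  assert (Pe := exp_pos (- (n2 z / 4 / t))).
  assert (Pm : 0 <= (/ sqrt t) ^ m) by (apply pow_le, Rlt_le, Rinv_0_lt_compat; assumption).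
  rewrite (Rabs_pos_eq (_ * exp _)) by (apply Rmult_le_pos; lra).
  assert (It0 : 0 < / t) by (apply Rinv_0_lt_compat; assumption).
  assert (Pm' : 0 <= (/ t) ^ m) by (apply pow_le; lra).
  assert (Key : (/ sqrt t) ^ m * exp (- (n2 z / 4 / t)) <= (B1 + B2) * t ^ 2).
  { destruct (Rle_lt_dec t (c0 / 2)) as [Hl|Hl].
    - assert (Hn : c0 / 2 <= n2 z) by lra.
      assert (Y : 0 < c0 / (8 * t)) by (apply Rdiv_lt_0_compat; lra).
      assert (E1 : exp (- (n2 z / 4 / t)) <= exp (- (c0 / (8 * t)))).
      { assert (Hx : c0 / (8 * t) <= n2 z / 4 / t).
        { replace (c0 / (8 * t)) with (c0 / 2 * (/ (4 * t))) by (field; lra).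
          replace (n2 z / 4 / t) with (n2 z * (/ (4 * t))) by (field; lra).
          apply Rmult_le_compat_r; [apply Rlt_le, Rinv_0_lt_compat; lra|assumption]. }
        destruct Hx as [Hx|Hx]; [apply Rlt_le, exp_increasing; lra|rewrite Hx; lra]. }
      (* The exponent is [m + 2]: [m] powers cancel the singular prefactor and two remain. *)
      pose proof (exp_neg_le_pow (c0 / (8 * t)) (m + 1) Y) as E2.
      assert (E3 : (/ t) ^ m * (INR (S (m + 1)) / (c0 / (8 * t))) ^ S (m + 1) = B1 * t ^ 2).
      { unfold B1. replace (INR (S (m + 1)) / (c0 / (8 * t))) with ((INR (S (m + 1)) * 8 / c0) * t) by (field; lra).
        rewrite Rpow_mult_distr. replace (S (m + 1)) with (m + 2)%nat at 3 by lia.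
        rewrite pow_add, pow_inv. field. apply pow_nonzero; lra. }
      apply Rle_trans with (B1 * t ^ 2); [|apply Rmult_le_compat_r; [apply pow2_ge_0|lra]].
      rewrite <- E3. apply Rmult_le_compat; try lra.
    - apply Rle_trans with (B2 * t ^ 2); [|apply Rmult_le_compat_r; [apply pow2_ge_0|lra]].
      assert (E1 : exp (- (n2 z / 4 / t)) <= 1).
      { rewrite <- exp_0. assert (0 <= n2 z / 4 / t) by (apply Rmult_le_pos; [apply Rmult_le_pos; [apply n2_ge0|lra]|lra]).
        destruct H1 as [H1|H1]; [apply Rlt_le, exp_increasing; lra|rewrite <- H1, Ropp_0; lra]. }
      assert (E2 : (/ t) ^ m <= (2 / c0) ^ m).
      { apply pow_incr. split; [lra|]. replace (2 / c0) with (/ (c0 / 2)) by (field; lra).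
        apply Rinv_le_contravar; lra. }
      unfold B2. rewrite Rmult_assoc. apply Rmult_le_compat; try lra.
      apply Rle_trans with 1; [assumption|].
      replace (4 / c0 ^ 2 * t ^ 2) with ((t / (c0 / 2)) ^ 2) by (field; lra).
      assert (1 <= t / (c0 / 2)) by (apply Rle_div_r; lra). nra. }
  specialize (H (t + n2 z)).
  replace ((B1 + B2) * B * t ^ 2) with ((B1 + B2) * t ^ 2 * B) by ring.
  apply Rmult_le_compat; try assumption; [|apply Rabs_pos]. apply Rmult_le_pos; lra.
Qed.

Lemma es_nonpos (m k : nat) (z : pt) : pt_t z <= 0 -> es c m k z = 0.
Proof. intros H. unfold es. rewrite Em_nonpos by assumption. ring. Qed.

Lemma cont_at_local (f g : pt -> R) (z : pt) (r : R) : cont4 g -> 0 < r ->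
  (forall w, near r z w -> f w = g w) -> filterlim f (nb z) (locally (f z)).
Proof.
  intros Hg Hr H. rewrite (H z) by (apply near_refl; assumption).
  apply (filterlim_ext_loc (F := nb z) g f).
  - exists r; split; [assumption|]. intros w Hw; symmetry; apply H; assumption.
  - apply cont4_nb; assumption.
Qed.

Lemma es_cont4 (m k : nat) : cont4 (es c m k).
Proof.
  destruct (es_flat m k) as [B [HB Hfl]].
  apply cont4_nb; intros z. destruct (Rtotal_order (pt_t z) 0) as [H|[H|H]].
  - apply (cont_at_local _ (fun _ => 0) z (- pt_t z)); [apply cont4_const|lra|].
    intros w N. apply es_nonpos. specialize (N Dt). simpl in N. apply Rabs_lt_between in N. lra.
  - rewrite es_nonpos by lra. apply filterlim_R_iff; [apply nb_filter|]. intros e He.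
    exists (Rmin 1 (e / (B + 1))); split; [apply Rmin_pos; [lra|apply Rdiv_lt_0_compat; lra]|].
    intros w N. specialize (N Dt). simpl in N. rewrite H, Rminus_0_r in N. rewrite Rminus_0_r.
    pose proof (Rmin_l 1 (e / (B + 1))). pose proof (Rmin_r 1 (e / (B + 1))).
    apply Rabs_lt_between in N.
    destruct (Rle_lt_dec (pt_t w) 0) as [Hw|Hw]; [rewrite es_nonpos, Rabs_R0; assumption|].
    apply Rle_lt_trans with (B * pt_t w ^ 2); [apply Hfl; lra|].
    assert (pt_t w ^ 2 <= pt_t w) by nra.
    apply Rle_lt_trans with (B * pt_t w); [apply Rmult_le_compat_l; assumption|].
    assert (pt_t w < e / (B + 1)) by lra. apply Rlt_div_r in H3; [|lra]. nra.
  - set (r := pt_t z / 2).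
    assert (Hr : 0 < r) by (unfold r; lra).
    (* For positive time the function agrees near [z] with the one in which [t] is replaced by
       [max(t, r)], and the latter is continuous everywhere. *)
    assert (Cm : cont4 (fun w => Rmax (pt_t w) r)).
    { apply (cont4_comp1 (fun x => Rmax x r) (crd Dt)); [apply cont4_crd|].
      intros x. apply continuity_pt_filterlim. apply filterlim_locally. intros e.
      exists e. intros y Hy. change (Rabs (Rmax y r - Rmax x r) < e). change (Rabs (y - x) < e) in Hy.
      unfold Rmax. destruct (Rle_dec y r), (Rle_dec x r); unfold Rabs in *;
        repeat match goal with |- context [Rcase_abs ?a] => destruct (Rcase_abs a) end;
        destruct (Rcase_abs (y - x)); pose proof (cond_pos e); lra. }
    assert (Cinv : forall g, cont4 g -> cont4 (fun w => / Rmax (g w) r)).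
    { intros g Hg. apply (cont4_comp1 (fun x => / Rmax x r) g); [assumption|].
      intros x. apply (continuity_pt_inv (fun x => Rmax x r)).
      - apply continuity_pt_filterlim. apply filterlim_locally. intros e.
        exists e. intros y Hy. change (Rabs (Rmax y r - Rmax x r) < e). change (Rabs (y - x) < e) in Hy.
        unfold Rmax. destruct (Rle_dec y r), (Rle_dec x r); unfold Rabs in *;
        repeat match goal with |- context [Rcase_abs ?a] => destruct (Rcase_abs a) end;
        destruct (Rcase_abs (y - x)); pose proof (cond_pos e); lra.
      - pose proof (Rmax_r x r). lra. }
    assert (Cn : cont4 n2) by apply Smooth_cont4, n2_Smooth.
    apply (cont_at_local _ (fun w => (sqrt (/ Rmax (pt_t w) r)) ^ m * exp (- (n2 w / 4 * / Rmax (pt_t w) r))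
        * c k (pt_t w + n2 w)) z r); [|assumption|].
    + apply cont4_mult; [apply cont4_mult|].
      * apply cont4_pow. apply (cont4_comp1 sqrt); [apply (Cinv (crd Dt)), cont4_crd|].
        intros x. apply continuity_pt_filterlim. apply continuous_sqrt.
      * apply (cont4_comp1 exp).
        -- apply cont4_opp, cont4_mult; [|apply (Cinv (crd Dt)), cont4_crd].
           apply cont4_mult; [assumption|apply cont4_const].
        -- intros x. apply derivable_continuous_pt, derivable_pt_exp.
      * apply (cont4_comp1 (c k)); [apply cont4_plus; [apply (cont4_crd Dt)|assumption]|].
        intros x. apply continuity_pt_filterlim. apply (ex_derive_continuous (c k)).
        eexists; apply Hc.
    + intros w N. specialize (N Dt). simpl in N. apply Rabs_lt_between in N.
      unfold es. rewrite Em_pos by (unfold r in *; lra).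
      rewrite Rmax_left by (unfold r in *; lra). rewrite sqrt_inv. unfold Rdiv. reflexivity.
Qed.

Lemma is_derive_chain (k : nat) (g : R -> R) (x dg : R) : is_derive g x dg ->
  is_derive (fun s => c k (g s)) x (dg * c (k + 1)%nat (g x)).
Proof. intros H. apply (is_derive_comp (c k) g); [apply Hc|assumption]. Qed.

Lemma es_hasD_x (d : dir) (m k : nat) : d <> Dt ->
  hasD d (es c m k) (fun z => crd d z * (- / 2 * es c (m + 2) k z + 2 * es c m (k + 1) z)).
Proof.
  intros Hd z. apply is_derive_Reals.
  destruct (Rle_lt_dec (pt_t z) 0) as [Ht|Ht].
  - rewrite !es_nonpos by assumption.
    apply (is_derive_ext (fun _ => 0)).
    + intros s. symmetry. apply es_nonpos. destruct d; simpl; [congruence|assumption|assumption|assumption].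
    + replace (crd d z * (- / 2 * 0 + 2 * 0)) with 0 by ring.
      apply (is_derive_const (K := R_AbsRing) (V := R_NormedModule) 0).
  - set (t := pt_t z) in *. set (A := (/ sqrt t) ^ m).
    set (N := fun s => n2 z + 2 * crd d z * s + s ^ 2).
    apply (is_derive_ext (fun s => (A * exp (- (N s / 4 / t))) * c k (t + N s))).
    + intros s. assert (E : N s = n2 (shift z d s)).
      { unfold N, n2. destruct d; [congruence| | |]; simpl; ring. }
      assert (E' : pt_t (shift z d s) = t) by (destruct d; [congruence| | |]; reflexivity).
      unfold es. rewrite E', <- E, Em_pos by assumption. reflexivity.
    + evar_last.
      { apply (is_derive_mult (fun s => A * exp (- (N s / 4 / t))) (fun s => c k (t + N s))).
        - unfold N. auto_derive; [lra|reflexivity].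
        - apply (is_derive_chain k (fun s => t + N s)). unfold N. auto_derive; [trivial|reflexivity].
        - intros; apply Rmult_comm. }
      unfold es. fold t. rewrite !Em_pos by assumption.
      assert (E2 : (/ sqrt t) ^ 2 = / t) by (rewrite pow_inv, pow2_sqrt by lra; reflexivity).
      rewrite pow_add, E2. fold A.
      unfold plus, mult; simpl. unfold N.
      replace (n2 z + 2 * crd d z * 0 + 0 * (0 * 1)) with (n2 z) by ring.
      replace (n2 z + 2 * crd d z * 0 + 0 ^ 2) with (n2 z) by ring.
      unfold Rdiv. field. lra.
Qed.

(** Away from [t = 0] this is the product rule; at [t = 0] the quadratic bound of [es_flat] forces
    the difference quotient to zero, which is also the value of the right-hand side. *)
Lemma es_hasD_t (m k : nat) :
  hasD Dt (es c m k) (fun z => - (INR m / 2) * es c (m + 2) k z + n2 z / 4 * es c (m + 4) k z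
     + es c m (k + 1) z).
Proof.
  intros z. destruct (Rtotal_order (pt_t z) 0) as [Ht|[Ht|Ht]].
  - rewrite !es_nonpos by lra. apply is_derive_Reals.
    replace (- (INR m / 2) * 0 + n2 z / 4 * 0 + 0) with 0 by ring.
    apply (is_derive_ext_loc (fun _ => 0)).
    + assert (P : 0 < - pt_t z) by lra. exists (mkposreal _ P). intros s Hs.
      change (Rabs (s - 0) < - pt_t z) in Hs. apply Rabs_lt_between in Hs.
      symmetry; apply es_nonpos; simpl; lra.
    + apply (is_derive_const (K := R_AbsRing) (V := R_NormedModule) 0).
  - rewrite !es_nonpos by lra.
    replace (- (INR m / 2) * 0 + n2 z / 4 * 0 + 0) with 0 by ring.
    destruct (es_flat m k) as [B [HB Hfl]]. intros e He.
    assert (P : 0 < Rmin 1 (e / (B + 1))) by (apply Rmin_pos; [lra|apply Rdiv_lt_0_compat; lra]).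
    exists (mkposreal _ P). intros h Hh Hhe. simpl in Hhe.
    pose proof (Rmin_l 1 (e / (B + 1))). pose proof (Rmin_r 1 (e / (B + 1))).
    rewrite Rplus_0_l, shift_0, (es_nonpos m k z) by lra.
    destruct (Rle_lt_dec h 0) as [Hs|Hs].
    + rewrite es_nonpos by (simpl; lra). replace ((0 - 0) / h - 0) with 0 by (field; assumption).
      rewrite Rabs_R0; assumption.
    + rewrite Rabs_pos_eq in Hhe by lra.
      pose proof (Hfl (shift z Dt h)) as X.
      replace (pt_t (shift z Dt h)) with h in X by (simpl; lra).
      specialize (X Hs ltac:(lra)). unfold Rminus. rewrite Ropp_0, !Rplus_0_r.
      unfold Rdiv. rewrite Rabs_mult, Rabs_inv, (Rabs_pos_eq h) by lra.
      apply Rle_lt_trans with (B * h).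
      * apply Rle_div_l; [lra|]. replace (B * h * h) with (B * h ^ 2) by ring. exact X.
      * assert (h < e / (B + 1)) by lra. apply Rlt_div_r in H1; [|lra]. nra.
  - apply is_derive_Reals. set (t := pt_t z) in *. set (N := n2 z).
    apply (is_derive_ext_loc (fun s => ((/ sqrt (t + s)) ^ m * exp (- (N / 4 / (t + s)))) * c k (t + s + N))).
    + exists (mkposreal _ Ht). intros s Hs. change (Rabs (s - 0) < t) in Hs. apply Rabs_lt_between in Hs.
      unfold es. change (n2 (shift z Dt s)) with N. change (pt_t (shift z Dt s)) with (t + s).
      rewrite Em_pos by lra. reflexivity.
    + assert (St : 0 < sqrt t) by (apply sqrt_lt_R0; assumption).
      evar_last.
      { apply (is_derive_mult (fun s => (/ sqrt (t + s)) ^ m * exp (- (N / 4 / (t + s)))) (fun s => c k (t + s + N))).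
        - auto_derive; [|reflexivity]. rewrite Rplus_0_r. repeat split; lra.
        - apply (is_derive_chain k (fun s => t + s + N)). auto_derive; [trivial|reflexivity].
        - intros; apply Rmult_comm. }
      unfold es. fold t. fold N. rewrite !Em_pos by assumption.
      unfold plus, mult; simpl. rewrite !Rplus_0_r.
      rewrite !pow_add.
      assert (E : t = sqrt t ^ 2) by (rewrite pow2_sqrt; lra).
      set (rt := sqrt t) in *.
      set (ex := exp (- (N / 4 / t))).
      change (exp (- (N / 4 * / t))) with ex. clearbody ex.
      destruct m.
      * simpl. rewrite E. field. lra.
      * change (Init.Nat.pred (S m)) with m. change ((/ rt) ^ S m) with (/ rt * (/ rt) ^ m).
        set (J := INR (S m)). generalize ((/ rt) ^ m); intros pm. rewrite E. field. lra.
Qed.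

Inductive EsAlg : (pt -> R) -> Prop :=
| EsAlg_sm f : Smooth f -> EsAlg f
| EsAlg_es m k : EsAlg (es c m k)
| EsAlg_plus f g : EsAlg f -> EsAlg g -> EsAlg (fun z => f z + g z)
| EsAlg_mult f g : EsAlg f -> EsAlg g -> EsAlg (fun z => f z * g z).

Lemma es_Smooth (m k : nat) : Smooth (es c m k).
Proof.
  apply (Smooth_coind EsAlg); [|apply EsAlg_es]. clear m k. intros f Hf. induction Hf.
  - split; [apply Smooth_cont4; assumption|]. intros d. exists (pd d f); split.
    + apply EsAlg_sm, Smooth_pd; assumption.
    + apply Smooth_hasD; assumption.
  - split; [apply es_cont4|]. intros d. destruct (dir_eq_dec d Dt) as [->|Hd].
    + eexists; split; [|apply es_hasD_t].
      apply (EsAlg_plus (fun z => - (INR m / 2) * es c (m + 2) k z + n2 z / 4 * es c (m + 4) k z) (es c m (k + 1)));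
        [|apply EsAlg_es].
      apply (EsAlg_plus (fun z => - (INR m / 2) * es c (m + 2) k z) (fun z => n2 z / 4 * es c (m + 4) k z)).
      * apply (EsAlg_mult (fun _ => - (INR m / 2))); [apply EsAlg_sm, Smooth_const|apply EsAlg_es].
      * apply (EsAlg_mult (fun z => n2 z / 4)); [|apply EsAlg_es]. apply EsAlg_sm.
        apply Smooth_mult; [apply n2_Smooth|apply Smooth_const].
    + eexists; split; [|apply es_hasD_x; assumption].
      apply (EsAlg_mult (crd d)); [apply EsAlg_sm, Smooth_crd|].
      apply (EsAlg_plus (fun z => - / 2 * es c (m + 2) k z) (fun z => 2 * es c m (k + 1) z)).
      * apply (EsAlg_mult (fun _ => - / 2)); [apply EsAlg_sm, Smooth_const|apply EsAlg_es].
      * apply (EsAlg_mult (fun _ => 2)); [apply EsAlg_sm, Smooth_const|apply EsAlg_es].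
  - destruct IHHf1 as [C1 D1'], IHHf2 as [C2 D2']. split; [apply cont4_plus; assumption|].
    intros d. destruct (D1' d) as [f' [Sf Hf']], (D2' d) as [g' [Sg Hg']].
    eexists; split; [|apply hasD_plus; eassumption]. apply EsAlg_plus; assumption.
  - destruct IHHf1 as [C1 D1'], IHHf2 as [C2 D2']. split; [apply cont4_mult; assumption|].
    intros d. destruct (D1' d) as [f' [Sf Hf']], (D2' d) as [g' [Sg Hg']].
    eexists; split; [|apply hasD_mult; eassumption].
    apply (EsAlg_plus (fun z => f' z * g z) (fun z => f z * g' z)); apply EsAlg_mult; assumption.
Qed.

Lemma es_psupp (m k : nat) : psupp 1 (es c m k).
Proof.
  intros z Hz. destruct Hc as [H0 [_ Hs]].
  assert (Ht : 0 < pt_t z) by (apply Rnot_le_lt; intros H; apply Hz, es_nonpos; assumption).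
  assert (Hq : pt_t z + n2 z <= 1).
  { apply Rnot_lt_le; intros H. apply Hz. unfold es. rewrite Hs by lra. ring. }
  unfold n2 in Hq.
  pose proof (pow2_ge_0 (pt_x1 z)). pose proof (pow2_ge_0 (pt_x2 z)). pose proof (pow2_ge_0 (pt_x3 z)).
  unfold past; simpl. rewrite !Rminus_0_r.
  repeat split; try lra; apply Rabs_le_between; nra.
Qed.

(** The terms with an undifferentiated cutoff cancel because the Gaussian with [m = 3] solves the
    heat equation. What is left are commutators; the coefficient -5 is 1 from the time derivative
    minus 6 from the Laplacian of [|x|^2]. *)
Lemma heat_es3 (z : pt) :
  heat (es c 3 0) z = -5 * es c 3 1 z + 2 * n2 z * es c 5 1 z - 4 * n2 z * es c 3 2 z.
Proof.
  unfold heat. rewrite (hasD_pd _ _ _ (es_hasD_t 3 0)).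
  assert (X : forall d, d <> Dt -> pd d (pd d (es c 3 0)) z =
     (- / 2 * es c 5 0 z + 2 * es c 3 1 z) + crd d z ^ 2 * (/ 4 * es c 7 0 z - 2 * es c 5 1 z + 4 * es c 3 2 z)).
  { intros d Hd. rewrite (hasD_pd _ _ _ (es_hasD_x d 3 0 Hd)).
    pose proof (hasD_mult d _ _ _ _ (hasD_crd d d) (hasD_plus d _ _ _ _
      (hasD_scal d (- / 2) _ _ (es_hasD_x d (3 + 2) 0 Hd)) (hasD_scal d 2 _ _ (es_hasD_x d 3 (0 + 1) Hd)))) as H.
    cbv beta in H.
    rewrite (hasD_pd _ _ _ H). simpl. unfold unitd. destruct (dir_eq_dec d d); [|congruence]. field. }
  rewrite !X by discriminate. simpl. unfold n2. field.
Qed.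

End Chain.

Lemma Em_dil (m : nat) (t a : R) : Em m t a = 2 ^ m * Em m (4 * t) (4 * a).
Proof.
  destruct (Rle_lt_dec t 0) as [H|H].
  - rewrite !Em_nonpos by lra. ring.
  - rewrite !Em_pos by lra. rewrite sqrt_mult by lra.
    replace (sqrt 4) with 2 by (replace 4 with (2 ^ 2) by ring; rewrite sqrt_pow2; lra).
    assert (0 < sqrt t) by (apply sqrt_lt_R0; assumption).
    rewrite Rinv_mult, Rpow_mult_distr, (pow_inv 2).
    replace (4 * a / (4 * t)) with (a / t) by (field; lra). field. apply pow_nonzero; lra.
Qed.

(** For [n = 5] the dilation preserves integrals; [n = 3] is the scaling of the heat kernel, which
    gains two powers, and [n = 4] that of its spatial gradient. *)
Definition ker (n : nat) (k : pt -> R) (s : R) (z : pt) : R :=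
  / s ^ n * k (aff origin (dil (/ s)) z).

Lemma ker_Smooth (n : nat) (k : pt -> R) (s : R) : Smooth k -> Smooth (ker n k s).
Proof. intros H. apply Smooth_scal, Smooth_aff; assumption. Qed.

Lemma ker_psupp (n : nat) (k : pt -> R) (s : R) : 0 < s -> psupp 1 k -> psupp s (ker n k s).
Proof.
  intros Hs H z Hz.
  assert (Hn : k (aff origin (dil (/ s)) z) <> 0) by (intros E; apply Hz; unfold ker; rewrite E; ring).
  destruct (H _ Hn) as [H0 [H1 [H2 H3]]]. simpl in *.
  assert (Hx : forall x, Rabs (0 + / s * x - 0) <= 1 -> Rabs (x - 0) <= s).
  { intros x Hx. rewrite Rplus_0_l, Rminus_0_r, Rabs_mult, Rabs_inv, (Rabs_pos_eq s) in Hx by lra.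
    rewrite Rminus_0_r. apply Rmult_le_compat_l with (r := s) in Hx; [|lra].
    rewrite <- Rmult_assoc, Rinv_r, Rmult_1_l in Hx by lra. lra. }
  unfold past; simpl. repeat split; try (apply Hx; assumption).
  - assert (0 < s * s) by nra. assert (E : pt_t z = s * s * (0 + / s * (/ s * 1) * pt_t z)) by (field; lra).
    rewrite E. nra.
  - assert (0 < s * s) by nra. assert (E : pt_t z = s * s * (0 + / s * (/ s * 1) * pt_t z)) by (field; lra).
    rewrite E. nra.
Qed.

Lemma ker_Cc (n : nat) (k : pt -> R) (s : R) : 0 < s -> Smooth k -> psupp 1 k -> Cc (ker n k s).
Proof.
  intros Hs Hk H. apply psupp_Cc with s; [lra|apply Smooth_cont4, ker_Smooth; assumption|].
  apply ker_psupp; assumption.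
Qed.

Lemma psupp1_Cc (k : pt -> R) : Smooth k -> psupp 1 k -> Cc k.
Proof. intros Hk H. apply psupp_Cc with 1; [lra|apply Smooth_cont4; assumption|assumption]. Qed.

Lemma Int4_ker5 (k : pt -> R) (s : R) : 0 < s -> Smooth k -> psupp 1 k -> Int4 (ker 5 k s) = Int4 k.
Proof.
  intros Hs Hk H. assert (Ck := psupp1_Cc k Hk H).
  assert (Hd := dil_neq0 (/ s) (Rinv_neq_0_compat _ (Rgt_not_eq _ _ Hs))).
  destruct (Cc_aff k origin (dil (/ s)) Hd Ck) as [C _].
  unfold ker. rewrite (Int4_scal _ (fun z => k (aff origin (dil (/ s)) z))), (Int4_aff k) by assumption.
  assert (0 < / s) by (apply Rinv_0_lt_compat; assumption).
  unfold dil; cbn [pt_t pt_x1 pt_x2 pt_x3]. rewrite !Rabs_pos_eq by (try apply pow_le; lra). field. lra.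
Qed.

(* [32 eta (dil 2 z)] is [eta] rescaled to scale 1/2, so [ker 3 K s] tested against [heat U]
   is the increment of the averages of [U] between the scales [s] and [s/2]. *)
Definition parametrix (K eta : pt -> R) : Prop :=
  Smooth K /\ Smooth eta /\ psupp 1 K /\ psupp 1 eta /\
  (forall z, heat K z = 32 * eta (aff origin (dil 2) z) - eta z).

Lemma parametrix_telescope (K eta U : pt -> R) (s : R) (z : pt) : parametrix K eta -> 0 < s -> Smooth U ->
  conv (ker 3 K s) (heat U) z = conv (ker 5 eta (s / 2)) U z - conv (ker 5 eta s) U z.
Proof.
  intros [SK [Se [PK [Pe HK]]]] Hs HU.
  rewrite conv_heat_swap; [|apply ker_Smooth; assumption|apply ker_Cc; assumption|assumption].
  rewrite <- conv_minus_l; [|apply ker_Cc; try assumption; lra|apply ker_Cc; assumption|apply Smooth_cont4; assumption].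
  f_equal. extensionality w. unfold ker at 1.
  rewrite (heat_scal _ (fun z => K (aff origin (dil (/ s)) z))) by (apply Smooth_aff; assumption).
  rewrite heat_dil, HK by assumption. unfold ker.
  replace (aff origin (dil 2) (aff origin (dil (/ s)) w)) with (aff origin (dil (/ (s / 2))) w).
  - field. lra.
  - apply pt_ext; intros []; simpl; field; lra.
Qed.

(** With the Gaussian [G] and [q = t + |x|^2], [K] is [G] times [S(q) - S(4q)], which vanishes near
    the singularity, and [eta] is minus the heat operator on [G S(q)] away from it. Since [G] is
    homogeneous, the heat operator on [K] is a difference of [eta] at two scales. The mass of [eta]
    is not visible from its formula; it is found by testing against a function of time alone. *)
Lemma parametrix_exists (Phi : pt -> R) : kernel_ok Phi ->
  exists K eta, parametrix K eta /\ 0 < Int4 eta.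
Proof.
  intros Hok. destruct (cutoff_exists Phi Hok) as [S [Sd [S1 [S0 [Sn Sp]]]]].
  assert (Sz : forall k x, x < 3 / 8 \/ 1 < x -> S (k + 1)%nat x = 0).
  { assert (X : forall k x, x < 3 / 8 \/ 7 / 8 < x -> S (k + 1)%nat x = 0).
    { induction k; intros x Hx.
      - simpl. pose proof (Sd 0%nat x) as D. simpl in D.
        rewrite <- (is_derive_unique _ _ _ D). destruct Hx as [Hx|Hx].
        + apply is_derive_unique. apply (is_derive_ext_loc (fun _ => 1)).
          * assert (P : 0 < 3 / 8 - x) by lra. exists (mkposreal _ P). intros y Hy.
            change (Rabs (y - x) < 3 / 8 - x) in Hy. apply Rabs_lt_between in Hy. symmetry; apply S1; lra.
          * apply (is_derive_const (K := R_AbsRing) (V := R_NormedModule) 1).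
        + apply is_derive_unique. apply (is_derive_ext_loc (fun _ => 0)).
          * assert (P : 0 < x - 7 / 8) by lra. exists (mkposreal _ P). intros y Hy.
            change (Rabs (y - x) < x - 7 / 8) in Hy. apply Rabs_lt_between in Hy. symmetry; apply S0; lra.
          * apply (is_derive_const (K := R_AbsRing) (V := R_NormedModule) 0).
      - pose proof (Sd (k + 1)%nat x) as D. replace (k + 1 + 1)%nat with (Datatypes.S k + 1)%nat in D by lia.
        rewrite <- (is_derive_unique _ _ _ D). apply is_derive_unique.
        apply (is_derive_ext_loc (fun _ => 0)).
        + destruct Hx as [Hx|Hx].
          * assert (P : 0 < 3 / 8 - x) by lra. exists (mkposreal _ P). intros y Hy.
            change (Rabs (y - x) < 3 / 8 - x) in Hy. apply Rabs_lt_between in Hy. symmetry; apply IHk; lra.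
          * assert (P : 0 < x - 7 / 8) by lra. exists (mkposreal _ P). intros y Hy.
            change (Rabs (y - x) < x - 7 / 8) in Hy. apply Rabs_lt_between in Hy. symmetry; apply IHk; lra.
        + apply (is_derive_const (K := R_AbsRing) (V := R_NormedModule) 0). }
    intros k x Hx. apply X. lra. }
  set (c := fun k x => S k x - 4 ^ k * S k (4 * x)).
  set (c' := fun k x => S (k + 1)%nat x).
  assert (Hc : chain c (3 / 32)).
  { split; [lra|split].
    - intros k x. unfold c. evar_last.
      { apply (is_derive_minus (S k) (fun x => 4 ^ k * S k (4 * x))); [apply Sd|].
        apply (is_derive_scal (fun x => S k (4 * x))).
        apply (is_derive_comp (S k) (fun x => 4 * x)); [apply Sd|]. auto_derive; [trivial|reflexivity]. }
      unfold minus, plus, opp, scal, mult; simpl. unfold mult; simpl. rewrite pow_add; simpl. ring.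
    - intros [|k] x Hx.
      + unfold c. simpl. destruct Hx as [Hx|Hx]; [rewrite !S1 by lra|rewrite !S0 by lra]; ring.
      + unfold c. rewrite <- Nat.add_1_r. rewrite !Sz by lra. ring. }
  assert (Hc' : chain c' (3 / 8)).
  { split; [lra|split].
    - intros k x. unfold c'. apply Sd.
    - intros k x Hx. apply Sz; assumption. }
  set (K := es c 3 0).
  set (eta := fun z => 5 * es c' 3 0 z + (4 * (n2 z * es c' 3 1 z) + (-2) * (n2 z * es c' 5 0 z))).
  assert (SK : Smooth K) by (apply (es_Smooth c _ Hc)).
  assert (Se : Smooth eta).
  { apply Smooth_plus; [apply Smooth_scal, (es_Smooth c' _ Hc')|].
    apply Smooth_plus; apply Smooth_scal, Smooth_mult; try apply n2_Smooth; apply (es_Smooth c' _ Hc'). }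
  assert (PK : psupp 1 K) by apply (es_psupp c _ Hc).
  assert (Pe : psupp 1 eta).
  { intros z Hz. unfold eta in Hz.
    destruct (Req_dec (es c' 3 0 z) 0) as [E1|E1]; [|apply (es_psupp c' _ Hc') in E1; assumption].
    destruct (Req_dec (es c' 3 1 z) 0) as [E2|E2]; [|apply (es_psupp c' _ Hc') in E2; assumption].
    destruct (Req_dec (es c' 5 0 z) 0) as [E3|E3]; [|apply (es_psupp c' _ Hc') in E3; assumption].
    exfalso; apply Hz. rewrite E1, E2, E3; ring. }
  assert (Par : parametrix K eta).
  { split; [exact SK|split; [exact Se|split; [exact PK|split; [exact Pe|]]]].
    intros z. unfold K. rewrite (heat_es3 c _ Hc). unfold eta, es.
    set (z' := aff origin (dil 2) z).
    assert (En : n2 z' = 4 * n2 z) by (unfold n2, z'; simpl; ring).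
    assert (Et : pt_t z' = 4 * pt_t z) by (unfold z'; simpl; ring).
    rewrite En, Et. unfold c, c'. cbn [Nat.add].
    replace (4 * n2 z / 4) with (4 * (n2 z / 4)) by field.
    replace (4 * pt_t z + 4 * n2 z) with (4 * (pt_t z + n2 z)) by ring.
    rewrite (Em_dil 3 (pt_t z)), (Em_dil 5 (pt_t z)). ring. }
  exists K, eta. split; [assumption|].
  (* This test function is 0 in the remote past, 1 from time -3/8 on, and [heat theta >= 0].
     Averages of it against [eta] at the origin therefore increase as the scale decreases: from
     nearly 0 at large scales to [Int4 eta] at small ones. *)
  set (theta := fun z => S 0%nat (- pt_t z)).
  assert (thD : forall k, hasD Dt (fun z => S k (- pt_t z)) (fun z => - S (k + 1)%nat (- pt_t z)) /\
     forall d, d <> Dt -> hasD d (fun z => S k (- pt_t z)) (fun _ => 0)).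
  { intros k. split.
    - intros z. apply is_derive_Reals. evar_last.
      { apply (is_derive_comp (S k) (fun s => - (pt_t z + s))); [apply Sd|]. auto_derive; [trivial|reflexivity]. }
      unfold scal; simpl; unfold mult; simpl. rewrite Rplus_0_r. ring.
    - intros d Hd z. apply is_derive_Reals. apply (is_derive_ext (fun _ => S k (- pt_t z))).
      + intros s. destruct d; [congruence| | |]; reflexivity.
      + apply (is_derive_const (K := R_AbsRing) (V := R_NormedModule)). }
  assert (Sc : forall k x, continuity_pt (S k) x).
  { intros k x. apply continuity_pt_filterlim. apply (ex_derive_continuous (S k)). eexists; apply Sd. }
  assert (Sth : Smooth theta).
  { apply (Smooth_coind (fun f => exists k a, f = fun z => a * S k (- pt_t z))).
    - intros f [k [a ->]]. split.
      + apply cont4_scal, (cont4_comp1 (S k)); [apply cont4_opp, (cont4_crd Dt)|apply Sc].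
      + intros d. destruct (dir_eq_dec d Dt) as [->|Hd].
        * exists (fun z => - a * S (k + 1)%nat (- pt_t z)). split; [exists (k + 1)%nat, (- a); reflexivity|].
          apply (hasD_ext Dt (fun z => a * S k (- pt_t z)) (fun z => a * - S (k + 1)%nat (- pt_t z)));
            [reflexivity|intros; ring|]. apply hasD_scal, thD.
        * exists (fun z => 0 * S 0%nat (- pt_t z)). split; [exists 0%nat, 0; reflexivity|].
          apply (hasD_ext d (fun z => a * S k (- pt_t z)) (fun z => a * 0));
            [reflexivity|intros; ring|]. apply hasD_scal, thD; assumption.
    - exists 0%nat, 1. extensionality z. unfold theta. ring. }
  assert (Hth : heat theta = fun z => - S 1%nat (- pt_t z)).
  { extensionality z. unfold heat, theta.
    rewrite (hasD_pd _ _ _ (proj1 (thD 0%nat))).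
    rewrite (hasD_pd _ _ _ (proj2 (thD 0%nat) D1 ltac:(discriminate))).
    rewrite (hasD_pd _ _ _ (proj2 (thD 0%nat) D2 ltac:(discriminate))).
    rewrite (hasD_pd _ _ _ (proj2 (thD 0%nat) D3 ltac:(discriminate))).
    rewrite !pd_const. simpl. ring. }
  assert (Smono : forall x y, x <= y -> S 0%nat y <= S 0%nat x).
  { intros x y Hxy. destruct (MVT_gen (S 0%nat) x y (S 1%nat)) as [xi [_ E]].
    - intros; apply Sd.
    - intros; apply Sc.
    - specialize (Sn xi). nra. }
  assert (cpos : forall x, 0 <= x -> 0 <= c 0%nat x).
  { intros x Hx. unfold c. simpl. specialize (Smono x (4 * x) ltac:(lra)). lra. }
  assert (Kpos : forall z, 0 <= K z).
  { intros z. unfold K, es. destruct (Rle_lt_dec (pt_t z) 0) as [Ht|Ht]; [rewrite Em_nonpos by assumption; lra|].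
    rewrite Em_pos by assumption. apply Rmult_le_pos.
    - apply Rmult_le_pos; [apply pow_le, Rlt_le, Rinv_0_lt_compat, sqrt_lt_R0; assumption|apply Rlt_le, exp_pos].
    - apply cpos. pose proof (n2_ge0 z). lra. }
  assert (hpos : forall z, 0 <= heat theta z) by (intros z; rewrite Hth; specialize (Sn (- pt_t z)); lra).
  assert (CKs : forall s, 0 < s -> 0 <= conv (ker 3 K s) (heat theta) origin).
  { intros s Hs. apply conv_ge_0; [apply ker_Cc; assumption|apply heat_cont4; assumption| |assumption].
    intros z. apply Rmult_le_pos; [apply Rlt_le, Rinv_0_lt_compat, pow_lt; assumption|apply Kpos]. }
  set (kap := conv (ker 3 K 1) (heat theta) origin).
  assert (Hkap : 0 < kap).
  { unfold kap, conv. apply (Int4_pos Phi _ (mkpt (- (5 / 8)) 0 0 0) Hok).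
    - apply Cc_conv_integrand; [apply ker_Cc; try assumption; lra|apply heat_cont4; assumption].
    - intros w. apply Rmult_le_pos; [|apply hpos]. unfold ker. rewrite pow1, Rinv_1, Rmult_1_l. apply Kpos.
    - apply Rmult_lt_0_compat.
      + unfold ker. rewrite pow1, Rinv_1, Rmult_1_l.
        replace (aff origin (dil 1) (psub origin (mkpt (- (5 / 8)) 0 0 0))) with (mkpt (5 / 8) 0 0 0)
          by (apply pt_ext; intros []; simpl; ring).
        unfold K, es. simpl. rewrite Em_pos by lra. apply Rmult_lt_0_compat.
        * apply Rmult_lt_0_compat; [apply pow_lt, Rinv_0_lt_compat, sqrt_lt_R0; lra|apply exp_pos].
        * replace (n2 (mkpt (5 / 8) 0 0 0)) with 0 by (unfold n2; simpl; ring). rewrite Rplus_0_r.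
          unfold c. simpl. rewrite (S0 (4 * (5 / 8))) by lra.
          assert (0 < S 0%nat (5 / 8)); [|lra].
          assert (Hge : 0 <= S 0%nat (5 / 8)) by (rewrite <- (S0 (7 / 8)) by lra; apply Smono; lra).
          (* If [S 0] vanished at 5/8 it would vanish beyond it by monotonicity, against the
             strictly negative derivative there. *)
          destruct Hge as [Hge|Hge]; [assumption|exfalso].
          pose proof (Sd 0%nat (5 / 8)) as Dd. apply is_derive_Reals in Dd. simpl in Dd.
          destruct (Dd (- S 1%nat (5 / 8)) ltac:(lra)) as [r Hr].
          assert (0 < Rmin (r / 2) (1 / 8)) by (apply Rmin_pos; [pose proof (cond_pos r); lra|lra]).
          pose proof (Rmin_l (r / 2) (1 / 8)). pose proof (Rmin_r (r / 2) (1 / 8)). pose proof (cond_pos r).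
          set (h := Rmin (r / 2) (1 / 8)) in *.
          specialize (Hr h ltac:(lra) ltac:(rewrite Rabs_pos_eq; lra)).
          rewrite <- Hge in Hr.
          assert (E0 : S 0%nat (5 / 8 + h) = 0).
          { apply Rle_antisym; [rewrite Hge; apply Smono; lra|].
            rewrite <- (S0 (7 / 8)) by lra. apply Smono; lra. }
          rewrite E0 in Hr. replace ((0 - 0) / h - S 1%nat (5 / 8)) with (- S 1%nat (5 / 8)) in Hr by (field; lra).
          rewrite Rabs_pos_eq in Hr by lra. lra.
      + rewrite Hth. simpl. rewrite Ropp_involutive. lra. }
  (* Every increment is nonnegative, and the one between the scales 1 and 1/2 equals [kap]. *)
  assert (Tele : forall n m, conv (ker 5 eta (1 / 2 ^ Datatypes.S n)) theta origin - conv (ker 5 eta (2 ^ m)) theta origin >= kap).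
  { intros n m.
    assert (Up : forall m, conv (ker 5 eta 1) theta origin >= conv (ker 5 eta (2 ^ m)) theta origin).
    { induction m0; [simpl; lra|].
      pose proof (parametrix_telescope K eta theta (2 ^ Datatypes.S m0) origin Par (pow2_pos _) Sth) as E.
      replace (2 ^ Datatypes.S m0 / 2) with (2 ^ m0) in E by (simpl; field).
      specialize (CKs (2 ^ Datatypes.S m0) (pow2_pos _)). lra. }
    assert (Dn : forall n, conv (ker 5 eta (1 / 2 ^ Datatypes.S n)) theta origin - conv (ker 5 eta 1) theta origin >= kap).
    { induction n0.
      - pose proof (parametrix_telescope K eta theta 1 origin Par Rlt_0_1 Sth) as E.
        simpl. rewrite Rmult_1_r. fold kap in E. lra.
      - assert (P : 0 < 1 / 2 ^ Datatypes.S n0) by (apply Rdiv_lt_0_compat; [lra|apply pow2_pos]).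
        pose proof (parametrix_telescope K eta theta _ origin Par P Sth) as E.
        replace (1 / 2 ^ Datatypes.S n0 / 2) with (1 / 2 ^ Datatypes.S (Datatypes.S n0)) in E by (simpl; field; apply pow_nonzero; lra).
        specialize (CKs _ P). lra. }
    specialize (Up m). specialize (Dn n). lra. }
  assert (Ce := psupp1_Cc eta Se Pe). destruct (Cc_bounded eta Ce) as [B [HB Hb]].
  (* At scale 1/2 the kernel sees only times from -1/4 to 0, where [theta] is 1. *)
  assert (Csm : conv (ker 5 eta (1 / 2 ^ Datatypes.S 0)) theta origin = Int4 eta).
  { assert (P : 0 < 1 / 2 ^ Datatypes.S 0) by (simpl; lra).
    rewrite <- (Int4_ker5 eta _ P Se Pe).
    rewrite conv_comm by (left; split; [apply ker_Cc; assumption|apply Smooth_cont4; assumption]).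
    unfold conv. f_equal. extensionality w.
    destruct (Req_dec (ker 5 eta (1 / 2 ^ Datatypes.S 0) w) 0) as [E|E]; [rewrite E; ring|].
    apply (ker_psupp 5 eta _ P Pe) in E. destruct E as [E _]. simpl in E.
    unfold theta. simpl. rewrite S1 by nra. ring. }
  (* At a large scale [s] the integrand lives on a time interval of length 1 instead of [s^2], so
     the average is of order [s^(-5) s^3]. *)
  assert (Clg : forall m, Rabs (conv (ker 5 eta (2 ^ m)) theta origin) <= 8 * B / 2 ^ m).
  { intros m. assert (P := pow2_pos m).
    rewrite conv_comm by (left; split; [apply ker_Cc; assumption|apply Smooth_cont4; assumption]).
    assert (M1 : 1 <= 2 ^ m) by (apply pow_R1_Rle; lra).
    set (s := 2 ^ m) in *.
    apply Rle_trans with (/ s ^ 5 * B * (2 * (1 / 2)) * (2 * s) * (2 * s) * (2 * s)).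
    - apply (Int4_bound_box _ (/ s ^ 5 * B) (mkpt (1 / 2) 0 0 0) (mkpt (1 / 2) s s s)).
      + apply cont4_mult; [apply cont4_psub_r, Smooth_cont4; assumption|apply Smooth_cont4, ker_Smooth; assumption].
      + apply Rmult_le_pos; [apply Rlt_le, Rinv_0_lt_compat, pow_lt; assumption|assumption].
      + intros []; simpl; lra.
      + intros w. rewrite Rabs_mult. rewrite <- (Rmult_1_l (/ s ^ 5 * B)).
        apply Rmult_le_compat; try apply Rabs_pos.
        * unfold theta. assert (0 <= S 0%nat (- pt_t (psub origin w)) <= 1); [|rewrite Rabs_pos_eq; lra].
          set (x := - pt_t (psub origin w)). clearbody x. split.
          -- destruct (Rle_lt_dec x (7 / 8)) as [Hx|Hx]; [rewrite <- (S0 (7 / 8)) by lra; apply Smono; assumption|rewrite S0; lra].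
          -- destruct (Rle_lt_dec (3 / 8) x) as [Hx|Hx]; [rewrite <- (S1 (3 / 8)) by lra; apply Smono; assumption|rewrite S1; lra].
        * unfold ker. rewrite Rabs_mult.
          rewrite (Rabs_pos_eq (/ s ^ 5)) by (apply Rlt_le, Rinv_0_lt_compat, pow_lt; assumption).
          apply Rmult_le_compat_l; [apply Rlt_le, Rinv_0_lt_compat, pow_lt; assumption|apply Hb].
      + intros w d Hd. destruct (Req_dec (ker 5 eta s w) 0) as [E|E]; [rewrite E; ring|].
        apply (ker_psupp 5 eta s P Pe) in E. destruct E as [E0 [E1 [E2 E3]]].
        simpl in E0, E1, E2, E3. destruct d; simpl in Hd; try lra.
        unfold theta. rewrite S0; [ring|]. simpl.
        apply Rnot_lt_le; intros Hlt. apply Rlt_not_le in Hd; apply Hd. apply Rabs_le_between. lra.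
    - replace (/ s ^ 5 * B * (2 * (1 / 2)) * (2 * s) * (2 * s) * (2 * s)) with (8 * B / s * / s) by (field; lra).
      assert (0 <= 8 * B / s) by (apply Rle_div_r; lra).
      assert (/ s <= 1) by (rewrite <- Rinv_1; apply Rinv_le_contravar; lra).
      assert (0 < / s) by (apply Rinv_0_lt_compat; assumption). nra. }
  apply Rlt_le_trans with kap; [assumption|].
  apply Rle_pow2 with (8 * B); [lra|]. intros m.
  specialize (Tele 0%nat m). rewrite Csm in Tele. specialize (Clg m). apply Rabs_le_between in Clg. lra.
Qed.

(** * Kernel estimates *)

Fixpoint bnd (n : nat) (B : R) (k : pt -> R) : Prop :=
  (forall z, Rabs (k z) <= B) /\
  match n with O => True | S n => forall d, bnd n B (pd d k) end.

Lemma bnd_le (n : nat) (B B' : R) (k : pt -> R) : B <= B' -> bnd n B k -> bnd n B' k.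
Proof.
  intros HB. revert k. induction n; intros k [H1 H2]; split; auto.
  - intros z; specialize (H1 z); lra.
  - intros z; specialize (H1 z); lra.
Qed.

Lemma bnd_exists (n : nat) (k : pt -> R) : Smooth k -> Cc k -> exists B, 0 <= B /\ bnd n B k.
Proof.
  revert k. induction n; intros k Hk Hc; destruct (Cc_bounded k Hc) as [B [HB Hb]].
  - exists B; split; [assumption|split; [assumption|trivial]].
  - assert (X : forall d, exists B, 0 <= B /\ bnd n B (pd d k))
      by (intros d; apply IHn; [apply Smooth_pd|apply Cc_pd]; assumption).
    destruct (X Dt) as [B0 [P0 Q0]], (X D1) as [B1 [P1 Q1]], (X D2) as [B2 [P2 Q2]], (X D3) as [B3 [P3 Q3]].
    exists (B + B0 + B1 + B2 + B3); split; [lra|]. split.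
    + intros z; specialize (Hb z); lra.
    + intros []; [apply bnd_le with B0|apply bnd_le with B1|apply bnd_le with B2|apply bnd_le with B3];
        try assumption; lra.
Qed.

Lemma pd_ker (d : dir) (n : nat) (k : pt -> R) (s : R) : Smooth k ->
  pd d (ker n k s) = fun z => crd d (dil (/ s)) * ker n (pd d k) s z.
Proof.
  intros Hk. unfold ker.
  rewrite (pd_scal d _ (fun z => k (aff origin (dil (/ s)) z))) by (apply Smooth_aff; assumption).
  rewrite pd_aff by assumption. extensionality z. ring.
Qed.

Lemma ker_le (n : nat) (k : pt -> R) (s B : R) (z : pt) : 0 < s -> (forall z, Rabs (k z) <= B) ->
  Rabs (ker n k s z) <= B / s ^ n.
Proof.
  intros Hs H. unfold ker. assert (P : 0 < / s ^ n) by (apply Rinv_0_lt_compat, pow_lt; assumption).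
  rewrite Rabs_mult, (Rabs_pos_eq (/ s ^ n)) by lra. unfold Rdiv. rewrite Rmult_comm.
  apply Rmult_le_compat_r; [lra|apply H].
Qed.

Lemma pd_pd_ker (d d' : dir) (n : nat) (k : pt -> R) (s : R) : Smooth k ->
  pd d (pd d' (ker n k s)) = fun z => crd d (dil (/ s)) * crd d' (dil (/ s)) * ker n (pd d (pd d' k)) s z.
Proof.
  intros Hk. rewrite (pd_ker d') by assumption.
  rewrite (pd_scal d _ (ker n (pd d' k) s)) by (apply ker_Smooth, Smooth_pd; assumption).
  rewrite pd_ker by (apply Smooth_pd; assumption). extensionality z. ring.
Qed.

Lemma crd_dil_x (d : dir) (l : R) : d <> Dt -> crd d (dil l) = l.
Proof. destruct d; intros H; [congruence| | |]; reflexivity. Qed.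

Lemma ker_D2bound (n : nat) (k : pt -> R) (s B : R) (w : pt) : 0 < s -> Smooth k -> bnd 2 B k ->
  D2bound (ker n k s) (B / s ^ (n + 2)) w.
Proof.
  intros Hs Hk [_ H]. assert (P : 0 < / s) by (apply Rinv_0_lt_compat; assumption).
  assert (E : B / s ^ (n + 2) = (/ s) ^ 2 * (B / s ^ n)).
  { rewrite pow_add. field. repeat split; try apply pow_nonzero; lra. }
  rewrite E. split.
  - rewrite pd_ker by assumption. cbn [crd dil pt_t]. rewrite Rabs_mult, (Rabs_pos_eq ((/ s) ^ 2)) by (apply pow_le; lra).
    apply Rmult_le_compat_l; [apply pow_le; lra|]. apply ker_le; [assumption|]. apply (H Dt).
  - intros d d' Hd Hd'. rewrite pd_pd_ker, !crd_dil_x by assumption.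
    replace (/ s * / s) with ((/ s) ^ 2) by ring.
    rewrite Rabs_mult, (Rabs_pos_eq ((/ s) ^ 2)) by (apply pow_le; lra).
    apply Rmult_le_compat_l; [apply pow_le; lra|]. apply ker_le; [assumption|]. apply (H d').
Qed.

(** The Taylor remainder with the increment [h] fixed and the base point as variable: in this form
    it is itself a kernel that can be convolved. *)
Definition Tk (F : pt -> R) (h w : pt) : R := F (padd w h) - F w - dot3 (grad F w) h.

Definition sd (F : pt -> R) (h w : pt) : R := F (psub w h) + F (psub w (xrefl h)) - 2 * F w.

Definition pball (r : R) (h : pt) : Prop :=
  Rabs (pt_t h) <= r ^ 2 /\ Rabs (pt_x1 h) <= r /\ Rabs (pt_x2 h) <= r /\ Rabs (pt_x3 h) <= r.

Lemma Tk_le (F : pt -> R) (A r : R) (h w : pt) : Smooth F -> 0 <= A -> 0 <= r ->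
  (forall w, D2bound F A w) -> pball r h -> Rabs (Tk F h w) <= 7 * A * r ^ 2.
Proof.
  intros HF HA Hr HB [H0 [H1 [H2 H3]]]. apply taylor_parabolic; try assumption. intros w' _; apply HB.
Qed.

Lemma past_pball (r : R) (h : pt) : past r h origin -> pball r h.
Proof.
  intros [H0 [H1 [H2 H3]]]. simpl in *. rewrite !Rminus_0_r in *.
  repeat split; try assumption. rewrite Rabs_pos_eq; simpl; lra.
Qed.

Lemma sd_le (F : pt -> R) (A r : R) (h w : pt) : Smooth F -> 0 <= A -> 0 <= r ->
  (forall w, D2bound F A w) -> pball r h -> Rabs (sd F h w) <= 14 * A * r ^ 2.
Proof.
  intros HF HA Hr HB [H0 [H1 [H2 H3]]].
  set (g := mkpt (- pt_t h) (- pt_x1 h) (- pt_x2 h) (- pt_x3 h)).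
  set (g' := mkpt (- pt_t h) (pt_x1 h) (pt_x2 h) (pt_x3 h)).
  assert (B1 : pball r g) by (unfold pball, g; simpl; rewrite !Rabs_Ropp; auto).
  assert (B2 : pball r g') by (unfold pball, g'; simpl; rewrite !Rabs_Ropp; auto).
  pose proof (Tk_le F A r g w HF HA Hr HB B1) as T1. pose proof (Tk_le F A r g' w HF HA Hr HB B2) as T2.
  unfold Tk in T1, T2.
  replace (padd w g) with (psub w h) in T1 by (apply pt_ext; intros []; simpl; ring).
  replace (padd w g') with (psub w (xrefl h)) in T2 by (apply pt_ext; intros []; simpl; ring).
  unfold sd. unfold dot3 in T1, T2. simpl in T1, T2.
  apply Rabs_le_between in T1. apply Rabs_le_between in T2. apply Rabs_le_between. simpl. lra.
Qed.

Definition one4 : pt := mkpt 1 1 1 1.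

Lemma psub_one (w h : pt) : psub w h = aff (psub origin h) one4 w.
Proof. apply pt_ext; intros []; simpl; ring. Qed.

Lemma padd_one (w h : pt) : padd w h = aff h one4 w.
Proof. apply pt_ext; intros []; simpl; ring. Qed.

Lemma sd_Smooth (F : pt -> R) (h : pt) : Smooth F -> Smooth (sd F h).
Proof.
  intros HF. apply Smooth_minus; [apply Smooth_plus|apply Smooth_scal; assumption].
  - apply (Smooth_ext (fun w => F (aff (psub origin h) one4 w))); [intros; rewrite <- psub_one; reflexivity|].
    apply Smooth_aff; assumption.
  - apply (Smooth_ext (fun w => F (aff (psub origin (xrefl h)) one4 w))); [intros; rewrite <- psub_one; reflexivity|].
    apply Smooth_aff; assumption.
Qed.

Lemma pd_sd (d : dir) (F : pt -> R) (h : pt) : Smooth F -> pd d (sd F h) = sd (pd d F) h.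
Proof.
  intros HF. apply hasD_pd.
  assert (X : forall g, hasD d (fun w => F (psub w g)) (fun w => pd d F (psub w g))).
  { intros g. apply (hasD_ext d (fun w => F (aff (psub origin g) one4 w))
      (fun w => crd d one4 * pd d F (aff (psub origin g) one4 w))).
    - intros; rewrite <- psub_one; reflexivity.
    - intros; rewrite <- psub_one. destruct d; cbn [crd one4 pt_t pt_x1 pt_x2 pt_x3]; ring.
    - apply hasD_aff, Smooth_hasD; assumption. }
  apply (hasD_ext d (fun w => (F (psub w h) + F (psub w (xrefl h))) + (-2) * F w)
    (fun w => (pd d F (psub w h) + pd d F (psub w (xrefl h))) + (-2) * pd d F w)).
  - intros; unfold sd; ring.
  - intros; unfold sd; ring.
  - apply hasD_plus; [apply hasD_plus; apply X|apply hasD_scal, Smooth_hasD; assumption].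
Qed.

Lemma Tk_Smooth (F : pt -> R) (h : pt) : Smooth F -> Smooth (Tk F h).
Proof.
  intros HF. apply Smooth_minus; [apply Smooth_minus; [|assumption]|].
  - apply (Smooth_ext (fun w => F (aff h one4 w))); [intros; rewrite <- padd_one; reflexivity|].
    apply Smooth_aff; assumption.
  - unfold dot3, grad; simpl. repeat apply Smooth_plus; apply Smooth_mult;
      try apply Smooth_const; apply Smooth_pd; assumption.
Qed.

(** Both operations combine translations and derivatives, so they commute. This allows a quadratic
    gain in each of the two increments, at the price of four derivatives. *)
Lemma sd_Tk (F : pt -> R) (h g w : pt) : Smooth F -> sd (Tk F h) g w = Tk (sd F g) h w.
Proof.
  intros HF. unfold Tk at 2. unfold dot3, grad; cbn [pt_x1 pt_x2 pt_x3].
  rewrite !pd_sd by assumption. unfold sd, Tk, dot3, grad; cbn [pt_x1 pt_x2 pt_x3].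
  replace (padd (psub w g) h) with (psub (padd w h) g) by (apply pt_ext; intros []; simpl; ring).
  replace (padd (psub w (xrefl g)) h) with (psub (padd w h) (xrefl g)) by (apply pt_ext; intros []; simpl; ring).
  ring.
Qed.

Lemma sdiff_of_D2 (k : pt -> R) (A T : R) : Smooth k -> 0 <= A -> 0 < T -> (forall w, D2bound k A w) ->
  sdiff_bound k (7 * A * T ^ 2) T.
Proof.
  intros Hk HA HT HB z h r Hr Hh.
  pose proof (sd_le k A r h z Hk HA Hr HB (past_pball r h Hh)) as X. unfold sd in X.
  replace (2 * (7 * A * T ^ 2) * (r / T) ^ 2) with (14 * A * r ^ 2) by (field; lra). exact X.
Qed.

(** This is [kernel_swap] with [a = 1]; a factor 7 comes from the Taylor bound, and
    [5376 = 24 * 7 * 2^5]. *)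
Lemma conv_ker_est (Phi k f : pt -> R) (n : nat) (B s H : R) (z : pt) : kernel_ok Phi ->
  0 < s -> Smooth k -> psupp 1 k -> 0 <= B -> bnd 2 B k -> cont4 f ->
  (forall s' w, 0 < s' <= s -> past (2 * s) z w -> Rabs (moll Phi s' f w) <= H / root8 s' ^ 9) ->
  Rabs (conv (ker n k s) f z) <= 5376 * B * (s ^ 5 / s ^ n) * (H / root8 s ^ 9).
Proof.
  intros Hok Hs Hk Hp HB Hb Hf HH.
  assert (Pn : 0 < s ^ n) by (apply pow_lt; assumption).
  assert (Bn : 0 <= B / s ^ n) by (apply Rle_div_r; lra).
  replace (5376 * B * (s ^ 5 / s ^ n) * (H / root8 s ^ 9)) with
    (24 * (7 * (B / s ^ n)) * ((1 + 1) * s) ^ 5 * (H / root8 s ^ 9)).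
  2: { assert (0 < root8 s) by (apply root8_pos; assumption). field. repeat split; first [lra|apply pow_nonzero; lra]. }
  apply kernel_swap with (Phi := Phi); try assumption.
  - lra.
  - apply ker_Cc; assumption.
  - rewrite Rmult_1_l. apply ker_psupp; assumption.
  - intros w. apply Rle_trans with (B / s ^ n); [apply ker_le; [assumption|apply Hb]|lra].
  - replace (7 * (B / s ^ n)) with (7 * (B / s ^ (n + 2)) * s ^ 2)
      by (rewrite pow_add; field; repeat split; first [lra|apply pow_nonzero; lra]).
    apply sdiff_of_D2; [apply ker_Smooth; assumption| |assumption|intros w; apply ker_D2bound; assumption].
    apply Rle_div_r; [apply pow_lt; assumption|lra].
Qed.

Lemma D2bound_sd (F : pt -> R) (A r : R) (g : pt) : Smooth F -> 0 <= A -> 0 <= r ->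
  (forall w, D2bound (pd Dt F) A w) ->
  (forall d d' w, d <> Dt -> d' <> Dt -> D2bound (pd d (pd d' F)) A w) -> pball r g ->
  forall w, D2bound (sd F g) (14 * A * r ^ 2) w.
Proof.
  intros HF HA Hr H1 H2 Hg w. split.
  - rewrite pd_sd by assumption. apply sd_le; try assumption. apply Smooth_pd; assumption.
  - intros d d' Hd Hd'. rewrite pd_sd by assumption. rewrite pd_sd by (apply Smooth_pd; assumption).
    apply sd_le; try assumption; [apply Smooth_pd, Smooth_pd; assumption|].
    intros w'. apply H2; assumption.
Qed.

Lemma ker_D2D2 (k : pt -> R) (n : nat) (s B : R) : 0 < s -> Smooth k -> 0 <= B -> bnd 4 B k ->
  (forall w, D2bound (pd Dt (ker n k s)) (B / s ^ (n + 4)) w) /\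
  (forall d d' w, d <> Dt -> d' <> Dt -> D2bound (pd d (pd d' (ker n k s))) (B / s ^ (n + 4)) w).
Proof.
  intros Hs Hk HB Hb. assert (P : 0 < / s) by (apply Rinv_0_lt_compat; assumption).
  assert (E : B / s ^ (n + 4) = (/ s) ^ 2 * (B / s ^ (n + 2))).
  { rewrite !pow_add. field. repeat split; try apply pow_nonzero; lra. }
  assert (X : forall j w, Smooth j -> bnd 2 B j -> D2bound (fun z => (/ s) ^ 2 * ker n j s z) (B / s ^ (n + 4)) w).
  { intros j w Hj Bj. destruct (ker_D2bound n j s B w Hs Hj Bj) as [D0 Dx]. rewrite E. split.
    - rewrite (pd_scal Dt _ (ker n j s)) by (apply ker_Smooth; assumption).
      rewrite Rabs_mult, (Rabs_pos_eq ((/ s) ^ 2)) by (apply pow_le; lra).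
      apply Rmult_le_compat_l; [apply pow_le; lra|assumption].
    - intros d d' Hd Hd'. rewrite (pd_scal d' _ (ker n j s)) by (apply ker_Smooth; assumption).
      rewrite (pd_scal d _ (pd d' (ker n j s))) by (apply Smooth_pd, ker_Smooth; assumption).
      rewrite Rabs_mult, (Rabs_pos_eq ((/ s) ^ 2)) by (apply pow_le; lra).
      apply Rmult_le_compat_l; [apply pow_le; lra|]. apply Dx; assumption. }
  destruct Hb as [_ Hb]. split.
  - intros w. rewrite pd_ker by assumption. apply (X (pd Dt k) w); [apply Smooth_pd; assumption|].
    destruct (Hb Dt) as [h0 h1]. split; [assumption|]. intros d. destruct (h1 d) as [h2 h3]. split; [assumption|].
    intros d'. destruct (h3 d') as [h4 _]. split; [assumption|trivial].
  - intros d d' w Hd Hd'. rewrite pd_pd_ker, !crd_dil_x by assumption.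
    replace (/ s * / s) with ((/ s) ^ 2) by ring.
    apply (X (pd d (pd d' k)) w); [apply Smooth_pd, Smooth_pd; assumption|].
    destruct (Hb d') as [_ h]. exact (h d).
Qed.

Lemma not_past_open (r : R) (z c : pt) : ~ past r z c ->
  exists e, 0 < e /\ forall w, near e z w -> ~ past r w c.
Proof.
  intros H. apply NNPP; intros Hn. apply H.
  assert (X : forall e, 0 < e -> exists w, near e z w /\ past r w c).
  { intros e He. apply NNPP; intros Hne. apply Hn. exists e; split; [assumption|].
    intros w Nw Pw. apply Hne. exists w; auto. }
  assert (Ab : forall a b : R, (forall e, 0 < e -> a <= b + e) -> a <= b) by (intros; apply le_epsilon; assumption).
  assert (Y : forall e, 0 < e -> 0 <= pt_t z - pt_t c + e /\ pt_t z - pt_t c <= r ^ 2 + e /\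
     Rabs (pt_x1 z - pt_x1 c) <= r + e /\ Rabs (pt_x2 z - pt_x2 c) <= r + e /\ Rabs (pt_x3 z - pt_x3 c) <= r + e).
  { intros e He. destruct (X e He) as [w [Nw [P0 [P1 [P2 P3]]]]].
    generalize (Nw Dt) (Nw D1) (Nw D2) (Nw D3); cbn [crd]. intros N0 N1 N2 N3.
    apply Rabs_lt_between in N0. apply Rabs_lt_between in N1. apply Rabs_lt_between in N2. apply Rabs_lt_between in N3.
    apply Rabs_le_between in P1. apply Rabs_le_between in P2. apply Rabs_le_between in P3.
    split; [lra|split; [lra|]]. repeat split; apply Rabs_le_between; lra. }
  repeat split; apply Ab; intros e He; specialize (Y e He); lra.
Qed.

Lemma psupp_pd (d : dir) (k : pt -> R) (r : R) : Smooth k -> psupp r k -> psupp r (pd d k).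
Proof.
  intros Hk Hp z Hz. apply NNPP; intros Hn. apply Hz.
  destruct (not_past_open r z origin Hn) as [e [He Hw]].
  apply (uniqueness_limite (fun s => k (shift z d s)) 0); [apply Smooth_hasD; assumption|].
  intros e' He'. exists (mkposreal e He). intros h H0 Hh. simpl in Hh.
  assert (Z : forall s, Rabs s < e -> k (shift z d s) = 0).
  { intros s Hs. apply NNPP; intros Hk0. apply (Hw (shift z d s)); [|apply Hp; assumption].
    intros d'. eapply Rle_lt_trans; [apply crd_shift|assumption]. }
  rewrite Rplus_0_l, !Z by (try rewrite Rabs_R0; assumption).
  replace ((0 - 0) / h - 0) with 0 by (field; assumption). rewrite Rabs_R0; assumption.
Qed.

(** The kernel is now the Taylor remainder of [ker 3 K s], of size [dd^2 / s^5]; its second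
    differences gain a further [(r/s)^2]. With support radius [2 * s] and a second-difference factor
    [7 * 14 / 2 = 49], the constant is [24 * 49 * 3^5]. *)
Lemma conv_taylor_est (Phi K f : pt -> R) (B s dd H : R) (x y : pt) : kernel_ok Phi ->
  0 < s -> Smooth K -> psupp 1 K -> 0 <= B -> bnd 4 B K -> cont4 f -> 0 <= dd <= s -> past dd x y ->
  (forall s' w, 0 < s' <= s -> past (3 * s) x w -> Rabs (moll Phi s' f w) <= H / root8 s' ^ 9) ->
  Rabs (conv (Tk (ker 3 K s) (psub y x)) f x) <= 285768 * B * dd ^ 2 * (H / root8 s ^ 9).
Proof.
  intros Hok Hs HK Hp HB Hb Hf Hd Hxy HH.
  set (F := ker 3 K s). set (h := psub y x).
  assert (SF : Smooth F) by (apply ker_Smooth; assumption).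
  assert (P5 : 0 < s ^ 5) by (apply pow_lt; assumption).
  assert (P7 : 0 < s ^ 7) by (apply pow_lt; assumption).
  assert (B5 : 0 <= B / s ^ 5) by (apply Rle_div_r; lra).
  assert (B7 : 0 <= B / s ^ 7) by (apply Rle_div_r; lra).
  assert (Hh : pball dd h).
  { destruct Hxy as [H0 [H1 [H2 H3]]]. unfold h, pball; cbn [psub pt_t pt_x1 pt_x2 pt_x3].
    rewrite (Rabs_minus_sym (pt_t y)), (Rabs_minus_sym (pt_x1 y)), (Rabs_minus_sym (pt_x2 y)), (Rabs_minus_sym (pt_x3 y)).
    rewrite (Rabs_pos_eq (pt_t x - pt_t y)) by lra. repeat split; lra. }
  assert (DF : forall w, D2bound F (B / s ^ 5) w).
  { intros w. apply (ker_D2bound 3 K s B w Hs HK). 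
    destruct Hb as [h0 h1]. split; [assumption|]. intros d. destruct (h1 d) as [h2 h3]. split; [assumption|].
    intros d'. destruct (h3 d') as [h4 _]. split; [assumption|trivial]. }
  destruct (ker_D2D2 K 3 s B Hs HK HB Hb) as [D4 D4'].
  replace (285768 * B * dd ^ 2 * (H / root8 s ^ 9)) with
    (24 * (49 * (B / s ^ 5) * dd ^ 2) * ((2 + 1) * s) ^ 5 * (H / root8 s ^ 9)).
  2: { assert (0 < root8 s) by (apply root8_pos; assumption). field. lra. }
  pose proof (pow2_ge_0 dd) as Pd.
  assert (PF : psupp s F) by (apply ker_psupp; assumption).
  (* The increment [h] points into the past, so the translated copy of the kernel reaches at most
     [dd] further back than [s]. *)
  assert (PT : psupp (2 * s) (Tk F h)).
  { intros w Hw.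
    destruct (classic (past s w origin)) as [Hp1|Hp1]; [apply past_le with s; [lra|assumption]|].
    assert (E1 : F w = 0) by (apply NNPP; intros E; apply Hp1, PF; assumption).
    assert (E2 : forall d, pd d F w = 0)
      by (intros d; apply NNPP; intros E; apply Hp1, (psupp_pd d F s SF PF); assumption).
    assert (E3 : F (padd w h) <> 0).
    { intros E3. apply Hw. unfold Tk, dot3, grad; cbn [pt_x1 pt_x2 pt_x3]. rewrite E1, E3, !E2. ring. }
    apply PF in E3.
    assert (T1 : past dd w (padd w h)).
    { destruct Hxy as [H0 [H1 [H2 H3]]]. unfold h, past; simpl.
      replace (pt_t w - (pt_t w + (pt_t y - pt_t x))) with (pt_t x - pt_t y) by ring.
      replace (pt_x1 w - (pt_x1 w + (pt_x1 y - pt_x1 x))) with (pt_x1 x - pt_x1 y) by ring.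
      replace (pt_x2 w - (pt_x2 w + (pt_x2 y - pt_x2 x))) with (pt_x2 x - pt_x2 y) by ring.
      replace (pt_x3 w - (pt_x3 w + (pt_x3 y - pt_x3 x))) with (pt_x3 x - pt_x3 y) by ring.
      simpl in H0. tauto. }
    apply past_le with (dd + s); [lra|]. apply past_trans with (padd w h); try assumption; lra. }
  apply kernel_swap with (Phi := Phi); try assumption.
  - lra.
  - apply psupp_Cc with (2 * s); [lra|apply Smooth_cont4, Tk_Smooth; assumption|assumption].
  - intros w. apply Rle_trans with (7 * (B / s ^ 5) * dd ^ 2).
    + apply Tk_le; try assumption; lra.
    + nra.
  - intros z g r Hr Hg.
    change (Rabs (sd (Tk F h) g z) <= 2 * (49 * (B / s ^ 5) * dd ^ 2) * (r / s) ^ 2).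
    rewrite sd_Tk by assumption.
    replace (2 * (49 * (B / s ^ 5) * dd ^ 2) * (r / s) ^ 2) with (7 * (14 * (B / s ^ 7) * r ^ 2) * dd ^ 2)
      by (field; lra).
    apply Tk_le; [apply sd_Smooth; assumption| |lra| |assumption].
    + apply Rmult_le_pos; [lra|apply pow2_ge_0].
    + apply D2bound_sd; try assumption. apply past_pball; assumption.
  - replace ((2 + 1) * s) with (3 * s) by ring. assumption.
Qed.

(** * A Schauder estimate for germs *)

Definition Rem (g : pt -> R) (x y : pt) : R := g y - g x - dot3 (grad g x) (psub y x).

Lemma Rem_minus (f g : pt -> R) (x y : pt) : Smooth f -> Smooth g ->
  Rem (fun z => f z - g z) x y = Rem f x y - Rem g x y.
Proof.
  intros Hf Hg. unfold Rem, dot3, grad; cbn [pt_x1 pt_x2 pt_x3].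
  assert (X : forall d, pd d (fun z => f z - g z) = fun z => pd d f z + (-1) * pd d g z).
  { intros d. apply hasD_pd. apply (hasD_ext d (fun z => f z + (-1) * g z) (fun z => pd d f z + (-1) * pd d g z)).
    - intros; ring.
    - reflexivity.
    - apply hasD_plus; [|apply hasD_scal]; apply Smooth_hasD; assumption. }
  rewrite !X. ring.
Qed.

(** The square of the smaller of [a/b] and [b/a]: the size of the contribution of scale [b] to an
    increment at distance [a], both measured by eighth roots. *)
Definition mk (a b : R) : R := if Rle_dec a b then (a / b) ^ 2 else (b / a) ^ 2.

(** The scales fall geometrically, so the contributions decay on both sides of the one comparable
    with [a], and their sum is bounded independently of [a] and of the starting scale. *)
Lemma two_sided_geom : exists C, 0 <= C /\ forall (a b0 M : R) (e : nat -> R) (n : nat),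
  0 < a -> 0 < b0 -> 0 <= M ->
  (forall k, Rabs (e (S k) - e k) <= M * mk a (b0 / root8 2 ^ k)) -> Rabs (e n - e 0%nat) <= M * C.
Proof.
  pose proof root8_2 as Q. set (t := root8 2) in *.
  set (c := / (t ^ 2 - 1)). assert (Ht : 0 < t ^ 2 - 1) by nra.
  assert (Hc : 0 < c) by (apply Rinv_0_lt_compat; assumption).
  assert (Ec : c * t ^ 2 = c + 1) by (unfold c; field; lra).
  exists (2 * c + 2); split; [lra|]. intros a b0 M e n Ha Hb0 HM H.
  set (b := fun k : nat => b0 / t ^ k).
  assert (bp : forall k, 0 < b k) by (intros k; apply Rdiv_lt_0_compat; [assumption|apply pow_lt; lra]).
  assert (bS : forall k, b k = t * b (S k)) by (intros k; unfold b; simpl; field; repeat split; first [lra|apply pow_nonzero; lra]).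
  (* Explicit partial sums: increasing like [(a / b n)^2] until the scale passes [a], then a
     constant minus the remaining tail. The choice of [c] gives [c t^2 = c + 1], which makes both
     inductions exact. *)
  assert (Inv : (a <= b n -> Rabs (e n - e 0%nat) <= M * (c * (a / b n) ^ 2)) /\
                (b n < a -> Rabs (e n - e 0%nat) <= M * (2 * c + 2 - (c + 1) * (b n / a) ^ 2))).
  { assert (sq1 : forall x, 0 <= x <= 1 -> 0 <= x ^ 2 <= 1) by (intros; nra).
    induction n as [|n [IH1 IH2]].
    - rewrite Rminus_diag, Rabs_R0. split; intros Hx.
      + apply Rmult_le_pos; [assumption|]. apply Rmult_le_pos; [lra|apply pow2_ge_0].
      + apply Rmult_le_pos; [assumption|].
        assert (0 <= b 0%nat / a <= 1) by (specialize (bp 0%nat); split; [apply Rle_div_r|apply Rle_div_l]; lra).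
        specialize (sq1 _ H0). nra.
    - assert (Tri : Rabs (e (S n) - e 0%nat) <= Rabs (e n - e 0%nat) + M * mk a (b n)).
      { replace (e (S n) - e 0%nat) with ((e (S n) - e n) + (e n - e 0%nat)) by ring.
        eapply Rle_trans; [apply Rabs_triang|]. specialize (H n). fold t in H. fold (b n) in H. lra. }
      pose proof (bp n) as B1. pose proof (bp (S n)) as B2. pose proof (bS n) as B3.
      assert (Hdec : b (S n) < b n) by (rewrite B3; nra).
      split; intros Hx.
      + assert (Hy : a <= b n) by lra. specialize (IH1 Hy).
        unfold mk in Tri. destruct (Rle_dec a (b n)); [|lra].
        eapply Rle_trans; [exact Tri|].
        apply Rle_trans with (M * (c * (a / b n) ^ 2) + M * (a / b n) ^ 2); [lra|].
        right. rewrite B3. rewrite <- Rmult_plus_distr_l. f_equal.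
        replace (c * (a / (t * b (S n))) ^ 2 + (a / (t * b (S n))) ^ 2) with ((c + 1) * (a / (t * b (S n))) ^ 2) by ring.
        rewrite <- Ec. field. lra.
      + assert (R1 : 0 <= b (S n) / a <= 1) by (split; [apply Rle_div_r|apply Rle_div_l]; lra).
        destruct (Rle_lt_dec a (b n)) as [Hy|Hy].
        * specialize (IH1 Hy). unfold mk in Tri. destruct (Rle_dec a (b n)); [|lra].
          assert (R2 : 0 <= a / b n <= 1) by (split; [apply Rle_div_r|apply Rle_div_l]; lra).
          apply sq1 in R1. apply sq1 in R2.
          eapply Rle_trans; [exact Tri|].
          apply Rle_trans with (M * ((c + 1) * (a / b n) ^ 2)); [lra|].
          apply Rmult_le_compat_l; [assumption|]. nra.
        * specialize (IH2 Hy). unfold mk in Tri. destruct (Rle_dec a (b n)); [lra|].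
          eapply Rle_trans; [exact Tri|].
          apply Rle_trans with (M * (2 * c + 2 - (c + 1) * (b n / a) ^ 2 + (b n / a) ^ 2)); [lra|].
          apply Rmult_le_compat_l; [assumption|].
          assert (E : (b n / a) ^ 2 = t ^ 2 * (b (S n) / a) ^ 2) by (rewrite B3; field; lra).
          rewrite E. pose proof (pow2_ge_0 (b (S n) / a)).
          replace (2 * c + 2 - (c + 1) * (t ^ 2 * (b (S n) / a) ^ 2) + t ^ 2 * (b (S n) / a) ^ 2)
            with (2 * c + 2 - (c * t ^ 2) * (b (S n) / a) ^ 2) by ring.
          rewrite Ec. lra. }
  destruct (Rle_lt_dec a (b n)) as [Hy|Hy].
  - eapply Rle_trans; [apply (proj1 Inv Hy)|]. apply Rmult_le_compat_l; [assumption|].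
    assert (0 <= a / b n <= 1) by (specialize (bp n); split; [apply Rle_div_r|apply Rle_div_l]; lra).
    assert ((a / b n) ^ 2 <= 1) by nra. nra.
  - eapply Rle_trans; [apply (proj2 Inv Hy)|]. apply Rmult_le_compat_l; [assumption|].
    pose proof (pow2_ge_0 (b n / a)). nra.
Qed.

(** Translations and spatial derivatives commute with convolution, so the Taylor remainder moves
    onto the kernel. *)
Lemma Rem_conv_Tk (F f : pt -> R) (x y : pt) : Smooth F -> Cc F -> cont4 f ->
  Rem (conv F f) x y = conv (Tk F (psub y x)) f x.
Proof.
  intros SF CF Cf. set (h := psub y x).
  assert (Cp : Cc (fun w => F (padd w h))).
  { destruct (Cc_aff F h one4) as [X _]; [intros []; simpl; lra|assumption|].
    replace (fun w => F (padd w h)) with (fun z => F (aff h one4 z)); [assumption|].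
    extensionality w. rewrite padd_one; reflexivity. }
  assert (Cd : forall d, Cc (pd d F)) by (intros; apply Cc_pd; assumption).
  assert (Cs : forall c d, Cc (fun w => c * pd d F w)) by (intros; apply (Cc_mult_r (fun _ => c)); [apply cont4_const|apply Cd]).
  assert (Cadd : forall g k, Cc g -> Cc k -> Cc (fun w => g w + k w)).
  { intros g k Hg Hk. replace (fun w => g w + k w) with (fun w => 1 * g w + 1 * k w) by (extensionality w; ring).
    apply Cc_lin; assumption. }
  assert (Cm : forall g k, Cc g -> Cc k -> Cc (fun w => g w - k w)).
  { intros g k Hg Hk. replace (fun w => g w - k w) with (fun w => 1 * g w + (-1) * k w) by (extensionality w; ring).
    apply Cc_lin; assumption. }
  replace (Tk F h) with (fun w => (F (padd w h) - F w) -
    ((pt_x1 h * pd D1 F w + pt_x2 h * pd D2 F w) + pt_x3 h * pd D3 F w))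
    by (extensionality w; unfold Tk, dot3, grad; cbn [pt_x1 pt_x2 pt_x3]; ring).
  rewrite conv_minus_l; [|apply Cm; assumption|apply Cadd; [apply Cadd|]; apply Cs|assumption].
  rewrite conv_minus_l by assumption.
  rewrite conv_plus_l; [|apply Cadd; apply Cs|apply Cs|assumption].
  rewrite conv_plus_l; [|apply Cs|apply Cs|assumption].
  rewrite !conv_scal_l by (try assumption; apply Cd).
  unfold Rem, dot3, grad; cbn [pt_x1 pt_x2 pt_x3].
  rewrite !(fun d => hasD_pd _ _ _ (conv_pd d F f SF Cf (or_introl CF))). fold h.
  replace (conv (fun w => F (padd w h)) f x) with (conv F f y); [ring|].
  unfold conv. f_equal. extensionality w. f_equal. f_equal.
  apply pt_ext; intros []; unfold h; simpl; ring.
Qed.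

Lemma eta_cv (eta g : pt -> R) (z : pt) (e : R) : Smooth eta -> psupp 1 eta -> cont4 g -> 0 < e ->
  exists s0, 0 < s0 /\ forall s, 0 < s <= s0 -> Rabs (conv (ker 5 eta s) g z - Int4 eta * g z) <= e.
Proof.
  intros Se Pe Cg He. destruct (Cc_bounded eta (psupp1_Cc eta Se Pe)) as [B [HB Hb]].
  set (e' := e / (8 * (B + 1))). assert (He' : 0 < e') by (apply Rdiv_lt_0_compat; lra).
  destruct (inbox_ex z) as [N [HN Hz]].
  destruct (cont4_unif_box g N e' Cg He') as [r [Hr Hu]].
  exists (Rmin 1 (r / 2)); split; [apply Rmin_pos; lra|]. intros s Hs.
  pose proof (Rmin_l 1 (r / 2)). pose proof (Rmin_r 1 (r / 2)).
  assert (Ck := ker_Cc 5 eta s (proj1 Hs) Se Pe).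
  assert (E : conv (ker 5 eta s) g z - Int4 eta * g z = conv (ker 5 eta s) (fun w => g w - g z) z).
  { rewrite conv_minus_r by (try assumption; apply cont4_const). rewrite conv_one by assumption.
    rewrite (Int4_ker5 eta s (proj1 Hs) Se Pe). ring. }
  rewrite E. apply Rle_trans with (8 * (B / s ^ 5) * e' * s ^ 5).
  - apply conv_bound; [lra|apply Ck|apply ker_psupp; [lra|assumption]|apply cont4_minus; [assumption|apply cont4_const]| |].
    + intros w. apply ker_le; [lra|assumption].
    + intros w Hw. apply Hu; [assumption|]. intros d. apply Rle_lt_trans with (r / 2); [|lra].
      apply (past_crd s); [lra|nra|assumption].
  - replace (8 * (B / s ^ 5) * e' * s ^ 5) with (8 * B * e') by (field; lra).
    apply Rle_trans with (8 * (B + 1) * e'); [nra|]. unfold e'. right. field. lra.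
Qed.

Lemma conv_pd_r (d : dir) (k U : pt -> R) : Smooth k -> Cc k -> Smooth U ->
  pd d (conv k U) = conv k (pd d U).
Proof.
  intros Sk Ck SU.
  replace (conv k U) with (conv U k) by (extensionality w; apply conv_comm; right; split; [apply Smooth_cont4|]; assumption).
  rewrite (hasD_pd _ _ _ (conv_pd d U k SU (Smooth_cont4 _ Sk) (or_intror Ck))).
  extensionality w. apply conv_comm. right; split; [apply Smooth_cont4, Smooth_pd|]; assumption.
Qed.

Lemma root8_4 (x : R) : 0 <= x -> root8 (4 * x) ^ 3 <= 2 * root8 x ^ 3.
Proof.
  intros Hx. replace (4 * x) with (2 * (2 * x)) by ring. rewrite !root8_mult by lra.
  pose proof root8_2. replace ((root8 2 * (root8 2 * root8 x)) ^ 3) with (root8 2 ^ 6 * root8 x ^ 3) by ring.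
  apply Rmult_le_compat_r; [apply pow_le, root8_ge0|].
  apply Rle_trans with ((11 / 10) ^ 6); [apply pow_incr; lra|lra].
Qed.

(** Averages of [U] at scales [s] and [s / 2] differ by [ker 3 K s] tested against [heat U]. With
    [a], [b] the eighth roots of the distance and of [s], scales above the distance give
    [a^16 / b^6] by Taylor expansion; below it, the values give [b^7 a^3] and the gradient
    [b^2 a^8]. All are [a^10] times at least the square of a ratio below 1, because 5/4 lies
    strictly between 1 and 2. *)
Lemma schauder (Phi K eta : pt -> R) : kernel_ok Phi -> parametrix K eta -> 0 < Int4 eta ->
  exists C, 0 <= C /\ forall (U : pt -> R) (x : pt) (sg : R), Smooth U -> 0 <= sg ->
    (forall w, past 1 x w -> Rabs (U w) <= sg) ->
    (forall s w, 0 < s <= 1 / 8 -> past 1 x w ->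
       Rabs (moll Phi s (heat U) w) <= sg * (root8 s ^ 3 + root8 (pdist x w) ^ 3) / root8 s ^ 9) ->
    forall y, past (1 / 8) x y -> Rabs (Rem U x y) <= C * sg * root8 (pdist x y) ^ 10.
Proof.
  intros Hok Par Hc. pose proof Par as [SK [Se [PK [Pe _]]]].
  destruct (bnd_exists 4 K SK (psupp1_Cc K SK PK)) as [B1 [HB1 Hb1]].
  destruct (bnd_exists 4 eta Se (psupp1_Cc eta Se Pe)) as [B2 [HB2 Hb2]].
  set (B := B1 + B2). assert (HB : 0 <= B) by (unfold B; lra).
  assert (HbK : bnd 4 B K) by (apply bnd_le with B1; [unfold B; lra|assumption]).
  assert (Hbe : bnd 4 B eta) by (apply bnd_le with B2; [unfold B; lra|assumption]).
  assert (b42 : forall k, bnd 4 B k -> bnd 2 B k).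
  { intros k [h0 h1]. split; [assumption|]. intros d. destruct (h1 d) as [h2 h3]. split; [assumption|].
    intros d'. destruct (h3 d') as [h4 _]. split; [assumption|trivial]. }
  assert (b4d : forall k d, bnd 4 B k -> bnd 2 B (pd d k)).
  { intros k d [h0 h1]. destruct (h1 d) as [h2 h3]. split; [assumption|]. intros d'.
    destruct (h3 d') as [h4 h5]. split; [assumption|]. intros d2. destruct (h5 d2) as [h6 _]. split; [assumption|trivial]. }
  destruct two_sided_geom as [C2 [HC2 Geo]].
  exists ((3584 * B + 1000000 * B * C2) / Int4 eta). split.
  { apply Rle_div_r; [assumption|]. nra. }
  intros U x sg SU Hsg HU Hf y Hy.
  set (d := pdist x y).
  assert (Hd0 : 0 <= d) by apply pdist_pos.
  assert (Hyp := proj1 (past_pdist (1 / 8) x y ltac:(lra)) Hy). destruct Hyp as [Hyt Hyd]. fold d in Hyd.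
  assert (Hpd : past d x y) by (apply past_pdist; [assumption|split; [assumption|unfold d; lra]]).
  destruct Hd0 as [Hd0|Hd0].
  2: { assert (E : y = x).
       { rewrite <- Hd0 in Hpd. destruct Hpd as [P0 [P1 [P2 P3]]]. simpl in P0. rewrite Rmult_0_l in P0.
         apply Rabs_le_between in P1. apply Rabs_le_between in P2. apply Rabs_le_between in P3.
         apply pt_ext; intros []; simpl; lra. }
       rewrite E. unfold Rem, dot3; cbn [psub pt_x1 pt_x2 pt_x3]. rewrite !Rminus_diag.
       match goal with |- Rabs ?q <= _ => replace q with 0 by ring end. rewrite Rabs_R0.
       apply Rmult_le_pos; [apply Rmult_le_pos; [apply Rle_div_r; [assumption|nra]|assumption]|].
       apply pow_le, root8_ge0. }
  set (f := heat U) in *. assert (Cf : cont4 f) by (apply heat_cont4; assumption).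
  set (a := root8 d). assert (Ha : 0 < a) by (apply root8_pos; assumption).
  assert (Ed : d = a ^ 8) by (unfold a; rewrite root8_pow; lra).
  assert (Ha1 : a <= 1) by (apply root8_le1; lra).
  assert (HP10 : 0 <= a ^ 10) by (apply pow_le; lra).
  set (s := fun k : nat => 1 / 8 / 2 ^ k).
  assert (sp : forall k, 0 < s k) by (intros k; apply Rdiv_lt_0_compat; [lra|apply pow2_pos]).
  assert (s1 : forall k, s k <= 1 / 8).
  { intros k. apply Rle_div_l; [apply pow2_pos|]. assert (1 <= 2 ^ k) by (apply pow_R1_Rle; lra). lra. }
  set (e := fun k => Rem (conv (ker 5 eta (s k)) U) x y).
  (* The constant covers both regimes: [3 * 285768] above the distance, and five terms of size
     [3 * 5376] below it. *)
  assert (Inc : forall k, Rabs (e (S k) - e k) <= (1000000 * B * sg * a ^ 10) * mk a (root8 (1 / 8) / root8 2 ^ k)).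
  { intros k. rewrite <- root8_half by lra. fold (s k).
    assert (Se5 : forall k, Smooth (conv (ker 5 eta (s k)) U)).
    { intros j. apply conv_Smooth; [apply ker_Smooth; assumption|apply Smooth_cont4; assumption|].
      left; apply ker_Cc; auto. }
    assert (E : e (S k) - e k = Rem (conv (ker 3 K (s k)) f) x y).
    { unfold e. rewrite <- Rem_minus by apply Se5. f_equal. extensionality z.
      unfold f. rewrite (parametrix_telescope K eta U (s k) z Par (sp k) SU).
      replace (s (S k)) with (s k / 2); [reflexivity|]. unfold s. simpl. field. apply pow_nonzero; lra. }
    rewrite E. specialize (sp k). specialize (s1 k). set (sk := s k) in *.
    set (b := root8 sk). assert (Hb : 0 < b) by (apply root8_pos; assumption).
    assert (Es : sk = b ^ 8) by (unfold b; rewrite root8_pow; lra).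
    assert (CK : Cc (ker 3 K sk)) by (apply ker_Cc; assumption).
    assert (SKs : Smooth (ker 3 K sk)) by (apply ker_Smooth; assumption).
    (* Within [3 * sk] of [x] the weight in the distance is at most twice that of the scale, hence
       the factor 3. *)
    assert (Hx : forall rr, 0 <= rr -> rr <= 3 * sk -> forall s' w, 0 < s' <= sk -> past rr x w -> Rabs (moll Phi s' f w) <= (3 * sg * b ^ 3) / root8 s' ^ 9).
    { intros rr Hr0 Hrr s' w Hs' Hw.
      assert (Pw : pdist x w <= rr) by (apply (proj1 (past_pdist rr x w Hr0) Hw)).
      pose proof (root8_pos s' (proj1 Hs')) as Qs.
      eapply Rle_trans; [apply Hf; [lra|]|].
      - apply past_le with rr; [lra|assumption].
      - apply Rmult_le_compat_r; [apply Rlt_le, Rinv_0_lt_compat, pow_lt; assumption|].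
        assert (root8 s' ^ 3 <= b ^ 3) by (apply pow_incr; split; [lra|apply root8_le; lra]).
        assert (root8 (pdist x w) ^ 3 <= 2 * b ^ 3).
        { apply Rle_trans with (root8 (4 * sk) ^ 3); [|apply root8_4; lra].
          apply pow_incr; split; [apply root8_ge0|apply root8_le; lra]. }
        replace (3 * sg * b ^ 3) with (sg * (b ^ 3 + 2 * b ^ 3)) by ring.
        apply Rmult_le_compat_l; [assumption|lra]. }
    unfold mk. destruct (Rle_dec a b) as [Hab|Hab].
    - assert (Hds : d <= sk) by (rewrite Ed, Es; apply pow_incr; lra).
      rewrite Rem_conv_Tk by assumption.
      eapply Rle_trans; [apply (conv_taylor_est Phi K f B sk d (3 * sg * b ^ 3) x y); try assumption; try lra|].
      + apply Hx; lra.
      + fold b. rewrite Ed.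
        replace (285768 * B * (a ^ 8) ^ 2 * (3 * sg * b ^ 3 / b ^ 9)) with
          (857304 * B * sg * a ^ 10 * ((a / b) ^ 2 * (a / b) ^ 4)) by (field; lra).
        assert (R1 : 0 <= a / b <= 1) by (split; [apply Rle_div_r|apply Rle_div_l]; lra).
        assert (R4 : 0 <= (a / b) ^ 4 <= 1).
        { split; [apply pow_le; lra|]. rewrite <- (pow1 4). apply pow_incr; lra. }
        pose proof (pow2_ge_0 (a / b)) as R2.
        assert (0 <= B * sg) by (apply Rmult_le_pos; assumption).
        assert (0 <= B * sg * a ^ 10) by (apply Rmult_le_pos; assumption).
        assert ((a / b) ^ 2 * (a / b) ^ 4 <= (a / b) ^ 2) by nra.
        apply Rle_trans with (857304 * B * sg * a ^ 10 * (a / b) ^ 2); [|nra].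
        apply Rmult_le_compat_l; [nra|assumption].
    (* Below the distance there is no cancellation: value at [y], value at [x] and gradient are
       bounded separately. The gradient decays slowest, like [(b / a)^2], and dictates the square in
       [mk]. *)
    - apply Rnot_le_lt in Hab.
      assert (Hds : sk <= d) by (rewrite Ed, Es; apply pow_incr; lra).
      assert (R1 : 0 <= b / a <= 1) by (split; [apply Rle_div_r|apply Rle_div_l]; lra).
      assert (HY : Rabs (conv (ker 3 K sk) f y) <= 16128 * B * sg * a ^ 10 * (b / a) ^ 2).
      { eapply Rle_trans; [apply (conv_ker_est Phi K f 3 B sk (3 * sg * a ^ 3) y); try assumption; [apply b42; assumption|]|].
        - intros s' w Hs' Hw.
          assert (Pxw : past (d + 2 * sk) x w) by (apply past_trans with y; try assumption; lra).
          assert (Pw : pdist x w <= d + 2 * sk) by (apply (proj1 (past_pdist (d + 2 * sk) x w ltac:(lra)) Pxw)).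
          pose proof (root8_pos s' (proj1 Hs')) as Qs.
          eapply Rle_trans; [apply Hf; [lra|]|].
          + apply past_le with (d + 2 * sk); [lra|assumption].
          + apply Rmult_le_compat_r; [apply Rlt_le, Rinv_0_lt_compat, pow_lt; assumption|].
            assert (root8 s' ^ 3 <= a ^ 3) by (apply pow_incr; split; [lra|apply root8_le; lra]).
            assert (root8 (pdist x w) ^ 3 <= 2 * a ^ 3).
            { apply Rle_trans with (root8 (4 * d) ^ 3); [|apply root8_4; lra].
              apply pow_incr; split; [apply root8_ge0|apply root8_le; lra]. }
            replace (3 * sg * a ^ 3) with (sg * (a ^ 3 + 2 * a ^ 3)) by ring.
            apply Rmult_le_compat_l; [assumption|lra].
        - fold b. rewrite Es.
          replace (5376 * B * ((b ^ 8) ^ 5 / (b ^ 8) ^ 3) * (3 * sg * a ^ 3 / b ^ 9)) with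
            (16128 * B * sg * a ^ 10 * ((b / a) ^ 2 * (b / a) ^ 5)) by (field; lra).
          assert (0 <= (b / a) ^ 5 <= 1).
          { split; [apply pow_le; lra|]. rewrite <- (pow1 5). apply pow_incr; lra. }
          pose proof (pow2_ge_0 (b / a)). apply Rmult_le_compat_l; [|nra].
          apply Rmult_le_pos; [nra|assumption]. }
      assert (HX : Rabs (conv (ker 3 K sk) f x) <= 16128 * B * sg * a ^ 10 * (b / a) ^ 2).
      { eapply Rle_trans; [apply (conv_ker_est Phi K f 3 B sk (3 * sg * b ^ 3) x); try assumption;
          [apply b42; assumption|apply Hx; lra]|].
        fold b. rewrite Es.
        replace (5376 * B * ((b ^ 8) ^ 5 / (b ^ 8) ^ 3) * (3 * sg * b ^ 3 / b ^ 9)) with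
          (16128 * B * sg * a ^ 10 * ((b / a) ^ 2 * (b / a) ^ 8)) by (field; lra).
        assert (0 <= (b / a) ^ 8 <= 1).
        { split; [apply pow_le; lra|]. rewrite <- (pow1 8). apply pow_incr; lra. }
        pose proof (pow2_ge_0 (b / a)). apply Rmult_le_compat_l; [|nra].
        apply Rmult_le_pos; [nra|assumption]. }
      assert (HD : forall dd, dd <> Dt -> Rabs (conv (pd dd (ker 3 K sk)) f x) <= 16128 * B * sg * b ^ 2).
      { intros dd Hdd. rewrite pd_ker, crd_dil_x by assumption.
        replace (fun z => / sk * ker 3 (pd dd K) sk z) with (ker 4 (pd dd K) sk)
          by (extensionality z; unfold ker; field; lra).
        eapply Rle_trans; [apply (conv_ker_est Phi (pd dd K) f 4 B sk (3 * sg * b ^ 3) x); try assumption|].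
        - apply Smooth_pd; assumption.
        - apply psupp_pd; assumption.
        - apply b4d; assumption.
        - apply Hx; lra.
        - fold b. rewrite Es. right. field. lra. }
      unfold Rem, dot3, grad; cbn [pt_x1 pt_x2 pt_x3 psub].
      rewrite !(fun d => hasD_pd _ _ _ (conv_pd d (ker 3 K sk) f SKs Cf (or_introl CK))).
      destruct Hpd as [_ [P1 [P2 P3]]].
      assert (HM : forall dd hh, dd <> Dt -> Rabs hh <= d ->
         Rabs (conv (pd dd (ker 3 K sk)) f x * hh) <= 16128 * B * sg * a ^ 10 * (b / a) ^ 2).
      { intros dd hh Hdd Hh. rewrite Rabs_mult.
        replace (16128 * B * sg * a ^ 10 * (b / a) ^ 2) with ((16128 * B * sg * b ^ 2) * d) by (rewrite Ed; field; lra).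
        apply Rmult_le_compat; try apply Rabs_pos; [apply HD; assumption|assumption]. }
      pose proof (HM D1 (pt_x1 y - pt_x1 x) ltac:(discriminate) ltac:(rewrite Rabs_minus_sym; assumption)) as M1.
      pose proof (HM D2 (pt_x2 y - pt_x2 x) ltac:(discriminate) ltac:(rewrite Rabs_minus_sym; assumption)) as M2.
      pose proof (HM D3 (pt_x3 y - pt_x3 x) ltac:(discriminate) ltac:(rewrite Rabs_minus_sym; assumption)) as M3.
      assert (0 <= B * sg * a ^ 10 * (b / a) ^ 2)
        by (apply Rmult_le_pos; [apply Rmult_le_pos; [apply Rmult_le_pos|]; assumption|apply pow2_ge_0]).
      apply Rabs_le_between in HY. apply Rabs_le_between in HX. apply Rabs_le_between in M1.
      apply Rabs_le_between in M2. apply Rabs_le_between in M3. apply Rabs_le_between. lra. }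
  (* At the coarsest scale 1/8 all derivatives fall on the kernel, so second derivatives are at most
     [8 * 8^2 * B * sg], and [7 * 512 = 3584]. *)
  assert (E0 : Rabs (e 0%nat) <= 3584 * B * sg * a ^ 10).
  { unfold e. set (F := conv (ker 5 eta (s 0%nat)) U).
    assert (Hs0 : s 0%nat = 1 / 8) by (unfold s; simpl; field).
    assert (SE := ker_Smooth 5 eta (s 0%nat) Se). assert (CE := ker_Cc 5 eta (s 0%nat) (sp 0%nat) Se Pe).
    assert (CU := Smooth_cont4 U SU).
    assert (SF : Smooth F) by (apply conv_Smooth; [assumption|assumption|left; assumption]).
    unfold Rem. replace y with (padd x (psub y x)) at 1 by (apply pt_ext; intros []; simpl; ring).
    apply Rle_trans with (7 * (512 * B * sg) * d ^ 2).
    - destruct Hpd as [P0 [P1 [P2 P3]]].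
      apply taylor_parabolic; [assumption|nra| |lra| | | |]; cbn [psub pt_t pt_x1 pt_x2 pt_x3];
        try (rewrite Rabs_minus_sym; assumption).
      2: { rewrite Rabs_minus_sym, Rabs_pos_eq; lra. }
      intros w Hw.
      assert (Pxw : past d x w).
      { destruct (Hw Dt) as [l0 [L0 W0]], (Hw D1) as [l1 [L1 W1]], (Hw D2) as [l2 [L2 W2]], (Hw D3) as [l3 [L3 W3]].
        simpl in W0, W1, W2, W3. unfold past. rewrite W0, W1, W2, W3.
        replace (pt_t x - (pt_t x + l0 * (pt_t y - pt_t x))) with (l0 * (pt_t x - pt_t y)) by ring.
        replace (pt_x1 x - (pt_x1 x + l1 * (pt_x1 y - pt_x1 x))) with (l1 * (pt_x1 x - pt_x1 y)) by ring.
        replace (pt_x2 x - (pt_x2 x + l2 * (pt_x2 y - pt_x2 x))) with (l2 * (pt_x2 x - pt_x2 y)) by ring.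
        replace (pt_x3 x - (pt_x3 x + l3 * (pt_x3 y - pt_x3 x))) with (l3 * (pt_x3 x - pt_x3 y)) by ring.
        pose proof (lam_abs l1 (pt_x1 x - pt_x1 y) L1). pose proof (lam_abs l2 (pt_x2 x - pt_x2 y) L2).
        pose proof (lam_abs l3 (pt_x3 x - pt_x3 y) L3). repeat split; try lra; nra. }
      assert (CB : forall k, Smooth k -> psupp (s 0%nat) k -> (forall z, Rabs (k z) <= B / s 0%nat ^ 7) ->
         Rabs (conv k U w) <= 512 * B * sg).
      { intros k Sk Pk Bk. eapply Rle_trans; [apply (conv_bound k U (s 0%nat) (B / s 0%nat ^ 7) sg w)|].
        - specialize (sp 0%nat); lra.
        - apply Smooth_cont4; assumption.
        - assumption.
        - assumption.
        - assumption.
        - intros w' Hw'. apply HU. apply past_le with (d + s 0%nat); [rewrite Hs0; lra|].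
          apply past_trans with w; try assumption; [lra|]. specialize (sp 0%nat); lra.
        - rewrite Hs0. right. field. }
      pose proof (fun w => ker_D2bound 5 eta (s 0%nat) B w (sp 0%nat) Se (b42 eta Hbe)) as D2.
      assert (PE := ker_psupp 5 eta (s 0%nat) (sp 0%nat) Pe).
      split.
      + unfold F. rewrite (hasD_pd _ _ _ (conv_pd Dt (ker 5 eta (s 0%nat)) U SE CU (or_introl CE))).
        apply CB; [apply Smooth_pd; assumption|apply psupp_pd; assumption|apply D2].
      + intros d1 d2 Hd1 Hd2. unfold F.
        rewrite (hasD_pd _ _ _ (conv_pd d2 (ker 5 eta (s 0%nat)) U SE CU (or_introl CE))).
        rewrite (hasD_pd _ _ _ (conv_pd d1 (pd d2 (ker 5 eta (s 0%nat))) U (Smooth_pd _ d2 SE) CU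
          (or_introl (Cc_pd d2 _ SE CE)))).
        apply CB; [apply Smooth_pd, Smooth_pd; assumption|apply psupp_pd; [apply Smooth_pd|apply psupp_pd]; assumption|].
        intros z. apply D2; assumption.
    - rewrite Ed. replace (7 * (512 * B * sg) * (a ^ 8) ^ 2) with (3584 * B * sg * (a ^ 10 * a ^ 6)) by ring.
      assert (0 <= a ^ 6 <= 1) by (split; [apply pow_le; lra|rewrite <- (pow1 6); apply pow_incr; lra]).
      apply Rmult_le_compat_l; [apply Rmult_le_pos; [nra|assumption]|nra]. }
  assert (En : forall n, Rabs (e n) <= (3584 * B + 1000000 * B * C2) * sg * a ^ 10).
  { intros n. assert (Q4 : 0 < root8 (1 / 8)) by (apply root8_pos; lra).
    assert (M0 : 0 <= 1000000 * B * sg * a ^ 10) by (apply Rmult_le_pos; [apply Rmult_le_pos; nra|assumption]).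
    pose proof (Geo a (root8 (1 / 8)) _ e n Ha Q4 M0 Inc) as G.
    apply Rabs_le_between in G. apply Rabs_le_between in E0. apply Rabs_le_between. lra. }
  (* As the scale tends to 0, the averages of [U] and of its gradient tend to [Int4 eta] times their
     values; the five limits share the error [ep]. *)
  assert (Lim : Rabs (Int4 eta * Rem U x y) <= (3584 * B + 1000000 * B * C2) * sg * a ^ 10).
  { apply le_epsilon. intros ep Hep. assert (Hep' : 0 < ep / 5) by lra.
    assert (CU := Smooth_cont4 U SU).
    destruct (eta_cv eta U y (ep / 5) Se Pe CU Hep') as [t1 [T1 G1]].
    destruct (eta_cv eta U x (ep / 5) Se Pe CU Hep') as [t2 [T2 G2]].
    assert (CD : forall d, cont4 (pd d U)) by (intros; apply Smooth_cont4, Smooth_pd; assumption).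
    destruct (eta_cv eta (pd D1 U) x (ep / 5) Se Pe (CD D1) Hep') as [t3 [T3 G3]].
    destruct (eta_cv eta (pd D2 U) x (ep / 5) Se Pe (CD D2) Hep') as [t4 [T4 G4]].
    destruct (eta_cv eta (pd D3 U) x (ep / 5) Se Pe (CD D3) Hep') as [t5 [T5 G5]].
    assert (Pt : 0 < Rmin (Rmin t1 t2) (Rmin t3 (Rmin t4 t5))) by (repeat apply Rmin_pos; assumption).
    destruct (small_pow2 (1 / 8) _ ltac:(lra) Pt) as [n Hn]. fold (s n) in Hn.
    pose proof (Rmin_l (Rmin t1 t2) (Rmin t3 (Rmin t4 t5))). pose proof (Rmin_r (Rmin t1 t2) (Rmin t3 (Rmin t4 t5))).
    pose proof (Rmin_l t1 t2). pose proof (Rmin_r t1 t2). pose proof (Rmin_l t3 (Rmin t4 t5)).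
    pose proof (Rmin_r t3 (Rmin t4 t5)). pose proof (Rmin_l t4 t5). pose proof (Rmin_r t4 t5).
    specialize (sp n). specialize (En n).
    specialize (G1 (s n) ltac:(lra)). specialize (G2 (s n) ltac:(lra)). specialize (G3 (s n) ltac:(lra)).
    specialize (G4 (s n) ltac:(lra)). specialize (G5 (s n) ltac:(lra)).
    unfold e, Rem, dot3, grad in En. cbn [pt_x1 pt_x2 pt_x3 psub] in En.
    rewrite !(fun d => conv_pd_r d (ker 5 eta (s n)) U (ker_Smooth 5 eta (s n) Se)
       (ker_Cc 5 eta (s n) sp Se Pe) SU) in En.
    unfold Rem, dot3, grad. cbn [pt_x1 pt_x2 pt_x3 psub].
    destruct Hpd as [_ [P1 [P2 P3]]].
    assert (HM : forall g c hh, Rabs (g - Int4 eta * c) <= ep / 5 -> Rabs hh <= d -> Rabs ((g - Int4 eta * c) * hh) <= ep / 5).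
    { intros g c hh Hg Hh. rewrite Rabs_mult. rewrite <- (Rmult_1_r (ep / 5)).
      apply Rmult_le_compat; try apply Rabs_pos; lra. }
    apply (HM _ _ (pt_x1 y - pt_x1 x)) in G3; [|rewrite Rabs_minus_sym; assumption].
    apply (HM _ _ (pt_x2 y - pt_x2 x)) in G4; [|rewrite Rabs_minus_sym; assumption].
    apply (HM _ _ (pt_x3 y - pt_x3 x)) in G5; [|rewrite Rabs_minus_sym; assumption].
    apply Rabs_le_between in G1. apply Rabs_le_between in G2. apply Rabs_le_between in G3.
    apply Rabs_le_between in G4. apply Rabs_le_between in G5. apply Rabs_le_between in En.
    apply Rabs_le_between. lra. }
  rewrite Rabs_mult, (Rabs_pos_eq (Int4 eta)) in Lim by lra. fold d. fold a.
  replace ((3584 * B + 1000000 * B * C2) / Int4 eta * sg * a ^ 10)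
    with ((3584 * B + 1000000 * B * C2) * sg * a ^ 10 / Int4 eta) by (field; lra).
  apply Rle_div_r; [assumption|]. lra.
Qed.

(** * Reconstruction of germs *)

Definition Om (r : R) (z : pt) : Prop :=
  - r ^ 2 <= pt_t z <= 0 /\ Rabs (pt_x1 z) <= r /\ Rabs (pt_x2 z) <= r /\ Rabs (pt_x3 z) <= r.

Lemma Om_past (r s : R) (z w : pt) : 0 <= r -> 0 <= s -> Om r z -> past s z w -> Om (r + s) w.
Proof.
  intros Hr Hs [Z0 [Z1 [Z2 Z3]]] [P0 [P1 [P2 P3]]].
  assert (0 <= r * s) by (apply Rmult_le_pos; assumption).
  apply Rabs_le_between in Z1. apply Rabs_le_between in Z2. apply Rabs_le_between in Z3.
  apply Rabs_le_between in P1. apply Rabs_le_between in P2. apply Rabs_le_between in P3.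
  split; [nra|]. repeat split; apply Rabs_le_between; lra.
Qed.

Lemma Om_le (r s : R) (z : pt) : 0 <= r <= s -> Om r z -> Om s z.
Proof. intros H [Z0 [Z1 [Z2 Z3]]]. split; [nra|]. repeat split; lra. Qed.

Lemma Om_inbox (r : R) (z : pt) : 0 <= r -> Om r z -> inbox (r + r ^ 2) z.
Proof.
  intros Hr [Z0 [Z1 [Z2 Z3]]]. assert (0 <= r ^ 2) by apply pow2_ge_0.
  intros []; simpl in *; try lra. apply Rabs_le_between; lra.
Qed.

(* germs in separated form: base point first, argument second *)
Definition gs (L : list ((pt -> R) * (pt -> R))) (x y : pt) : R :=
  fold_right (fun p acc => fst p x * snd p y + acc) 0 L.

Definition gcont (L : list ((pt -> R) * (pt -> R))) : Prop :=
  Forall (fun p => cont4 (fst p) /\ cont4 (snd p)) L.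

Lemma gs_cont_r (L : list ((pt -> R) * (pt -> R))) (x : pt) : gcont L -> cont4 (gs L x).
Proof.
  intros H. induction H as [|p L [H1 H2] _ IH]; simpl; [apply cont4_const|].
  apply cont4_plus; [apply cont4_scal; assumption|exact IH].
Qed.

Lemma gs_cont_diag (L : list ((pt -> R) * (pt -> R))) : gcont L -> cont4 (fun y => gs L y y).
Proof.
  intros H. induction H as [|p L [H1 H2] _ IH]; simpl; [apply cont4_const|].
  apply cont4_plus; [apply cont4_mult; assumption|exact IH].
Qed.

Section Recon.
Variable Phi : pt -> R.
Hypothesis Hok : kernel_ok Phi.

Lemma moll_plus (T : R) (f g : pt -> R) (z : pt) : 0 < T -> cont4 f -> cont4 g ->
  moll Phi T (fun w => f w + g w) z = moll Phi T f z + moll Phi T g z.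
Proof. intros HT Hf Hg. exact (conv_plus_r (Psi Phi T) f g z (proj1 (Psi_prob Phi Hok T HT)) Hf Hg). Qed.

Lemma moll_minus (T : R) (f g : pt -> R) (z : pt) : 0 < T -> cont4 f -> cont4 g ->
  moll Phi T (fun w => f w - g w) z = moll Phi T f z - moll Phi T g z.
Proof. intros HT Hf Hg. exact (conv_minus_r (Psi Phi T) f g z (proj1 (Psi_prob Phi Hok T HT)) Hf Hg). Qed.

Lemma moll_scal (T c : R) (f : pt -> R) (z : pt) : 0 < T -> cont4 f ->
  moll Phi T (fun w => c * f w) z = c * moll Phi T f z.
Proof. intros HT Hf. exact (conv_scal_r (Psi Phi T) f c z (proj1 (Psi_prob Phi Hok T HT)) Hf). Qed.

Lemma moll_gs (T : R) (L : list ((pt -> R) * (pt -> R))) (x z : pt) : 0 < T -> gcont L ->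
  moll Phi T (gs L x) z = fold_right (fun p acc => fst p x * moll Phi T (snd p) z + acc) 0 L.
Proof.
  intros HT H. induction H as [|p L [H1 H2] HL IH]; simpl.
  - unfold moll. apply Int4_ext0. intros w. unfold gs; simpl. ring.
  - change (gs (p :: L) x) with (fun w => (fun w => fst p x * snd p w) w + gs L x w).
    rewrite moll_plus; [|assumption|apply cont4_scal; assumption|apply gs_cont_r; assumption].
    rewrite moll_scal by assumption. rewrite IH. reflexivity.
Qed.

Lemma moll_gs_cv (L : list ((pt -> R) * (pt -> R))) (M e : R) : gcont L -> 0 < e ->
  exists T0, 0 < T0 /\ forall T, 0 < T <= T0 -> forall z, inbox M z ->
    Rabs (moll Phi T (gs L z) z - gs L z z) <= e.
Proof.
  intros H. revert e. induction H as [|p L [H1 H2] HL IH]; intros e He.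
  - exists 1; split; [lra|]. intros T HT z _. rewrite moll_gs by (try lra; constructor). simpl.
    unfold gs; simpl. rewrite Rminus_diag, Rabs_R0; lra.
  - destruct (IH (e / 2) ltac:(lra)) as [T1 [HT1 G1]].
    destruct (cont4_bounded_box (fst p) M H1) as [B [HB Hb]].
    destruct (moll_cv Phi Hok (snd p) M (e / (2 * (B + 1))) H2) as [T2 [HT2 G2]]; [apply Rdiv_lt_0_compat; lra|].
    exists (Rmin T1 T2); split; [apply Rmin_pos; assumption|]. intros T HT z Hz.
    pose proof (Rmin_l T1 T2). pose proof (Rmin_r T1 T2).
    specialize (G1 T ltac:(lra) z Hz). specialize (G2 T ltac:(lra) z Hz).
    rewrite moll_gs by (try lra; constructor; auto). rewrite moll_gs in G1 by (try lra; assumption). simpl.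
    assert (X : Rabs (fst p z * (moll Phi T (snd p) z - snd p z)) <= e / 2).
    { rewrite Rabs_mult. apply Rle_trans with (B * (e / (2 * (B + 1)))).
      - apply Rmult_le_compat; try apply Rabs_pos; auto.
      - apply Rle_trans with ((B + 1) * (e / (2 * (B + 1)))); [|right; field; lra].
        apply Rmult_le_compat_r; [apply Rlt_le, Rdiv_lt_0_compat; lra|lra]. }
    apply Rabs_le_between in X. apply Rabs_le_between in G1. apply Rabs_le_between. lra.
Qed.

(* With [e_t(z) = (W)_t(z) - (G_z)_t(z)], [W(y) = G_y(y)], one has
   [e_t = Phi_{t/2} * (e_{t/2} - (G_z - G_z')_{t/2}(z'))] and [e_t -> 0]. *)
Lemma reconstruction (L : list ((pt -> R) * (pt -> R))) (rho T Hc : R) : gcont L -> 0 < T -> T <= rho -> 0 <= Hc ->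
  (forall t z z', 0 < t <= T -> Om rho z -> past t z z' ->
     Rabs (moll Phi t (gs L z) z' - moll Phi t (gs L z') z') <= Hc * root8 t) ->
  forall z, Om (rho - T) z ->
    Rabs (moll Phi T (fun y => gs L y y) z - moll Phi T (gs L z) z) <= Hc / (root8 2 - 1) * root8 T.
Proof.
  intros HL HT HTr HH0 HD z Hz. set (W := fun y => gs L y y).
  assert (CW : cont4 W) by (apply gs_cont_diag; assumption).
  pose proof root8_2 as Q.
  apply le_epsilon. intros ep Hep. set (M := rho + rho ^ 2).
  destruct (moll_gs_cv L M (ep / 2) HL ltac:(lra)) as [T1 [HT1 G1]].
  destruct (moll_cv Phi Hok W M (ep / 2) CW ltac:(lra)) as [T2 [HT2 G2]].
  destruct (small_pow2 T (Rmin T1 T2) ltac:(lra) ltac:(apply Rmin_pos; assumption)) as [N HN].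
  pose proof (Rmin_l T1 T2). pose proof (Rmin_r T1 T2).
  assert (tp : forall n, 0 < T / 2 ^ n) by (intros; apply Rdiv_lt_0_compat; [assumption|apply pow2_pos]).
  assert (tT : forall n, T / 2 ^ n <= T).
  { intros n. apply Rle_div_l; [apply pow2_pos|]. assert (1 <= 2 ^ n) by (apply pow_R1_Rle; lra). nra. }
  (* Induction from the finest scale [N], where both terms are within [ep / 2] of the diagonal
     value. From [t / 2] to [t] the cost is [Hc * root8 (t / 2)], absorbed exactly because
     [root8 t = root8 2 * root8 (t / 2)]. The domain shrinks with the scale since the averages look
     into the past. *)
  assert (Claim : forall m n, (n + m = N)%nat -> forall z, Om (rho - T / 2 ^ n) z ->
    Rabs (moll Phi (T / 2 ^ n) W z - moll Phi (T / 2 ^ n) (gs L z) z) <= Hc / (root8 2 - 1) * root8 (T / 2 ^ n) + ep).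
  { induction m; intros n Hn w Hw.
    - assert (n = N) by lia; subst n.
      assert (Iw : inbox M w).
      { apply Om_inbox; [lra|]. apply Om_le with (rho - T / 2 ^ N); [|assumption].
        specialize (tp N); specialize (tT N); lra. }
      specialize (G1 (T / 2 ^ N) ltac:(specialize (tp N); lra) w Iw).
      specialize (G2 (T / 2 ^ N) ltac:(specialize (tp N); lra) w Iw). fold (W w) in G1.
      assert (0 <= Hc / (root8 2 - 1) * root8 (T / 2 ^ N)).
      { apply Rmult_le_pos; [apply Rle_div_r; lra|apply root8_ge0]. }
      apply Rabs_le_between in G1. apply Rabs_le_between in G2. apply Rabs_le_between. lra.
    - set (t := T / 2 ^ n) in *. assert (Et : T / 2 ^ S n = t / 2) by (unfold t; simpl; field; apply pow_nonzero; lra).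
      assert (Ht : 0 < t) by apply tp. assert (HtT : t <= T) by apply tT.
      assert (Ht2 : 0 < t / 2) by lra.
      specialize (IHm (S n) ltac:(lia)). rewrite Et in IHm.
      rewrite (moll_rec Phi Hok t W w Ht CW).
      rewrite (moll_rec Phi Hok t (gs L w) w Ht (gs_cont_r L w HL)).
      destruct (PhiT_prob Phi Hok (t / 2) Ht2) as [CP PP].
      rewrite <- conv_minus_r; [|assumption|apply moll_cont4; assumption|apply moll_cont4; [assumption|assumption|apply gs_cont_r; assumption]].
      rewrite <- (Rminus_0_r (conv _ _ w)).
      apply (conv_prob_le _ _ (t / 2)).
      + split; assumption.
      + apply PhiT_psupp; assumption.
      + apply cont4_minus; apply moll_cont4; try assumption. apply gs_cont_r; assumption.
      + intros w' Hw'. rewrite Rminus_0_r.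
        assert (Ow : Om (rho - t / 2) w').
        { replace (rho - t / 2) with (rho - t + t / 2) by field. apply Om_past with w; try lra; assumption. }
        specialize (IHm w' Ow).
        assert (Ow0 : Om rho w) by (apply Om_le with (rho - t); [lra|assumption]).
        specialize (HD (t / 2) w w' ltac:(lra) Ow0 Hw').
        assert (Eq : root8 t = root8 2 * root8 (t / 2)) by (rewrite <- root8_mult by lra; f_equal; field).
        rewrite Eq.
        replace (Hc / (root8 2 - 1) * (root8 2 * root8 (t / 2))) with
          (Hc / (root8 2 - 1) * root8 (t / 2) + Hc * root8 (t / 2)) by (field; lra).
        apply Rabs_le_between in IHm. apply Rabs_le_between in HD. apply Rabs_le_between. lra. }
  specialize (Claim N 0%nat ltac:(lia) z). replace (T / 2 ^ 0) with T in Claim by (simpl; field).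
  apply Claim. assumption.
Qed.

End Recon.

(** * The remainder equation at unit scale *)

Section Unit.
Variable Phi : pt -> R.

(** The spatial gradient at [z] of [v + Y3 + 3 v(z) Y2] with the coefficient [v(z)] frozen; it plays
    the part of the derivative of [v], which has no bound of its own. *)
Definition nu (v Y2 Y3 : pt -> R) (z : pt) : pt :=
  mkpt 0 (pd D1 v z + pd D1 Y3 z + 3 * v z * pd D1 Y2 z)
         (pd D2 v z + pd D2 Y3 z + 3 * v z * pd D2 Y2 z)
         (pd D3 v z + pd D3 Y3 z + 3 * v z * pd D3 Y2 z).

(* the remainder of the local expansion of [v] around [z] in the basis
   [1, Y3, Y2, X] *)
Definition vrem (v Y2 Y3 : pt -> R) (z y : pt) : R :=
  v y - v z + (Y3 y - Y3 z) + 3 * v z * (Y2 y - Y2 z) - dot3 (nu v Y2 Y3 z) (psub y z).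

(** The situation after dilation: smallness [del] of all data on the past cube of size [Kr], with
    exponents rounded to eighths, and goodness at level 3. The latter gives the bound 3, the radius
    1/3 and the constant 12, which dominates [3 * 3^(5/4)]. *)
Record unit_hyp (Kr del C2 : R) (v t1 t2 t3 Y2 Y3 : pt -> R) : Prop := {
  uv : Smooth v; u1 : Smooth t1; u2 : Smooth t2; u3 : Smooth t3; uY2 : Smooth Y2; uY3 : Smooth Y3;
  uE2 : forall z, Om Kr z -> heat Y2 z = t2 z;
  uE3 : forall z, Om Kr z -> heat Y3 z = t3 z;
  uEv : forall z, Om Kr z -> heat v z =
    - v z ^ 3 - 3 * v z ^ 2 * t1 z - 3 * v z * t2 z - t3 z - 9 * C2 * (v z + t1 z);
  uq1 : forall z t, Om Kr z -> 0 < t <= 1 -> Rabs (moll Phi t t1 z) <= del / root8 t ^ 5;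
  uq2 : forall z t, Om Kr z -> 0 < t <= 1 -> Rabs (moll Phi t t2 z) <= del / root8 t ^ 9;
  uq3 : forall z t, Om Kr z -> 0 < t <= 1 -> Rabs (moll Phi t t3 z) <= del / root8 t ^ 13;
  uq6 : forall d z t, d <> Dt -> Om Kr z -> 0 < t <= 1 ->
    Rabs (moll Phi t (fun y => crd d y * t2 y) z - crd d z * moll Phi t t2 z) <= del / root8 t;
  uq7 : forall z t, Om Kr z -> 0 < t <= 1 ->
    Rabs (moll Phi t (fun y => Y2 y * t2 y - C2) z - Y2 z * moll Phi t t2 z) <= del / root8 t;
  uq8 : forall z t, Om Kr z -> 0 < t <= 1 ->
    Rabs (moll Phi t (fun y => Y3 y * t1 y) z - Y3 z * moll Phi t t1 z) <= del / root8 t;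
  uq9 : forall z t, Om Kr z -> 0 < t <= 1 ->
    Rabs (moll Phi t (fun y => Y3 y * t2 y - 3 * C2 * t1 y) z - Y3 z * moll Phi t t2 z) <= del / root8 t ^ 5;
  uh2 : forall z w, pdist z w <= 1 -> Rabs (Y2 z - Y2 w) <= del * root8 (pdist z w) ^ 7;
  uh3 : forall z w, pdist z w <= 1 -> Rabs (Y3 z - Y3 w) <= del * root8 (pdist z w) ^ 3;
  uv3 : forall z, Om Kr z -> Rabs (v z) <= 3;
  ur3 : forall z y, Om Kr z -> past (1 / 3) z y -> Rabs (vrem v Y2 Y3 z y) <= 12 * root8 (pdist z y) ^ 10
}.

Hypothesis Hok : kernel_ok Phi.
Variables (Kr del C2 : R) (v t1 t2 t3 Y2 Y3 : pt -> R).
Hypothesis HU : unit_hyp Kr del C2 v t1 t2 t3 Y2 Y3.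
Hypothesis HK : 10 <= Kr.
Hypothesis Hdel : 0 <= del <= 1.

Let N := nu v Y2 Y3.
Let rem := vrem v Y2 Y3.

(** * Hölder bounds deduced from the remainder *)

Lemma root8_pow_le (d : R) (n m : nat) : d <= 1 -> (m <= n)%nat -> root8 d ^ n <= root8 d ^ m.
Proof.
  intros Hd Hnm. pose proof (root8_ge0 d). pose proof (root8_le1 d Hd).
  replace n with (m + (n - m))%nat by lia. rewrite pow_add.
  assert (0 <= root8 d ^ (n - m) <= 1) by (split; [apply pow_le; lra|rewrite <- (pow1 (n - m)); apply pow_incr; lra]).
  assert (0 <= root8 d ^ m) by (apply pow_le; lra). nra.
Qed.

Lemma pdist_crd (z w : pt) (d : dir) : d <> Dt -> Rabs (crd d w - crd d z) <= pdist z w.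
Proof.
  intros Hd. pose proof (proj1 (pdist_le_iff z w (pdist z w) (pdist_pos z w)) (Rle_refl _)) as [_ [H1 [H2 H3]]].
  rewrite Rabs_minus_sym. destruct d; [congruence| | |]; simpl; assumption.
Qed.

Lemma past_shift (d : dir) (r : R) (z : pt) : d <> Dt -> 0 <= r -> past r z (shift z d r).
Proof.
  intros Hd Hr. pose proof (pow2_ge_0 r).
  assert (X : forall a, Rabs (a - (a + r)) <= r).
  { intros a. replace (a - (a + r)) with (- r) by ring. rewrite Rabs_Ropp, Rabs_pos_eq; lra. }
  assert (Y : forall a : R, Rabs (a - a) <= r) by (intros a; rewrite Rminus_diag, Rabs_R0; assumption).
  destruct d; [congruence| | |]; unfold past; cbn [shift pt_t pt_x1 pt_x2 pt_x3];
    rewrite Rminus_diag; repeat split; auto; lra.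
Qed.

Lemma dot3_shift (n z : pt) (d : dir) (r : R) : d <> Dt -> dot3 n (psub (shift z d r) z) = crd d n * r.
Proof. intros Hd. destruct d; [congruence| | |]; unfold dot3; simpl; ring. Qed.

Lemma past_pd (r : R) (z y : pt) : 0 <= r -> past r z y -> pdist z y <= r /\ past (pdist z y) z y.
Proof.
  intros Hr H. apply past_pdist in H; [|assumption]. split; [apply H|].
  apply past_pdist; [apply pdist_pos|]. split; [apply H|lra].
Qed.

(** At displacement 1/3 along one axis every other term of the expansion is bounded:
    [12 + 6 + 1 + 9 = 28], times 3. *)
Lemma nu_bound (d : dir) (z : pt) : d <> Dt -> Om (Kr - 1) z -> Rabs (crd d (N z)) <= 84.
Proof.
  intros Hd Hz. set (y := shift z d (1 / 3)).
  assert (Py : past (1 / 3) z y) by (apply past_shift; [assumption|lra]).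
  assert (Oz : Om Kr z) by (apply Om_le with (Kr - 1); [lra|assumption]).
  assert (Oy : Om Kr y).
  { apply Om_le with (Kr - 1 + 1 / 3); [lra|]. apply Om_past with z; try lra; assumption. }
  destruct (past_pd (1 / 3) z y ltac:(lra) Py) as [Pd _].
  pose proof (ur3 _ _ _ _ _ _ _ _ _ HU z y Oz Py) as R1.
  pose proof (uv3 _ _ _ _ _ _ _ _ _ HU z Oz) as V1. pose proof (uv3 _ _ _ _ _ _ _ _ _ HU y Oy) as V2.
  pose proof (uh2 _ _ _ _ _ _ _ _ _ HU y z) as H2. pose proof (uh3 _ _ _ _ _ _ _ _ _ HU y z) as H3.
  assert (Pd' : pdist y z <= 1).
  { apply (pdist_le_iff y z 1 ltac:(lra)). apply (pdist_le_iff z y (1 / 3) ltac:(lra)) in Pd.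
    rewrite (Rabs_minus_sym (pt_t y)), (Rabs_minus_sym (pt_x1 y)), (Rabs_minus_sym (pt_x2 y)), (Rabs_minus_sym (pt_x3 y)).
    simpl. simpl in Pd. lra. }
  specialize (H2 Pd'). specialize (H3 Pd').
  assert (Q : forall n, 0 <= root8 (pdist y z) ^ n <= 1).
  { intros n. pose proof (root8_ge0 (pdist y z)). pose proof (root8_le1 _ Pd').
    split; [apply pow_le; lra|rewrite <- (pow1 n); apply pow_incr; lra]. }
  pose proof (Q 7%nat). pose proof (Q 3%nat).
  assert (Q10 : root8 (pdist z y) ^ 10 <= 1).
  { rewrite <- (pow1 10). apply pow_incr. split; [apply root8_ge0|apply root8_le1; lra]. }
  assert (E2 : Rabs (Y2 y - Y2 z) <= 1) by nra. assert (E3 : Rabs (Y3 y - Y3 z) <= 1) by nra.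
  assert (E4 : Rabs (3 * v z * (Y2 y - Y2 z)) <= 9).
  { rewrite !Rabs_mult, (Rabs_pos_eq 3) by lra. pose proof (Rabs_pos (v z)). pose proof (Rabs_pos (Y2 y - Y2 z)). nra. }
  assert (Ed : dot3 (N z) (psub y z) = crd d (N z) * (1 / 3)) by (apply dot3_shift; assumption).
  unfold vrem in R1. fold N in R1. rewrite Ed in R1.
  apply Rabs_le_between in R1. apply Rabs_le_between in V1. apply Rabs_le_between in V2.
  apply Rabs_le_between in E3. apply Rabs_le_between in E4. apply Rabs_le_between. lra.
Qed.

Lemma dot3_bound (n y : pt) (B r : R) : 0 <= B -> (forall d, d <> Dt -> Rabs (crd d n) <= B) ->
  (forall d, d <> Dt -> Rabs (crd d y) <= r) -> Rabs (dot3 n y) <= 3 * B * r.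
Proof.
  intros HB H1 H2.
  assert (X : forall d, d <> Dt -> Rabs (crd d n * crd d y) <= B * r).
  { intros d Hd. rewrite Rabs_mult. apply Rmult_le_compat; try apply Rabs_pos; auto. }
  pose proof (X D1 ltac:(discriminate)) as X1. pose proof (X D2 ltac:(discriminate)) as X2.
  pose proof (X D3 ltac:(discriminate)) as X3. simpl in X1, X2, X3. unfold dot3.
  apply Rabs_le_between in X1. apply Rabs_le_between in X2. apply Rabs_le_between in X3.
  apply Rabs_le_between. lra.
Qed.

Lemma pdist_sym (z w : pt) : pdist z w = pdist w z.
Proof.
  unfold pdist, xnorm; simpl. rewrite (Rabs_minus_sym (pt_t z)), (Rabs_minus_sym (pt_x1 z)), (Rabs_minus_sym (pt_x2 z)),
    (Rabs_minus_sym (pt_x3 z)). reflexivity.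
Qed.

(** The roughest part of [v] is [-Y3], so the sum has regularity 7/8 although each summand has only
    3/8. The constant is [12 + 9 + 3 * 84]. The better exponent is needed against [t1], of order
    -5/8. *)
Lemma vY3_holder (z y : pt) : Om (Kr - 1) z -> past (1 / 3) z y ->
  Rabs (v y - v z + (Y3 y - Y3 z)) <= 273 * root8 (pdist z y) ^ 7.
Proof.
  intros Hz Py. assert (Oz : Om Kr z) by (apply Om_le with (Kr - 1); [lra|assumption]).
  destruct (past_pd (1 / 3) z y ltac:(lra) Py) as [Pd _].
  pose proof (ur3 _ _ _ _ _ _ _ _ _ HU z y Oz Py) as R1.
  pose proof (uv3 _ _ _ _ _ _ _ _ _ HU z Oz) as V1.
  pose proof (uh2 _ _ _ _ _ _ _ _ _ HU y z) as H2. rewrite pdist_sym in H2. specialize (H2 ltac:(lra)).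
  set (a := root8 (pdist z y)) in *.
  assert (Pa : 0 <= a ^ 7) by (apply pow_le, root8_ge0).
  assert (A10 : a ^ 10 <= a ^ 7) by (apply root8_pow_le; [lra|lia]).
  assert (A8 : a ^ 8 <= a ^ 7) by (apply root8_pow_le; [lra|lia]).
  assert (E8 : a ^ 8 = pdist z y) by (apply root8_pow, pdist_pos).
  assert (Dn : Rabs (dot3 (N z) (psub y z)) <= 3 * 84 * pdist z y).
  { apply dot3_bound; [lra|intros; apply nu_bound; assumption|].
    intros d Hd. rewrite crd_psub. apply pdist_crd; assumption. }
  assert (E2 : Rabs (3 * v z * (Y2 y - Y2 z)) <= 9 * a ^ 7).
  { rewrite !Rabs_mult, (Rabs_pos_eq 3) by lra. pose proof (Rabs_pos (v z)). pose proof (Rabs_pos (Y2 y - Y2 z)).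
    assert (Rabs (Y2 y - Y2 z) <= a ^ 7) by nra. nra. }
  unfold vrem in R1. fold N in R1.
  apply Rabs_le_between in R1. apply Rabs_le_between in E2. apply Rabs_le_between in Dn.
  apply Rabs_le_between. lra.
Qed.

Lemma v_holder (z y : pt) : Om (Kr - 1) z -> past (1 / 3) z y ->
  Rabs (v y - v z) <= 274 * root8 (pdist z y) ^ 3.
Proof.
  intros Hz Py. pose proof (vY3_holder z y Hz Py) as R1.
  destruct (past_pd (1 / 3) z y ltac:(lra) Py) as [Pd _].
  pose proof (uh3 _ _ _ _ _ _ _ _ _ HU y z) as H3. rewrite pdist_sym in H3. specialize (H3 ltac:(lra)).
  assert (A7 : root8 (pdist z y) ^ 7 <= root8 (pdist z y) ^ 3) by (apply root8_pow_le; [lra|lia]).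
  assert (Pa : 0 <= root8 (pdist z y) ^ 3) by (apply pow_le, root8_ge0).
  assert (Rabs (Y3 y - Y3 z) <= root8 (pdist z y) ^ 3) by nra.
  apply Rabs_le_between in R1. apply Rabs_le_between in H. apply Rabs_le_between. lra.
Qed.

(* Compares the expansions around [z] and [x] at a third point displaced from [x] along
   one axis. *)
Lemma nu_holder (d : dir) (z x : pt) : d <> Dt -> Om (Kr - 2) z -> past (1 / 6) z x ->
  Rabs (crd d (N x) - crd d (N z)) <= 876 * root8 (pdist z x) ^ 2.
Proof.
  intros Hd Hz Px. destruct (past_pd (1 / 6) z x ltac:(lra) Px) as [Pd Pr].
  set (r := pdist z x) in *.
  destruct (pdist_pos z x) as [Hr|Hr]; fold r in Hr.
  2: { assert (E : x = z).
       { rewrite <- Hr in Pr. destruct Pr as [P0 [P1 [P2 P3]]]. simpl in P0. rewrite Rmult_0_l in P0.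
         apply Rabs_le_between in P1. apply Rabs_le_between in P2. apply Rabs_le_between in P3.
         apply pt_ext; intros []; simpl; lra. }
       rewrite E, Rminus_diag, Rabs_R0. apply Rmult_le_pos; [lra|apply pow_le, root8_ge0]. }
  set (y := shift x d r).
  assert (Py : past r x y) by (apply past_shift; [assumption|lra]).
  assert (Pzy : past (2 * r) z y) by (replace (2 * r) with (r + r) by ring; apply past_trans with x; try lra; assumption).
  assert (Oz1 : Om (Kr - 1) z) by (apply Om_le with (Kr - 2); [lra|assumption]).
  assert (Oz : Om Kr z) by (apply Om_le with (Kr - 2); [lra|assumption]).
  assert (Ox : Om Kr x).
  { apply Om_le with (Kr - 2 + 1 / 6); [lra|]. apply Om_past with z; try lra; assumption. }
  pose proof (ur3 _ _ _ _ _ _ _ _ _ HU x y Ox ltac:(apply past_le with r; [lra|assumption])) as R1.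
  pose proof (ur3 _ _ _ _ _ _ _ _ _ HU z y Oz ltac:(apply past_le with (2 * r); [lra|assumption])) as R2.
  pose proof (ur3 _ _ _ _ _ _ _ _ _ HU z x Oz ltac:(apply past_le with r; [lra|assumption])) as R3.
  pose proof (v_holder z x Oz1 ltac:(apply past_le with r; [lra|assumption])) as V1.
  destruct (past_pd r x y ltac:(lra) Py) as [D1' _]. destruct (past_pd (2 * r) z y ltac:(lra) Pzy) as [D2' _].
  pose proof (uh2 _ _ _ _ _ _ _ _ _ HU y x) as H2. rewrite pdist_sym in H2. specialize (H2 ltac:(lra)).
  fold r in V1, R3. set (a := root8 r) in *.
  assert (Ha : 0 < a) by (apply root8_pos; assumption).
  assert (Ha1 : a <= 1) by (apply root8_le1; lra).
  assert (Q1 : root8 (pdist x y) ^ 10 <= a ^ 10) by (apply pow_incr; split; [apply root8_ge0|apply root8_le; assumption]).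
  assert (Q7 : root8 (pdist x y) ^ 7 <= a ^ 7) by (apply pow_incr; split; [apply root8_ge0|apply root8_le; assumption]).
  (* The displaced point is at distance at most [2 r] from [z], and
     [2^(10/8) = 2 * root8 2 ^ 2 <= 2.42]. *)
  assert (Q2 : root8 (pdist z y) ^ 10 <= 242 / 100 * a ^ 10).
  { apply Rle_trans with (root8 (2 * r) ^ 10); [apply pow_incr; split; [apply root8_ge0|apply root8_le; assumption]|].
    rewrite root8_mult by lra. fold a. rewrite Rpow_mult_distr. apply Rmult_le_compat_r; [apply pow_le; lra|].
    pose proof root8_2. replace (root8 2 ^ 10) with (root8 2 ^ 8 * root8 2 ^ 2) by ring. rewrite root8_pow by lra. nra. }
  assert (P7 : 0 <= a ^ 7) by (apply pow_le; lra). assert (P3 : 0 <= a ^ 3) by (apply pow_le; lra).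
  assert (P10 : 0 <= a ^ 10) by (apply pow_le; lra).
  assert (E2 : Rabs (3 * (v x - v z) * (Y2 y - Y2 x)) <= 822 * a ^ 10).
  { rewrite !Rabs_mult, (Rabs_pos_eq 3) by lra. pose proof (Rabs_pos (v x - v z)). pose proof (Rabs_pos (Y2 y - Y2 x)).
    assert (Rabs (Y2 y - Y2 x) <= a ^ 7) by nra. replace (822 * a ^ 10) with (3 * (274 * a ^ 3) * a ^ 7) by ring.
    apply Rmult_le_compat; try nra. }
  assert (Id : (crd d (N x) - crd d (N z)) * r = 3 * (v x - v z) * (Y2 y - Y2 x) -
     vrem v Y2 Y3 x y + vrem v Y2 Y3 z y - vrem v Y2 Y3 z x).
  { unfold vrem. fold N.
    rewrite Rmult_minus_distr_r. rewrite <- (dot3_shift (N x) x d r Hd). fold y.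
    replace (crd d (N z) * r) with (dot3 (N z) (psub y x)) by (apply dot3_shift; assumption).
    unfold dot3, psub; simpl. ring. }
  apply Rmult_le_reg_r with r; [assumption|].
  rewrite <- (Rabs_pos_eq r) at 1 by lra. rewrite <- Rabs_mult, Id.
  assert (Er : r = a ^ 8) by (unfold a; rewrite root8_pow; lra). 
  assert (E3 : 876 * a ^ 2 * r = 876 * a ^ 10)
    by (transitivity (876 * a ^ 2 * a ^ 8); [rewrite <- Er; reflexivity|ring]).
  rewrite E3.
  apply Rabs_le_between in R1. apply Rabs_le_between in R2. apply Rabs_le_between in R3.
  apply Rabs_le_between in E2. apply Rabs_le_between. lra.
Qed.

(** The expansion of [v] around [x] multiplied by [t2], sorted by coefficients at the base point.
    The products [Y3 t2] and [Y2 t2] appear in renormalised form; the counterterms they bring in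
    reappear on the diagonal in [Wf]. *)
Definition LW : list ((pt -> R) * (pt -> R)) :=
  (fun x => v x + Y3 x + 3 * v x * Y2 x - dot3 (N x) x, t2) ::
  (fun _ => -1, fun y => Y3 y * t2 y - 3 * C2 * t1 y) ::
  (fun x => -3 * v x, fun y => Y2 y * t2 y - C2) ::
  (fun x => crd D1 (N x), fun y => crd D1 y * t2 y) ::
  (fun x => crd D2 (N x), fun y => crd D2 y * t2 y) ::
  (fun x => crd D3 (N x), fun y => crd D3 y * t2 y) :: nil.

(** For [v^2 t1] a shorter expansion suffices: [v(y)^2] is replaced by
    [v(x)^2 - 2 v(x) (Y3(y) - Y3(x))]. The product [Y3 t1] takes no counterterm. *)
Definition LH : list ((pt -> R) * (pt -> R)) :=
  (fun x => v x ^ 2 + 2 * v x * Y3 x, t1) :: (fun x => -2 * v x, fun y => Y3 y * t1 y) :: nil.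

Let Cv : cont4 v := Smooth_cont4 v (uv _ _ _ _ _ _ _ _ _ HU).
Let C1' : cont4 t1 := Smooth_cont4 t1 (u1 _ _ _ _ _ _ _ _ _ HU).
Let C2' : cont4 t2 := Smooth_cont4 t2 (u2 _ _ _ _ _ _ _ _ _ HU).
Let CY2 : cont4 Y2 := Smooth_cont4 Y2 (uY2 _ _ _ _ _ _ _ _ _ HU).
Let CY3 : cont4 Y3 := Smooth_cont4 Y3 (uY3 _ _ _ _ _ _ _ _ _ HU).

Lemma nu_cont (d : dir) : cont4 (fun x => crd d (N x)).
Proof.
  destruct HU.
  destruct d; simpl; [apply cont4_const| | |];
  (apply cont4_plus; [apply cont4_plus; apply Smooth_cont4, Smooth_pd; assumption|];
   apply cont4_mult; [apply cont4_scal; assumption|apply Smooth_cont4, Smooth_pd; assumption]).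
Qed.

Lemma LW_cont : gcont LW.
Proof.
  assert (Cx : forall d, cont4 (fun y => crd d y * t2 y)) by (intros; apply cont4_mult; [apply cont4_crd|exact C2']).
  repeat constructor; cbn [fst snd]; try apply cont4_const; try apply nu_cont; try apply Cx; try exact C2'.
  - apply cont4_minus.
    + apply cont4_plus; [apply cont4_plus; assumption|]. apply cont4_mult; [apply cont4_scal|]; assumption.
    + unfold dot3. repeat apply cont4_plus; apply cont4_mult;
        first [apply (nu_cont D1)|apply (nu_cont D2)|apply (nu_cont D3)|apply (cont4_crd D1)|apply (cont4_crd D2)|apply (cont4_crd D3)].
  - apply cont4_minus; [apply cont4_mult; assumption|apply cont4_scal; assumption].
  - apply cont4_scal; assumption.
  - apply cont4_minus; [apply cont4_mult; assumption|apply cont4_const].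
Qed.

Lemma LH_cont : gcont LH.
Proof.
  repeat constructor; cbn [fst snd]; try exact C1'.
  - apply cont4_plus; [apply cont4_pow; assumption|apply cont4_mult; [apply cont4_scal|]; assumption].
  - apply cont4_scal; assumption.
  - apply cont4_mult; assumption.
Qed.

(** The counterterm [3 C2 t1] comes from [Y3 t2] with coefficient -1 and [3 C2 v] from [Y2 t2] with
    coefficient [-3 v]. Three times [Wf] thus contains the whole [9 C2 (v + t1)] of the equation. *)
Definition Wf (y : pt) : R := v y * t2 y + 3 * C2 * t1 y + 3 * C2 * v y.

Lemma LW_diag (y : pt) : gs LW y y = Wf y.
Proof. unfold gs, LW, Wf, dot3; simpl. ring. Qed.

Lemma LH_diag (y : pt) : gs LH y y = v y ^ 2 * t1 y.
Proof. unfold gs, LH; simpl. ring. Qed.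

(** Changing the base point leaves the remainder against [t2], the increment of [v] against the
    quantity of [Q7], and the increment of [nu] against that of [Q6]. The orders in eighths are 10 -
    9, 3 - 1 and 2 - 1: all at least 1, which is what reconstruction asks for. *)
Lemma LW_step (t : R) (z z' : pt) : 0 < t <= 1 / 6 -> Om (Kr - 2) z -> past t z z' ->
  Rabs (moll Phi t (gs LW z) z' - moll Phi t (gs LW z') z') <= 100000 * del * root8 t.
Proof.
  intros Ht Hz Pz.
  destruct (past_pd t z z' ltac:(lra) Pz) as [Pd _].
  assert (Oz1 : Om (Kr - 1) z) by (apply Om_le with (Kr - 2); [lra|assumption]).
  assert (Oz : Om Kr z) by (apply Om_le with (Kr - 2); [lra|assumption]).
  assert (Oz' : Om Kr z').
  { apply Om_le with (Kr - 2 + t); [lra|]. apply Om_past with z; try lra; assumption. }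
  pose proof (ur3 _ _ _ _ _ _ _ _ _ HU z z' Oz ltac:(apply past_le with t; [lra|assumption])) as R1.
  pose proof (v_holder z z' Oz1 ltac:(apply past_le with t; [lra|assumption])) as V1.
  assert (Nh : forall d, d <> Dt -> Rabs (crd d (N z') - crd d (N z)) <= 876 * root8 (pdist z z') ^ 2).
  { intros d Hd. apply nu_holder; [assumption|assumption|]. apply past_le with t; [lra|assumption]. }
  pose proof (uq2 _ _ _ _ _ _ _ _ _ HU z' t Oz' ltac:(lra)) as M2.
  pose proof (uq7 _ _ _ _ _ _ _ _ _ HU z' t Oz' ltac:(lra)) as M7.
  assert (M6 := fun d Hd => uq6 _ _ _ _ _ _ _ _ _ HU d z' t Hd Oz' ltac:(lra)).
  rewrite !moll_gs by (try assumption; try lra; apply LW_cont). unfold LW. cbn [fold_right fst snd].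
  set (m2 := moll Phi t t2 z') in *. set (b := root8 t) in *. set (a := root8 (pdist z z')) in *.
  assert (Hb : 0 < b) by (apply root8_pos; lra). assert (Ha0 : 0 <= a) by apply root8_ge0.
  assert (Hab : a <= b) by (apply root8_le; assumption). assert (Hb1 : b <= 1) by (apply root8_le1; lra).
  assert (ab : forall n, a ^ n <= b ^ n) by (intros; apply pow_incr; lra).
  (* A coefficient of order [n] against a tested quantity of order [-m] leaves at least one power of
     [b], since [m < n] and [b <= 1]. *)
  assert (Gen : forall c A x n m, (m < n)%nat -> 0 <= A -> Rabs c <= A * a ^ n -> Rabs x <= del / b ^ m -> Rabs (c * x) <= A * del * b).
  { intros c A x n m Hnm HA Hc Hx. rewrite Rabs_mult.
    apply Rle_trans with (A * b ^ n * (del / b ^ m)).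
    - apply Rmult_le_compat; try apply Rabs_pos; [|assumption].
      eapply Rle_trans; [exact Hc|]. apply Rmult_le_compat_l; auto.
    - replace n with (m + 1 + (n - m - 1))%nat by lia. rewrite !pow_add.
      replace (A * (b ^ m * b ^ 1 * b ^ (n - m - 1)) * (del / b ^ m)) with (A * del * b * b ^ (n - m - 1))
        by (field; apply pow_nonzero; lra).
      assert (0 <= b ^ (n - m - 1) <= 1) by (split; [apply pow_le; lra|rewrite <- (pow1 (n - m - 1)); apply pow_incr; lra]).
      assert (0 <= A * del * b) by (apply Rmult_le_pos; [apply Rmult_le_pos|]; lra). nra. }
  assert (T1 : Rabs (vrem v Y2 Y3 z z' * m2) <= 12 * del * b) by (apply (Gen _ 12 _ 10%nat 9%nat); try assumption; [lia|lra]).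
  assert (T2 : Rabs ((v z' - v z) * (moll Phi t (fun y => Y2 y * t2 y - C2) z' - Y2 z' * m2)) <= 274 * del * b).
  { apply (Gen _ 274 _ 3%nat 1%nat); try assumption; [lia|lra|]. rewrite pow_1; assumption. }
  assert (T3 : forall d, d <> Dt -> Rabs ((crd d (N z') - crd d (N z)) * (moll Phi t (fun y => crd d y * t2 y) z' - crd d z' * m2)) <= 876 * del * b).
  { intros d Hd. apply (Gen _ 876 _ 2%nat 1%nat); [lia|lra|apply Nh; assumption|]. rewrite pow_1; apply M6; assumption. }
  pose proof (T3 D1 ltac:(discriminate)) as S1. pose proof (T3 D2 ltac:(discriminate)) as S2.
  pose proof (T3 D3 ltac:(discriminate)) as S3.
  match goal with |- Rabs ?q <= _ => replace q with
    (- (vrem v Y2 Y3 z z' * m2) + 3 * ((v z' - v z) * (moll Phi t (fun y => Y2 y * t2 y - C2) z' - Y2 z' * m2))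
     - (crd D1 (N z') - crd D1 (N z)) * (moll Phi t (fun y => crd D1 y * t2 y) z' - crd D1 z' * m2)
     - (crd D2 (N z') - crd D2 (N z)) * (moll Phi t (fun y => crd D2 y * t2 y) z' - crd D2 z' * m2)
     - (crd D3 (N z') - crd D3 (N z)) * (moll Phi t (fun y => crd D3 y * t2 y) z' - crd D3 z' * m2)) end.
  2: { unfold vrem. fold N. unfold dot3, psub; cbn [crd pt_x1 pt_x2 pt_x3]. ring. }
  assert (0 <= del * b) by (apply Rmult_le_pos; lra).
  apply Rabs_le_between in T1. apply Rabs_le_between in T2. apply Rabs_le_between in S1.
  apply Rabs_le_between in S2. apply Rabs_le_between in S3. apply Rabs_le_between. lra.
Qed.

(** The increments are [2 v] times that of [v + Y3] and the square of that of [v], both against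
    [t1], and the increment of [v] against the quantity of [Q8]. The orders are 7 - 5, 6 - 5 and 3 -
    1; the square of 274 is the largest constant. *)
Lemma LH_step (t : R) (z z' : pt) : 0 < t <= 1 / 6 -> Om (Kr - 2) z -> past t z z' ->
  Rabs (moll Phi t (gs LH z) z' - moll Phi t (gs LH z') z') <= 100000 * del * root8 t.
Proof.
  intros Ht Hz Pz.
  destruct (past_pd t z z' ltac:(lra) Pz) as [Pd _].
  assert (Oz1 : Om (Kr - 1) z) by (apply Om_le with (Kr - 2); [lra|assumption]).
  assert (Oz : Om Kr z) by (apply Om_le with (Kr - 2); [lra|assumption]).
  assert (Oz' : Om Kr z').
  { apply Om_le with (Kr - 2 + t); [lra|]. apply Om_past with z; try lra; assumption. }
  pose proof (uv3 _ _ _ _ _ _ _ _ _ HU z Oz) as V0.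
  pose proof (vY3_holder z z' Oz1 ltac:(apply past_le with t; [lra|assumption])) as V7.
  pose proof (v_holder z z' Oz1 ltac:(apply past_le with t; [lra|assumption])) as V1.
  pose proof (uq1 _ _ _ _ _ _ _ _ _ HU z' t Oz' ltac:(lra)) as M1.
  pose proof (uq8 _ _ _ _ _ _ _ _ _ HU z' t Oz' ltac:(lra)) as M8.
  rewrite !moll_gs by (try assumption; try lra; apply LH_cont). unfold LH. cbn [fold_right fst snd].
  set (m1 := moll Phi t t1 z') in *. set (b := root8 t) in *. set (a := root8 (pdist z z')) in *.
  assert (Hb : 0 < b) by (apply root8_pos; lra). assert (Ha0 : 0 <= a) by apply root8_ge0.
  assert (Hab : a <= b) by (apply root8_le; assumption). assert (Hb1 : b <= 1) by (apply root8_le1; lra).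
  assert (ab : forall n, a ^ n <= b ^ n) by (intros; apply pow_incr; lra).
  assert (Gen : forall c A x n m, (m < n)%nat -> 0 <= A -> Rabs c <= A * a ^ n -> Rabs x <= del / b ^ m -> Rabs (c * x) <= A * del * b).
  { intros c A x n m Hnm HA Hc Hx. rewrite Rabs_mult.
    apply Rle_trans with (A * b ^ n * (del / b ^ m)).
    - apply Rmult_le_compat; try apply Rabs_pos; [|assumption].
      eapply Rle_trans; [exact Hc|]. apply Rmult_le_compat_l; auto.
    - replace n with (m + 1 + (n - m - 1))%nat by lia. rewrite !pow_add.
      replace (A * (b ^ m * b ^ 1 * b ^ (n - m - 1)) * (del / b ^ m)) with (A * del * b * b ^ (n - m - 1))
        by (field; apply pow_nonzero; lra).
      assert (0 <= b ^ (n - m - 1) <= 1) by (split; [apply pow_le; lra|rewrite <- (pow1 (n - m - 1)); apply pow_incr; lra]).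
      assert (0 <= A * del * b) by (apply Rmult_le_pos; [apply Rmult_le_pos|]; lra). nra. }
  assert (T1 : Rabs (2 * v z * (v z' - v z + (Y3 z' - Y3 z)) * m1) <= 1638 * del * b).
  { apply (Gen _ 1638 _ 7%nat 5%nat); try assumption; [lia|lra|].
    rewrite !Rabs_mult, (Rabs_pos_eq 2) by lra.
    replace (1638 * a ^ 7) with (2 * 3 * (273 * a ^ 7)) by ring.
    pose proof (Rabs_pos (v z)). apply Rmult_le_compat; try apply Rabs_pos; [lra|lra|assumption]. }
  assert (T2 : Rabs ((v z' - v z) ^ 2 * m1) <= 75076 * del * b).
  { apply (Gen _ 75076 _ 6%nat 5%nat); try assumption; [lia|lra|].
    replace ((v z' - v z) ^ 2) with ((v z' - v z) * (v z' - v z)) by ring. rewrite Rabs_mult.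
    replace (75076 * a ^ 6) with ((274 * a ^ 3) * (274 * a ^ 3)) by ring.
    apply Rmult_le_compat; try apply Rabs_pos; assumption. }
  assert (T3 : Rabs ((v z' - v z) * (moll Phi t (fun y => Y3 y * t1 y) z' - Y3 z' * m1)) <= 274 * del * b).
  { apply (Gen _ 274 _ 3%nat 1%nat); try assumption; [lia|lra|]. rewrite pow_1; assumption. }
  match goal with |- Rabs ?q <= _ => replace q with
    (- (2 * v z * (v z' - v z + (Y3 z' - Y3 z)) * m1) - (v z' - v z) ^ 2 * m1
      + 2 * ((v z' - v z) * (moll Phi t (fun y => Y3 y * t1 y) z' - Y3 z' * m1))) by ring end.
  assert (0 <= del * b) by (apply Rmult_le_pos; lra).
  apply Rabs_le_between in T1. apply Rabs_le_between in T2. apply Rabs_le_between in T3.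
  apply Rabs_le_between. lra.
Qed.

(** The second summand is the reconstruction constant for the step bound 100000; 300 covers the germ
    at its own base point, [1 + 9 + 3 * 84] in [W_est]. *)
Definition CR : R := 300 + 100000 / (root8 2 - 1).

Lemma CR_pos : 0 < CR.
Proof. unfold CR. pose proof root8_2. assert (0 < 100000 / (root8 2 - 1)) by (apply Rdiv_lt_0_compat; lra). lra. Qed.

Lemma div_pow_le (b c : R) (n m : nat) : 0 < b <= 1 -> 0 <= c -> (n <= m)%nat -> c / b ^ n <= c / b ^ m.
Proof.
  intros Hb Hc Hnm. apply Rmult_le_compat_l; [assumption|]. apply Rinv_le_contravar; [apply pow_lt; lra|].
  replace m with (n + (m - n))%nat by lia. rewrite pow_add.
  assert (0 <= b ^ (m - n) <= 1) by (split; [apply pow_le; lra|rewrite <- (pow1 (m - n)); apply pow_incr; lra]).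
  assert (0 <= b ^ n) by (apply pow_le; lra). nra.
Qed.

(** Tested at its own base point, the germ is [v z] times the mollified [t2] plus the centred
    quantities of [Q6], [Q7] and [Q9]. The leading term is of order -9 and is kept apart, because
    the Schauder step pairs it with [v(0) t2] so that only an increment of [v] remains. *)
Lemma W_est (T : R) (z : pt) : 0 < T <= 1 / 6 -> Om (Kr - 3) z ->
  Rabs (moll Phi T Wf z - v z * moll Phi T t2 z) <= CR * del / root8 T ^ 5.
Proof.
  intros HT Hz.
  assert (Oz1 : Om (Kr - 1) z) by (apply Om_le with (Kr - 3); [lra|assumption]).
  assert (Oz : Om Kr z) by (apply Om_le with (Kr - 3); [lra|assumption]).
  pose proof (reconstruction Phi Hok LW (Kr - 2) T (100000 * del) LW_cont ltac:(lra) ltac:(lra) ltac:(lra)) as Rc.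
  specialize (Rc (fun t z z' Ht => LW_step t z z' ltac:(lra)) z ltac:(apply Om_le with (Kr - 3); [lra|assumption])).
  replace (fun y => gs LW y y) with Wf in Rc by (extensionality y; symmetry; apply LW_diag).
  rewrite moll_gs in Rc by (try assumption; try lra; apply LW_cont). unfold LW in Rc. cbn [fold_right fst snd] in Rc.
  pose proof (uq7 _ _ _ _ _ _ _ _ _ HU z T Oz ltac:(lra)) as M7.
  pose proof (uq9 _ _ _ _ _ _ _ _ _ HU z T Oz ltac:(lra)) as M9.
  assert (M6 := fun d Hd => uq6 _ _ _ _ _ _ _ _ _ HU d z T Hd Oz ltac:(lra)).
  pose proof (uv3 _ _ _ _ _ _ _ _ _ HU z Oz) as V0.
  set (m2 := moll Phi T t2 z) in *. set (b := root8 T) in *.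
  assert (Hb : 0 < b) by (apply root8_pos; lra). assert (Hb1 : b <= 1) by (apply root8_le1; lra).
  assert (B15 : del / b <= del / b ^ 5) by (rewrite <- (pow_1 b) at 1; apply div_pow_le; [lra|lra|lia]).
  assert (B0 : b <= / b ^ 5).
  { rewrite <- (Rmult_1_r (/ b ^ 5)). apply Rle_trans with 1; [lra|]. rewrite Rmult_1_r.
    rewrite <- Rinv_1. apply Rinv_le_contravar; [apply pow_lt; lra|]. rewrite <- (pow1 5). apply pow_incr; lra. }
  assert (T7 : Rabs (3 * v z * (moll Phi T (fun y => Y2 y * t2 y - C2) z - Y2 z * m2)) <= 9 * (del / b ^ 5)).
  { rewrite !Rabs_mult, (Rabs_pos_eq 3) by lra. replace (9 * (del / b ^ 5)) with (3 * 3 * (del / b ^ 5)) by ring.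
    pose proof (Rabs_pos (v z)). apply Rmult_le_compat; try apply Rabs_pos; lra. }
  assert (T6 : forall d, d <> Dt -> Rabs (crd d (N z) * (moll Phi T (fun y => crd d y * t2 y) z - crd d z * m2)) <= 84 * (del / b ^ 5)).
  { intros d Hd. rewrite Rabs_mult. apply Rmult_le_compat; try apply Rabs_pos; [apply nu_bound; assumption|].
    eapply Rle_trans; [apply M6; assumption|lra]. }
  pose proof (T6 D1 ltac:(discriminate)) as S1. pose proof (T6 D2 ltac:(discriminate)) as S2.
  pose proof (T6 D3 ltac:(discriminate)) as S3.
  assert (RR : 100000 * del / (root8 2 - 1) * b <= 100000 / (root8 2 - 1) * (del / b ^ 5)).
  { pose proof root8_2. replace (100000 * del / (root8 2 - 1) * b) with (100000 / (root8 2 - 1) * (del * b)) by (field; lra).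
    apply Rmult_le_compat_l; [apply Rlt_le, Rdiv_lt_0_compat; lra|]. apply Rmult_le_compat_l; lra. }
  assert (0 <= del / b ^ 5) by (apply Rle_div_r; [apply pow_lt; lra|lra]).
  replace (CR * del / b ^ 5) with (CR * (del / b ^ 5)) by (unfold Rdiv; ring). unfold CR.
  assert (Id : (v z + Y3 z + 3 * v z * Y2 z - dot3 (N z) z) * m2 +
     (-1 * moll Phi T (fun y => Y3 y * t2 y - 3 * C2 * t1 y) z +
      (-3 * v z * moll Phi T (fun y => Y2 y * t2 y - C2) z +
       (crd D1 (N z) * moll Phi T (fun y => crd D1 y * t2 y) z +
        (crd D2 (N z) * moll Phi T (fun y => crd D2 y * t2 y) z +
         (crd D3 (N z) * moll Phi T (fun y => crd D3 y * t2 y) z + 0))))) =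
     v z * m2 - (moll Phi T (fun y => Y3 y * t2 y - 3 * C2 * t1 y) z - Y3 z * m2)
     - 3 * v z * (moll Phi T (fun y => Y2 y * t2 y - C2) z - Y2 z * m2)
     + crd D1 (N z) * (moll Phi T (fun y => crd D1 y * t2 y) z - crd D1 z * m2)
     + crd D2 (N z) * (moll Phi T (fun y => crd D2 y * t2 y) z - crd D2 z * m2)
     + crd D3 (N z) * (moll Phi T (fun y => crd D3 y * t2 y) z - crd D3 z * m2)).
  { unfold dot3; cbn [crd]. ring. }
  rewrite Id in Rc.
  apply Rabs_le_between in Rc. apply Rabs_le_between in M9. apply Rabs_le_between in T7.
  apply Rabs_le_between in S1. apply Rabs_le_between in S2. apply Rabs_le_between in S3.
  apply Rabs_le_between. lra.
Qed.

Lemma H_est (T : R) (z : pt) : 0 < T <= 1 / 6 -> Om (Kr - 3) z ->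
  Rabs (moll Phi T (fun y => v y ^ 2 * t1 y) z) <= CR * del / root8 T ^ 5.
Proof.
  intros HT Hz.
  assert (Oz : Om Kr z) by (apply Om_le with (Kr - 3); [lra|assumption]).
  pose proof (reconstruction Phi Hok LH (Kr - 2) T (100000 * del) LH_cont ltac:(lra) ltac:(lra) ltac:(lra)) as Rc.
  specialize (Rc (fun t z z' Ht => LH_step t z z' ltac:(lra)) z ltac:(apply Om_le with (Kr - 3); [lra|assumption])).
  replace (fun y => gs LH y y) with (fun y => v y ^ 2 * t1 y) in Rc by (extensionality y; symmetry; apply LH_diag).
  rewrite moll_gs in Rc by (try assumption; try lra; apply LH_cont). unfold LH in Rc. cbn [fold_right fst snd] in Rc.
  pose proof (uq1 _ _ _ _ _ _ _ _ _ HU z T Oz ltac:(lra)) as M1.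
  pose proof (uq8 _ _ _ _ _ _ _ _ _ HU z T Oz ltac:(lra)) as M8.
  pose proof (uv3 _ _ _ _ _ _ _ _ _ HU z Oz) as V0.
  set (m1 := moll Phi T t1 z) in *. set (b := root8 T) in *.
  assert (Hb : 0 < b) by (apply root8_pos; lra). assert (Hb1 : b <= 1) by (apply root8_le1; lra).
  assert (B15 : del / b <= del / b ^ 5) by (rewrite <- (pow_1 b) at 1; apply div_pow_le; [lra|lra|lia]).
  assert (B0 : b <= / b ^ 5).
  { rewrite <- (Rmult_1_r (/ b ^ 5)). apply Rle_trans with 1; [lra|]. rewrite Rmult_1_r.
    rewrite <- Rinv_1. apply Rinv_le_contravar; [apply pow_lt; lra|]. rewrite <- (pow1 5). apply pow_incr; lra. }
  assert (T1 : Rabs (v z ^ 2 * m1) <= 9 * (del / b ^ 5)).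
  { rewrite Rabs_mult, <- RPow_abs. pose proof (Rabs_pos (v z)).
    apply Rmult_le_compat; try apply Rabs_pos; [apply pow_le; lra|nra|assumption]. }
  assert (T8 : Rabs (2 * v z * (moll Phi T (fun y => Y3 y * t1 y) z - Y3 z * m1)) <= 6 * (del / b ^ 5)).
  { rewrite !Rabs_mult, (Rabs_pos_eq 2) by lra. replace (6 * (del / b ^ 5)) with (2 * 3 * (del / b ^ 5)) by ring.
    pose proof (Rabs_pos (v z)). apply Rmult_le_compat; try apply Rabs_pos; lra. }
  assert (RR : 100000 * del / (root8 2 - 1) * b <= 100000 / (root8 2 - 1) * (del / b ^ 5)).
  { pose proof root8_2. replace (100000 * del / (root8 2 - 1) * b) with (100000 / (root8 2 - 1) * (del * b)) by (field; lra).
    apply Rmult_le_compat_l; [apply Rlt_le, Rdiv_lt_0_compat; lra|]. apply Rmult_le_compat_l; lra. }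
  assert (0 <= del / b ^ 5) by (apply Rle_div_r; [apply pow_lt; lra|lra]).
  replace (CR * del / b ^ 5) with (CR * (del / b ^ 5)) by (unfold Rdiv; ring). unfold CR.
  assert (Id : (v z ^ 2 + 2 * v z * Y3 z) * m1 + (-2 * v z * moll Phi T (fun y => Y3 y * t1 y) z + 0) =
    v z ^ 2 * m1 - 2 * v z * (moll Phi T (fun y => Y3 y * t1 y) z - Y3 z * m1)) by ring.
  rewrite Id in Rc.
  apply Rabs_le_between in Rc. apply Rabs_le_between in T1. apply Rabs_le_between in T8.
  apply Rabs_le_between. lra.
Qed.

End Unit.

(** * Maximum principle with a quadratic barrier *)

(** One-sided in order to allow a maximum at the final time of a past cylinder. *)
Lemma deriv_left_max (f : R -> R) (l r : R) : derivable_pt_lim f 0 l -> 0 < r ->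
  (forall s, - r < s <= 0 -> f s <= f 0) -> 0 <= l.
Proof.
  intros Hd Hr H. apply Rnot_lt_le; intros Hl.
  destruct (Hd (- l) ltac:(lra)) as [e He]. pose proof (cond_pos e).
  set (h := - Rmin (e / 2) (r / 2)).
  assert (0 < Rmin (e / 2) (r / 2)) by (apply Rmin_pos; lra).
  pose proof (Rmin_l (e / 2) (r / 2)). pose proof (Rmin_r (e / 2) (r / 2)).
  specialize (He h ltac:(unfold h; lra) ltac:(unfold h; rewrite Rabs_Ropp, Rabs_pos_eq; lra)).
  rewrite Rplus_0_l in He. specialize (H h ltac:(unfold h; lra)).
  assert (0 <= (f h - f 0) / h).
  { replace ((f h - f 0) / h) with ((f 0 - f h) / (- h)) by (field; unfold h; lra).
    apply Rle_div_r; [unfold h; lra|]. lra. }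
  apply Rabs_lt_between in He. lra.
Qed.

Lemma deriv2_max (f f' : R -> R) (l r : R) : (forall s, derivable_pt_lim f s (f' s)) ->
  derivable_pt_lim f' 0 l -> 0 < r -> (forall s, - r < s < r -> f s <= f 0) -> l <= 0.
Proof.
  intros Hd Hd2 Hr H.
  assert (F0 : f' 0 = 0).
  { apply Rle_antisym.
    - assert (X : 0 <= - f' 0); [|lra].
      apply (deriv_left_max (fun s => f (- s)) (- f' 0) r); [|assumption|].
      + apply is_derive_Reals. evar_last.
        { apply (is_derive_comp f (fun s => - s)); [apply is_derive_Reals; apply Hd|auto_derive; [trivial|reflexivity]]. }
        unfold scal; simpl; unfold mult; simpl. rewrite Ropp_0. ring.
      + intros s Hs. rewrite Ropp_0. apply H; lra.
    - apply (deriv_left_max f (f' 0) r); [apply Hd|assumption|]. intros s Hs; apply H; lra. }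
  apply Rnot_lt_le; intros Hl.
  destruct (Hd2 l Hl) as [e He]. pose proof (cond_pos e).
  set (h := Rmin (e / 2) (r / 2)).
  assert (0 < h) by (apply Rmin_pos; lra).
  pose proof (Rmin_l (e / 2) (r / 2)). pose proof (Rmin_r (e / 2) (r / 2)). fold h in H2, H3.
  destruct (MVT_cor2 f f' 0 h H1) as [c [Ec Hc]]; [intros; apply Hd|].
  specialize (He c ltac:(lra) ltac:(rewrite Rabs_pos_eq; lra)).
  rewrite Rplus_0_l, F0, Rminus_0_r in He. apply Rabs_lt_between in He.
  assert (P : 0 < f' c / c) by lra.
  assert (0 < f' c) by (apply Rmult_lt_reg_r with (/ c); [apply Rinv_0_lt_compat; lra|rewrite Rmult_0_l; exact P]).
  specialize (H h ltac:(lra)). rewrite Rminus_0_r in Ec. nra.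
Qed.

Lemma heat_n2 (z : pt) : heat n2 z = -6.
Proof.
  assert (E : n2 = fun z => (crd D1 z * crd D1 z + crd D2 z * crd D2 z) + crd D3 z * crd D3 z)
    by (extensionality w; unfold n2; simpl; ring).
  assert (P : forall d, pd d n2 = fun z => 2 * (unitd d D1 * crd D1 z + unitd d D2 * crd D2 z + unitd d D3 * crd D3 z)).
  { intros d. rewrite E. apply hasD_pd.
    pose proof (hasD_plus d _ _ _ _ (hasD_plus d _ _ _ _ (hasD_mult d _ _ _ _ (hasD_crd d D1) (hasD_crd d D1))
      (hasD_mult d _ _ _ _ (hasD_crd d D2) (hasD_crd d D2))) (hasD_mult d _ _ _ _ (hasD_crd d D3) (hasD_crd d D3))) as X.
    cbv beta in X. revert X. apply hasD_ext; [reflexivity|intros; ring]. }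
  assert (P2 : forall d, d <> Dt -> pd d (pd d n2) z = 2).
  { intros d Hd. rewrite P.
    assert (X : hasD d (fun z => 2 * (unitd d D1 * crd D1 z + unitd d D2 * crd D2 z + unitd d D3 * crd D3 z))
       (fun z => 2 * (unitd d D1 * unitd d D1 + unitd d D2 * unitd d D2 + unitd d D3 * unitd d D3))).
    { apply hasD_scal. apply hasD_plus; [apply hasD_plus|]; apply hasD_scal; apply hasD_crd. }
    rewrite (hasD_pd _ _ _ X). unfold unitd. destruct d; [congruence| | |];
      repeat match goal with |- context [dir_eq_dec ?a ?b] => destruct (dir_eq_dec a b); try congruence end; ring. }
  unfold heat. rewrite !P2 by discriminate. rewrite P. unfold unitd.
  repeat match goal with |- context [dir_eq_dec ?a ?b] => destruct (dir_eq_dec a b); try congruence end.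
  ring.
Qed.

Lemma heat_crd_t (z : pt) : heat (crd Dt) z = 1.
Proof.
  unfold heat. rewrite !(fun d => hasD_pd _ _ _ (hasD_crd d Dt)). rewrite !pd_const.
  unfold unitd. repeat match goal with |- context [dir_eq_dec ?a ?b] => destruct (dir_eq_dec a b); try congruence end. ring.
Qed.

(** The barrier is [c] plus [3 / L^2] times the squared spatial distance plus elapsed time; it
    reaches 3 on the lateral and initial boundary, so the only boundary information is [w <= 3]. Its
    heat operator is [-(6 + 1)] times [3 / L^2]. At a positive maximum of the difference,
    [w^3 <= e + 21 / L^2 <= c^3], against [w > c]. *)
Lemma max_principle_cubic (w : pt -> R) (z0 : pt) (L c e : R) : Smooth w -> 0 < L -> 0 < c ->
  (forall z, past L z0 z -> w z <= 3 /\ heat w z <= - w z ^ 3 + e) ->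
  e + 21 / L ^ 2 <= c ^ 3 -> w z0 <= c.
Proof.
  intros Sw HL Hc Hw He.
  set (k := 3 / L ^ 2). assert (Hk : 0 < k) by (apply Rdiv_lt_0_compat; [lra|apply pow_lt; assumption]).
  assert (EkL : k * L ^ 2 = 3) by (unfold k; field; lra).
  set (phi := fun z => (c + k * pt_t z0) + (k * n2 (aff (psub origin z0) (dil 1) z) + (- k) * crd Dt z)).
  assert (Sn : Smooth (fun z => n2 (aff (psub origin z0) (dil 1) z))) by apply Smooth_aff, n2_Smooth.
  assert (Sp1 : Smooth (fun z => k * n2 (aff (psub origin z0) (dil 1) z) + (- k) * crd Dt z)).
  { apply Smooth_plus; [apply Smooth_scal; assumption|apply Smooth_scal, Smooth_crd]. }
  assert (Sphi : Smooth phi) by (apply Smooth_plus; [apply Smooth_const|assumption]).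
  assert (Hphi : forall z, heat phi z = - (21 / L ^ 2)).
  { intros z. unfold phi.
    rewrite (heat_plus (fun _ => c + k * pt_t z0)) by (try assumption; apply Smooth_const).
    rewrite (heat_plus (fun z => k * n2 (aff (psub origin z0) (dil 1) z)) (fun z => - k * crd Dt z))
      by (first [apply Smooth_scal; assumption|apply Smooth_scal, Smooth_crd]).
    rewrite heat_const, (heat_scal k (fun z => n2 (aff (psub origin z0) (dil 1) z))), heat_scal by (try assumption; apply Smooth_crd).
    rewrite heat_dil, heat_n2, heat_crd_t by apply n2_Smooth. unfold k. field. lra. }
  assert (Ephi : forall z, phi z = c + k * ((pt_x1 z - pt_x1 z0) ^ 2 + (pt_x2 z - pt_x2 z0) ^ 2 + (pt_x3 z - pt_x3 z0) ^ 2
     + (pt_t z0 - pt_t z))).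
  { intros z. unfold phi, n2; simpl. ring. }
  set (g := fun z => w z + (-1) * phi z).
  assert (Sg : Smooth g) by (apply Smooth_plus; [assumption|apply Smooth_scal; assumption]).
  destruct (inbox_ex z0) as [B [HB Hz0]].
  destruct (cont4_attains_max g (B + L + L ^ 2) (past L z0) (Smooth_cont4 g Sg)) as [z1 [Hz1 Hmax]].
  - exists z0. apply past_refl; lra.
  - intros z [P0 [P1 [P2 P3]]]. assert (0 <= L ^ 2) by apply pow2_ge_0.
    generalize (Hz0 Dt) (Hz0 D1) (Hz0 D2) (Hz0 D3). cbn [crd]. intros Z0 Z1 Z2 Z3.
    apply Rabs_le_between in P1. apply Rabs_le_between in P2. apply Rabs_le_between in P3.
    apply Rabs_le_between in Z0. apply Rabs_le_between in Z1. apply Rabs_le_between in Z2. apply Rabs_le_between in Z3.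
    intros []; cbn [crd]; apply Rabs_le_between; lra.
  - intros z Hz.
    apply NNPP; intros Hn. apply Hz.
    assert (X : forall e, 0 < e -> exists w, near e z w /\ past L z0 w).
    { intros e' He'. apply NNPP; intros Hne. apply Hn. exists e'; split; [assumption|].
      intros w' Nw Pw. apply Hne. exists w'; auto. }
    assert (Ab : forall a b : R, (forall e, 0 < e -> a <= b + e) -> a <= b) by (intros; apply le_epsilon; assumption).
    assert (Y : forall e, 0 < e -> 0 <= pt_t z0 - pt_t z + e /\ pt_t z0 - pt_t z <= L ^ 2 + e /\
      Rabs (pt_x1 z0 - pt_x1 z) <= L + e /\ Rabs (pt_x2 z0 - pt_x2 z) <= L + e /\ Rabs (pt_x3 z0 - pt_x3 z) <= L + e).
    { intros e' He'. destruct (X e' He') as [w' [Nw [P0 [P1 [P2 P3]]]]].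
      generalize (Nw Dt) (Nw D1) (Nw D2) (Nw D3); cbn [crd]. intros N0 N1 N2 N3.
      apply Rabs_lt_between in N0. apply Rabs_lt_between in N1. apply Rabs_lt_between in N2. apply Rabs_lt_between in N3.
      apply Rabs_le_between in P1. apply Rabs_le_between in P2. apply Rabs_le_between in P3.
      split; [lra|split; [lra|]]. repeat split; apply Rabs_le_between; lra. }
    repeat split; apply Ab; intros e' He'; specialize (Y e' He'); lra.
  - destruct (Rle_lt_dec (g z1) 0) as [H0|H0].
    + specialize (Hmax z0 (past_refl L z0 ltac:(lra))). unfold g in Hmax, H0. rewrite (Ephi z0), !Rminus_diag in Hmax.
      replace (0 ^ 2) with 0 in Hmax by ring. lra.
    + exfalso. destruct (Hw z1 Hz1) as [W3 WH]. destruct Hz1 as [P0 [P1 [P2 P3]]].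
      unfold g in H0. rewrite Ephi in H0.
      pose proof (pow2_ge_0 (pt_x1 z1 - pt_x1 z0)) as S1. pose proof (pow2_ge_0 (pt_x2 z1 - pt_x2 z0)) as S2.
      pose proof (pow2_ge_0 (pt_x3 z1 - pt_x3 z0)) as S3.
      (* As [w <= 3] and [w] exceeds the barrier, the quadratic part is below 3: the maximum is
         interior in space and after the initial time, though it may sit at the final time. *)
      assert (Q : (pt_x1 z1 - pt_x1 z0) ^ 2 + (pt_x2 z1 - pt_x2 z0) ^ 2 + (pt_x3 z1 - pt_x3 z0) ^ 2 + (pt_t z0 - pt_t z1) < L ^ 2).
      { apply Rmult_lt_reg_l with k; [assumption|]. lra. }
      assert (In : forall a, a ^ 2 < L ^ 2 -> Rabs a < L) by (intros a Ha; apply Rabs_lt_between; nra).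
      assert (I1 : Rabs (pt_x1 z1 - pt_x1 z0) < L) by (apply In; lra).
      assert (I2 : Rabs (pt_x2 z1 - pt_x2 z0) < L) by (apply In; lra).
      assert (I3 : Rabs (pt_x3 z1 - pt_x3 z0) < L) by (apply In; lra).
      assert (Gt : 0 <= pd Dt g z1).
      { apply (deriv_left_max (fun s => g (shift z1 Dt s)) _ (L ^ 2 - (pt_t z0 - pt_t z1))).
        - apply Smooth_hasD; assumption.
        - lra.
        - intros s Hs. rewrite shift_0. apply Hmax. unfold past; cbn [shift pt_t pt_x1 pt_x2 pt_x3].
          repeat split; try assumption; lra. }
      assert (Gx : forall d, d <> Dt -> pd d (pd d g) z1 <= 0).
      { intros d Hd.
        assert (Hcd : exists r, 0 < r /\ forall s, - r < s < r -> past L z0 (shift z1 d s)).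
        { rewrite Rabs_minus_sym in P1, P2, P3.
          apply Rabs_lt_between in I1. apply Rabs_lt_between in I2. apply Rabs_lt_between in I3.
          destruct d; [congruence| | |].
          - exists (Rmin (L - (pt_x1 z1 - pt_x1 z0)) (L + (pt_x1 z1 - pt_x1 z0))). split; [apply Rmin_pos; lra|].
            intros s Hs. pose proof (Rmin_l (L - (pt_x1 z1 - pt_x1 z0)) (L + (pt_x1 z1 - pt_x1 z0))).
            pose proof (Rmin_r (L - (pt_x1 z1 - pt_x1 z0)) (L + (pt_x1 z1 - pt_x1 z0))).
            unfold past; cbn [shift pt_t pt_x1 pt_x2 pt_x3]. repeat split; try lra; apply Rabs_le_between; lra.
          - exists (Rmin (L - (pt_x2 z1 - pt_x2 z0)) (L + (pt_x2 z1 - pt_x2 z0))). split; [apply Rmin_pos; lra|].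
            intros s Hs. pose proof (Rmin_l (L - (pt_x2 z1 - pt_x2 z0)) (L + (pt_x2 z1 - pt_x2 z0))).
            pose proof (Rmin_r (L - (pt_x2 z1 - pt_x2 z0)) (L + (pt_x2 z1 - pt_x2 z0))).
            unfold past; cbn [shift pt_t pt_x1 pt_x2 pt_x3]. repeat split; try lra; apply Rabs_le_between; lra.
          - exists (Rmin (L - (pt_x3 z1 - pt_x3 z0)) (L + (pt_x3 z1 - pt_x3 z0))). split; [apply Rmin_pos; lra|].
            intros s Hs. pose proof (Rmin_l (L - (pt_x3 z1 - pt_x3 z0)) (L + (pt_x3 z1 - pt_x3 z0))).
            pose proof (Rmin_r (L - (pt_x3 z1 - pt_x3 z0)) (L + (pt_x3 z1 - pt_x3 z0))).
            unfold past; cbn [shift pt_t pt_x1 pt_x2 pt_x3]. repeat split; try lra; apply Rabs_le_between; lra. }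
        destruct Hcd as [r [Hr Hs]].
        apply (deriv2_max (fun s => g (shift z1 d s)) (fun s => pd d g (shift z1 d s)) _ r).
        - intros s. apply is_derive_Reals, hasD_at, Smooth_hasD; assumption.
        - apply (Smooth_hasD (pd d g) d); apply Smooth_pd; assumption.
        - assumption.
        - intros s Hss. rewrite shift_0. apply Hmax, Hs; assumption. }
      assert (Hg : heat g z1 = heat w z1 + 21 / L ^ 2).
      { unfold g. rewrite (heat_plus w (fun z => -1 * phi z)) by (try assumption; apply Smooth_scal; assumption).
        rewrite heat_scal by assumption. rewrite Hphi. ring. }
      pose proof (Gx D1 ltac:(discriminate)). pose proof (Gx D2 ltac:(discriminate)). pose proof (Gx D3 ltac:(discriminate)).
      assert (0 <= heat g z1) by (unfold heat; lra).
      assert (Wc : c < w z1) by nra.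
      assert (c ^ 3 < w z1 ^ 3) by (apply pow_lt_mono; [lra|assumption|lia]).
      lra.
Qed.

(** * The unit-scale proposition *)

Lemma moll_ext_past (Phi f g : pt -> R) (T : R) (z : pt) : kernel_ok Phi -> 0 < T ->
  (forall w, past T z w -> f w = g w) -> moll Phi T f z = moll Phi T g z.
Proof.
  intros Hok HT H. unfold moll. f_equal. extensionality w.
  destruct (Req_dec (Psi Phi T (psub z w)) 0) as [E|E]; [rewrite E; ring|].
  rewrite H; [reflexivity|]. apply past_psub. apply (Psi_psupp Phi Hok T HT); assumption.
Qed.

(** The convolution is commuted so that derivatives fall on [f]; [Psi], a uniform limit, enters only
    through continuity and compact support. *)
Lemma moll_Smooth (Phi f : pt -> R) (T : R) : kernel_ok Phi -> 0 < T -> Smooth f -> Smooth (moll Phi T f).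
Proof.
  intros Hok HT Sf. destruct (Psi_prob Phi Hok T HT) as [CP _].
  apply (Smooth_ext (conv f (Psi Phi T))).
  - intros z. apply (conv_comm f (Psi Phi T)). right; split; [apply Smooth_cont4; assumption|assumption].
  - apply conv_Smooth; [assumption|apply CP|right; assumption].
Qed.

Lemma moll_heat (Phi f : pt -> R) (T : R) (z : pt) : kernel_ok Phi -> 0 < T -> Smooth f ->
  heat (moll Phi T f) z = moll Phi T (heat f) z.
Proof.
  intros Hok HT Sf. destruct (Psi_prob Phi Hok T HT) as [CP _].
  replace (moll Phi T f) with (conv f (Psi Phi T)).
  - rewrite conv_heat; [|assumption|apply CP|right; assumption].
    apply (conv_comm (heat f) (Psi Phi T)). right; split; [apply heat_cont4; assumption|assumption].
  - extensionality w. apply (conv_comm f (Psi Phi T)). right; split; [apply Smooth_cont4; assumption|assumption].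
Qed.

Lemma root8_of_pow (b : R) : 0 <= b -> root8 (b ^ 8) = b.
Proof.
  intros Hb. unfold root8. replace (b ^ 8) with ((b ^ 4) ^ 2) by ring. rewrite sqrt_pow2 by (apply pow_le; assumption).
  replace (b ^ 4) with ((b ^ 2) ^ 2) by ring. rewrite sqrt_pow2 by (apply pow_le; assumption).
  apply sqrt_pow2; assumption.
Qed.

Lemma cube_diff (x y B : R) : Rabs x <= B -> Rabs y <= B -> Rabs (x ^ 3 - y ^ 3) <= 3 * B ^ 2 * Rabs (x - y).
Proof.
  intros Hx Hy. replace (x ^ 3 - y ^ 3) with ((x ^ 2 + x * y + y ^ 2) * (x - y)) by ring.
  rewrite Rabs_mult. apply Rmult_le_compat_r; [apply Rabs_pos|].
  apply Rabs_le_between in Hx. apply Rabs_le_between in Hy. apply Rabs_le_between. nra.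
Qed.

Section UnitProp.
Variable Phi : pt -> R.
Hypothesis Hok : kernel_ok Phi.

Lemma unit_heat (Kr del C2 : R) (v t1 t2 t3 Y2 Y3 : pt -> R) (z : pt) :
  unit_hyp Phi Kr del C2 v t1 t2 t3 Y2 Y3 -> Om Kr z ->
  heat v z = - v z ^ 3 - 3 * (v z ^ 2 * t1 z) - 3 * Wf C2 v t1 t2 z - t3 z.
Proof. intros HU Hz. rewrite (uEv _ _ _ _ _ _ _ _ _ _ HU z Hz). unfold Wf. ring. Qed.

(** Three smallness choices in order: a mollification scale so fine that commuting it with the cube
    costs at most [sg^3 / 32], data small against the worst power [b^(-13)] at that scale, and a
    cube so large that the barrier costs at most [sg^3 / 32]. The total [3/32] is below [1/8], the
    cube of 1/2. *)
Lemma step_one (sg : R) : 0 < sg <= 1 -> exists K0 d0, 10 <= K0 /\ 0 < d0 <= 1 /\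
  forall Kr del C2 v t1 t2 t3 Y2 Y3, K0 <= Kr -> 0 <= del <= d0 ->
    unit_hyp Phi Kr del C2 v t1 t2 t3 Y2 Y3 -> forall z, Om 2 z -> Rabs (v z) <= sg.
Proof.
  intros Hsg. set (b := sg / 100). assert (Hb : 0 < b <= 1 / 100) by (unfold b; lra).
  set (T := b ^ 8).
  assert (HT : 0 < T) by (apply pow_lt; lra).
  assert (HT6 : T <= 1 / 6).
  { unfold T. apply Rle_trans with ((1 / 100) ^ 8); [apply pow_incr; lra|]. simpl. lra. }
  assert (HqT : root8 T = b) by (apply root8_of_pow; lra).
  pose proof CR_pos as HCR.
  assert (Pb13 : 0 < b ^ 13) by (apply pow_lt; lra).
  assert (Ps3 : 0 < sg ^ 3) by (apply pow_lt; lra).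
  (* The factor [6 CR + 10] collects the error terms: [3 CR] from [v^2 t1], [3 CR + 9] from [Wf] and
     [v t2], and 1 from [t3]. *)
  set (d0 := Rmin 1 (sg ^ 3 / 32 * b ^ 13 / (6 * CR + 10))).
  assert (Hd0 : 0 < d0).
  { apply Rmin_pos; [lra|]. apply Rdiv_lt_0_compat; [|lra]. apply Rmult_lt_0_compat; lra. }
  (* Since [672 = 21 * 32] and [L >= 1], the barrier term [21 / L^2] is at most [sg^3 / 32]. *)
  set (L := 672 / sg ^ 3).
  assert (sg3 : sg ^ 3 <= 1) by (rewrite <- (pow1 3); apply pow_incr; lra).
  assert (HL : 672 <= L) .
  { apply Rmult_le_reg_r with (sg ^ 3); [lra|]. unfold L, Rdiv. rewrite Rmult_assoc, Rinv_l; lra. }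
  exists (L + 10), d0. split; [lra|split; [split; [assumption|apply Rmin_l]|]].
  intros Kr del C2 v t1 t2 t3 Y2 Y3 HK Hdel HU z0 Hz0.
  assert (Hdel1 : 0 <= del <= 1) by (pose proof (Rmin_l 1 (sg ^ 3 / 32 * b ^ 13 / (6 * CR + 10))) as X; fold d0 in X; lra).
  assert (Hdel2 : (6 * CR + 10) * (del / b ^ 13) <= sg ^ 3 / 32).
  { pose proof (Rmin_r 1 (sg ^ 3 / 32 * b ^ 13 / (6 * CR + 10))) as X. fold d0 in X.
    assert (Y : del <= sg ^ 3 / 32 * b ^ 13 / (6 * CR + 10)) by lra.
    apply Rle_div_r in Y; [|lra].
    replace ((6 * CR + 10) * (del / b ^ 13)) with (del * (6 * CR + 10) / b ^ 13) by (field; lra).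
    apply Rle_div_l; [assumption|]. exact Y. }
  assert (HKr : 10 <= Kr) by lra.
  pose proof (uv _ _ _ _ _ _ _ _ _ _ HU) as Sv. pose proof (Smooth_cont4 v Sv) as Cv.
  set (w := moll Phi T v).
  assert (Sw : Smooth w) by (apply moll_Smooth; assumption).
  assert (b3 : b ^ 3 = sg ^ 3 / 1000000) by (unfold b; field).
  assert (Vd : forall z, Om (Kr - 3) z -> forall y, past T z y -> Rabs (v y - v z) <= 274 * b ^ 3).
  { intros z Hz y Hy.
    assert (Oz1 : Om (Kr - 1) z) by (apply Om_le with (Kr - 3); [lra|assumption]).
    destruct (past_pd T z y ltac:(lra) Hy) as [Pd _].
    eapply Rle_trans; [apply (v_holder Phi Kr del C2 v t1 t2 t3 Y2 Y3 HU HKr Hdel1 z y Oz1); apply past_le with T; [lra|assumption]|].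
    apply Rmult_le_compat_l; [lra|]. apply pow_incr. split; [apply root8_ge0|]. rewrite <- HqT. apply root8_le; assumption. }
  assert (Wd : forall z, Om (Kr - 3) z -> Rabs (w z - v z) <= 274 * b ^ 3).
  { intros z Hz. apply moll_le; [assumption|assumption|assumption|]. apply Vd; assumption. }
  assert (V3 : forall z, Om Kr z -> Rabs (v z) <= 3) by (apply (uv3 _ _ _ _ _ _ _ _ _ _ HU)).
  assert (Opast : forall z y, Om (Kr - 3) z -> past T z y -> Om Kr y).
  { intros z y Hz Hy. apply Om_le with (Kr - 3 + T); [lra|]. apply Om_past with z; try lra; assumption. }
  assert (W3 : forall z, Om (Kr - 3) z -> Rabs (w z) <= 3).
  { intros z Hz. rewrite <- (Rminus_0_r (w z)). apply moll_le; [assumption|assumption|assumption|].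
    intros y Hy. rewrite Rminus_0_r. apply V3, Opast with z; assumption. }
  set (e := sg ^ 3 / 32 + sg ^ 3 / 32).
  assert (Heat : forall z, Om (Kr - 3) z -> Rabs (heat w z + w z ^ 3) <= e).
  { intros z Hz. assert (Oz : Om Kr z) by (apply Om_le with (Kr - 3); [lra|assumption]).
    unfold w at 1. rewrite moll_heat by assumption.
    pose proof (Smooth_cont4 t1 (u1 _ _ _ _ _ _ _ _ _ _ HU)) as Ct1.
    pose proof (Smooth_cont4 t2 (u2 _ _ _ _ _ _ _ _ _ _ HU)) as Ct2.
    pose proof (Smooth_cont4 t3 (u3 _ _ _ _ _ _ _ _ _ _ HU)) as Ct3.
    assert (CW : cont4 (Wf C2 v t1 t2)).
    { unfold Wf. apply cont4_plus; [apply cont4_plus; [apply cont4_mult; assumption|apply cont4_scal; assumption]|apply cont4_scal; assumption]. }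
    assert (CH : cont4 (fun y => v y ^ 2 * t1 y)) by (apply cont4_mult; [apply cont4_pow|]; assumption).
    assert (C3 : cont4 (fun y => v y ^ 3)) by (apply cont4_pow; assumption).
    rewrite (moll_ext_past Phi (heat v) (fun y => ((-1) * v y ^ 3 + (-3) * (v y ^ 2 * t1 y)) + ((-3) * Wf C2 v t1 t2 y + (-1) * t3 y)) T z Hok HT).
    2: { intros y Hy. rewrite (unit_heat Kr del C2 v t1 t2 t3 Y2 Y3 y HU) by (apply Opast with z; assumption). ring. }
    rewrite moll_plus by (first [assumption|apply cont4_plus; apply cont4_scal; assumption]).
    rewrite (moll_plus Phi Hok T (fun y => -1 * v y ^ 3) (fun y => -3 * (v y ^ 2 * t1 y))) by (try assumption; apply cont4_scal; assumption).
    rewrite (moll_plus Phi Hok T (fun y => -3 * Wf C2 v t1 t2 y) (fun y => -1 * t3 y)) by (try assumption; apply cont4_scal; assumption).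
    rewrite (moll_scal Phi Hok T (-1) (fun y => v y ^ 3)), (moll_scal Phi Hok T (-3) (fun y => v y ^ 2 * t1 y)),
      (moll_scal Phi Hok T (-3) (Wf C2 v t1 t2)), (moll_scal Phi Hok T (-1) t3) by assumption.
    assert (E3 : Rabs (moll Phi T (fun y => v y ^ 3) z - v z ^ 3) <= 27 * (274 * b ^ 3)).
    { apply moll_le; [assumption|assumption|assumption|]. intros y Hy.
      eapply Rle_trans; [apply (cube_diff _ _ 3); [apply V3, Opast with z; assumption|apply V3; assumption]|].
      replace (3 * 3 ^ 2) with 27 by ring. apply Rmult_le_compat_l; [lra|]. apply Vd; assumption. }
    assert (Ew : Rabs (w z ^ 3 - v z ^ 3) <= 27 * (274 * b ^ 3)).
    { eapply Rle_trans; [apply (cube_diff _ _ 3); [apply W3; assumption|apply V3; assumption]|].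
      replace (3 * 3 ^ 2) with 27 by ring. apply Rmult_le_compat_l; [lra|]. apply Wd; assumption. }
    pose proof (W_est Phi Hok Kr del C2 v t1 t2 t3 Y2 Y3 HU HKr Hdel1 T z ltac:(lra) Hz) as EW.
    pose proof (H_est Phi Hok Kr del C2 v t1 t2 t3 Y2 Y3 HU HKr Hdel1 T z ltac:(lra) Hz) as EH.
    pose proof (uq2 _ _ _ _ _ _ _ _ _ _ HU z T Oz ltac:(lra)) as E2.
    pose proof (uq3 _ _ _ _ _ _ _ _ _ _ HU z T Oz ltac:(lra)) as Eq3.
    rewrite HqT in *.
    assert (B5 : del / b ^ 5 <= del / b ^ 13) by (apply div_pow_le; [lra|lra|lia]).
    assert (B9 : del / b ^ 9 <= del / b ^ 13) by (apply div_pow_le; [lra|lra|lia]).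
    set (D := del / b ^ 13) in *.
    assert (EW' : Rabs (moll Phi T (Wf C2 v t1 t2) z - v z * moll Phi T t2 z) <= CR * D).
    { eapply Rle_trans; [exact EW|]. unfold Rdiv. rewrite Rmult_assoc. apply Rmult_le_compat_l; [lra|exact B5]. }
    assert (EH' : Rabs (moll Phi T (fun y => v y ^ 2 * t1 y) z) <= CR * D).
    { eapply Rle_trans; [exact EH|]. unfold Rdiv. rewrite Rmult_assoc. apply Rmult_le_compat_l; [lra|exact B5]. }
    assert (E2' : Rabs (v z * moll Phi T t2 z) <= 3 * D).
    { rewrite Rabs_mult. apply Rmult_le_compat; try apply Rabs_pos; [apply V3; assumption|lra]. }
    clear EW EH E2.
    apply Rabs_le_between in E3. apply Rabs_le_between in Ew. apply Rabs_le_between in EW'.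
    apply Rabs_le_between in EH'. apply Rabs_le_between in E2'. apply Rabs_le_between in Eq3.
    apply Rabs_le_between. unfold e. lra. }
  assert (Hin : forall z, past L z0 z -> Om (Kr - 3) z).
  { intros z Hz. apply Om_le with (2 + L); [lra|]. apply Om_past with z0; try lra; assumption. }
  assert (He : e + 21 / L ^ 2 <= (sg / 2) ^ 3).
  { assert (21 / L ^ 2 <= sg ^ 3 / 32).
    { apply Rle_div_l; [apply pow_lt; lra|].
      assert (X : sg ^ 3 * L = 672) by (unfold L; field; lra).
      replace (sg ^ 3 / 32 * L ^ 2) with (sg ^ 3 * L * L / 32) by field. rewrite X. lra. }
    replace ((sg / 2) ^ 3) with (sg ^ 3 / 8) by field. unfold e. lra. }
  assert (U1 : w z0 <= sg / 2).
  { apply (max_principle_cubic w z0 L (sg / 2) e); try assumption; try lra.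
    intros z Hz. pose proof (W3 z (Hin z Hz)) as A1. pose proof (Heat z (Hin z Hz)) as A2.
    apply Rabs_le_between in A1. apply Rabs_le_between in A2. split; lra. }
  (* The cubic equation is odd, so the same comparison bounds [-w]. *)
  assert (U2 : (fun z => -1 * w z) z0 <= sg / 2).
  { apply (max_principle_cubic (fun z => -1 * w z) z0 L (sg / 2) e); try assumption; try lra.
    - apply Smooth_scal; assumption.
    - intros z Hz. pose proof (W3 z (Hin z Hz)) as A1. pose proof (Heat z (Hin z Hz)) as A2.
      rewrite heat_scal by assumption.
      apply Rabs_le_between in A1. apply Rabs_le_between in A2.
      replace ((-1 * w z) ^ 3) with (- w z ^ 3) by ring. split; lra. }
  pose proof (Wd z0 ltac:(apply Om_le with 2; [lra|assumption])) as D0.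
  assert (274 * b ^ 3 <= sg / 2).
  { rewrite b3. assert (sg ^ 3 <= sg); [|lra]. simpl. nra. }
  apply Rabs_le_between in D0. apply Rabs_le_between. lra.
Qed.

(** With [c = v(0)] frozen, [heat U] is a cube plus reconstructed products of order at least -5/8,
    plus [(v - c) t2]. The last term carries the weight [pdist^(3/8)] at order -9/8, which is the
    form of hypothesis [schauder] was built for. *)
Lemma unit_prop : exists Kr del, 10 <= Kr /\ 0 < del <= 1 /\
  forall C2 v t1 t2 t3 Y2 Y3, unit_hyp Phi Kr del C2 v t1 t2 t3 Y2 Y3 ->
    Rabs (v origin) <= 1 /\
    forall y, past 1 origin y -> Rabs (vrem v Y2 Y3 origin y) <= root8 (pdist origin y) ^ 10.
Proof.
  destruct (parametrix_exists Phi Hok) as [K [eta [Par Hc]]].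
  destruct (schauder Phi K eta Hok Par Hc) as [C [HC Sch]].
  pose proof CR_pos as HCR.
  (* The size of [v] is fixed after the Schauder constant [C], and the smallness of the data after
     both. *)
  set (sg := 1 / (100 * (51 + 24 * C))).
  assert (Hsg : 0 < sg <= 1 / 100).
  { split; [apply Rdiv_lt_0_compat; lra|]. unfold sg. apply Rle_div_l; lra. }
  destruct (step_one sg ltac:(lra)) as [K0 [d0 [HK0 [Hd0 St]]]].
  set (del := Rmin d0 (sg / (6 * CR + 1000))).
  assert (Hdel : 0 < del) by (apply Rmin_pos; [lra|apply Rdiv_lt_0_compat; lra]).
  assert (Hdd : del <= d0) by apply Rmin_l.
  assert (Hds : (6 * CR + 1000) * del <= sg).
  { pose proof (Rmin_r d0 (sg / (6 * CR + 1000))) as X. fold del in X. apply Rle_div_r in X; [|lra]. lra. }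
  exists K0, del. split; [assumption|split; [lra|]].
  intros C2 v t1 t2 t3 Y2 Y3 HU.
  assert (Vs : forall z, Om 2 z -> Rabs (v z) <= sg) by (apply (St K0 del C2 v t1 t2 t3 Y2 Y3); [lra|lra|assumption]).
  assert (O0 : Om 1 origin).
  { unfold Om, origin; simpl. rewrite Rabs_R0. repeat split; lra. }
  assert (V0 : Rabs (v origin) <= sg) by (apply Vs, Om_le with 1; [lra|assumption]).
  split; [lra|].
  set (c := v origin) in *.
  pose proof (uv _ _ _ _ _ _ _ _ _ _ HU) as Sv. pose proof (uY2 _ _ _ _ _ _ _ _ _ _ HU) as S2.
  pose proof (uY3 _ _ _ _ _ _ _ _ _ _ HU) as S3.
  (* The constant makes [U] vanish at the origin, so that no bound on [Y2] or [Y3] themselves is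
     needed, only on their increments. *)
  set (U := fun z => (v z + Y3 z) + (3 * c * Y2 z + (- (v origin + Y3 origin + 3 * c * Y2 origin)))).
  assert (S3c : Smooth (fun z => 3 * c * Y2 z + (- (v origin + Y3 origin + 3 * c * Y2 origin))))
    by (apply Smooth_plus; [apply Smooth_scal; assumption|apply Smooth_const]).
  assert (SvY : Smooth (fun z => v z + Y3 z)) by (apply Smooth_plus; assumption).
  assert (SU : Smooth U) by (apply Smooth_plus; assumption).
  assert (ER : forall y, Rem U origin y = vrem v Y2 Y3 origin y).
  { intros y. unfold Rem, vrem, U, nu, grad, dot3. fold c. cbn [pt_x1 pt_x2 pt_x3].
    assert (P : forall d, pd d (fun z => v z + Y3 z + (3 * c * Y2 z + - (v origin + Y3 origin + 3 * c * Y2 origin))) =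
      fun z => pd d v z + pd d Y3 z + (3 * c * pd d Y2 z + 0)).
    { intros d. apply hasD_pd. apply hasD_plus; [apply hasD_plus; apply Smooth_hasD; assumption|].
      apply hasD_plus; [apply hasD_scal, Smooth_hasD; assumption|apply hasD_const]. }
    rewrite !P. fold c. ring. }
  set (s' := 2 * sg + (6 * CR + 1000) * del).
  assert (Hs' : 0 <= s') by (unfold s'; nra).
  assert (Past1 : forall w, past 1 origin w -> Om 2 w).
  { intros w Hw. replace 2 with (1 + 1) by ring. apply Om_past with origin; try lra; assumption. }
  assert (Ub : forall w, past 1 origin w -> Rabs (U w) <= s').
  { intros w Hw. destruct (past_pd 1 origin w ltac:(lra) Hw) as [Pd _].
    pose proof (Vs w (Past1 w Hw)) as A1.
    pose proof (uh2 _ _ _ _ _ _ _ _ _ _ HU w origin) as H2. rewrite pdist_sym in H2. specialize (H2 Pd).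
    pose proof (uh3 _ _ _ _ _ _ _ _ _ _ HU w origin) as H3. rewrite pdist_sym in H3. specialize (H3 Pd).
    assert (Q : forall n, 0 <= root8 (pdist origin w) ^ n <= 1).
    { intros n. pose proof (root8_ge0 (pdist origin w)). pose proof (root8_le1 _ Pd).
      split; [apply pow_le; lra|rewrite <- (pow1 n); apply pow_incr; lra]. }
    pose proof (Q 7%nat). pose proof (Q 3%nat).
    assert (E3 : Rabs (Y3 w - Y3 origin) <= del) by nra.
    assert (E2 : Rabs (3 * c * (Y2 w - Y2 origin)) <= 3 * del).
    { rewrite !Rabs_mult, (Rabs_pos_eq 3) by lra. pose proof (Rabs_pos c). pose proof (Rabs_pos (Y2 w - Y2 origin)).
      assert (Rabs (Y2 w - Y2 origin) <= del) by nra. nra. }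
    unfold U, s'. fold c. pose proof V0 as V0'.
    apply Rabs_le_between in V0'. apply Rabs_le_between in A1. apply Rabs_le_between in E2. apply Rabs_le_between in E3.
    apply Rabs_le_between. nra. }
  assert (Mb : forall s w, 0 < s <= 1 / 8 -> past 1 origin w ->
     Rabs (moll Phi s (heat U) w) <= s' * (root8 s ^ 3 + root8 (pdist origin w) ^ 3) / root8 s ^ 9).
  { intros s w Hs Hw. destruct (past_pd 1 origin w ltac:(lra) Hw) as [Pd _].
    assert (Ow1 : Om 2 w) by (apply Past1; assumption).
    assert (Opast : forall y, past s w y -> past (1 + 1 / 8) origin y).
    { intros y Hy. apply past_trans with w; try lra; [assumption|]. apply past_le with s; [lra|assumption]. }
    assert (Vy : forall y, past s w y -> Rabs (v y) <= sg).
    { intros y Hy. apply Vs. apply Om_le with (0 + (1 + 1 / 8)); [lra|]. apply Om_past with origin; try lra.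
      - unfold Om, origin; simpl. rewrite Rabs_R0. repeat split; lra.
      - apply Opast; assumption. }
    assert (OK : forall y, past s w y -> Om K0 y).
    { intros y Hy. apply Om_le with (1 + (1 + 1 / 8)); [lra|]. apply Om_past with origin; try lra; [assumption|]. apply Opast; assumption. }
    pose proof (Smooth_cont4 v Sv) as Cv.
    pose proof (Smooth_cont4 t1 (u1 _ _ _ _ _ _ _ _ _ _ HU)) as Ct1.
    pose proof (Smooth_cont4 t2 (u2 _ _ _ _ _ _ _ _ _ _ HU)) as Ct2.
    assert (CW : cont4 (Wf C2 v t1 t2)).
    { unfold Wf. apply cont4_plus; [apply cont4_plus; [apply cont4_mult; assumption|apply cont4_scal; assumption]|apply cont4_scal; assumption]. }
    assert (CH : cont4 (fun y => v y ^ 2 * t1 y)) by (apply cont4_mult; [apply cont4_pow|]; assumption).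
    assert (C3 : cont4 (fun y => v y ^ 3)) by (apply cont4_pow; assumption).
    (* Adding [Y3] removes [t3] from the equation, and [3 c Y2] contributes [3 c t2], to be compared
       with the [3 v t2] inside [3 Wf]. *)
    rewrite (moll_ext_past Phi (heat U) (fun y => ((-1) * v y ^ 3 + (-3) * (v y ^ 2 * t1 y)) + ((-3) * Wf C2 v t1 t2 y + (3 * c) * t2 y)) s w Hok (proj1 Hs)).
    2: { intros y Hy. unfold U. rewrite (heat_plus (fun z => v z + Y3 z)) by assumption.
         rewrite (heat_plus v Y3) by assumption.
         rewrite (heat_plus (fun z => 3 * c * Y2 z)) by (first [apply Smooth_scal; assumption|apply Smooth_const]).
         rewrite heat_scal, heat_const by assumption.
         rewrite (unit_heat K0 del C2 v t1 t2 t3 Y2 Y3 y HU) by (apply OK; assumption).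
         rewrite (uE2 _ _ _ _ _ _ _ _ _ _ HU y (OK y Hy)), (uE3 _ _ _ _ _ _ _ _ _ _ HU y (OK y Hy)). ring. }
    assert (Hs0 := proj1 Hs).
    rewrite moll_plus by (first [assumption|apply cont4_plus; apply cont4_scal; assumption]).
    rewrite (moll_plus Phi Hok s (fun y => -1 * v y ^ 3) (fun y => -3 * (v y ^ 2 * t1 y))) by (try assumption; apply cont4_scal; assumption).
    rewrite (moll_plus Phi Hok s (fun y => -3 * Wf C2 v t1 t2 y) (fun y => 3 * c * t2 y)) by (try assumption; apply cont4_scal; assumption).
    rewrite (moll_scal Phi Hok s (-1) (fun y => v y ^ 3)), (moll_scal Phi Hok s (-3) (fun y => v y ^ 2 * t1 y)),
      (moll_scal Phi Hok s (-3) (Wf C2 v t1 t2)), (moll_scal Phi Hok s (3 * c) t2) by assumption.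
    assert (OwK3 : Om (K0 - 3) w) by (apply Om_le with 2; [lra|assumption]).
    assert (OwK : Om K0 w) by (apply Om_le with 2; [lra|assumption]).
    pose proof (W_est Phi Hok K0 del C2 v t1 t2 t3 Y2 Y3 HU HK0 ltac:(lra) s w ltac:(lra) OwK3) as EW.
    pose proof (H_est Phi Hok K0 del C2 v t1 t2 t3 Y2 Y3 HU HK0 ltac:(lra) s w ltac:(lra) OwK3) as EH.
    pose proof (uq2 _ _ _ _ _ _ _ _ _ _ HU w s OwK ltac:(lra)) as E2.
    assert (E3 : Rabs (moll Phi s (fun y => v y ^ 3) w) <= sg).
    { rewrite <- (Rminus_0_r (moll _ _ _ _)). apply moll_le; [assumption|assumption|assumption|]. intros y Hy.
      rewrite Rminus_0_r, <- RPow_abs. specialize (Vy y Hy). pose proof (Rabs_pos (v y)).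
      apply Rle_trans with (sg ^ 3); [apply pow_incr; lra|]. simpl. nra. }
    set (b := root8 s) in *. set (a := root8 (pdist origin w)) in *.
    assert (Hb : 0 < b) by (apply root8_pos; lra). assert (Hb1 : b <= 1) by (apply root8_le1; lra).
    assert (Ha0 : 0 <= a) by apply root8_ge0.
    (* Hölder continuity of [v] is known up to distance 1/3; beyond it the weight is at least 1/8
       and the smallness of [v] at both points suffices. *)
    assert (Vw : Rabs (v w - c) <= 274 * a ^ 3).
    { destruct (Rle_lt_dec (pdist origin w) (1 / 3)) as [Hp|Hp].
      - apply (v_holder Phi K0 del C2 v t1 t2 t3 Y2 Y3 HU HK0 ltac:(lra) origin w); [apply Om_le with 1; [lra|assumption]|].
        apply past_pdist; [lra|]. split; [|assumption]. apply (past_pdist 1 origin w ltac:(lra)) in Hw. apply Hw.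
      - assert (Ha : 1 / 2 <= a).
        { unfold a. rewrite <- (root8_of_pow (1 / 2)) by lra. apply root8_le. simpl. lra. }
        assert (A3 : (1 / 2) ^ 3 <= a ^ 3) by (apply pow_incr; lra). simpl in A3.
        pose proof (Vs w Ow1) as A1. apply Rabs_le_between in A1. pose proof V0 as V0'. apply Rabs_le_between in V0'.
        apply Rabs_le_between. simpl. lra. }
    assert (Pi : forall n, 0 < / b ^ n) by (intros; apply Rinv_0_lt_compat, pow_lt; assumption).
    assert (I6 : / b ^ 5 <= / b ^ 6).
    { apply Rinv_le_contravar; [apply pow_lt; assumption|]. replace (b ^ 6) with (b ^ 5 * b) by ring.
      assert (0 < b ^ 5) by (apply pow_lt; assumption). nra. }
    assert (I1 : 1 <= / b ^ 6).
    { rewrite <- Rinv_1. apply Rinv_le_contravar; [apply pow_lt; assumption|]. rewrite <- (pow1 6). apply pow_incr; lra. }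
    assert (E36 : b ^ 3 / b ^ 9 = / b ^ 6) by (field; lra).
    replace (s' * (b ^ 3 + a ^ 3) / b ^ 9) with (s' * (b ^ 3 / b ^ 9) + s' * (a ^ 3 / b ^ 9)) by (unfold Rdiv; ring).
    rewrite E36.
    assert (Pa : 0 <= a ^ 3) by (apply pow_le; assumption).
    assert (T2 : Rabs ((v w - c) * moll Phi s t2 w) <= 274 * del * (a ^ 3 / b ^ 9)).
    { rewrite Rabs_mult. replace (274 * del * (a ^ 3 / b ^ 9)) with (274 * a ^ 3 * (del / b ^ 9)) by (unfold Rdiv; ring).
      apply Rmult_le_compat; try apply Rabs_pos; assumption. }
    assert (EW' : Rabs (moll Phi s (Wf C2 v t1 t2) w - v w * moll Phi s t2 w) <= CR * del * / b ^ 6).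
    { eapply Rle_trans; [exact EW|]. apply Rmult_le_compat_l; [nra|exact I6]. }
    assert (EH' : Rabs (moll Phi s (fun y => v y ^ 2 * t1 y) w) <= CR * del * / b ^ 6).
    { eapply Rle_trans; [exact EH|]. apply Rmult_le_compat_l; [nra|exact I6]. }
    assert (E3' : Rabs (moll Phi s (fun y => v y ^ 3) w) <= sg * / b ^ 6) by nra.
    assert (Pab : 0 <= a ^ 3 / b ^ 9) by (apply Rmult_le_pos; [assumption|apply Rlt_le, Pi]).
    assert (F1 : sg * / b ^ 6 + 6 * (CR * del * / b ^ 6) <= s' * / b ^ 6).
    { replace (sg * / b ^ 6 + 6 * (CR * del * / b ^ 6)) with ((sg + 6 * CR * del) * / b ^ 6) by ring.
      apply Rmult_le_compat_r; [apply Rlt_le, Pi|]. unfold s'. nra. }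
    assert (F2 : 3 * (274 * del * (a ^ 3 / b ^ 9)) <= s' * (a ^ 3 / b ^ 9)).
    { replace (3 * (274 * del * (a ^ 3 / b ^ 9))) with (822 * del * (a ^ 3 / b ^ 9)) by ring.
      apply Rmult_le_compat_r; [assumption|]. unfold s'. nra. }
    clear EW EH E2 E3.
    apply Rabs_le_between in T2. apply Rabs_le_between in EW'. apply Rabs_le_between in EH'. apply Rabs_le_between in E3'.
    apply Rabs_le_between. split; lra. }
  pose proof (Sch U origin s' SU Hs' Ub Mb) as Sc.
  assert (Hs3 : s' <= 3 * sg) by (unfold s'; lra).
  assert (Esg : (51 + 24 * C) * sg = 1 / 100) by (unfold sg; field; lra).
  assert (HCs : C * s' <= 1 / 20) by nra.
  intros y Hy. destruct (past_pd 1 origin y ltac:(lra) Hy) as [Pd _].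
  destruct (Rle_lt_dec (pdist origin y) (1 / 8)) as [Hp|Hp].
  - assert (Py : past (1 / 8) origin y).
    { apply past_pdist; [lra|]. split; [|assumption]. apply (past_pdist 1 origin y ltac:(lra)) in Hy. apply Hy. }
    specialize (Sc y Py). rewrite ER in Sc.
    assert (0 <= root8 (pdist origin y) ^ 10) by (apply pow_le, root8_ge0). nra.
  - assert (U0 : U origin = 0) by (unfold U; fold c; ring).
    assert (Nb : forall d, d <> Dt -> Rabs (crd d (grad U origin)) <= 8 * (1 + C) * s').
    { intros d Hd. set (x := shift origin d (1 / 8)).
      assert (Px : past (1 / 8) origin x) by (apply past_shift; [assumption|lra]).
      specialize (Sc x Px). pose proof (Ub x ltac:(apply past_le with (1 / 8); [lra|assumption])) as Ux.
      assert (Q10 : 0 <= root8 (pdist origin x) ^ 10 <= 1).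
      { destruct (past_pd (1 / 8) origin x ltac:(lra) Px) as [Pdx _].
        split; [apply pow_le, root8_ge0|]. rewrite <- (pow1 10). apply pow_incr. split; [apply root8_ge0|apply root8_le1; lra]. }
      assert (Sc' : Rabs (Rem U origin x) <= C * s').
      { eapply Rle_trans; [exact Sc|]. assert (0 <= C * s') by (apply Rmult_le_pos; assumption). nra. }
      unfold Rem in Sc'. rewrite U0 in Sc'.
      replace (dot3 (grad U origin) (psub x origin)) with (crd d (grad U origin) * (1 / 8)) in Sc'
        by (symmetry; apply dot3_shift; assumption).
      apply Rabs_le_between in Sc'. apply Rabs_le_between in Ux. apply Rabs_le_between. lra. }
    assert (Dn : Rabs (dot3 (grad U origin) (psub y origin)) <= 3 * (8 * (1 + C) * s') * 1).
    { apply dot3_bound; [apply Rmult_le_pos; lra|assumption|]. intros d Hd. rewrite crd_psub.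
      eapply Rle_trans; [apply pdist_crd; assumption|assumption]. }
    pose proof (Ub y Hy) as Uy.
    rewrite <- ER. unfold Rem. rewrite U0.
    assert (Hq : 1 / 20 <= root8 (pdist origin y) ^ 10).
    { apply Rle_trans with ((3 / 4) ^ 10); [simpl; lra|]. apply pow_incr. split; [lra|].
      rewrite <- (root8_of_pow (3 / 4)) by lra. apply root8_le. simpl. lra. }
    assert (Hfin : s' + 24 * (1 + C) * s' <= 1 / 20) by nra.
    apply Rabs_le_between in Dn. apply Rabs_le_between in Uy. apply Rabs_le_between. lra.
Qed.

End UnitProp.

(** * Parabolic rescaling *)

Lemma Int4_dil (h : pt -> R) (p : pt) (l : R) : 0 < l -> Cc h ->
  Int4 h = l ^ 5 * Int4 (fun z => h (aff p (dil l) z)).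
Proof.
  intros Hl Hh. rewrite (Int4_aff h p (dil l) (dil_neq0 l (Rgt_not_eq _ _ Hl)) Hh).
  unfold dil; cbn [pt_t pt_x1 pt_x2 pt_x3]. rewrite !Rabs_pos_eq by (try apply pow_le; lra). field. lra.
Qed.

Lemma conv_dil (f g f' g' : pt -> R) (l a b : R) (z : pt) : 0 < l -> Cc f -> Cc g -> Cc f' -> Cc g' ->
  (forall w, f (aff origin (dil l) w) = a * f' w) -> (forall w, g (aff origin (dil l) w) = b * g' w) ->
  conv f g (aff origin (dil l) z) = l ^ 5 * a * b * conv f' g' z.
Proof.
  intros Hl Cf Cg Cf' Cg' Hf Hg. unfold conv at 1.
  rewrite (Int4_dil _ origin l Hl) by (apply Cc_conv_integrand; [assumption|apply Cg]).
  replace (fun z0 => f (psub (aff origin (dil l) z) (aff origin (dil l) z0)) * g (aff origin (dil l) z0))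
    with (fun w => (a * b) * (f' (psub z w) * g' w)).
  - rewrite Int4_scal by (apply Cc_conv_integrand; [assumption|apply Cg']). unfold conv. ring.
  - extensionality w. rewrite Hg.
    replace (psub (aff origin (dil l) z) (aff origin (dil l) w)) with (aff origin (dil l) (psub z w))
      by (apply pt_ext; intros []; simpl; ring).
    rewrite Hf. ring.
Qed.

Section Scaling.
Variable Phi : pt -> R.
Hypothesis Hok : kernel_ok Phi.

Lemma PhiT_dil (l T : R) (z : pt) : 0 < l -> 0 < T ->
  PhiT Phi (l * T) (aff origin (dil l) z) = / l ^ 5 * PhiT Phi T z.
Proof.
  intros Hl HT. assert (0 < l * T) by nra. rewrite !PhiT_aff by assumption.
  replace (aff origin (dil (/ (l * T))) (aff origin (dil l) z)) with (aff origin (dil (/ T)) z).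
  - field. lra.
  - apply pt_ext; intros []; simpl; field; lra.
Qed.

Lemma PsiN_dil (l T : R) (n : nat) (z : pt) : 0 < l -> 0 < T ->
  PsiN Phi (l * T) n (aff origin (dil l) z) = / l ^ 5 * PsiN Phi T n z.
Proof.
  intros Hl HT. assert (HlT : 0 < l * T) by nra. revert z. induction n; intros z.
  - simpl. replace (l * T / 2) with (l * (T / 2)) by field. apply PhiT_dil; lra.
  - cbn [PsiN]. assert (P := pow2_pos (S (S n))).
    assert (H1 : 0 < T / 2 ^ S (S n)) by (apply Rdiv_lt_0_compat; assumption).
    assert (H2 : 0 < l * T / 2 ^ S (S n)) by (apply Rdiv_lt_0_compat; assumption).
    rewrite (conv_dil (PsiN Phi (l * T) n) (PhiT Phi (l * T / 2 ^ S (S n))) (PsiN Phi T n) (PhiT Phi (T / 2 ^ S (S n)))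
      l (/ l ^ 5) (/ l ^ 5) z Hl).
    + field. lra.
    + apply PsiN_ok; assumption.
    + apply PhiT_prob; assumption.
    + apply PsiN_ok; assumption.
    + apply PhiT_prob; assumption.
    + apply IHn.
    + intros w. replace (l * T / 2 ^ S (S n)) with (l * (T / 2 ^ S (S n))) by (unfold Rdiv; ring).
      apply PhiT_dil; assumption.
Qed.

(** Exact self-similarity of each factor passes to the finite products, and the two uniform errors
    vanish in the limit. *)
Lemma Psi_dil (l T : R) (z : pt) : 0 < l -> 0 < T ->
  Psi Phi (l * T) (aff origin (dil l) z) = / l ^ 5 * Psi Phi T z.
Proof.
  intros Hl HT. assert (HlT : 0 < l * T) by nra.
  destruct (Psi_unif Phi Hok T HT) as [c [Hc H]]. destruct (Psi_unif Phi Hok (l * T) HlT) as [c' [Hc' H']].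
  assert (Pl : 0 < / l ^ 5) by (apply Rinv_0_lt_compat, pow_lt; assumption).
  apply Rminus_diag_uniq. apply Rabs_eq_0. apply Rle_antisym; [|apply Rabs_pos].
  apply Rle_pow2 with (c' + / l ^ 5 * c); [nra|]. intros n. rewrite Rplus_0_l.
  specialize (H n z). specialize (H' n (aff origin (dil l) z)). rewrite PsiN_dil in H' by assumption.
  assert (H2 : Rabs (/ l ^ 5 * (PsiN Phi T (S n) z - Psi Phi T z)) <= / l ^ 5 * (c / 2 ^ n)).
  { rewrite Rabs_mult, (Rabs_pos_eq (/ l ^ 5)) by lra. apply Rmult_le_compat_l; lra. }
  replace ((c' + / l ^ 5 * c) / 2 ^ n) with (c' / 2 ^ n + / l ^ 5 * (c / 2 ^ n)) by (unfold Rdiv; ring).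
  apply Rabs_le_between in H'. apply Rabs_le_between in H2. apply Rabs_le_between. lra.
Qed.

Lemma moll_dil (l T : R) (f : pt -> R) (p z : pt) : 0 < l -> 0 < T -> cont4 f ->
  moll Phi (l * T) f (aff p (dil l) z) = moll Phi T (fun w => f (aff p (dil l) w)) z.
Proof.
  intros Hl HT Hf. assert (HlT : 0 < l * T) by nra. unfold moll.
  rewrite (Int4_dil _ p l Hl) by (apply Cc_conv_integrand; [apply Psi_prob; assumption|assumption]).
  rewrite <- Int4_scal.
  - f_equal. extensionality w.
    replace (psub (aff p (dil l) z) (aff p (dil l) w)) with (aff origin (dil l) (psub z w))
      by (apply pt_ext; intros []; simpl; ring).
    rewrite Psi_dil by assumption. field. lra.
  - pose proof (Cc_conv_integrand (Psi Phi (l * T)) f (aff p (dil l) z) (proj1 (Psi_prob Phi Hok _ HlT)) Hf) as C.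
    destruct (Cc_aff _ p (dil l) (dil_neq0 l (Rgt_not_eq _ _ Hl)) C) as [X _]. exact X.
Qed.

Lemma loc_moll (T a : R) (F f g : pt -> R) (x : pt) : 0 < T -> cont4 f -> cont4 g ->
  (forall y, F y = f y - a * g y) ->
  Int4 (fun y => F y * Psi Phi T (psub x y)) = moll Phi T f x - a * moll Phi T g x.
Proof.
  intros HT Hf Hg HF. rewrite <- moll_scal, <- moll_minus by (try assumption; apply cont4_scal; assumption).
  unfold moll. f_equal. extensionality y. rewrite HF. ring.
Qed.

End Scaling.

Lemma pdist_eq0 (z w : pt) : pdist z w = 0 <-> z = w.
Proof.
  split; intros E.
  - apply Req_le in E. apply (pdist_le_iff z w 0 ltac:(lra)) in E. destruct E as [P0 [P1 [P2 P3]]].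
    simpl in P0. rewrite Rmult_0_l in P0. apply Rabs_le_between in P0. apply Rabs_le_between in P1.
    apply Rabs_le_between in P2. apply Rabs_le_between in P3. apply pt_ext; intros []; simpl; lra.
  - subst w. apply Rle_antisym; [|apply pdist_pos]. apply pdist_le_iff; [lra|].
    rewrite !Rminus_diag, Rabs_R0. repeat split; simpl; lra.
Qed.

Lemma pdist_dil (l : R) (p z w : pt) : 0 <= l -> pdist (aff p (dil l) z) (aff p (dil l) w) = l * pdist z w.
Proof.
  intros Hl. unfold pdist, xnorm; simpl.
  assert (X : forall c a b, Rabs (c + l * a - (c + l * b)) = l * Rabs (a - b)).
  { intros c a b. replace (c + l * a - (c + l * b)) with (l * (a - b)) by ring.
    rewrite Rabs_mult, (Rabs_pos_eq l); lra. }
  rewrite !X.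
  replace (pt_t p + l * (l * 1) * pt_t z - (pt_t p + l * (l * 1) * pt_t w)) with ((l * l) * (pt_t z - pt_t w)) by ring.
  rewrite Rabs_mult, (Rabs_pos_eq (l * l)) by nra. rewrite sqrt_mult_alt by nra. rewrite sqrt_square by assumption.
  rewrite !RmaxRmult by assumption. reflexivity.
Qed.

Lemma past_dil (l r : R) (p z w : pt) : 0 < l -> 0 <= r ->
  (past (l * r) (aff p (dil l) z) (aff p (dil l) w) <-> past r z w).
Proof.
  intros Hl Hr. rewrite !past_pdist by (try assumption; nra). rewrite pdist_dil by lra. simpl.
  assert (0 < l * (l * 1)) by nra. split; intros [H1 H2]; split; nra.
Qed.

(** The factors match: [v] and [Y3] carry one power of [l], and in [v Y2] the power sits in [v], so
    the whole expansion is homogeneous of degree one. *)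
Lemma vrem_dil (v Y2 Y3 : pt -> R) (l : R) (p z y : pt) : Smooth v -> Smooth Y2 -> Smooth Y3 ->
  vrem (fun w => l * v (aff p (dil l) w)) (fun w => Y2 (aff p (dil l) w)) (fun w => l * Y3 (aff p (dil l) w)) z y =
  l * vrem v Y2 Y3 (aff p (dil l) z) (aff p (dil l) y).
Proof.
  intros Sv S2 S3.
  assert (P1 : forall d f, Smooth f -> pd d (fun w => l * f (aff p (dil l) w)) = fun w => l * (crd d (dil l) * pd d f (aff p (dil l) w))).
  { intros d f Sf. rewrite (pd_scal d l (fun w => f (aff p (dil l) w))) by (apply Smooth_aff; assumption).
    rewrite pd_aff by assumption. reflexivity. }
  unfold vrem, nu, dot3; cbn [pt_x1 pt_x2 pt_x3].
  rewrite !P1, !pd_aff by assumption. simpl. ring.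
Qed.

(** * From real exponents to eighths *)

Lemma root8_Rpower (x : R) (k : nat) : 0 < x -> root8 x ^ k = Rpower x (INR k / 8).
Proof.
  intros Hx. assert (E : root8 x = Rpower x (/ 8)).
  { unfold root8. rewrite <- (Rpower_sqrt x) by assumption.
    rewrite <- (Rpower_sqrt (Rpower x (/ 2))) by apply exp_pos.
    rewrite <- (Rpower_sqrt (Rpower (Rpower x (/ 2)) (/ 2))) by apply exp_pos.
    rewrite !Rpower_mult. f_equal. field. }
  rewrite E. rewrite <- Rpower_pow by apply exp_pos. rewrite Rpower_mult. f_equal. field.
Qed.

Lemma Rpower_le_base1 (t a b : R) : 0 < t <= 1 -> a <= b -> Rpower t b <= Rpower t a.
Proof.
  intros Ht Hab. unfold Rpower.
  assert (ln t <= 0) by (rewrite <- ln_1; apply ln_le; lra).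
  destruct (Req_dec (b * ln t) (a * ln t)) as [E|E]; [rewrite E; lra|].
  apply Rlt_le, exp_increasing. nra.
Qed.

Lemma Rpower_pos (a b : R) : 0 < Rpower a b.
Proof. apply exp_pos. Qed.

(* [m] is the scaling dimension of the tested object. *)
Lemma scale_neg (l t X q del e0 g : R) (m k : nat) : 0 < l -> 0 < t <= 1 -> 0 <= X -> 0 <= del ->
  Rpower (l * t) e0 * X <= q -> q <= del * Rpower (/ l) g -> INR m = e0 + g -> e0 <= INR k / 8 ->
  l ^ m * X <= del / root8 t ^ k.
Proof.
  intros Hl Ht HX Hdel H1 H2 Hm Hk.
  rewrite root8_Rpower by lra. rewrite <- Rpower_pow by assumption. rewrite Hm, Rpower_plus.
  assert (Et : Rpower (l * t) e0 = Rpower l e0 * Rpower t e0) by (rewrite Rpower_mult_distr; lra).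
  assert (Eg : Rpower (/ l) g * Rpower l g = 1).
  { rewrite Rpower_mult_distr by (try assumption; apply Rinv_0_lt_compat; assumption).
    rewrite Rinv_l by lra. unfold Rpower. rewrite ln_1, Rmult_0_r, exp_0. reflexivity. }
  pose proof (Rpower_pos l e0). pose proof (Rpower_pos l g). pose proof (Rpower_pos t e0).
  pose proof (Rpower_pos t (INR k / 8)).
  apply (proj1 (Rle_div_r _ del (Rpower t (INR k / 8)) H4)).
  apply Rle_trans with (Rpower l e0 * Rpower l g * X * Rpower t e0).
  (* Rounding the exponent up to [k / 8] only weakens the bound, since [t <= 1]. *)
  - apply Rmult_le_compat_l; [|apply Rpower_le_base1; assumption].
    apply Rmult_le_pos; [nra|assumption].
  - replace (Rpower l e0 * Rpower l g * X * Rpower t e0) with (Rpower l g * (Rpower (l * t) e0 * X)) by (rewrite Et; ring).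
    apply Rle_trans with (Rpower l g * (del * Rpower (/ l) g)); [apply Rmult_le_compat_l; lra|].
    replace (Rpower l g * (del * Rpower (/ l) g)) with (del * (Rpower (/ l) g * Rpower l g)) by ring. rewrite Eg. lra.
Qed.

(** The positive-regularity counterpart of [scale_neg]: the Hölder exponent is rounded down to
    eighths, which is harmless at distances at most 1. *)
Lemma scale_hol (l d X q del al g : R) (m k : nat) : 0 < l -> 0 < d <= 1 -> 0 <= X -> 0 <= del ->
  X / Rpower (l * d) al <= q -> q <= del * Rpower (/ l) g -> INR m + al = g -> INR k / 8 <= al ->
  l ^ m * X <= del * root8 d ^ k.
Proof.
  intros Hl Hd HX Hdel H1 H2 Hm Hk.
  rewrite root8_Rpower by lra. rewrite <- Rpower_pow by assumption.
  assert (Et : Rpower (l * d) al = Rpower l al * Rpower d al) by (rewrite Rpower_mult_distr; lra).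
  assert (Eg : Rpower (/ l) g * Rpower l g = 1).
  { rewrite Rpower_mult_distr by (try assumption; apply Rinv_0_lt_compat; assumption).
    rewrite Rinv_l by lra. unfold Rpower. rewrite ln_1, Rmult_0_r, exp_0. reflexivity. }
  pose proof (Rpower_pos l (INR m)). pose proof (Rpower_pos l g). pose proof (Rpower_pos l al).
  pose proof (Rpower_pos d al). pose proof (Rpower_pos (l * d) al).
  apply Rle_div_l in H1; [|assumption].
  apply Rle_trans with (Rpower l (INR m) * ((del * Rpower (/ l) g) * (Rpower l al * Rpower d al))).
  - apply Rmult_le_compat_l; [lra|]. rewrite <- Et. eapply Rle_trans; [exact H1|].
    apply Rmult_le_compat_r; lra.
  - replace (Rpower l (INR m) * (del * Rpower (/ l) g * (Rpower l al * Rpower d al)))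
      with (del * (Rpower (/ l) g * (Rpower l (INR m) * Rpower l al)) * Rpower d al) by ring.
    rewrite <- Rpower_plus, Hm, Eg, Rmult_1_r. apply Rmult_le_compat_l; [assumption|].
    apply Rpower_le_base1; assumption.
Qed.

(** * Improvement of the pointwise bound and conclusion *)

Definition Good (v Y2 Y3 : pt -> R) (x : pt) (mu : R) : Prop :=
  Rabs (v x) <= mu /\ forall y, past (/ mu) x y ->
    Rabs (vrem v Y2 Y3 x y) <= mu * root8 mu ^ 10 * root8 (pdist x y) ^ 10.

(** Raising the level shrinks the ball on which the remainder is tested and enlarges both bounds. *)
Lemma Good_le (v Y2 Y3 : pt -> R) (x : pt) (mu mu' : R) : 0 < mu <= mu' ->
  Good v Y2 Y3 x mu -> Good v Y2 Y3 x mu'.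
Proof.
  intros Hm [H1 H2]. split; [lra|]. intros y Hy.
  assert (Pi : 0 < / mu') by (apply Rinv_0_lt_compat; lra).
  eapply Rle_trans; [apply H2; apply past_le with (/ mu'); [|assumption]|].
  - split; [lra|]. apply Rinv_le_contravar; lra.
  - apply Rmult_le_compat_r; [apply pow_le, root8_ge0|].
    apply Rmult_le_compat; [lra|apply pow_le, root8_ge0|lra|].
    apply pow_incr. split; [apply root8_ge0|apply root8_le; lra].
Qed.

Definition dP (x : pt) : R := Rmin (sqrt (pt_t x)) (1 - xnorm x).

Lemma dP_pos (x : pt) : inP x -> 0 < dP x <= 1.
Proof.
  intros [H0 [H1 [H2 H3]]]. assert (xnorm x < 1) by (apply xnorm_crd_lt; auto).
  assert (0 < sqrt (pt_t x)) by (apply sqrt_lt_R0; lra).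
  split; [apply Rmin_pos; lra|]. eapply Rle_trans; [apply Rmin_l|].
  rewrite <- sqrt_1. apply sqrt_le_1_alt. lra.
Qed.

(** A step of at most half the distance lowers time by at most a quarter of [dP x ^ 2], while time
    is at least [dP x ^ 2] at the start. *)
Lemma dP_past (x y : pt) (r : R) : inP x -> 0 <= r -> r <= dP x / 2 -> past r x y -> inP y /\ dP x / 2 <= dP y.
Proof.
  intros Hx Hr Hrd [P0 [P1 [P2 P3]]]. pose proof (dP_pos x Hx) as Hd. destruct Hx as [H0 [H1 [H2 H3]]].
  pose proof (Rmin_l (sqrt (pt_t x)) (1 - xnorm x)) as M1. pose proof (Rmin_r (sqrt (pt_t x)) (1 - xnorm x)) as M2.
  fold (dP x) in M1, M2.
  pose proof (proj1 (xnorm_crd x (xnorm x)) (Rle_refl _)) as [N1 [N2 N3]].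
  assert (Ht : (dP x) ^ 2 <= pt_t x).
  { replace (pt_t x) with (sqrt (pt_t x) ^ 2) by (apply pow2_sqrt; lra). apply pow_incr; lra. }
  assert (Hty : (dP x / 2) ^ 2 <= pt_t y) by nra.
  assert (X : forall a b, Rabs (a - b) <= r -> Rabs a <= xnorm x -> Rabs b <= 1 - dP x / 2).
  { intros a b Hab Ha. apply Rabs_le_between in Hab. apply Rabs_le_between in Ha. apply Rabs_le_between. lra. }
  pose proof (X _ _ P1 N1). pose proof (X _ _ P2 N2). pose proof (X _ _ P3 N3).
  split.
  - unfold inP. repeat split; try lra. nra.
  - apply Rmin_glb.
    + rewrite <- (sqrt_pow2 (dP x / 2)) by lra. apply sqrt_le_1_alt; assumption.
    + assert (xnorm y <= 1 - dP x / 2) by (apply xnorm_crd; auto). lra.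
Qed.

Lemma Om_dil_past (p z : pt) (l r : R) : 0 < l -> 0 <= r -> Om r z -> past (l * r) p (aff p (dil l) z).
Proof.
  intros Hl Hr [Z0 [Z1 [Z2 Z3]]]. unfold past; simpl.
  assert (X : forall c a, Rabs a <= r -> Rabs (c - (c + l * a)) <= l * r).
  { intros c a Ha. replace (c - (c + l * a)) with (- (l * a)) by ring.
    rewrite Rabs_Ropp, Rabs_mult, (Rabs_pos_eq l) by lra. apply Rmult_le_compat_l; lra. }
  assert (0 < l * l) by nra. split; [|repeat split; apply X; assumption].
  simpl in Z0. split; nra.
Qed.

(** Goodness at level [3 lam], rescaled by [lam], has the constant [3^(9/4)]; this justifies the 12
    in [unit_hyp]. *)
Lemma root8_3 : 3 * root8 3 ^ 10 <= 12.
Proof.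
  assert (H : root8 3 <= 1149 / 1000).
  { rewrite <- (root8_of_pow (1149 / 1000)) by lra. apply root8_le. lra. }
  pose proof (root8_ge0 3). replace (root8 3 ^ 10) with (root8 3 ^ 8 * root8 3 ^ 2) by ring. rewrite root8_pow by lra. nra.
Qed.

(** The transfer of [unit_prop] to level [lam] by a dilation around [p]. For each datum the scaling
    dimension and the exponent of its norm add up to [n_i (1/2 - eps)], which is why these powers of
    [lam] are the right smallness conditions. *)
Lemma good_improve (Phi : pt -> R) (Kr del eps : R) : kernel_ok Phi -> 10 <= Kr -> 0 < del <= 1 -> 0 < eps <= 1 / 100 ->
  (forall C2 v t1 t2 t3 Y2 Y3, unit_hyp Phi Kr del C2 v t1 t2 t3 Y2 Y3 ->
    Rabs (v origin) <= 1 /\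
    forall y, past 1 origin y -> Rabs (vrem v Y2 Y3 origin y) <= root8 (pdist origin y) ^ 10) ->
  forall (C2 : R) (v t1 t2 t3 Y2 Y3 : pt -> R) (q1 q2 q3 q4 q5 q6 q7 q8' q9 : R),
  Smooth v -> Smooth t1 -> Smooth t2 -> Smooth t3 -> Smooth Y2 -> Smooth Y3 ->
  (forall z, inP z -> heat Y2 z = t2 z) -> (forall z, inP z -> heat Y3 z = t3 z) ->
  (forall z, inP z -> heat v z =
    - v z ^ 3 - 3 * v z ^ 2 * t1 z - 3 * v z * t2 z - t3 z - 9 * C2 * (v z + t1 z)) ->
  neg_bound Phi (- / 2 - eps) t1 q1 -> neg_bound Phi (-1 - 2 * eps) t2 q2 ->
  neg_bound Phi (- 3 / 2 - 3 * eps) t3 q3 ->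
  holder_bound (1 - 2 * eps) Y2 q4 -> holder_bound (/ 2 - 3 * eps) Y3 q5 -> Q6_bound Phi eps t2 q6 ->
  loc_bound Phi (4 * eps) (fun x y => Y2 y * t2 y - C2 - Y2 x * t2 y) q7 ->
  loc_bound Phi (4 * eps) (fun x y => Y3 y * t1 y - Y3 x * t1 y) q8' ->
  loc_bound Phi (/ 2 + 5 * eps) (fun x y => Y3 y * t2 y - 3 * C2 * t1 y - Y3 x * t2 y) q9 ->
  forall (p : pt) (lam : R), inP p -> 1 < lam -> 2 * Kr <= lam * dP p ->
  (forall x, inP x -> past (Kr / lam) p x -> Good v Y2 Y3 x (3 * lam)) ->
  q1 <= del * Rpower lam (INR 1 * (/ 2 - eps)) -> q2 <= del * Rpower lam (INR 2 * (/ 2 - eps)) ->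
  q3 <= del * Rpower lam (INR 3 * (/ 2 - eps)) -> q4 <= del * Rpower lam (INR 2 * (/ 2 - eps)) ->
  q5 <= del * Rpower lam (INR 3 * (/ 2 - eps)) -> q6 <= del * Rpower lam (INR 2 * (/ 2 - eps)) ->
  q7 <= del * Rpower lam (INR 4 * (/ 2 - eps)) -> q8' <= del * Rpower lam (INR 4 * (/ 2 - eps)) ->
  q9 <= del * Rpower lam (INR 5 * (/ 2 - eps)) ->
  Good v Y2 Y3 p lam.
Proof.
  intros Hok HKr Hdel Heps Hunit C2 v t1 t2 t3 Y2 Y3 q1 q2 q3 q4 q5 q6 q7 q8' q9 Sv S1 S2 S3 SY2 SY3
    E2 E3 Ev N1 N2 N3 HY2 HY3 N6 N7 N8 N9 p lam Hp Hlam Hld HG B1 B2 B3 B4 B5 B6 B7 B8 B9.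
  set (l := / lam). assert (Hl : 0 < l) by (apply Rinv_0_lt_compat; lra).
  assert (Ell : / l = lam) by (unfold l; apply Rinv_inv).
  assert (Hl1 : l < 1) by (unfold l; rewrite <- Rinv_1; apply Rinv_lt_contravar; lra).
  set (A := aff p (dil l)).
  assert (C1' := Smooth_cont4 t1 S1). assert (C2' := Smooth_cont4 t2 S2). assert (C3' := Smooth_cont4 t3 S3).
  assert (CY2 := Smooth_cont4 Y2 SY2). assert (CY3 := Smooth_cont4 Y3 SY3).
  rewrite <- Ell in B1, B2, B3, B4, B5, B6, B7, B8, B9.
  assert (HlK : l * Kr <= dP p / 2).
  { unfold l. apply Rmult_le_reg_l with lam; [lra|]. rewrite <- Rmult_assoc, Rinv_r by lra. lra. }
  (* The condition [2 * Kr <= lam * dP p] enters here: the cube of size [Kr] is mapped into the past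
     ball of radius [dP p / 2]. *)
  assert (InA : forall z, Om Kr z -> inP (A z)).
  { intros z Hz. apply (dP_past p (A z) (l * Kr)); try assumption; [nra|]. apply Om_dil_past; try assumption; lra. }
  assert (lt1 : forall t, 0 < t <= 1 -> 0 < l * t < 1) by (intros; nra).
  assert (MD : forall f t z, 0 < t <= 1 -> cont4 f -> moll Phi t (fun w => f (A w)) z = moll Phi (l * t) f (A z)).
  { intros f t z Ht Cf. symmetry. apply moll_dil; try assumption; lra. }
  assert (cA : forall f, cont4 f -> cont4 (fun w => f (A w))) by (intros; apply cont4_aff; assumption).
  (* The factors are the scaling dimensions that keep the equations: [l] for [v], [tau1], [Y3];
     [l^2] for [tau2] and [C2]; [l^3] for [tau3]; none for [Y2], because two powers are consumed by
     the heat operator. *)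
  assert (UH : unit_hyp Phi Kr del (l ^ 2 * C2) (fun z => l * v (A z)) (fun z => l * t1 (A z)) (fun z => l ^ 2 * t2 (A z))
    (fun z => l ^ 3 * t3 (A z)) (fun z => Y2 (A z)) (fun z => l * Y3 (A z))).
  { constructor.
    - apply Smooth_scal, Smooth_aff; assumption.
    - apply Smooth_scal, Smooth_aff; assumption.
    - apply Smooth_scal, Smooth_aff; assumption.
    - apply Smooth_scal, Smooth_aff; assumption.
    - apply Smooth_aff; assumption.
    - apply Smooth_scal, Smooth_aff; assumption.
    - intros z Hz. unfold A. rewrite heat_dil by assumption. fold A. rewrite E2 by (apply InA; assumption). reflexivity.
    - intros z Hz. unfold A. rewrite (heat_scal l (fun w => Y3 (aff p (dil l) w))) by (apply Smooth_aff; assumption).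
      rewrite heat_dil by assumption. fold A. rewrite E3 by (apply InA; assumption). ring.
    - intros z Hz. unfold A. rewrite (heat_scal l (fun w => v (aff p (dil l) w))) by (apply Smooth_aff; assumption).
      rewrite heat_dil by assumption. fold A. rewrite Ev by (apply InA; assumption). ring.
    - intros z t Hz Ht. rewrite (moll_scal Phi Hok t l (fun w => t1 (A w))) by (first [lra|apply cA; assumption]).
      rewrite MD by assumption. rewrite Rabs_mult, (Rabs_pos_eq l) by lra.
      replace l with (l ^ 1) at 1 by ring.
      apply (scale_neg l t _ q1 del (/ 2 + eps) (INR 1 * (/ 2 - eps))); try assumption; try lra; try apply Rabs_pos.
      + pose proof (N1 (A z) (InA z Hz) (l * t) ltac:(specialize (lt1 t Ht); lra)) as X.
        replace (- (- / 2 - eps)) with (/ 2 + eps) in X by ring. exact X.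
      + simpl; lra.
      + simpl; lra.
    - intros z t Hz Ht. rewrite (moll_scal Phi Hok t (l ^ 2) (fun w => t2 (A w))) by (first [lra|apply cA; assumption]).
      rewrite MD by assumption. rewrite Rabs_mult, (Rabs_pos_eq (l ^ 2)) by (apply pow_le; lra).
      apply (scale_neg l t _ q2 del (1 + 2 * eps) (INR 2 * (/ 2 - eps))); try assumption; try lra; try apply Rabs_pos.
      + pose proof (N2 (A z) (InA z Hz) (l * t) ltac:(specialize (lt1 t Ht); lra)) as X.
        replace (- (-1 - 2 * eps)) with (1 + 2 * eps) in X by ring. exact X.
      + simpl; lra.
      + simpl; lra.
    - intros z t Hz Ht. rewrite (moll_scal Phi Hok t (l ^ 3) (fun w => t3 (A w))) by (first [lra|apply cA; assumption]).
      rewrite MD by assumption. rewrite Rabs_mult, (Rabs_pos_eq (l ^ 3)) by (apply pow_le; lra).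
      apply (scale_neg l t _ q3 del (3 / 2 + 3 * eps) (INR 3 * (/ 2 - eps))); try assumption; try lra; try apply Rabs_pos.
      + pose proof (N3 (A z) (InA z Hz) (l * t) ltac:(specialize (lt1 t Ht); lra)) as X.
        replace (- (- 3 / 2 - 3 * eps)) with (3 / 2 + 3 * eps) in X by field. exact X.
      + simpl; lra.
      + simpl; lra.
    - intros d z t Hd Hz Ht.
      assert (Ec : forall w, crd d w = / l * (crd d (A w) - crd d p)).
      { intros w. unfold A. rewrite crd_aff, crd_dil_x by assumption. field. lra. }
      assert (Cd : cont4 (fun y => crd d y * t2 y)) by (apply cont4_mult; [apply cont4_crd|assumption]).
      rewrite (moll_scal Phi Hok t (l ^ 2) (fun w => t2 (A w))) by (first [lra|apply cA; assumption]).
      (* In original variables the coordinate is [(X - p) / l], which leaves one power of [l]; the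
         offset [crd d p] cancels because [Q6] is centred at the base point. *)
      replace (fun y => crd d y * (l ^ 2 * t2 (A y))) with (fun y => l * ((fun w => crd d (A w) * t2 (A w)) y - crd d p * t2 (A y)))
        by (extensionality y; rewrite (Ec y); field; lra).
      rewrite (moll_scal Phi Hok t l (fun y => (fun w => crd d (A w) * t2 (A w)) y - crd d p * t2 (A y))).
      2: lra. 2: { apply cont4_minus; [apply (cA _ Cd)|apply cont4_scal, cA; assumption]. }
      rewrite (moll_minus Phi Hok t (fun w => crd d (A w) * t2 (A w)) (fun y => crd d p * t2 (A y))).
      2: lra. 2: apply (cA _ Cd). 2: apply cont4_scal, cA; assumption.
      rewrite (moll_scal Phi Hok t (crd d p) (fun w => t2 (A w))) by (first [lra|apply cA; assumption]).
      rewrite (MD (fun y => crd d y * t2 y)), (MD t2) by assumption.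
      match goal with |- Rabs ?q <= _ => replace q with
        (l * (moll Phi (l * t) (fun y => crd d y * t2 y) (A z) - crd d (A z) * moll Phi (l * t) t2 (A z)))
        by (rewrite (Ec z); field; lra) end.
      rewrite Rabs_mult, (Rabs_pos_eq l) by lra. replace l with (l ^ 1) at 1 by ring.
      rewrite <- (pow_1 (root8 t)).
      apply (scale_neg l t _ q6 del (2 * eps) (INR 2 * (/ 2 - eps))); try assumption; try lra; try apply Rabs_pos.
      + specialize (lt1 t Ht). pose proof (N6 (A z) (InA z Hz) (l * t) lt1) as X.
        rewrite <- (loc_moll Phi Hok (l * t) (crd d (A z)) (fun y => (crd d y - crd d (A z)) * t2 y) (fun y => crd d y * t2 y) t2)
          by (try assumption; try lra; intros; ring).
        eapply Rle_trans; [|exact X]. apply Rmult_le_compat_l; [apply Rlt_le, Rpower_pos|].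
        destruct d; [congruence| | |]; cbn [crd].
        * apply Rmax_l.
        * eapply Rle_trans; [apply Rmax_l|apply Rmax_r].
        * eapply Rle_trans; [apply Rmax_r|apply Rmax_r].
      + simpl; lra.
      + simpl; lra.
    - intros z t Hz Ht.
      assert (C7 : cont4 (fun y => Y2 y * t2 y - C2)) by (apply cont4_minus; [apply cont4_mult; assumption|apply cont4_const]).
      rewrite (moll_scal Phi Hok t (l ^ 2) (fun w => t2 (A w))) by (first [lra|apply cA; assumption]).
      replace (fun y => Y2 (A y) * (l ^ 2 * t2 (A y)) - l ^ 2 * C2) with (fun y => l ^ 2 * (fun w => Y2 (A w) * t2 (A w) - C2) y)
        by (extensionality y; ring).
      rewrite (moll_scal Phi Hok t (l ^ 2) (fun w => Y2 (A w) * t2 (A w) - C2)) by (first [lra|apply (cA _ C7)]).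
      rewrite (MD (fun y => Y2 y * t2 y - C2)), (MD t2) by assumption.
      match goal with |- Rabs ?q <= _ => replace q with
        (l ^ 2 * (moll Phi (l * t) (fun y => Y2 y * t2 y - C2) (A z) - Y2 (A z) * moll Phi (l * t) t2 (A z))) by ring end.
      rewrite Rabs_mult, (Rabs_pos_eq (l ^ 2)) by (apply pow_le; lra). rewrite <- (pow_1 (root8 t)).
      apply (scale_neg l t _ q7 del (4 * eps) (INR 4 * (/ 2 - eps))); try assumption; try lra; try apply Rabs_pos.
      + specialize (lt1 t Ht). pose proof (N7 (A z) (InA z Hz) (l * t) lt1) as X.
        rewrite (loc_moll Phi Hok (l * t) (Y2 (A z)) _ (fun y => Y2 y * t2 y - C2) t2) in X
          by (try assumption; try lra; intros; ring). exact X.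
      + simpl; lra.
      + simpl; lra.
    - intros z t Hz Ht.
      assert (C8 : cont4 (fun y => Y3 y * t1 y)) by (apply cont4_mult; assumption).
      rewrite (moll_scal Phi Hok t l (fun w => t1 (A w))) by (first [lra|apply cA; assumption]).
      replace (fun y => l * Y3 (A y) * (l * t1 (A y))) with (fun y => l ^ 2 * (fun w => Y3 (A w) * t1 (A w)) y)
        by (extensionality y; ring).
      rewrite (moll_scal Phi Hok t (l ^ 2) (fun w => Y3 (A w) * t1 (A w))) by (first [lra|apply (cA _ C8)]).
      rewrite (MD (fun y => Y3 y * t1 y)), (MD t1) by assumption.
      match goal with |- Rabs ?q <= _ => replace q with
        (l ^ 2 * (moll Phi (l * t) (fun y => Y3 y * t1 y) (A z) - Y3 (A z) * moll Phi (l * t) t1 (A z))) by ring end.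
      rewrite Rabs_mult, (Rabs_pos_eq (l ^ 2)) by (apply pow_le; lra). rewrite <- (pow_1 (root8 t)).
      apply (scale_neg l t _ q8' del (4 * eps) (INR 4 * (/ 2 - eps))); try assumption; try lra; try apply Rabs_pos.
      + specialize (lt1 t Ht). pose proof (N8 (A z) (InA z Hz) (l * t) lt1) as X.
        rewrite (loc_moll Phi Hok (l * t) (Y3 (A z)) _ (fun y => Y3 y * t1 y) t1) in X
          by (try assumption; try lra; intros; ring). exact X.
      + simpl; lra.
      + simpl; lra.
    - intros z t Hz Ht.
      assert (C9 : cont4 (fun y => Y3 y * t2 y - 3 * C2 * t1 y)) by (apply cont4_minus; [apply cont4_mult; assumption|apply cont4_scal; assumption]).
      rewrite (moll_scal Phi Hok t (l ^ 2) (fun w => t2 (A w))) by (first [lra|apply cA; assumption]).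
      replace (fun y => l * Y3 (A y) * (l ^ 2 * t2 (A y)) - 3 * (l ^ 2 * C2) * (l * t1 (A y)))
        with (fun y => l ^ 3 * (fun w => Y3 (A w) * t2 (A w) - 3 * C2 * t1 (A w)) y)
        by (extensionality y; ring).
      rewrite (moll_scal Phi Hok t (l ^ 3) (fun w => Y3 (A w) * t2 (A w) - 3 * C2 * t1 (A w))) by (first [lra|apply (cA _ C9)]).
      rewrite (MD (fun y => Y3 y * t2 y - 3 * C2 * t1 y)), (MD t2) by assumption.
      match goal with |- Rabs ?q <= _ => replace q with
        (l ^ 3 * (moll Phi (l * t) (fun y => Y3 y * t2 y - 3 * C2 * t1 y) (A z) - Y3 (A z) * moll Phi (l * t) t2 (A z))) by ring end.
      rewrite Rabs_mult, (Rabs_pos_eq (l ^ 3)) by (apply pow_le; lra).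
      apply (scale_neg l t _ q9 del (/ 2 + 5 * eps) (INR 5 * (/ 2 - eps))); try assumption; try lra; try apply Rabs_pos.
      + specialize (lt1 t Ht). pose proof (N9 (A z) (InA z Hz) (l * t) lt1) as X.
        rewrite (loc_moll Phi Hok (l * t) (Y3 (A z)) _ (fun y => Y3 y * t2 y - 3 * C2 * t1 y) t2) in X
          by (try assumption; try lra; intros; ring). exact X.
      + simpl; lra.
      + simpl; lra.
    - intros z w Hd. destruct (pdist_pos z w) as [Hp0|Hp0].
      + assert (Hne : A z <> A w).
        { intros E. apply pdist_eq0 in E. unfold A in E. rewrite pdist_dil in E by lra. nra. }
        (* [Y2] has dimension 0, and its exponent [1 - 2 eps] is already [2 (1/2 - eps)]. *)
        rewrite <- (Rmult_1_l (Rabs _)). replace 1 with (l ^ 0) by ring.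
        apply (scale_hol l _ _ q4 del (1 - 2 * eps) (INR 2 * (/ 2 - eps))); try assumption; try lra; try apply Rabs_pos.
        * pose proof (HY2 (A z) (A w) Hne) as X. unfold A in X at 3 4. rewrite pdist_dil in X by lra. exact X.
        * simpl; lra.
        * simpl; lra.
      + symmetry in Hp0. apply pdist_eq0 in Hp0. rewrite Hp0, Rminus_diag, Rabs_R0. apply Rmult_le_pos; [lra|apply pow_le, root8_ge0].
    - intros z w Hd. destruct (pdist_pos z w) as [Hp0|Hp0].
      + assert (Hne : A z <> A w).
        { intros E. apply pdist_eq0 in E. unfold A in E. rewrite pdist_dil in E by lra. nra. }
        rewrite <- Rmult_minus_distr_l, Rabs_mult, (Rabs_pos_eq l) by lra. replace l with (l ^ 1) at 1 by ring.
        apply (scale_hol l _ _ q5 del (/ 2 - 3 * eps) (INR 3 * (/ 2 - eps))); try assumption; try lra; try apply Rabs_pos.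
        * pose proof (HY3 (A z) (A w) Hne) as X. unfold A in X at 3 4. rewrite pdist_dil in X by lra. exact X.
        * simpl; lra.
        * simpl; lra.
      + symmetry in Hp0. apply pdist_eq0 in Hp0. rewrite Hp0, Rminus_diag, Rabs_R0. apply Rmult_le_pos; [lra|apply pow_le, root8_ge0].
    - intros z Hz. destruct (HG (A z) (InA z Hz)) as [X _].
      + replace (Kr / lam) with (l * Kr) by (unfold l, Rdiv; ring). apply Om_dil_past; try assumption; lra.
      + rewrite Rabs_mult, (Rabs_pos_eq l) by lra.
        apply Rle_trans with (l * (3 * lam)); [apply Rmult_le_compat_l; lra|]. unfold l. right. field. lra.
    - intros z y Hz Hy. destruct (HG (A z) (InA z Hz)) as [_ X].
      + replace (Kr / lam) with (l * Kr) by (unfold l, Rdiv; ring). apply Om_dil_past; try assumption; lra.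
      + unfold A. rewrite vrem_dil by assumption. fold A. rewrite Rabs_mult, (Rabs_pos_eq l) by lra.
        assert (Py : past (/ (3 * lam)) (A z) (A y)).
        { replace (/ (3 * lam)) with (l * (1 / 3)) by (unfold l; field; lra). unfold A. apply past_dil; [assumption|lra|assumption]. }
        specialize (X (A y) Py). unfold A in X at 3 4. rewrite pdist_dil, (root8_mult l), (root8_mult 3) in X by lra.
        eapply Rle_trans; [apply Rmult_le_compat_l; [lra|exact X]|].
        assert (EQ : root8 lam * root8 l = 1).
        { rewrite <- root8_mult by lra. unfold l. rewrite Rinv_r by lra. apply root8_1. }
        replace (l * (3 * lam * (root8 3 * root8 lam) ^ 10 * (root8 l * root8 (pdist z y)) ^ 10))
          with ((l * lam) * (3 * root8 3 ^ 10) * (root8 lam * root8 l) ^ 10 * root8 (pdist z y) ^ 10) by ring.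
        rewrite EQ, pow1. replace (l * lam) with 1 by (unfold l; field; lra).
        pose proof root8_3. assert (0 <= root8 (pdist z y) ^ 10) by (apply pow_le, root8_ge0). nra. }
  destruct (Hunit _ _ _ _ _ _ _ UH) as [R1 R2].
  assert (Ap : A origin = p) by (unfold A; apply pt_ext; intros []; simpl; ring).
  rewrite Ap in R1. rewrite Rabs_mult, (Rabs_pos_eq l) in R1 by lra.
  split.
  - apply Rmult_le_reg_l with l; [assumption|]. replace (l * lam) with 1 by (unfold l; field; lra). exact R1.
  - intros y Hy.
    (* The preimage of [y] under the dilation. *)
    set (y' := aff (mkpt (- lam ^ 2 * pt_t p) (- lam * pt_x1 p) (- lam * pt_x2 p) (- lam * pt_x3 p)) (dil lam) y).
    assert (Ey : A y' = y) by (unfold A, y', l; apply pt_ext; intros []; simpl; field; lra).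
    assert (Py' : past 1 origin y').
    { apply (past_dil l 1 p origin y' Hl ltac:(lra)). fold A. rewrite Ap, Ey, Rmult_1_r. exact Hy. }
    specialize (R2 y' Py'). unfold A in R2. rewrite vrem_dil in R2 by assumption. fold A in R2.
    rewrite Ap, Ey in R2. rewrite Rabs_mult, (Rabs_pos_eq l) in R2 by lra.
    assert (Ed : pdist p y = l * pdist origin y') by (rewrite <- Ap, <- Ey; apply pdist_dil; lra).
    rewrite Ed, root8_mult by lra.
    assert (EQ : root8 lam * root8 l = 1).
    { rewrite <- root8_mult by lra. unfold l. rewrite Rinv_r by lra. apply root8_1. }
    replace (lam * root8 lam ^ 10 * (root8 l * root8 (pdist origin y')) ^ 10) with (lam * (root8 lam * root8 l) ^ 10 * root8 (pdist origin y') ^ 10) by ring.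
    rewrite EQ, pow1, Rmult_1_r. apply Rmult_le_reg_l with l; [assumption|].
    replace (l * (lam * root8 (pdist origin y') ^ 10)) with ((l * lam) * root8 (pdist origin y') ^ 10) by ring.
    replace (l * lam) with 1 by (unfold l; field; lra). rewrite Rmult_1_l. exact R2.
Qed.

(** * Starting level from smoothness *)

Lemma bounded_box_list (M : R) (fs : list (pt -> R)) : (forall f, In f fs -> cont4 f) ->
  exists B, 0 <= B /\ forall f, In f fs -> forall z, inbox M z -> Rabs (f z) <= B.
Proof.
  induction fs as [|f fs IH]; intros H.
  - exists 0. split; [lra|]. intros f [].
  - destruct IH as [B [HB H1]]; [intros g Hg; apply H; right; assumption|].
    destruct (cont4_bounded_box f M (H f (or_introl eq_refl))) as [B' [HB' H2]].
    exists (B + B'). split; [lra|]. intros g [<-|Hg] z Hz.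
    + specialize (H2 z Hz). lra.
    + specialize (H1 g Hg z Hz). lra.
Qed.

Lemma D2bound_box (F : pt -> R) (M : R) : Smooth F -> exists B, 0 <= B /\ forall w, inbox M w -> D2bound F B w.
Proof.
  intros HF.
  destruct (bounded_box_list M (pd Dt F :: map (fun dd => pd (fst dd) (pd (snd dd) F))
    (list_prod (D1 :: D2 :: D3 :: nil) (D1 :: D2 :: D3 :: nil)))) as [B [HB H]].
  - intros f [<-|Hf]; [apply Smooth_cont4, Smooth_pd; assumption|].
    apply in_map_iff in Hf. destruct Hf as [dd [<- _]]. apply Smooth_cont4. do 2 apply Smooth_pd. assumption.
  - exists B. split; [assumption|]. intros w Hw. split.
    + apply H; [left; reflexivity|assumption].
    + intros d d' Hd Hd'. apply (H (pd d (pd d' F))); [right|assumption].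
      apply (in_map (fun dd => pd (fst dd) (pd (snd dd) F)) _ (d, d')).
      apply in_prod; [destruct d|destruct d']; simpl; tauto.
Qed.

Lemma Rem_box (F : pt -> R) : Smooth F -> exists B, 0 <= B /\ forall x y, inbox 1 x -> past 1 x y ->
  Rabs (Rem F x y) <= 7 * B * pdist x y ^ 2.
Proof.
  intros HF. destruct (D2bound_box F 2 HF) as [B [HB H]]. exists B. split; [assumption|].
  intros x y Hx Hy. pose proof (past_crd 1 1 x y ltac:(lra) ltac:(lra) Hy) as Hc.
  apply past_pd in Hy; [|lra]. destruct Hy as [Hd [P0 [P1 [P2 P3]]]].
  unfold Rem. replace (F y) with (F (padd x (psub y x))) by (f_equal; apply pt_ext; intros []; simpl; ring).
  apply taylor_parabolic; try assumption.
  - intros w Hw. apply H. intros d. destruct (Hw d) as [lam [Hl E]].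
    specialize (Hc d). specialize (Hx d). rewrite E.
    assert (Ed : crd d (psub y x) = crd d y - crd d x) by (destruct d; reflexivity). rewrite Ed.
    eapply Rle_trans; [apply Rabs_triang|]. rewrite Rabs_mult, (Rabs_pos_eq lam) by lra.
    pose proof (Rabs_pos (crd d y - crd d x)). nra.
  - apply pdist_pos.
  - simpl pt_t. apply Rabs_le_between. lra.
  - rewrite Rabs_minus_sym in P1. exact P1.
  - rewrite Rabs_minus_sym in P2. exact P2.
  - rewrite Rabs_minus_sym in P3. exact P3.
Qed.

(** Smoothness on a compact neighbourhood gives remainders of order [d^2], which is at most
    [d^(5/4)] for [d <= 1]. The resulting [V] depends on the functions and carries no uniformity; it
    only starts the iteration. *)
Lemma good_initial (v Y2 Y3 : pt -> R) : Smooth v -> Smooth Y2 -> Smooth Y3 ->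
  exists V, 0 < V /\ forall a x, 0 <= a -> inP x -> Good v Y2 Y3 x (a + V / dP x).
Proof.
  intros Sv S2 S3.
  destruct (cont4_bounded_box v 1 (Smooth_cont4 v Sv)) as [b [Hb Bv]].
  destruct (Rem_box v Sv) as [b1 [Hb1 B1]]. destruct (Rem_box Y2 S2) as [b2 [Hb2 B2]].
  destruct (Rem_box Y3 S3) as [b3 [Hb3 B3]].
  assert (Pbb : 0 <= b * b2) by (apply Rmult_le_pos; assumption).
  (* The summand 1 keeps the level at least 1, so that only distances up to 1 are tested; [b] bounds
     [v], and 7 is the constant of the Taylor estimate. *)
  set (V := 1 + b + 7 * (b1 + b3 + 3 * (b * b2))). exists V. split; [unfold V; lra|].
  intros a x Ha Hx. pose proof (dP_pos x Hx) as Hd.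
  assert (Hx1 : inbox 1 x).
  { destruct Hx as [X0 [X1 [X2 X3]]]. intros []; simpl; try lra. apply Rabs_le_between. lra. }
  assert (Hmu : V <= a + V / dP x).
  { assert (V <= V / dP x); [|lra]. apply (proj1 (Rle_div_r V V (dP x) (proj1 Hd))). unfold V. nra. }
  set (mu := a + V / dP x) in *. assert (Hmu1 : 1 <= mu) by (unfold V in Hmu; lra).
  split.
  - specialize (Bv x Hx1). unfold V in Hmu. lra.
  - intros y Hy.
    assert (Hy1 : past 1 x y).
    { apply past_le with (/ mu); [|assumption]. split; [apply Rlt_le, Rinv_0_lt_compat; lra|].
      rewrite <- Rinv_1. apply Rinv_le_contravar; lra. }
    specialize (B1 x y Hx1 Hy1). specialize (B2 x y Hx1 Hy1). specialize (B3 x y Hx1 Hy1). specialize (Bv x Hx1).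
    destruct (past_pd 1 x y ltac:(lra) Hy1) as [Hp _]. pose proof (pdist_pos x y) as Hp0.
    replace (vrem v Y2 Y3 x y) with (Rem v x y + Rem Y3 x y + 3 * (v x * Rem Y2 x y))
      by (unfold vrem, Rem, nu, grad, dot3; cbn [pt_x1 pt_x2 pt_x3]; ring).
    assert (B4 : Rabs (v x * Rem Y2 x y) <= b * (7 * b2 * pdist x y ^ 2)).
    { rewrite Rabs_mult. apply Rmult_le_compat; try apply Rabs_pos; assumption. }
    assert (Ed : pdist x y ^ 2 <= root8 (pdist x y) ^ 10).
    { rewrite <- (root8_pow (pdist x y)) at 1 by assumption. rewrite <- pow_mult. apply root8_pow_le; [assumption|lia]. }
    assert (E1 : 1 <= root8 mu ^ 10) by (apply pow_R1_Rle; rewrite <- root8_1; apply root8_le; assumption).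
    set (Q := root8 (pdist x y) ^ 10) in *. pose proof (pow2_ge_0 (pdist x y)).
    apply Rle_trans with (V * Q).
    + apply Rle_trans with (7 * (b1 + b3 + 3 * (b * b2)) * pdist x y ^ 2).
      * apply Rabs_le_between in B1. apply Rabs_le_between in B3. apply Rabs_le_between in B4. apply Rabs_le_between. lra.
      * unfold V. apply Rmult_le_compat; lra.
    + apply Rmult_le_compat_r; [lra|]. nra.
Qed.

(** One improvement replaces [V] by [9/10 V] at all points simultaneously, as long as [V >= 3 Kr].
    Finitely many steps bring any starting value down to that threshold, so the result does not
    depend on [V0]. *)
Lemma good_iterate (v Y2 Y3 : pt -> R) (a Kr V0 : R) : 0 < a -> 10 <= Kr -> 0 < V0 ->
  (forall p lam, inP p -> 1 < lam -> a <= lam -> 2 * Kr <= lam * dP p ->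
    (forall x, inP x -> past (Kr / lam) p x -> Good v Y2 Y3 x (3 * lam)) -> Good v Y2 Y3 p lam) ->
  (forall x, inP x -> Good v Y2 Y3 x (a + V0 / dP x)) ->
  forall x, inP x -> Good v Y2 Y3 x (a + 3 * Kr / dP x).
Proof.
  intros Ha HK HV0 Himp H0.
  set (S := fun V => forall x, inP x -> Good v Y2 Y3 x (a + V / dP x)).
  assert (mono : forall V V', 0 < V <= V' -> S V -> S V').
  { intros V V' HV HS x Hx. pose proof (dP_pos x Hx) as Hd. apply Good_le with (a + V / dP x); [|apply HS; assumption].
    assert (0 < V / dP x) by (apply Rdiv_lt_0_compat; lra).
    split; [lra|]. apply Rplus_le_compat_l. apply Rmult_le_compat_r; [apply Rlt_le, Rinv_0_lt_compat; lra|lra]. }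
  (* The threshold gives [27/10 Kr <= lam * dP p]. In the ball of radius [Kr / lam] the distance to
     the boundary at most halves, so the level there is at most [a + 2 V / dP p], and this is below
     [3 lam] because [3 * 9/10 >= 2]. *)
  assert (step : forall V, 3 * Kr <= V -> S V -> S (9 / 10 * V)).
  { intros V HV HS p Hp. pose proof (dP_pos p Hp) as Hd. set (lam := a + 9 / 10 * V / dP p).
    assert (HL : 9 / 10 * V <= lam * dP p).
    { unfold lam. rewrite Rmult_plus_distr_r. replace (9 / 10 * V / dP p * dP p) with (9 / 10 * V) by (field; lra). nra. }
    assert (Hl : 9 / 10 * V <= lam).
    { assert (0 < lam) by (unfold lam; assert (0 < 9 / 10 * V / dP p) by (apply Rdiv_lt_0_compat; lra); lra). nra. }
    apply Himp; [assumption|lra| |lra|].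
    - unfold lam. assert (0 < 9 / 10 * V / dP p) by (apply Rdiv_lt_0_compat; lra). lra.
    - intros x Hx Hpx.
      destruct (dP_past p x (Kr / lam)) as [_ Hdx]; try assumption.
      + apply Rlt_le, Rdiv_lt_0_compat; lra.
      + apply (proj2 (Rle_div_l Kr (dP p / 2) lam ltac:(lra))). lra.
      + apply Good_le with (a + V / dP x); [|apply HS; assumption]. pose proof (dP_pos x Hx) as Hd'.
        assert (0 < V / dP x) by (apply Rdiv_lt_0_compat; lra). split; [lra|].
        apply Rle_trans with (a + V / (dP p / 2)).
        * apply Rplus_le_compat_l. apply Rmult_le_compat_l; [lra|]. apply Rinv_le_contravar; lra.
        * unfold lam. replace (V / (dP p / 2)) with (2 * (V / dP p)) by (field; lra).
          replace (9 / 10 * V / dP p) with (9 / 10 * (V / dP p)) by (field; lra).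
          assert (0 < V / dP p) by (apply Rdiv_lt_0_compat; lra). lra. }
  (* The maximum with [3 * Kr] lets the induction go on idle once the threshold has been passed. *)
  assert (iter : forall n, S (Rmax (3 * Kr) ((9 / 10) ^ n * V0))).
  { induction n.
    - apply mono with V0; [|exact H0]. split; [assumption|]. simpl. rewrite Rmult_1_l. apply Rmax_r.
    - destruct (Rle_dec ((9 / 10) ^ n * V0) (3 * Kr)) as [c|c].
      + rewrite Rmax_left in IHn by assumption. apply mono with (3 * Kr); [|assumption].
        split; [lra|apply Rmax_l].
      + rewrite Rmax_right in IHn by lra. apply mono with (9 / 10 * ((9 / 10) ^ n * V0)); [|apply step; [lra|assumption]].
        split; [lra|]. rewrite <- Rmult_assoc. apply Rmax_r. }
  destruct (pow_lt_1_zero (9 / 10) ltac:(rewrite Rabs_pos_eq; lra) (3 * Kr / V0)) as [n Hn].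
  { apply Rdiv_lt_0_compat; lra. }
  specialize (Hn n (le_n n)). rewrite Rabs_pos_eq in Hn by (apply pow_le; lra).
  apply (proj2 (Rlt_div_r _ _ V0 HV0)) in Hn.
  specialize (iter n). rewrite Rmax_left in iter by lra. exact iter.
Qed.

(** All exponents [n_i (1/2 - eps)] are at least 1/3, so a factor [del^3] inside the power produces
    at least a factor [del] outside. This is the origin of the cube. *)
Lemma le_of_rpow_le (q e del m lam : R) : / 3 <= e -> 0 < del <= 1 -> 0 < lam ->
  rpow q (/ e) <= m -> m <= del ^ 3 * lam -> q <= del * Rpower lam e.
Proof.
  intros He Hdel Hlam H Hm. assert (0 < Rpower lam e) by apply Rpower_pos.
  unfold rpow in H. destruct (Rlt_dec 0 q) as [Hq|Hq]; [|nra].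
  replace q with (Rpower (Rpower q (/ e)) e) by (rewrite Rpower_mult, Rinv_l, Rpower_1 by lra; reflexivity).
  assert (0 < del ^ 3) by (apply pow_lt; lra).
  apply Rle_trans with (Rpower (del ^ 3 * lam) e).
  - apply Rle_Rpower_l; [lra|]. split; [apply Rpower_pos|lra].
  - rewrite <- Rpower_mult_distr by assumption. apply Rmult_le_compat_r; [lra|].
    rewrite <- (Rpower_1 del) at 2 by lra. rewrite <- Rpower_pow, Rpower_mult by lra.
    apply Rpower_le_base1; [lra|]. simpl; lra.
Qed.

Theorem theorem2p1 :
  forall Phi : pt -> R, kernel_ok Phi ->
  exists eps0, 0 < eps0 /\
  forall eps, 0 < eps < eps0 ->
  exists C : R,
  forall (zeta tau1 Y2 Y3 u : pt -> R) (C1 C2 : R),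
    Smooth zeta -> Smooth tau1 -> Smooth Y2 -> Smooth Y3 -> Smooth u ->
    let tau2 := fun z => tau1 z ^ 2 - C1 in
    let tau3 := fun z => tau1 z ^ 3 - 3 * C1 * tau1 z in
    (forall z, inP z -> heat tau1 z = zeta z) ->
    (forall z, inP z -> heat Y2 z = tau2 z) ->
    (forall z, inP z -> heat Y3 z = tau3 z) ->
    (forall z, inP z -> heat u z = - u z ^ 3 + zeta z + (3 * C1 - 9 * C2) * u z) ->
    forall q1 q2 q3 q4 q5 q6 q7 q8 q9 : R,
      0 <= q1 -> 0 <= q2 -> 0 <= q3 -> 0 <= q4 -> 0 <= q5 ->
      0 <= q6 -> 0 <= q7 -> 0 <= q8 -> 0 <= q9 ->
      neg_bound Phi (- / 2 - eps) tau1 q1 ->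
      neg_bound Phi (-1 - 2 * eps) tau2 q2 ->
      neg_bound Phi (- 3 / 2 - 3 * eps) tau3 q3 ->
      holder_bound (1 - 2 * eps) Y2 q4 ->
      holder_bound (/ 2 - 3 * eps) Y3 q5 ->
      Q6_bound Phi eps tau2 q6 ->
      loc_bound Phi (4 * eps) (fun x y => Y2 y * tau2 y - C2 - Y2 x * tau2 y) q7 ->
      loc_bound Phi (4 * eps) (fun x y => Y3 y * tau1 y - Y3 x * tau1 y) q8 ->
      loc_bound Phi (/ 2 + 5 * eps)
        (fun x y => Y3 y * tau2 y - 3 * C2 * tau1 y - Y3 x * tau2 y) q9 ->
    forall R0, 0 < R0 < 1 ->
    forall z, inPR R0 z ->
      Rabs (u z - tau1 z) <=
      C * fold_right Rmax (/ R0)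
        (map (fun p => rpow (fst p) (/ (INR (snd p) * (/ 2 - eps))))
          ((q1, 1%nat) :: (q2, 2%nat) :: (q3, 3%nat) :: (q4, 2%nat) :: (q5, 3%nat)
           :: (q6, 2%nat) :: (q7, 4%nat) :: (q8, 4%nat) :: (q9, 5%nat) :: nil)).
Proof.
  (* The tightest rounding to eighths is [1/2 + 5 eps <= 5/8] for [Q9], satisfied for
     [eps <= 1/40]. *)
  intros Phi Hok. exists (1 / 100). split; [lra|]. intros eps Heps.
  destruct (unit_prop Phi Hok) as [Kr [del [HK [Hdel Hunit]]]].
  assert (Pd : 0 < del ^ 3) by (apply pow_lt; lra).
  (* The first term makes every rescaled [Q_i] smaller than [del]; the second is the stopping
     threshold of the iteration, divided by a distance to the boundary of at least [R0]. *)
  exists (/ del ^ 3 + 3 * Kr).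
  intros zeta tau1 Y2 Y3 u C1 C2 Sz S1 SY2 SY3 Su tau2 tau3 E1 E2 E3 Eu
    q1 q2 q3 q4 q5 q6 q7 q8' q9 _ _ _ _ _ _ _ _ _ N1 N2 N3 HY2 HY3 N6 N7 N8 N9 R0 HR0 z Hz.
  set (qs := (q1, 1%nat) :: _). set (fr := fun p => _).
  assert (fold_ge : forall l r, r <= fold_right Rmax r l /\ forall c, In c l -> c <= fold_right Rmax r l).
  { induction l as [|c l IH]; intros r; simpl.
    - split; [lra|intros c []].
    - destruct (IH r) as [I1 I2]. split; [eapply Rle_trans; [exact I1|apply Rmax_r]|].
      intros c' [<-|Hc]; [apply Rmax_l|]. eapply Rle_trans; [apply I2; assumption|apply Rmax_r]. }
  destruct (fold_ge (map fr qs) (/ R0)) as [MR Mq].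
  set (m := fold_right Rmax (/ R0) (map fr qs)) in *.
  assert (PR0 : 0 < / R0) by (apply Rinv_0_lt_compat; lra).
  assert (S2 : Smooth tau2).
  { apply (Smooth_ext (fun z => tau1 z * tau1 z - C1)); [intros; unfold tau2; ring|].
    apply Smooth_minus; [apply Smooth_mult; assumption|apply Smooth_const]. }
  assert (S3 : Smooth tau3).
  { apply (Smooth_ext (fun z => tau1 z * (tau1 z * tau1 z) - 3 * C1 * tau1 z)); [intros; unfold tau3; ring|].
    apply Smooth_minus; [|apply Smooth_scal; assumption]. repeat apply Smooth_mult; assumption. }
  set (v := fun z => u z - tau1 z). assert (Sv : Smooth v) by (apply Smooth_minus; assumption).
  assert (Ev : forall z, inP z -> heat v z =
    - v z ^ 3 - 3 * v z ^ 2 * tau1 z - 3 * v z * tau2 z - tau3 z - 9 * C2 * (v z + tau1 z)).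
  (* Expanding [(v + tau1)^3], the terms with [C1] are exactly those that turn [tau1^2] and [tau1^3]
     into [tau2] and [tau3]. *)
  { intros w Hw. unfold v at 1. 
    replace (fun z => u z - tau1 z) with (fun z => u z + (-1) * tau1 z) by (extensionality y; ring).
    rewrite heat_plus, heat_scal by (try apply Smooth_scal; assumption).
    rewrite Eu, E1 by assumption. unfold v, tau2, tau3. ring. }
  set (a := / del ^ 3 * m).
  assert (Pa : 0 < a) by (apply Rmult_lt_0_compat; [apply Rinv_0_lt_compat; assumption|lra]).
  destruct (good_initial v Y2 Y3 Sv SY2 SY3) as [V0 [HV0 HI]].
  assert (HG : forall x, inP x -> Good v Y2 Y3 x (a + 3 * Kr / dP x)).
  { apply good_iterate with V0; try assumption.
    - intros p lam Hp Hlam Hal Hld HG.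
      assert (Hm : m <= del ^ 3 * lam).
      { apply Rle_trans with (del ^ 3 * a); [right; unfold a; field; lra|apply Rmult_le_compat_l; lra]. }
      assert (HQ : forall q n, In (q, n) qs -> (1 <= n)%nat -> q <= del * Rpower lam (INR n * (/ 2 - eps))).
      { intros q n Hin Hn. apply le_of_rpow_le with m; try assumption; [|lra|].
        - apply le_INR in Hn. simpl in Hn. nra.
        - apply Mq. apply (in_map fr qs (q, n) Hin). }
      apply (good_improve Phi Kr del eps Hok HK Hdel ltac:(lra) Hunit C2 v tau1 tau2 tau3 Y2 Y3
        q1 q2 q3 q4 q5 q6 q7 q8' q9); try assumption; apply HQ; unfold qs; simpl; auto 20; lia.
    - intros x Hx. apply HI; [lra|assumption]. }
  destruct Hz as [Ht Hx].
  assert (Hin : inP z).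
  { pose proof (proj1 (xnorm_crd_lt z (1 - R0)) Hx) as [X1 [X2 X3]]. unfold inP. repeat split; try lra. nra. }
  assert (HdP : R0 <= dP z).
  { apply Rmin_glb; [|lra]. rewrite <- (sqrt_pow2 R0) by lra. apply sqrt_le_1_alt. lra. }
  destruct (HG z Hin) as [Hv _]. fold (v z). eapply Rle_trans; [exact Hv|].
  rewrite Rmult_plus_distr_r. fold a. apply Rplus_le_compat_l.
  apply Rle_trans with (3 * Kr * / R0).
  - apply Rmult_le_compat_l; [lra|]. apply Rinv_le_contravar; lra.
  - apply Rmult_le_compat_l; lra.
Qed.
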